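(* Fix constants $\alpha_1,\alpha_2,\alpha_3\in\mathbb{C}$ and consider the third-order differential system in the unknowns $x,y,z$ with independent variable $t$: $$\frac{dx}{dt}=x(t-x-2z)+\alpha_1,\qquad \frac{dy}{dt}=y(-t+y+2z)+\alpha_2,\qquad \frac{dz}{dt}=z(t-2y-z)+\alpha_3 .$$ Let $B=\operatorname{Spec}\mathbb{C}[t]\cong\mathbb{C}$, let $v$ be the regular vector field on $\mathbb{C}^3\times B$ (with coordinates $(x,y,z,t)$) defined by this system, and embed $\mathbb{C}^3\times B\subset\mathbb{P}^3\times B$ by $(x,y,z)=(z_1/z_0,z_2/z_0,z_3/z_0)$, with boundary hyperplane $\mathcal{H}=\{z_0=0\}\subset\mathbb{P}^3$. Then, by a finite sequence of blow-ups and blow-downs starting from $\mathbb{P}^3\times B$, one obtains a smooth projective family of $3$-folds $\pi:\mathcal{X}\to B$, together with a birational map $\varphi:\mathcal{X}\dashrightarrow\mathbb{P}^3\times B$ over $B$ (that is, $\pi$ equals the composite of $\varphi$ with the projection $\mathbb{P}^3\times B\to B$) and a boundary divisor $\mathcal{D}\subset\mathcal{X}$, such that the following hold. (1) The phase space $\mathcal{X}\setminus\mathcal{D}$ over $B=\mathbb{C}$ for the vector field $v$ is obtained by gluing eight copies of $\mathbb{C}^3\times\mathbb{C}$, $$U_0\times\mathbb{C}=\mathbb{C}^3\times\mathbb{C}\ni(x,y,z,t),\qquad U_j\times\mathbb{C}=\mathbb{C}^3\times\mathbb{C}\ni(x_j,y_j,z_j,t)\quad(j=1,\dots,7),$$ via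 the following rational transformations (with $t$ unchanged): 1) $x_1=\dfrac{1}{x+z},\quad y_1=(yz+\alpha_2)z,\quad z_1=\dfrac1z$; 2) $x_2=x+z,\quad y_2=(yz+\alpha_2)z,\quad z_2=\dfrac1z$; 3) $x_3=\dfrac1x,\quad y_3=y,\quad z_3=z$; 4) $x_4=(xz-\alpha_1)z,\quad y_4=\big((y+z-t)z+1-\alpha_2-\alpha_3\big)z,\quad z_4=\dfrac1z$; 5) $x_5=\dfrac1x,\quad y_5=\dfrac1y,\quad z_5=(yz-\alpha_3)y$; 6) $x_6=x,\quad y_6=\dfrac1y,\quad z_6=(yz-\alpha_3)y$; 7) $x_7=\dfrac{1}{z(xz-\alpha_1)},\quad y_7=z\big((y+z-t)z+1-\alpha_2-\alpha_3\big),\quad z_7=\dfrac1z$. (2) Each fiber $(\mathcal{X}\setminus\mathcal{D})_t$, $t\in B$, of $\pi:\mathcal{X}\setminus\mathcal{D}\to B$ has a stratification $$(\mathcal{X}\setminus\mathcal{D})_t=\mathbb{C}^3\sqcup\mathbb{C}^2\sqcup\mathbb{C}^2\sqcup\mathbb{C}^2\sqcup\mathbb{C}^2\sqcup\mathbb{C}^1\sqcup\mathbb{C}^1\sqcup\mathbb{C}^1,$$ where $\mathbb{C}^3$ is the original affine open subset $\mathbb{P}^3\setminus\mathcal{H}$. The three-dimensional stratum is a parameter space of the holomorphic solutions of the system, and each two-dimensional (respectively one-dimensional) stratum is a parameter space of a two-parameter (respectively one-parameter) family of meromorphic solutions.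
   Context: Vector field: $v=\frac{\partial}{\partial t}+\big(x(t-x-2z)+\alpha_1\big)\frac{\partial}{\partial x}+\big(y(-t+y+2z)+\alpha_2\big)\frac{\partial}{\partial y}+\big(z(t-2y-z)+\alpha_3\big)\frac{\partial}{\partial z}$ on $\mathbb{C}^3\times B$; it extends to a rational vector field on $\mathbb{P}^3\times B$. Phase space: the space over $B$ to which $v$ extends as a holomorphic vector field, i.e. in each of the coordinate systems $(x_j,y_j,z_j,t)$ the right-hand sides of the transformed differential equations are holomorphic, so that Cauchy's existence and uniqueness theorem applies at each of its points. Gluing: each chart $U_j\times\mathbb{C}$ ($j=1,\dots,7$) is identified birationally with $U_0\times\mathbb{C}$ by the listed transformation, hence any two charts are birationally identified with each other, and points of two charts are identified wherever the resulting birational transition map is a local biregular isomorphism. Boundary divisor: $\mathcal{D}$ is the closed complement in $\mathcal{X}$ of the phase space. Parameter space of solutions: for $t_0\in B$, a point of the fiber $(\mathcal{X}\setminus\mathcal{D})_{t_0}$ is the initial value at $t=t_0$ of a unique local solution. If the point lies in the stratum $\mathbb{C}^3=U_0$, the corresponding solution $(x(t),y(t),z(t))$ is holomorphic at $t_0$; if it lies in another stratum, the solution $(x(t),y(t),z(t))$ is meromorphic at $t_0$ with a pole there, and the points of the stratum parametrize the family of such solutions. *)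

(* Defs.v *)
From mathcomp Require Import all_boot all_order all_algebra.
From mathcomp Require mpoly.
From mathcomp Require Import complex.
From mathcomp Require Import all_classical all_reals all_analysis.

Set Implicit Arguments.
Unset Strict Implicit.
Unset Printing Implicit Defensive.

Import Order.TTheory GRing.Theory Num.Theory.
Import numFieldNormedType.Exports.

Local Open Scope classical_set_scope.
Local Open Scope ring_scope.

(* The complex numbers, packaged so that the norm topology is inferred. *)
Definition complexes (R : realType) : numClosedFieldType := R[i]%C.

(******************************************************************************)
(* Varieties over B = Spec C[t], in the classical language of point sets.     *)
(*                                                                            *)
(* [pt K N] is the type of pairs (z, t). It serves both for K^N x B and for   *)
(* P^(N-1) x B; in the latter case z is a vector of homogeneous coordinates,  *)
(* z != 0, and points are compared with [peq]. A subset of P^(N-1) x B is     *)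
(* given by the set of all its representatives. A map over B to P^(M-1) x B   *)
(* is given by its homogeneous coordinates [f : pt K N -> 'rV_M], the         *)
(* t-coordinate being preserved.                                              *)
(******************************************************************************)

Definition pt (K : numClosedFieldType) (N : nat) : Type := ('rV[K]_N * K)%type.

Definition rpoly (K : numClosedFieldType) (N : nat) : Type :=
  mpoly.mpoly N {poly K}.

Section Varieties.
Variable K : numClosedFieldType.

Definition peq N (u w : 'rV[K]_N) : Prop :=
  [/\ u != 0, w != 0 & exists c : K, w = c *: u].

(* Homogeneity in the variables z_i of an element of K[t][z_1, ..., z_N]. This
   is mpoly's [p \is d.-homog] spelled out: mpoly's notations clash with those
   of MathComp-Analysis. *)
Definition homog_deg N (d : nat) (p : rpoly K N) : Prop :=
  all [pred m | mpoly.mdeg m == d] (mpoly.msupp p).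

Definition homog N (p : rpoly K N) : Prop := exists d, homog_deg d p.

Definition peval N (p : rpoly K N) (q : pt K N) : K :=
  (mpoly.meval (fun i => (q.1 ord0 i)%:P) p).[q.2].

Definition pevalv N M (F : 'I_M -> rpoly K N) (q : pt K N) : 'rV[K]_M :=
  \row_i peval (F i) q.

Definition Proj N : set (pt K N) := [set q | q.1 != 0].

Definition basic_open N (h : rpoly K N) : set (pt K N) :=
  [set q | q.1 != 0 /\ peval h q != 0].

Definition zclosed N (A : set (pt K N)) : Prop :=
  exists2 I : set (rpoly K N), (forall g, I g -> homog g) &
    A = [set q | q.1 != 0 /\ forall g, I g -> peval g q = 0].

Definition zclosure N (A : set (pt K N)) : set (pt K N) :=
  [set q | q.1 != 0 /\ forall g : rpoly K N, homog g ->
     (forall a, A a -> peval g a = 0) -> peval g q = 0].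

Definition zopen_in N (X U : set (pt K N)) : Prop :=
  exists2 A, zclosed A & U = X `\` A.

Definition locally_zclosed N (S : set (pt K N)) : Prop :=
  exists A B, [/\ zclosed A, zclosed B & S = A `\` B].

Definition dense_in N (X U : set (pt K N)) : Prop := X `<=` zclosure U.

Definition dense_open N (X U : set (pt K N)) : Prop :=
  zopen_in X U /\ dense_in X U.

Definition irreducible N (X : set (pt K N)) : Prop :=
  X !=set0 /\ forall A B, zclosed A -> zclosed B -> X `<=` A `|` B ->
    X `<=` A \/ X `<=` B.

Definition fiber N (X : set (pt K N)) (t : K) : set (pt K N) :=
  X `&` [set q | q.2 = t].

(** Morphisms and rational maps over B *)

Definition regular_map N M (X : set (pt K N)) (f : pt K N -> 'rV[K]_M) : Prop :=
  forall p, X p -> exists d (F : 'I_M -> rpoly K N),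
    [/\ forall i, homog_deg d (F i), pevalv F p != 0 &
        forall q, X q -> pevalv F q != 0 -> peq (f q) (pevalv F q)].

Definition isomorphic_via N M (X : set (pt K N)) (Y : set (pt K M))
    (f : pt K N -> 'rV[K]_M) : Prop :=
  exists g : pt K M -> 'rV[K]_N,
    [/\ regular_map X f, regular_map Y g,
        forall q, X q -> Y (f q, q.2) /\ peq (g (f q, q.2)) q.1 &
        forall q, Y q -> X (g q, q.2) /\ peq (f (g q, q.2)) q.1].

(* A rational map is a function with arbitrary values outside a dense open
   set; two of them are equal when they agree on a dense open set. *)
Definition rational_map N M (X : set (pt K N)) (f : pt K N -> 'rV[K]_M) : Prop :=
  exists2 U, dense_open X U & regular_map U f.

Definition generically N (X : set (pt K N)) (P : pt K N -> Prop) : Prop :=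
  exists2 U, dense_open X U & forall q, U q -> P q.

Definition birational_map N M (X : set (pt K N)) (Y : set (pt K M))
    (f : pt K N -> 'rV[K]_M) : Prop :=
  exists U V, [/\ dense_open X U, dense_open Y V & isomorphic_via U V f].

(** Smoothness: Z is cut out near p by r equations with Jacobian of rank r *)

Definition local_equations N (Z : set (pt K N)) (p : pt K N) r
    (g : 'I_r -> rpoly K N) : Prop :=
  (forall i, homog (g i)) /\
  exists h : rpoly K N, [/\ homog h, basic_open h p &
    forall q, basic_open h q -> (Z q <-> forall i, peval (g i) q = 0)].

Definition jacobian_z N r (g : 'I_r -> rpoly K N) (q : pt K N) : 'M[K]_(r, N) :=
  \matrix_(i, j) peval (mpoly.mderiv j (g i)) q.

Definition jacobian_t N r (g : 'I_r -> rpoly K N) (q : pt K N) : 'cV[K]_r :=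
  \col_i ((mpoly.meval (fun j => (q.1 ord0 j)%:P) (g i))^`()).[q.2].

(* Smooth over Spec K. *)
Definition nonsingular N (Z : set (pt K N)) : Prop :=
  forall p, Z p -> exists r (g : 'I_r -> rpoly K N),
    local_equations Z p g /\ \rank (row_mx (jacobian_z g p) (jacobian_t g p)) = r.

(* Smooth over B: only derivatives along the fibres. Near p the fibres have
   dimension d = (N - 1) - r. *)
Definition smooth_over_base N (d : nat) (X : set (pt K N)) : Prop :=
  forall p, X p -> exists r (g : 'I_r -> rpoly K N),
    [/\ local_equations X p g, \rank (jacobian_z g p) = r & (r + d).+1 = N].

Definition smooth_projective_family N (d : nat) (X : set (pt K N)) : Prop :=
  [/\ zclosed X, smooth_over_base d X & forall t, irreducible (fiber X t)].

(* A closed subset of pure codimension one of a smooth X, that is, the support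
   of an effective Cartier divisor. *)
Definition divisor N (X D : set (pt K N)) : Prop :=
  [/\ zclosed D, D `<=` X, dense_in X (X `\` D) &
      forall p, X p -> exists h g : rpoly K N, [/\ homog h, homog g,
        basic_open h p &
        forall q, X q -> basic_open h q -> (D q <-> peval g q = 0)]].

(** Blow-ups *)

Definition segre N M (u : 'rV[K]_N) (w : 'rV[K]_M) : 'rV[K]_(N * M) :=
  mxvec (u^T *m w).

(* The f_i are of the same degree d and generate the (twisted) ideal sheaf of
   the closed subvariety Z of X. *)
Definition generate_ideal N M (X Z : set (pt K N)) (f : 'I_M -> rpoly K N) :
    Prop :=
  [/\ exists d, forall i, homog_deg d (f i),
      forall q, Z q -> pevalv f q = 0 &
      forall g, homog g -> (forall q, Z q -> peval g q = 0) ->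
      forall p, X p -> exists (h : rpoly K N) (a : 'I_M -> rpoly K N),
        [/\ homog h, basic_open h p &
        forall q, X q ->
          peval h q * peval g q = \sum_i peval (a i) q * peval (f i) q]].

(* Closure of the graph of (f_1 : ... : f_M), in the Segre embedding of
   P^(N-1) x P^(M-1) x B. *)
Definition graph_closure N M (X : set (pt K N)) (f : 'I_M -> rpoly K N) :
    set (pt K (N * M)) :=
  zclosure [set s | exists q, [/\ X q, pevalv f q != 0 &
                      s = (segre q.1 (pevalv f q), q.2)]].

(* b : X' -> X is, up to isomorphism over X, the blow-up of the nonsingular
   variety X along a nowhere dense nonsingular closed subvariety Z. *)
Definition is_blowup N' N (X' : set (pt K N')) (X : set (pt K N))
    (b : pt K N' -> 'rV[K]_N) : Prop :=
  [/\ zclosed X', zclosed X, nonsingular X &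
  exists (Z : set (pt K N)) (M : nat) (f : 'I_M -> rpoly K N),
    [/\ [/\ zclosed Z, Z `<=` X, dense_in X (X `\` Z) & nonsingular Z],
        generate_ideal X Z f &
        exists2 h, isomorphic_via X' (graph_closure X f) h &
          forall q, X' q -> exists w, peq (h q) (segre (b q) w)]].

(* [modification_of_P3 X phi]: X is obtained from P^3 x B by a finite sequence
   of blow-ups and blow-downs, and phi is the resulting rational map
   X --> P^3 x B. *)
Inductive modification_of_P3 :
    forall N, set (pt K N) -> (pt K N -> 'rV[K]_4) -> Prop :=
| Modif_start : modification_of_P3 (@Proj 4) (fun q => q.1)
| Modif_blowup N N' (X : set (pt K N)) (X' : set (pt K N')) phi phi' b :
    modification_of_P3 X phi -> is_blowup X' X b -> rational_map X' phi' ->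
    generically X' (fun q => peq (phi' q) (phi (b q, q.2))) ->
    modification_of_P3 X' phi'
| Modif_blowdown N N' (X : set (pt K N)) (X' : set (pt K N')) phi phi' b :
    modification_of_P3 X phi -> is_blowup X X' b -> rational_map X' phi' ->
    generically X (fun q => peq (phi q) (phi' (b q, q.2))) ->
    modification_of_P3 X' phi'.

(** Affine spaces embedded in P^(N-1) x B *)

Definition fracv d m (G : 'I_m -> rpoly K d) (H : rpoly K d) (q : pt K d) :
    'rV[K]_m :=
  \row_i (peval (G i) q / peval H q).

Definition image_over d N (A : set K) (e : pt K d -> 'rV[K]_N) :
    set (pt K N) :=
  [set q | A q.2 /\ exists c, peq (e (c, q.2)) q.1].

(* e is an isomorphism over B from K^d x A onto S, where A is either B or a
   point of B. *)
Definition affine_iso d N (A : set K) (e : pt K d -> 'rV[K]_N)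
    (S : set (pt K N)) : Prop :=
  [/\ S = image_over A e,
      forall p, A p.2 -> exists F : 'I_N -> rpoly K d, pevalv F p != 0 /\
        forall q, A q.2 -> pevalv F q != 0 -> peq (e q) (pevalv F q) &
      exists k : pt K N -> 'rV[K]_d,
        (forall q, A q.2 -> k (e q, q.2) = q.1) /\
        forall p, S p -> exists m (G : 'I_d -> rpoly K N) H,
          [/\ forall i, homog_deg m (G i), homog_deg m H, peval H p != 0 &
              forall q, S q -> peval H q != 0 -> k q = fracv G H q]].

Definition stratification N n (Y : set (pt K N)) (t : K) (dim : 'I_n -> nat)
    (S : 'I_n -> set (pt K N)) : Prop :=
  [/\ Y = \bigcup_i S i, trivIset setT S,
      forall i, locally_zclosed (S i),
      forall i, (Y `&` zclosure (S i)) `\` S i `<=`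
        \bigcup_(j in [set j | (dim j < dim i)%N]) S j &
      forall i, exists e : pt K (dim i) -> 'rV[K]_N,
        affine_iso [set t] e (S i)].

End Varieties.

(******************************************************************************)
(* The system and its charts                                                  *)
(******************************************************************************)

Section System.
Variables (K : numClosedFieldType) (alpha1 alpha2 alpha3 : K).

Definition row3 (a b c : K) : 'rV[K]_3 := \row_i [:: a; b; c]`_i.

Definition xc (q : pt K 3) : K := q.1 ord0 (inord 0).
Definition yc (q : pt K 3) : K := q.1 ord0 (inord 1).
Definition zc (q : pt K 3) : K := q.1 ord0 (inord 2).

(* The components of v along x, y, z; the component along t is 1. *)
Definition vfield (q : pt K 3) : 'rV[K]_3 :=
  let: (x, y, z, t) := (xc q, yc q, zc q, q.2) in
  row3 (x * (t - x - 2 * z) + alpha1)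
       (y * (- t + y + 2 * z) + alpha2)
       (z * (t - 2 * y - z) + alpha3).

Definition chart (j : 'I_8) (q : pt K 3) : 'rV[K]_3 :=
  let: (x, y, z, t) := (xc q, yc q, zc q, q.2) in
  match val j with
  | 0 => q.1
  | 1 => row3 (1 / (x + z)) ((y * z + alpha2) * z) (1 / z)
  | 2 => row3 (x + z) ((y * z + alpha2) * z) (1 / z)
  | 3 => row3 (1 / x) y z
  | 4 => row3 ((x * z - alpha1) * z)
              (((y + z - t) * z + 1 - alpha2 - alpha3) * z) (1 / z)
  | 5 => row3 (1 / x) (1 / y) ((y * z - alpha3) * y)
  | 6 => row3 x (1 / y) ((y * z - alpha3) * y)
  | _ => row3 (1 / (z * (x * z - alpha1)))
              (z * ((y + z - t) * z + 1 - alpha2 - alpha3)) (1 / z)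
  end.

(* Nonvanishing of the denominators of [chart j]. *)
Definition chart_dom (j : 'I_8) : set (pt K 3) :=
  [set q | let: (x, y, z) := (xc q, yc q, zc q) in
  match val j with
  | 0 => True
  | 1 => x + z != 0 /\ z != 0
  | 2 => z != 0
  | 3 => x != 0
  | 4 => z != 0
  | 5 => x != 0 /\ y != 0
  | 6 => y != 0
  | _ => z * (x * z - alpha1) != 0
  end].

(* The transition map from chart i to chart j, i.e. the rational map
   [chart i u |-> chart j u], is a local biregular isomorphism at p, with
   value q. *)
Definition transition_biregular (i j : 'I_8) (p q : pt K 3) : Prop :=
  p.2 = q.2 /\
  exists (G : 'I_3 -> rpoly K 3) H (G' : 'I_3 -> rpoly K 3) H',
    [/\ peval H p != 0 /\ fracv G H p = q.1,
        peval H' q != 0 /\ fracv G' H' q = p.1 &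
        forall u, chart_dom i u -> chart_dom j u ->
          let: (a, b) := ((chart i u, u.2), (chart j u, u.2)) in
          (peval H a != 0 -> fracv G H a = b.1) /\
          (peval H' b != 0 -> fracv G' H' b = a.1)].

(* Y is, over B, the space obtained by gluing the eight copies of K^3 x B;
   psi j is the inclusion of the j-th copy. *)
Definition glued_from_charts N (X Y : set (pt K N))
    (psi : 'I_8 -> pt K 3 -> 'rV[K]_N) : Prop :=
  [/\ Y = \bigcup_j image_over setT (psi j),
      forall j, zopen_in X (image_over setT (psi j)) /\
                affine_iso setT (psi j) (image_over setT (psi j)),
      forall j q, chart_dom j q ->
        peq (psi ord0 q) (psi j (chart j q, q.2)) &
      forall i j p q,
        (p.2 = q.2 /\ peq (psi i p) (psi j q)) <->
        transition_biregular i j p q].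

(* In each chart the right-hand side F j of the transformed system is
   holomorphic. *)
Definition extends_holomorphically (F : 'I_8 -> pt K 3 -> 'rV[K]_3) : Prop :=
  forall j, (forall p : 'rV[K]_3 * K, differentiable (F j : 'rV[K]_3 * K -> 'rV[K]_3) p) /\
    forall q : 'rV[K]_3 * K, chart_dom j q ->
      is_derive q (vfield q, 1) (chart j : 'rV[K]_3 * K -> 'rV[K]_3)
        (F j (chart j q, q.2)).

(* gamma, defined near t0, is an integral curve, parametrized by t, of the
   vector field that is F j in the j-th chart. *)
Definition integral_curve N (psi : 'I_8 -> pt K 3 -> 'rV[K]_N)
    (F : 'I_8 -> pt K 3 -> 'rV[K]_3) (t0 : K) (gamma : K -> 'rV[K]_N) : Prop :=
  \forall t \near t0, exists (j : 'I_8) (c : K -> 'rV[K]_3),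
    (\forall s \near t, peq (psi j (c s, s)) (gamma s)) /\
    is_derive (t : K) (1 : K) c (F j (c t, t)).

Definition cauchy_property N (Y : set (pt K N)) psi F : Prop :=
  forall q : pt K N, Y q ->
    (exists2 gamma, integral_curve psi F q.2 gamma & peq (gamma q.2) q.1) /\
    forall gamma gamma',
      integral_curve psi F q.2 gamma -> peq (gamma q.2) q.1 ->
      integral_curve psi F q.2 gamma' -> peq (gamma' q.2) q.1 ->
      \forall t \near q.2, peq (gamma t) (gamma' t).

Definition holomorphic_solution (t0 : K) (u : K -> 'rV[K]_3) : Prop :=
  \forall t \near t0, is_derive (t : K) (1 : K) u (vfield (u t, t)).

Definition holomorphic_at (t0 : K) (f : K -> K) : Prop :=
  \forall t \near t0, derivable f (t : K) (1 : K).

Definition meromorphic_at (t0 : K) (f : K -> K) : Prop :=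
  exists n g, holomorphic_at t0 g /\
    \forall t \near t0^', (t - t0) ^+ n * f t = g t.

Definition pole_at (t0 : K) (f : K -> K) : Prop :=
  meromorphic_at t0 f /\
  ~ exists2 g, holomorphic_at t0 g & \forall t \near t0^', f t = g t.

Definition meromorphic_solution_with_pole (t0 : K) (u : K -> 'rV[K]_3) : Prop :=
  [/\ \forall t \near t0^', is_derive (t : K) (1 : K) u (vfield (u t, t)),
      forall i, meromorphic_at t0 (fun t => u t ord0 i) &
      exists i, pole_at t0 (fun t => u t ord0 i)].

(* u = (x, y, z) is the solution of the system with initial value q in the
   phase space. *)
Definition solution_from N (psi : 'I_8 -> pt K 3 -> 'rV[K]_N) F (q : pt K N)
    (u : K -> 'rV[K]_3) : Prop :=
  exists gamma, [/\ integral_curve psi F q.2 gamma, peq (gamma q.2) q.1 &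
    \forall t \near q.2^', peq (gamma t) (psi ord0 (u t, t))].

(* The points of S, a subset of the fibre over t0, parametrize bijectively a
   family of (germs at t0 of) solutions with property Sol. *)
Definition parameter_space N (psi : 'I_8 -> pt K 3 -> 'rV[K]_N) F (t0 : K)
    (S : set (pt K N)) (Sol : (K -> 'rV[K]_3) -> Prop) : Prop :=
  [/\ forall q, S q -> exists2 u, solution_from psi F q u & Sol u,
      forall q u u', S q -> solution_from psi F q u ->
        solution_from psi F q u' -> \forall t \near t0^', u t = u' t &
      forall q q' u, S q -> S q' -> solution_from psi F q u ->
        solution_from psi F q' u -> peq q.1 q'.1].

End System.

(* Dimensions of the eight strata. *)
Definition stratum_dim (i : 'I_8) : nat :=
  nth 0%N [:: 3; 2; 2; 2; 2; 1; 1; 1] i.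

(* Main.v *)
(* Every variety in the construction is the closure of the image of C^3 x B under a vector
   B(x, y, z, t) of polynomials. Multiplying B by the values of a family of forms of the same
   degree blows up their common zeros, so that blow-ups become computations with polynomial
   vectors. The blow-up of P^3 at a point is a P^1-bundle over P^2, with fibre coordinate x;
   three chains of blow-ups of points of the base, as for Okamoto's surface of the fourth
   Painleve equation in (y, z), followed by elementary transformations along the last
   exceptional curves, give X, still a P^1-bundle. The phase space is the preimage of the
   union of C^2 with three exceptional affine lines: over C^2 and over
   each line the two charts of the fibre P^1 give the eight copies of C^3.

   The transformed fields agree on overlaps because they all come from v on a dense set.
   Solutions in a chart are limits of Picard iterates, which are polynomials in t; uniqueness
   follows from a mean value inequality obtained by bisection. At a boundary point of a chart
   some coordinate has a simple zero along the solution (in chart 7, moreover, x_7 vanishes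
   to third order because x_7' = z_7^2 + x_7 b), whence the poles of x, y or z. *)
Require Import Defs.
From mathcomp Require Import all_boot all_order all_algebra.
From mathcomp Require mpoly.
From mathcomp Require Import complex.
From mathcomp Require Import all_classical all_reals all_analysis.
From mathcomp Require Import ring lra.
Import (canonicals, coercions) mpoly.

Set Implicit Arguments.
Unset Strict Implicit.
Unset Printing Implicit Defensive.

Import Order.TTheory GRing.Theory Num.Theory.
Import numFieldNormedType.Exports.

Local Open Scope classical_set_scope.
Local Open Scope ring_scope.

(** The conditions concern all points of X and not just the phase space: smoothness and the local
    equation of the boundary need charts everywhere. Each stage therefore carries a covering of the
    whole surface by charts with a frame of the bundle and a local equation of the complement of the
    open set kept so far ([bcovered]). Global coordinates exist on C^3 x B only; identities are
    checked there by [field] and reach the closure by density, which is why proportionality and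
    incidence are always written as the vanishing of forms. An elementary transformation is one
    blow-up followed by one blow-down. It divides the fibre coordinate by the equation of a curve,
    and the power of y or z between x/y, (x+z)/z, (xz - alpha_1)/z^2 and the fibre coordinates of
    the statement fixes their number: one, one, three. The analysis is done over an abstract field
    with two hypotheses on geometric sequences. Holomorphic functions appear as limits of
    polynomials in a weighted l^1 norm, for which integration and division by the variable act on
    coefficients with explicit bounds. *)

Section PolynomialFunctions.

(** * Polynomial functions, homogeneous forms and density *)

Variable K : numClosedFieldType.

Lemma pevalD n (p r : rpoly K n) q : peval (p + r) q = peval p q + peval r q.
Proof. by rewrite /peval mpoly.mevalD hornerD. Qed.

Lemma pevalN n (p : rpoly K n) q : peval (- p) q = - peval p q.
Proof. by rewrite /peval mpoly.mevalN hornerN. Qed.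

Lemma pevalM n (p r : rpoly K n) q : peval (p * r) q = peval p q * peval r q.
Proof. by rewrite /peval mpoly.mevalM hornerM. Qed.

Lemma pevalC n (c : {poly K}) q : peval (mpoly.mpolyC n c) q = c.[q.2].
Proof. by rewrite /peval mpoly.mevalC. Qed.

Lemma pevalX n (i : 'I_n) (q : pt K n) :
  peval (mpoly.mpolyX _ (mpoly.mnm1 i)) q = q.1 ord0 i.
Proof. by rewrite /peval mpoly.mevalXU hornerC. Qed.

Lemma peval0 n (q : pt K n) : peval 0 q = 0.
Proof. by rewrite /peval mpoly.meval0 horner0. Qed.

Lemma rpoly_ind n (P : rpoly K n -> Prop) :
  (forall c, P (mpoly.mpolyC n c)) ->
  (forall i, P (mpoly.mpolyX _ (mpoly.mnm1 i))) ->
  (forall p r, P p -> P r -> P (p + r)) ->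
  (forall p r, P p -> P r -> P (p * r)) -> forall p, P p.
Proof.
move=> PC PX PD PM; apply: mpoly.mpolyind => [|c m p _ _ Pp].
  by rewrite -mpoly.mpolyC0; apply: (PC).
apply: (PD) => //; rewrite -mpoly.mul_mpolyC; apply: (PM) => //.
rewrite mpoly.mpolyXE_id; elim/big_ind: _ => [||i _].
- by rewrite -mpoly.mpolyC1; apply: (PC).
- exact: PM.
- elim: (m i) => [|k IH]; first by rewrite expr0 -mpoly.mpolyC1; apply: (PC).
  by rewrite exprS; apply: (PM).
Qed.

(** Polynomials are used through their functions, so that identities are pointwise and within reach
    of [ring] and [field]; [density_all] plays the role of cancelling a nonzero factor. *)
Definition ispoly n (f : pt K n -> K) : Prop :=
  exists p : rpoly K n, forall q, f q = peval p q.

Lemma ispoly_ext n (f g : pt K n -> K) : f =1 g -> ispoly g -> ispoly f.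
Proof. by move=> fg [p gp]; exists p => q; rewrite fg. Qed.

Lemma ispoly_peval n (p : rpoly K n) : ispoly (peval p).
Proof. by exists p. Qed.

Lemma ispoly_tp n (c : {poly K}) : @ispoly n (fun q => c.[q.2]).
Proof. by exists (mpoly.mpolyC n c) => q; rewrite pevalC. Qed.

Lemma ispoly_c n (c : K) : @ispoly n (fun q => c).
Proof. by apply: ispoly_ext (ispoly_tp n c%:P) => q; rewrite hornerC. Qed.

Lemma ispoly_t n : @ispoly n (fun q => q.2).
Proof. by apply: ispoly_ext (ispoly_tp n 'X) => q; rewrite hornerX. Qed.

Lemma ispoly_x n i : @ispoly n (fun q => q.1 ord0 i).
Proof. by eexists => q; rewrite -pevalX. Qed.

Lemma ispolyD n (f g : pt K n -> K) :
  ispoly f -> ispoly g -> ispoly (fun q => f q + g q).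
Proof. by move=> [p fp] [r gr]; exists (p + r) => q; rewrite pevalD fp gr. Qed.

Lemma ispolyM n (f g : pt K n -> K) :
  ispoly f -> ispoly g -> ispoly (fun q => f q * g q).
Proof. by move=> [p fp] [r gr]; exists (p * r) => q; rewrite pevalM fp gr. Qed.

Lemma ispolyN n (f : pt K n -> K) : ispoly f -> ispoly (fun q => - f q).
Proof. by move=> [p fp]; exists (- p) => q; rewrite pevalN fp. Qed.

Lemma ispolyB n (f g : pt K n -> K) :
  ispoly f -> ispoly g -> ispoly (fun q => f q - g q).
Proof. by move=> fp gp; apply: ispolyD => //; apply: ispolyN. Qed.

Lemma ispolyX n (f : pt K n -> K) k : ispoly f -> ispoly (fun q => f q ^+ k).
Proof.
move=> fp; elim: k => [|k IH]; first exact: ispoly_c.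
by apply: (ispoly_ext _ (ispolyM fp IH)) => q; rewrite exprS.
Qed.

Lemma ispoly_sum n (I : Type) (r : seq I) (P : pred I) (f : I -> pt K n -> K) :
  (forall i, ispoly (f i)) -> ispoly (fun q => \sum_(i <- r | P i) f i q).
Proof.
move=> fp; elim: r => [|i r IH].
  by apply: (ispoly_ext _ (ispoly_c n 0)) => q; rewrite big_nil.
apply: (@ispoly_ext _ _ (fun q => (if P i then f i q else 0) +
   \sum_(j <- r | P j) f j q)) => [q|].
  by rewrite big_cons; case: ifP => _; rewrite ?add0r.
by apply: ispolyD => //; case: (P i) => //; apply: ispoly_c.
Qed.

Lemma ispoly_prod n (I : Type) (r : seq I) (P : pred I) (f : I -> pt K n -> K) :
  (forall i, ispoly (f i)) -> ispoly (fun q => \prod_(i <- r | P i) f i q).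
Proof.
move=> fp; elim: r => [|i r IH].
  by apply: (ispoly_ext _ (ispoly_c n 1)) => q; rewrite big_nil.
apply: (@ispoly_ext _ _ (fun q => (if P i then f i q else 1) *
   \prod_(j <- r | P j) f j q)) => [q|].
  by rewrite big_cons; case: ifP => _; rewrite ?mul1r.
by apply: ispolyM => //; case: (P i) => //; apply: ispoly_c.
Qed.

Lemma ispoly_ind n (P : (pt K n -> K) -> Prop) :
  (forall f g, f =1 g -> P g -> P f) ->
  (forall c : {poly K}, P (fun q => c.[q.2])) ->
  (forall i, P (fun q => q.1 ord0 i)) ->
  (forall f g, ispoly f -> ispoly g -> P f -> P g -> P (fun q => f q + g q)) ->
  (forall f g, ispoly f -> ispoly g -> P f -> P g -> P (fun q => f q * g q)) ->
  forall f, ispoly f -> P f.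
Proof.
move=> Pe Pc Px PD PM f [p fp]; apply: (Pe _ _ fp) => {f fp}.
elim/rpoly_ind: p => [c|i|p r Pp Pr|p r Pp Pr].
- by apply: Pe (Pc c) => q; rewrite pevalC.
- by apply: Pe (Px i) => q; rewrite pevalX.
- by apply: Pe (PD _ _ (ispoly_peval p) (ispoly_peval r) Pp Pr) => q;
    rewrite pevalD.
- by apply: Pe (PM _ _ (ispoly_peval p) (ispoly_peval r) Pp Pr) => q;
    rewrite pevalM.
Qed.

Lemma ispoly_comp n m (f : pt K n -> K) (g : pt K m -> 'rV[K]_n) :
  ispoly f -> (forall i, ispoly (fun q => g q ord0 i)) ->
  ispoly (fun q => f (g q, q.2)).
Proof.
move=> + gp; move: f; apply: ispoly_ind => [f1 f2 e h|c|i|f1 f2 _ _|f1 f2 _ _].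
- by apply: ispoly_ext h => q; rewrite e.
- exact: ispoly_tp.
- exact: gp.
- exact: ispolyD.
- exact: ispolyM.
Qed.

Definition polyv n m (f : pt K n -> 'rV[K]_m) : Prop :=
  forall i, ispoly (fun q => f q ord0 i).

Lemma polyv_pevalv n m (f : pt K n -> 'rV[K]_m) :
  polyv f -> exists F, f =1 pevalv F.
Proof.
move=> /choice[F fF]; exists F => q; apply/rowP => i.
by rewrite mxE -fF.
Qed.

Lemma polyv_comp n m k (f : pt K n -> 'rV[K]_m) (g : pt K k -> 'rV[K]_n) :
  polyv f -> polyv g -> polyv (fun q => f (g q, q.2)).
Proof. by move=> fp gp i; apply: (ispoly_comp (fp i)). Qed.

(* The restriction of a polynomial function to a line is a polynomial in one
   variable, so it vanishes identically as soon as it does off the zeros of a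
   nonzero polynomial. *)
Definition line n (q0 q1 : pt K n) (s : K) : pt K n :=
  (q0.1 + s *: (q1.1 - q0.1), q0.2 + s * (q1.2 - q0.2)).

Lemma line0 n (q0 q1 : pt K n) : line q0 q1 0 = q0.
Proof. by rewrite /line scale0r mul0r !addr0; case: q0. Qed.

Lemma line1 n (q0 q1 : pt K n) : line q0 q1 1 = q1.
Proof. by rewrite /line scale1r mul1r !(addrC q0.1, addrC q0.2) !subrK; case: q1. Qed.

Lemma ispoly_line n (f : pt K n -> K) q0 q1 :
  ispoly f -> exists P : {poly K}, forall s, f (line q0 q1 s) = P.[s].
Proof.
move: f; apply: ispoly_ind => [f1 f2 e [P h]|c|i|f1 f2 _ _|f1 f2 _ _].
- by exists P => s; rewrite e.
- exists (c \Po (q0.2%:P + (q1.2 - q0.2)%:P * 'X)) => s.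
  by rewrite horner_comp !hornerE /= mulrC.
- exists ((q0.1 ord0 i)%:P + (q1.1 ord0 i - q0.1 ord0 i)%:P * 'X) => s.
  by rewrite !hornerE /= !mxE mulrC.
- by move=> [P h1] [Q h2]; exists (P + Q) => s; rewrite hornerD h1 h2.
- by move=> [P h1] [Q h2]; exists (P * Q) => s; rewrite hornerM h1 h2.
Qed.

(** The naturals below [size P] are distinct in characteristic zero and would be too many roots. *)
Lemma poly_eq0_all (P : {poly K}) : (forall s, P.[s] = 0) -> P = 0.
Proof.
move=> P0; apply/eqP/negP => /negP Pn0.
have := max_poly_roots (rs := [seq i%:R | i <- iota 0 (size P)]) Pn0.
rewrite size_map size_iota ltnn => h; apply/notF/h; last first.
  by rewrite map_inj_uniq ?iota_uniq //; apply: mulrIn; apply: oner_neq0.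
by apply/allP => x _; rewrite rootE P0.
Qed.

Lemma density n (f w : pt K n -> K) q0 q1 : ispoly f -> ispoly w ->
  w q1 != 0 -> (forall s, w (line q0 q1 s) != 0 -> f (line q0 q1 s) = 0) ->
  f q0 = 0.
Proof.
move=> /ispoly_line-/(_ q0 q1)[P fP] /ispoly_line-/(_ q0 q1)[W wW] w1 h.
have : P * W = 0.
  apply: poly_eq0_all => s; rewrite hornerM -fP -wW.
  by case: (eqVneq (w (line q0 q1 s)) 0) => [->|/h ->]; rewrite (mulr0, mul0r).
move=> /eqP; rewrite mulf_eq0 => /orP[|] /eqP P0.
  by rewrite -(line0 q0 q1) fP P0 horner0.
by move: w1; rewrite -(line1 q0 q1) wW P0 horner0 eqxx.
Qed.

Lemma density_all n (f w : pt K n -> K) : ispoly f -> ispoly w ->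
  (exists q, w q != 0) -> (forall q, w q != 0 -> f q = 0) -> forall q, f q = 0.
Proof. by move=> fp wp [q1 w1] h q; apply: (density fp wp w1) => s; apply: h. Qed.

(** The line between two points with the same t stays in that fibre. This fibrewise form yields the
    irreducibility of every single fibre of the family. *)
Lemma density_fiber n (f w : pt K n -> K) t : ispoly f -> ispoly w ->
  (exists2 q, q.2 = t & w q != 0) ->
  (forall q, q.2 = t -> w q != 0 -> f q = 0) ->
  forall q, q.2 = t -> f q = 0.
Proof.
move=> fp wp [q1 q1t w1] h q qt; apply: (density fp wp w1) => s; apply: h.
by rewrite /= q1t qt subrr mulr0 addr0.
Qed.

(** Absence of zero divisors: a [g] vanishing wherever [f] does not would vanish everywhere by
    density. *)
Lemma nonzero_mul n (f g : pt K n -> K) : ispoly f -> ispoly g ->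
  (exists q, f q != 0) -> (exists q, g q != 0) -> exists q, f q * g q != 0.
Proof.
move=> fp gp fn [q gq]; apply/not_existsP => h.
move: gq; rewrite (density_all gp fp fn) ?eqxx // => q' fq'.
apply/eqP; have := h q'; rewrite mulf_eq0 negb_or fq' /= => /negP.
by rewrite negbK.
Qed.

Lemma nonzero_fiber_mul n (f g : pt K n -> K) t : ispoly f -> ispoly g ->
  (exists2 q, q.2 = t & f q != 0) -> (exists2 q, q.2 = t & g q != 0) ->
  exists2 q, q.2 = t & f q * g q != 0.
Proof.
move=> fp gp fn [q qt gq]; apply: contrapT => h.
move: gq; rewrite (density_fiber gp fp fn) ?eqxx // => q' qt' fq'.
apply/eqP/negPn/negP => gq'; apply: h; exists q' => //.
by rewrite mulf_neq0.
Qed.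

Definition hpoly N d (f : pt K N -> K) : Prop :=
  exists2 p : rpoly K N, homog_deg d p & forall q, f q = peval p q.

Lemma hpoly_ext N d (f g : pt K N -> K) : f =1 g -> hpoly d g -> hpoly d f.
Proof. by move=> fg [p hp gp]; exists p => // q; rewrite fg. Qed.

Lemma hpoly_ispoly N d (f : pt K N -> K) : hpoly d f -> ispoly f.
Proof. by move=> [p _ fp]; exists p. Qed.

Lemma homog_degE N d (p : rpoly K N) :
  homog_deg d p <-> (p \is mpoly.ishomog1 d mpoly.mdeg).
Proof. by rewrite mpoly.dhomogE. Qed.

Lemma homog_degC N (c : {poly K}) : homog_deg 0 (mpoly.mpolyC N c).
Proof.
apply/homog_degE; rewrite -[mpoly.mpolyC N c]mulr1 mpoly.mul_mpolyC.
by apply: mpoly.dhomogZ; apply: mpoly.dhomog1.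
Qed.

Lemma homog_degX N (i : 'I_N) :
  homog_deg 1 (mpoly.mpolyX {poly K} (mpoly.mnm1 i)).
Proof. by apply/homog_degE; rewrite mpoly.dhomogX; apply/eqP/mpoly.mdeg1. Qed.

Lemma homog_degD N d (p r : rpoly K N) :
  homog_deg d p -> homog_deg d r -> homog_deg d (p + r).
Proof. by rewrite !homog_degE; apply: mpoly.dhomogD. Qed.

Lemma homog_degM N d e (p r : rpoly K N) :
  homog_deg d p -> homog_deg e r -> homog_deg (d + e) (p * r).
Proof. by rewrite !homog_degE; apply: mpoly.dhomogM. Qed.

Lemma homog_degXn N d k (p : rpoly K N) :
  homog_deg d p -> homog_deg (d * k) (p ^+ k).
Proof. by rewrite !homog_degE; apply: mpoly.dhomogMn. Qed.

Lemma hpoly_tp N (c : {poly K}) : @hpoly N 0 (fun q => c.[q.2]).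
Proof.
by exists (mpoly.mpolyC N c) => [|q]; [apply: homog_degC|rewrite pevalC].
Qed.

Lemma hpoly_c N (c : K) : @hpoly N 0 (fun q => c).
Proof. by apply: hpoly_ext (hpoly_tp N c%:P) => q; rewrite hornerC. Qed.

Lemma hpoly0 N d : @hpoly N d (fun q => 0).
Proof.
exists 0 => [|q]; first by apply/homog_degE; apply: mpoly.dhomog0.
by rewrite peval0.
Qed.

Lemma hpoly_x N i : @hpoly N 1 (fun q => q.1 ord0 i).
Proof. by eexists => [|q]; [apply: homog_degX|rewrite -pevalX]. Qed.

Lemma hpolyD N d (f g : pt K N -> K) :
  hpoly d f -> hpoly d g -> hpoly d (fun q => f q + g q).
Proof.
move=> [p hp fp] [r hr gr]; exists (p + r) => [|q]; first exact: homog_degD.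
by rewrite pevalD fp gr.
Qed.

Lemma hpolyM N d e (f g : pt K N -> K) :
  hpoly d f -> hpoly e g -> hpoly (d + e) (fun q => f q * g q).
Proof.
move=> [p hp fp] [r hr gr]; exists (p * r) => [|q]; first exact: homog_degM.
by rewrite pevalM fp gr.
Qed.

Lemma hpolyN N d (f : pt K N -> K) : hpoly d f -> hpoly d (fun q => - f q).
Proof.
move=> fh; apply: hpoly_ext (hpolyM (hpoly_c N (-1)) fh) => q.
by rewrite mulN1r.
Qed.

Lemma hpolyB N d (f g : pt K N -> K) :
  hpoly d f -> hpoly d g -> hpoly d (fun q => f q - g q).
Proof. by move=> fp gp; apply: hpolyD => //; apply: hpolyN. Qed.

Lemma hpolyXn N d k (f : pt K N -> K) :
  hpoly d f -> hpoly (d * k) (fun q => f q ^+ k).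
Proof.
move=> fh; elim: k => [|k IH]; first by rewrite muln0; apply: hpoly_c.
rewrite mulnS; apply: hpoly_ext (hpolyM fh IH) => q.
by rewrite exprS.
Qed.

Lemma hpoly_sum N d (I : Type) (r : seq I) (P : pred I) (f : I -> pt K N -> K) :
  (forall i, hpoly d (f i)) -> hpoly d (fun q => \sum_(i <- r | P i) f i q).
Proof.
move=> fp; elim: r => [|i r IH].
  by apply: (hpoly_ext _ (hpoly0 N d)) => q; rewrite big_nil.
apply: (@hpoly_ext _ _ _ (fun q => (if P i then f i q else 0) +
   \sum_(j <- r | P j) f j q)) => [q|].
  by rewrite big_cons; case: ifP => _; rewrite ?add0r.
by apply: hpolyD => //; case: (P i) => //; apply: hpoly0.
Qed.

Lemma hpoly_scale N d (f : pt K N -> K) (c : K) v t :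
  hpoly d f -> f (c *: v, t) = c ^+ d * f (v, t).
Proof.
move=> [p hp fp]; rewrite !fp /peval !mpoly.mevalE /= !horner_sum mulr_sumr.
apply: eq_big_seq => m /(allP hp) /eqP md; rewrite !hornerM mulrCA.
congr (_ * _); rewrite !horner_prod -[in RHS]md mpoly.mdegE expr_sum.
rewrite -big_split /=; apply: eq_bigr => i _.
by rewrite !horner_exp !hornerC mxE exprMn.
Qed.

(* A polynomial in the ratios [lam a / l] becomes homogeneous after multiplication
   by a power of the linear form [l]. *)
Lemma homogenize_mpoly n N (p : rpoly K n) (lam : 'I_n -> rpoly K N) l :
  (forall a, homog_deg 1 (lam a)) -> homog_deg 1 l ->
  exists D R, [/\ homog_deg D R,
    forall q, peval l q != 0 -> peval R q = peval l q ^+ D *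
      peval p (\row_a (peval (lam a) q / peval l q), q.2) &
    forall i, (forall a, mpoly.mderiv i (lam a) = 0) -> mpoly.mderiv i l = 0 ->
      mpoly.mderiv i R = 0].
Proof.
move=> hlam hl.
have dl i k : mpoly.mderiv i l = 0 -> mpoly.mderiv i (l ^+ k) = 0.
  move=> l0; elim: k => [|k IH].
    by rewrite expr0 -mpoly.mpolyC1 mpoly.mderivC.
  by rewrite exprS mpoly.mderivM l0 IH mul0r mulr0 addr0.
have el k q : peval (l ^+ k) q = peval l q ^+ k.
  elim: k => [|k IH]; last by rewrite !exprS pevalM IH.
  by rewrite !expr0 -mpoly.mpolyC1 pevalC hornerC.
elim/rpoly_ind: p => [c|a|p r [D [R [h1 h2 h3]]] [E [S [k1 k2 k3]]]
   |p r [D [R [h1 h2 h3]]] [E [S [k1 k2 k3]]]].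
- exists 0%N, (mpoly.mpolyC N c); split=> [|q lq|i _ _].
  + exact: homog_degC.
  + by rewrite !pevalC mul1r.
  + by rewrite mpoly.mderivC.
- exists 1%N, (lam a); split=> [|q lq|i la _] //.
  by rewrite pevalX mxE expr1 mulrC divfK.
- exists (D + E)%N, (R * l ^+ E + S * l ^+ D); split=> [|q lq|i la l0].
  + have hX k : homog_deg k (l ^+ k) by rewrite -[k in homog_deg k]mul1n; apply: homog_degXn.
    by apply: homog_degD; [|rewrite addnC]; apply: homog_degM.
  + rewrite !pevalD !pevalM !el h2 // k2 // exprD; ring.
  + by rewrite mpoly.mderivD !mpoly.mderivM h3 // k3 // !dl // !(mul0r, mulr0, addr0).
- exists (D + E)%N, (R * S); split=> [|q lq|i la l0].
  + exact: homog_degM.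
  + rewrite !pevalM h2 // k2 // exprD; ring.
  + by rewrite !mpoly.mderivM h3 // k3 // !(mul0r, mulr0, addr0).
Qed.

Lemma homogenize n N (f : pt K n -> K) (lam : 'I_n -> pt K N -> K) l :
  ispoly f -> (forall a, hpoly 1 (lam a)) -> hpoly 1 l ->
  exists D R, hpoly D R /\
    forall q, l q != 0 -> R q = l q ^+ D * f (\row_a (lam a q / l q), q.2).
Proof.
move=> [p fp] hlam [lp hl el].
have [lamp lamP] := choice (fun a => let: ex_intro2 p h1 h2 := hlam a in
  ex_intro (fun p => homog_deg 1 p /\ forall q, lam a q = peval p q) p (conj h1 h2)).
have [D [R [h1 h2 _]]] := homogenize_mpoly p (fun a => (lamP a).1) hl.
exists D, (peval R); split; first by exists R.
move=> q lq; rewrite h2 -?el // fp; congr (_ * peval _ (_, _)).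
by apply/rowP => a; rewrite !mxE (lamP a).2.
Qed.

End PolynomialFunctions.

(** * Closures of parametrized varieties and regular maps between them *)

Section Models.
Variable K : numClosedFieldType.

Lemma rV_neq0P N (v : 'rV[K]_N) : v != 0 -> exists i, v ord0 i != 0.
Proof.
move=> v0; apply/not_existsP => h; case/eqP: v0; apply/rowP => i.
by rewrite mxE; apply/eqP/negPn/negP/h.
Qed.

Lemma rV_neq0 N (v : 'rV[K]_N) i : v ord0 i != 0 -> v != 0.
Proof. by apply: contraNneq => ->; rewrite mxE. Qed.

Lemma rVZ N c (v : 'rV[K]_N) i : (c *: v) ord0 i = c * v ord0 i.
Proof. by rewrite mxE. Qed.

Lemma rVD N (v w : 'rV[K]_N) i : (v + w) ord0 i = v ord0 i + w ord0 i.
Proof. by rewrite mxE. Qed.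

(** Vanishing of the 2 x 2 minors. Unlike [peq] it asks for no nonvanishing, so it is a closed
    condition and passes from the image of a parametrization to its closure. *)
Definition para N (v w : 'rV[K]_N) : Prop :=
  forall i j, v ord0 i * w ord0 j = v ord0 j * w ord0 i.

Lemma para_sym N (v w : 'rV[K]_N) : para v w -> para w v.
Proof. by move=> h i j; rewrite mulrC h mulrC. Qed.

Lemma para_refl N (v : 'rV[K]_N) : para v v.
Proof. by move=> i j; rewrite mulrC. Qed.

Lemma paraZ N (v w : 'rV[K]_N) c : para v w -> para v (c *: w).
Proof. by move=> h i j; rewrite !mxE !(mulrCA _ c) h. Qed.

Lemma para_colinear N (v w : 'rV[K]_N) :
  v != 0 -> para v w -> exists c, w = c *: v.
Proof.
move=> /rV_neq0P[i vi] h; exists (w ord0 i / v ord0 i); apply/rowP => j.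
by rewrite !mxE mulrAC [_ * v _ _]mulrC -h mulrAC divff ?mul1r.
Qed.

Lemma peq_para N (v w : 'rV[K]_N) : peq v w -> para v w.
Proof. by move=> [_ _ [c ->]]; apply/paraZ/para_refl. Qed.

Lemma para_peq N (v w : 'rV[K]_N) : v != 0 -> w != 0 -> para v w -> peq v w.
Proof. by move=> v0 w0 /(para_colinear v0)[c e]; split=> //; exists c. Qed.

Lemma peq_refl N (v : 'rV[K]_N) : v != 0 -> peq v v.
Proof. by move=> v0; split=> //; exists 1; rewrite scale1r. Qed.

Lemma peqP N (v w : 'rV[K]_N) :
  peq v w <-> v != 0 /\ exists2 c, c != 0 & w = c *: v.
Proof.
split=> [[v0 w0 [c e]]|[v0 [c c0 e]]].
  split=> //; exists c => //; apply: contra_neq w0 => c0.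
  by rewrite e c0 scale0r.
by split=> //; [rewrite e scaler_eq0 negb_or c0|exists c].
Qed.

Lemma peq_sym N (v w : 'rV[K]_N) : peq v w -> peq w v.
Proof. by case=> v0 w0 h; apply: para_peq => //; apply/para_sym/peq_para. Qed.

Lemma peq_trans N (v w x : 'rV[K]_N) : peq v w -> peq w x -> peq v x.
Proof.
move=> /peqP[v0 [c c0 ->]] /peqP[w0 [d d0 ->]]; apply/peqP; split=> //.
by exists (d * c); rewrite ?mulf_neq0 // scalerA.
Qed.

Lemma peqZ N (v : 'rV[K]_N) c : v != 0 -> c != 0 -> peq v (c *: v).
Proof. by move=> v0 c0; apply/peqP; split=> //; exists c. Qed.

Lemma peq_neq0 N (v w : 'rV[K]_N) i :
  peq v w -> v ord0 i != 0 -> w ord0 i != 0.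
Proof. by move=> /peqP[_ [c c0 ->]] vi; rewrite mxE mulf_neq0. Qed.

Lemma para_trans N (v w x : 'rV[K]_N) : w != 0 -> para v w -> para w x -> para v x.
Proof.
move=> w0 /para_sym /(para_colinear w0)[c ->] wx.
by apply: para_sym; apply: paraZ; apply: para_sym.
Qed.

Definition hvec N M d (F : pt K N -> 'rV[K]_M) : Prop :=
  forall i, hpoly d (fun q => F q ord0 i).

Lemma hvec_pevalv N M d (F : pt K N -> 'rV[K]_M) : hvec d F ->
  exists G, (forall i, homog_deg d (G i)) /\ F =1 pevalv G.
Proof.
move=> hF.
have /choice[G GP] : forall i, exists p, homog_deg d p /\
    forall q, F q ord0 i = peval p q by move=> i; have [p] := hF i; exists p.
by exists G; split=> [i|q]; [exact: (GP i).1|apply/rowP => i; rewrite mxE (GP i).2].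
Qed.

Lemma hvec_polyv N M d (F : pt K N -> 'rV[K]_M) : hvec d F -> polyv F.
Proof. by move=> h i; apply: hpoly_ispoly (h i). Qed.

Lemma hvec_scale N M d (F : pt K N -> 'rV[K]_M) c v t : hvec d F ->
  F (c *: v, t) = c ^+ d *: F (v, t).
Proof.
by move=> h; apply/rowP => i; rewrite [RHS]mxE; apply: (hpoly_scale c v t (h i)).
Qed.

Lemma hpoly_comp N M d e (g : pt K M -> K) (F : pt K N -> 'rV[K]_M) :
  hpoly d g -> hvec e F -> hpoly (d * e) (fun q => g (F q, q.2)).
Proof.
move=> [p hp gp] hF.
(* Monomials of the wrong degree are replaced by 0, so that every summand is homogeneous of degree
   [d * e], even off the support. *)
pose term m (q : pt K N) := if mpoly.mdeg m == d then
  (mpoly.mcoeff m p).[q.2] * \prod_i (F q ord0 i) ^+ (m i) else 0.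
apply: (@hpoly_ext _ _ _ _ (fun q => \sum_(m <- mpoly.msupp p) term m q)) => [q|].
  rewrite gp /peval mpoly.mevalE horner_sum; apply: eq_big_seq => m mp.
  have md : mpoly.mdeg m == d := allP hp _ mp.
  rewrite /term md hornerM horner_prod; congr (_ * _).
  by apply: eq_bigr => i _; rewrite horner_exp hornerC.
apply: hpoly_sum => m; rewrite /term; case: eqP => [md|_]; last exact: hpoly0.
rewrite -[X in hpoly X _]add0n; apply: hpolyM; first exact: hpoly_tp.
rewrite -md mpoly.mdegE; elim: (index_enum _) => [|i r IH].
  by rewrite big_nil; apply: (hpoly_ext _ (hpoly_c N 1)) => q; rewrite big_nil.
rewrite big_cons mulnDl; apply: hpoly_ext (hpolyM _ IH) => [q|].
  by rewrite big_cons.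
by rewrite mulnC; apply: hpolyXn.
Qed.

Lemma hvec_comp N M L d e (G : pt K M -> 'rV[K]_L) (F : pt K N -> 'rV[K]_M) :
  hvec d G -> hvec e F -> hvec (d * e) (fun q => G (F q, q.2)).
Proof. by move=> hG hF i; apply: (hpoly_comp (hG i)). Qed.

Lemma zclosureP N (S : set (pt K N)) p : zclosure S p <->
  p.1 != 0 /\ forall d g, hpoly d g -> (forall a, S a -> g a = 0) -> g p = 0.
Proof.
split=> [[p0 h]|[p0 h]]; split=> //.
  move=> d g [r hr gr] S0; rewrite gr; apply: h; first by exists d.
  by move=> a Sa; rewrite -gr S0.
by move=> r [d hr] S0; apply: (h d (peval r)) => //; exists r.
Qed.

Lemma zclosedP N (A : set (pt K N)) : zclosed A <->
  exists I : nat -> (pt K N -> K) -> Prop, (forall d g, I d g -> hpoly d g) /\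
    forall q, A q <-> q.1 != 0 /\ forall d g, I d g -> g q = 0.
Proof.
split=> [[I hI ->]|[I [hI AI]]].
  exists (fun d g => exists2 r, I r & homog_deg d r /\ g = peval r).
  split=> [d g [r Ir [hr ->]]|q]; first by exists r.
  split=> [[q0 h]|[q0 h]]; split=> //; first by move=> d g [r Ir [_ ->]]; apply: h.
  by move=> r Ir; have [d hd] := hI _ Ir; apply: (h d); exists r.
exists [set r | exists d, homog_deg d r /\ I d (peval r)].
  by move=> r [d [hd _]]; exists d.
apply/seteqP; split=> q.
  by move/AI => [q0 h]; split=> // r [d [_ /h]].
move=> [q0 h]; apply/AI; split=> // d g Ig.
have [r hr gr] := hI _ _ Ig; rewrite gr; apply: h; exists d; split=> //.
by rewrite (_ : peval r = g) //; apply/funext => ?; rewrite gr.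
Qed.

Lemma zclosure_zclosed N (S : set (pt K N)) : zclosed (zclosure S).
Proof.
apply/zclosedP; exists (fun d g => hpoly d g /\ forall a, S a -> g a = 0).
split=> [d g []//|q]; rewrite zclosureP.
by split=> -[q0 h]; split=> // d g; [move=> []; apply: h|move=> ? ?; apply: (h d)].
Qed.

Lemma zclosedI N (A B : set (pt K N)) : zclosed A -> zclosed B -> zclosed (A `&` B).
Proof.
move=> /zclosedP[I [hI AI]] /zclosedP[J [hJ BJ]].
apply/zclosedP; exists (fun d g => I d g \/ J d g).
split=> [d g [/hI|/hJ]//|q]; split.
  by move=> [/AI[q0 h] /BJ[_ k]]; split=> // d g [/h|/k].
move=> [q0 h]; split.
  by apply/AI; split=> // d g Ig; apply: (h d); left.
by apply/BJ; split=> // d g Ig; apply: (h d); right.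
Qed.

Lemma zclosure_min N (S A : set (pt K N)) : zclosed A -> S `<=` A -> zclosure S `<=` A.
Proof.
move=> /zclosedP[I [hI AI]] SA p /zclosureP[p0 h]; apply/AI; split=> // d g Ig.
by apply: (h d g (hI _ _ Ig)) => a /SA /AI[_ k]; apply: (k d).
Qed.

Lemma zclosed_hpoly N (I : Type) (d : I -> nat) (g : I -> pt K N -> K) :
  (forall i, hpoly (d i) (g i)) ->
  zclosed [set q | q.1 != 0 /\ forall i, g i q = 0].
Proof.
move=> hg; apply/zclosedP; exists (fun e f => exists2 i, e = d i & f = g i).
split=> [e f [i -> ->]//|q]; split=> -[q0 h]; split=> //.
  by move=> e f [i _ ->].
by move=> i; apply: (h (d i)); exists i.
Qed.

Definition model n N (B : pt K n -> 'rV[K]_N) : set (pt K N) :=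
  zclosure [set s | exists u, s = (B u, u.2)].

Lemma model_zclosed n N (B : pt K n -> 'rV[K]_N) : zclosed (model B).
Proof. exact: zclosure_zclosed. Qed.

Lemma model_neq0 n N (B : pt K n -> 'rV[K]_N) p : model B p -> p.1 != 0.
Proof. by case. Qed.

Lemma model_vanish n N (B : pt K n -> 'rV[K]_N) p d g :
  hpoly d g -> (forall u, g (B u, u.2) = 0) -> model B p -> g p = 0.
Proof. by move=> hg h /zclosureP[_]; apply; [exact: hg|move=> _ [u ->]]. Qed.

Lemma modelP n N (B : pt K n -> 'rV[K]_N) p : model B p <->
  p.1 != 0 /\ forall d g, hpoly d g -> (forall u, g (B u, u.2) = 0) -> g p = 0.
Proof.
rewrite [model B p]zclosureP; split=> -[p0 h]; split=> // d g hg h0.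
  by apply: (h d g hg) => _ [u ->].
by apply: (h d g hg) => u; apply: h0; exists u.
Qed.

Lemma model_pt n N (B : pt K n -> 'rV[K]_N) u : B u != 0 -> model B (B u, u.2).
Proof. by move=> B0; apply/modelP; split=> // d g hg; apply. Qed.

Lemma model_peq n N (B : pt K n -> 'rV[K]_N) v w t :
  peq v w -> model B (v, t) -> model B (w, t).
Proof.
move=> /peqP[v0 [c c0 ->]] /modelP[_ h]; apply/modelP; split=> /=.
  by rewrite scaler_eq0 negb_or c0.
by move=> d g hg /(h _ _ hg) e; rewrite (hpoly_scale c v t hg) e mulr0.
Qed.

Lemma segreE N M (u : 'rV[K]_N) (w : 'rV[K]_M) i j :
  segre u w ord0 (mxvec_index i j) = u ord0 i * w ord0 j.
Proof. by rewrite /segre mxvecE mxE big_ord1 mxE. Qed.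

Lemma segre_neq0 N M (u : 'rV[K]_N) (w : 'rV[K]_M) :
  (segre u w != 0) = (u != 0) && (w != 0).
Proof.
apply/idP/andP => [/rV_neq0P[k]|[/rV_neq0P[i ui] /rV_neq0P[j wj]]].
  case/mxvec_indexP: k => i j; rewrite segreE mulf_eq0 negb_or => /andP[].
  by move=> /rV_neq0 -> /rV_neq0 ->.
by apply: (@rV_neq0 _ _ (mxvec_index i j)); rewrite segreE mulf_neq0.
Qed.

(** On [segre u w] the m-th column is w_m u: the first projection given by linear forms, valid where
    w_m is nonzero. [rowv] does the same for the second factor. *)
Definition colv N M (m : 'I_M) (p : 'rV[K]_(N * M)) : 'rV[K]_N :=
  \row_i p ord0 (mxvec_index i m).

Definition rowv N M (m : 'I_N) (p : 'rV[K]_(N * M)) : 'rV[K]_M :=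
  \row_j p ord0 (mxvec_index m j).

Lemma colv_segre N M (u : 'rV[K]_N) (w : 'rV[K]_M) m :
  colv m (segre u w) = w ord0 m *: u.
Proof. by apply/rowP => i; rewrite !mxE segreE mulrC. Qed.

Lemma rowv_segre N M (u : 'rV[K]_N) (w : 'rV[K]_M) m :
  rowv m (segre u w) = u ord0 m *: w.
Proof. by apply/rowP => i; rewrite !mxE segreE. Qed.

Lemma segre_peq N M (u u' : 'rV[K]_N) (w w' : 'rV[K]_M) :
  peq u u' -> peq w w' -> peq (segre u w) (segre u' w').
Proof.
move=> /peqP[u0 [c c0 ->]] /peqP[w0 [d d0 ->]]; apply/peqP.
rewrite segre_neq0 u0 w0; split=> //; exists (c * d); first by rewrite mulf_neq0.
by apply/rowP => k; case/mxvec_indexP: k => i j; rewrite mxE !segreE !mxE; ring.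
Qed.

Lemma segre_para N M (u u' : 'rV[K]_N) (w w' : 'rV[K]_M) :
  para u u' -> para w w' -> para (segre u w) (segre u' w').
Proof.
move=> h k i j; case/mxvec_indexP: i => i1 i2; case/mxvec_indexP: j => j1 j2.
by rewrite !segreE mulrACA h k mulrACA.
Qed.

Lemma segre_peq_inv N M (u u' : 'rV[K]_N) (w w' : 'rV[K]_M) :
  peq (segre u w) (segre u' w') -> peq u u' /\ peq w w'.
Proof.
move=> [+ + [c e]]; rewrite !segre_neq0 => /andP[u0 w0] /andP[u'0 w'0].
have [m w'm] := rV_neq0P w'0; have [l u'l] := rV_neq0P u'0; split.
- have := congr1 (colv m) e; rewrite colv_segre => em.
  apply: para_peq => //; apply: (@para_trans _ _ (w' ord0 m *: u')).
  + by rewrite scaler_eq0 negb_or w'm.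
  + rewrite em (_ : colv m _ = c *: colv m (segre u w)); last first.
      by apply/rowP => i; rewrite !mxE.
    by rewrite colv_segre scalerA; apply/paraZ/para_refl.
  + by apply/para_sym/paraZ/para_refl.
- have := congr1 (rowv l) e; rewrite rowv_segre => em.
  apply: para_peq => //; apply: (@para_trans _ _ (u' ord0 l *: w')).
  + by rewrite scaler_eq0 negb_or u'l.
  + rewrite em (_ : rowv l _ = c *: rowv l (segre u w)); last first.
      by apply/rowP => i; rewrite !mxE.
    by rewrite rowv_segre scalerA; apply/paraZ/para_refl.
  + by apply/para_sym/paraZ/para_refl.
Qed.

Definition tens n N M (A : pt K n -> 'rV[K]_N) (B : pt K n -> 'rV[K]_M) u :=
  segre (A u) (B u).

Lemma polyv_tens n N M (A : pt K n -> 'rV[K]_N) (B : pt K n -> 'rV[K]_M) :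
  polyv A -> polyv B -> polyv (tens A B).
Proof.
move=> pA pB k; case/mxvec_indexP: k => i j.
by apply: ispoly_ext (ispolyM (pA i) (pB j)) => q; rewrite /tens segreE.
Qed.

Lemma hvec_tens N d e L M (A : pt K N -> 'rV[K]_L) (B : pt K N -> 'rV[K]_M) :
  hvec d A -> hvec e B -> hvec (d + e) (tens A B).
Proof.
move=> pA pB k; case/mxvec_indexP: k => i j.
by apply: hpoly_ext (hpolyM (pA i) (pB j)) => q; rewrite /tens segreE.
Qed.

Lemma hvec_id N : hvec 1 (fun q : pt K N => q.1).
Proof. by move=> i; apply: hpoly_x. Qed.

Lemma hvec_colv N M m : hvec 1 (fun q : pt K (N * M) => colv m q.1).
Proof. by move=> i; apply: hpoly_ext (hpoly_x K (mxvec_index i m)) => q; rewrite mxE. Qed.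

Lemma hvec_rowv N M m : hvec 1 (fun q : pt K (N * M) => rowv m q.1).
Proof. by move=> i; apply: hpoly_ext (hpoly_x K (mxvec_index m i)) => q; rewrite mxE. Qed.

(** The rank one equations between the entries of the matrix p hold on the image, hence on the
    closure, so every point of it splits. Forms vanishing on the image of a factor pull back along a
    column or a row. *)
Lemma model_tens n N M (A : pt K n -> 'rV[K]_N) (B : pt K n -> 'rV[K]_M) p :
  model (tens A B) p -> exists s w,
    [/\ p.1 = segre s w, model A (s, p.2) & model B (w, p.2)].
Proof.
move=> mp; have [k] := rV_neq0P (model_neq0 mp).
case/mxvec_indexP: k => i0 j0 p0.
have rk i j : p.1 ord0 (mxvec_index i j) * p.1 ord0 (mxvec_index i0 j0) =
              p.1 ord0 (mxvec_index i j0) * p.1 ord0 (mxvec_index i0 j).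
  apply/eqP; rewrite -subr_eq0; apply/eqP.
  pose g (q : pt K (N * M)) := q.1 ord0 (mxvec_index i j) *
    q.1 ord0 (mxvec_index i0 j0) -
    q.1 ord0 (mxvec_index i j0) * q.1 ord0 (mxvec_index i0 j).
  apply: (@model_vanish _ _ _ p (1 + 1) g) mp => [|u].
    by apply: hpolyB; apply: hpolyM; apply: hpoly_x.
  by rewrite /g /= /tens !segreE; ring.
(* The nonzero entry serves as pivot: its column, and its row divided by the pivot, multiply back to
   p. *)
exists (colv j0 p.1), ((p.1 ord0 (mxvec_index i0 j0))^-1 *: rowv i0 p.1); split.
- apply/rowP => k; case/mxvec_indexP: k => i j.
  by rewrite segreE !mxE mulrCA -rk mulrC mulfK.
- apply/modelP; split=> [|d g hg g0] /=.
    by apply: (@rV_neq0 _ _ i0); rewrite mxE.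
  have := hpoly_comp hg (@hvec_colv N M j0).
  move/(@model_vanish _ _ (tens A B) p); apply=> // u /=.
  by rewrite /tens colv_segre (hpoly_scale _ _ _ hg) g0 mulr0.
- apply: (@model_peq _ _ _ (rowv i0 p.1)).
    apply: peqZ; last by rewrite invr_neq0.
    by apply: (@rV_neq0 _ _ j0); rewrite mxE.
  apply/modelP; split=> [|d g hg g0] /=.
    by apply: (@rV_neq0 _ _ j0); rewrite mxE.
  have := hpoly_comp hg (@hvec_rowv N M i0).
  move/(@model_vanish _ _ (tens A B) p); apply=> // u /=.
  by rewrite /tens rowv_segre (hpoly_scale _ _ _ hg) g0 mulr0.
Qed.

(* [resolves B B'] : the rational map [B u |-> B' u] is regular on [model B]. *)
Definition resolves_by n N M (B : pt K n -> 'rV[K]_N) (B' : pt K n -> 'rV[K]_M)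
    (F : pt K N -> 'rV[K]_M) : Prop :=
  (exists d, hvec d F) /\ forall u, para (F (B u, u.2)) (B' u).

Definition resolves n N M (B : pt K n -> 'rV[K]_N) (B' : pt K n -> 'rV[K]_M) : Prop :=
  forall p, model B p -> exists2 F, resolves_by B B' F & F p != 0.

Lemma resolves_by_model n N M (B : pt K n -> 'rV[K]_N) (B' : pt K n -> 'rV[K]_M) F p :
  (forall u, B' u != 0) -> resolves_by B B' F -> model B p -> F p != 0 ->
  model B' (F p, p.2).
Proof.
move=> B'0 [[d hF] FB] mp Fp; apply/modelP; split=> // e g hg g0.
apply: (model_vanish (hpoly_comp hg hF) _ mp) => u /=.
have [c ->] := para_colinear (B'0 u) (para_sym (FB u)).
by rewrite (hpoly_scale _ _ _ hg) g0 mulr0.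
Qed.

(** Proportionality is closed, so two representatives of the same rational map agree wherever both
    are nonzero. This makes pointwise choices of representatives glue. *)
Lemma resolves_by_para n N M (B : pt K n -> 'rV[K]_N) (B' : pt K n -> 'rV[K]_M) F F' p :
  (forall u, B' u != 0) -> resolves_by B B' F -> resolves_by B B' F' ->
  model B p -> para (F p) (F' p).
Proof.
move=> B'0 [[d hF] FB] [[d' hF'] FB'] mp i j; apply/eqP; rewrite -subr_eq0; apply/eqP.
apply: (@model_vanish _ _ _ _ (d + d')
   (fun p => F p ord0 i * F' p ord0 j - F p ord0 j * F' p ord0 i)) mp => [|u].
  by apply: hpolyB; apply: hpolyM.
apply/eqP; rewrite subr_eq0; apply/eqP.
exact: (para_trans (B'0 u) (FB u) (para_sym (FB' u))).
Qed.

Definition res_map n N M (B : pt K n -> 'rV[K]_N) (B' : pt K n -> 'rV[K]_M)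
    (phi : pt K N -> 'rV[K]_M) : Prop :=
  [/\ regular_map (model B) phi, forall p, model B p -> model B' (phi p, p.2) &
      forall p F, model B p -> resolves_by B B' F -> F p != 0 -> peq (phi p) (F p)].

(** At each p a representative regular at p is chosen and evaluated at p alone; by
    [resolves_by_para] the result still agrees near p with a single representative. *)
Lemma res_mapP n N M (B : pt K n -> 'rV[K]_N) (B' : pt K n -> 'rV[K]_M) :
  (forall u, B' u != 0) -> resolves B B' -> exists phi, res_map B B' phi.
Proof.
move=> B'0 rB.
have /choice[G GP] : forall p, exists G, model B p -> resolves_by B B' G /\ G p != 0.
  move=> p; case: (pselect (model B p)) => [/rB[F h k]|]; first by exists F.
  by move=> np; exists (fun=> 0).
have key p F : model B p -> resolves_by B B' F -> F p != 0 -> peq (G p p) (F p).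
  move=> mp rF Fp; have [h k] := GP p mp.
  by apply: para_peq => //; apply: resolves_by_para mp.
exists (fun p => G p p); split=> // [p mp|p mp].
  have [h k] := GP p mp; have [[d hd] h2] := h.
  have [P [hP GPe]] := hvec_pevalv hd; exists d, P; split=> //.
    by rewrite -GPe.
  by move=> q mq; rewrite -GPe; apply: key.
by have [h k] := GP p mp; exact: (resolves_by_model B'0 h mp k).
Qed.

Lemma resolves_trans n N M L (B : pt K n -> 'rV[K]_N) (B' : pt K n -> 'rV[K]_M)
    (C : pt K n -> 'rV[K]_L) : (forall u, B' u != 0) ->
  resolves B B' -> resolves B' C -> resolves B C.
Proof.
move=> B'0 h1 h2 p mp; have [F rF Fp] := h1 p mp.
have [G [[e hG] GB] Gp] := h2 _ (resolves_by_model B'0 rF mp Fp).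
have [[d hF] FB] := rF.
exists (fun q => G (F q, q.2)) => //; split=> [|u /=].
  by exists (e * d)%N; apply: hvec_comp.
have [c ->] := para_colinear (B'0 u) (para_sym (FB u)).
by rewrite (hvec_scale _ _ _ hG); apply/para_sym/paraZ/para_sym.
Qed.

Lemma resolves_id n N (B : pt K n -> 'rV[K]_N) : resolves B B.
Proof.
move=> p mp; exists (fun q => q.1); last exact: model_neq0 mp.
by split=> [|u]; [exists 1%N; apply: hvec_id|apply: para_refl].
Qed.

Lemma resolves_tensl n N M (A : pt K n -> 'rV[K]_N) (B : pt K n -> 'rV[K]_M) :
  resolves (tens A B) A.
Proof.
move=> p mp; have [s [w [e ms mw]]] := model_tens mp.
have [m wm] := rV_neq0P (model_neq0 mw).
exists (fun q => colv m q.1); last first.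
  by rewrite e colv_segre scaler_eq0 negb_or wm (model_neq0 ms).
split=> [|u]; first by exists 1%N; apply: hvec_colv.
by rewrite /= /tens colv_segre; apply/para_sym/paraZ/para_refl.
Qed.

Lemma resolves_tensr n N M (A : pt K n -> 'rV[K]_N) (B : pt K n -> 'rV[K]_M) :
  resolves (tens A B) B.
Proof.
move=> p mp; have [s [w [e ms mw]]] := model_tens mp.
have [m wm] := rV_neq0P (model_neq0 ms).
exists (fun q => rowv m q.1); last first.
  by rewrite e rowv_segre scaler_eq0 negb_or wm (model_neq0 mw).
split=> [|u]; first by exists 1%N; apply: hvec_rowv.
by rewrite /= /tens rowv_segre; apply/para_sym/paraZ/para_refl.
Qed.

(** Two regular maps combine to a regular map into the closure of their joint image. Together with
    the two projections and transitivity this reduces the comparison of blow-ups to formal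
    bookkeeping. *)
Lemma resolves_pair n N M L (C : pt K n -> 'rV[K]_L) (A : pt K n -> 'rV[K]_N)
    (B : pt K n -> 'rV[K]_M) :
  resolves C A -> resolves C B -> resolves C (tens A B).
Proof.
move=> rA rB p mp; have [F [[d hF] FA] Fp] := rA p mp.
have [G [[e hG] GB] Gp] := rB p mp.
exists (tens F G); last by rewrite segre_neq0 Fp.
by split=> [|u]; [exists (d + e)%N; apply: hvec_tens|apply: segre_para].
Qed.

(** The composite and the identity are two representatives of the map from [B] to itself, hence
    agree by [resolves_by_para]. *)
Lemma res_map_comp n N M (B : pt K n -> 'rV[K]_N) (B' : pt K n -> 'rV[K]_M) phi psi p :
  (forall u, B u != 0) -> (forall u, B' u != 0) ->
  resolves B B' -> resolves B' B -> res_map B B' phi -> res_map B' B psi ->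
  model B p -> peq (psi (phi p, p.2)) p.1.
Proof.
move=> B0 B'0 r1 r2 [_ m1 h1] [_ m2 h2] mp.
have [F rF Fp] := r1 p mp; have mF := resolves_by_model B'0 rF mp Fp.
have mphi := m1 p mp; have [G rG Gp] := r2 _ mphi.
have e := h1 p F mp rF Fp.
apply: peq_trans (h2 _ G mphi rG Gp) _.
have rGF : resolves_by B B (fun q => G (F q, q.2)).
  have [[d hF] FB] := rF; have [[d' hG] GB] := rG.
  split; first by exists (d' * d)%N; apply: hvec_comp.
  move=> u /=; have [c ->] := para_colinear (B'0 u) (para_sym (FB u)).
  by rewrite (hvec_scale _ _ _ hG); apply/para_sym/paraZ/para_sym.
have rI : resolves_by B B (fun q => q.1).
  by split=> [|u]; [exists 1%N; apply: hvec_id|apply: para_refl].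
have [[d' hG] _] := rG.
have eG : peq (G (phi p, p.2)) (G (F p, p.2)).
  have /peqP[phi0 [c c0 ->]] := e.
  by rewrite (hvec_scale _ _ _ hG); apply: peqZ; rewrite ?expf_neq0.
have [_ GF0 _] := eG; apply: peq_trans eG _.
by apply: para_peq => //; [exact: model_neq0 mp|apply: (resolves_by_para B0 rGF rI)].
Qed.

Lemma resolves_iso n N M (B : pt K n -> 'rV[K]_N) (B' : pt K n -> 'rV[K]_M) phi :
  (forall u, B u != 0) -> (forall u, B' u != 0) ->
  resolves B B' -> resolves B' B -> res_map B B' phi ->
  isomorphic_via (model B) (model B') phi.
Proof.
move=> B0 B'0 r1 r2 h1; have [psi h2] := res_mapP B0 r2.
exists psi; split; [by case: h1|by case: h2| |] => q mq.
- have [_ m1 _] := h1; split; first exact: m1.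
  exact: (res_map_comp B0 B'0 r1 r2 h1 h2 mq).
- have [_ m2 _] := h2; split; first exact: m2.
  exact: (res_map_comp B'0 B0 r2 r1 h2 h1 mq).
Qed.

End Models.

(** * Homogenization and local equations of parametrized varieties *)

Section Charts.
Variable K : numClosedFieldType.

Lemma homogenize_family n N (I : finType) (f : I -> pt K n -> K)
    (lam : 'I_n -> pt K N -> K) l :
  (forall i, ispoly (f i)) -> (forall a, hpoly 1 (lam a)) -> hpoly 1 l ->
  exists D (R : I -> pt K N -> K), (forall i, hpoly D (R i)) /\
    forall i q, R i q = l q ^+ D * f i (\row_a (lam a q / l q), q.2).
Proof.
move=> fp hlam hl.
have /choice[DR DRP] : forall i, exists DR : nat * (pt K N -> K), hpoly DR.1 DR.2 /\
    forall q, l q != 0 -> DR.2 q = l q ^+ DR.1 * f i (\row_a (lam a q / l q), q.2).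
  by move=> i; have [D [R h]] := homogenize (fp i) hlam hl; exists (D, R).
(* The common degree exceeds each individual one, so that both sides vanish where [l] does and the
   identity holds at every q. *)
pose D := (\max_i (DR i).1).+1.
have leD i : ((DR i).1 < D)%N by rewrite ltnS; apply: leq_bigmax.
exists D, (fun i q => (DR i).2 q * l q ^+ (D - (DR i).1)); split=> [i|i q].
  rewrite -{1}(subnKC (ltnW (leD i))) -[X in (_ + X)%N]mul1n.
  by apply: hpolyM; [exact: (DRP i).1|exact: hpolyXn].
case: (eqVneq (l q) 0) => [->|lq].
  by rewrite expr0n subn_eq0 leqNgt leD mulr0 exprS !mul0r.
by rewrite (DRP i).2 // mulrAC -exprD subnKC // ltnW.
Qed.

(* Coordinates [q a], [a \notin J], are replaced by functions of [t]. *)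
Definition subst n (J : {set 'I_n}) (gam : 'I_n -> {poly K}) (q : pt K n) : 'rV[K]_n :=
  \row_a (if a \in J then q.1 ord0 a else (gam a).[q.2]).

Lemma polyv_subst n J gam : polyv (@subst n J gam).
Proof.
move=> a; case: (boolP (a \in J)) => aJ.
  by apply: ispoly_ext (ispoly_x K a) => q; rewrite mxE aJ.
by apply: ispoly_ext (ispoly_tp _ (gam a)) => q; rewrite mxE (negbTE aJ).
Qed.

Lemma subst_id n (J : {set 'I_n}) gam (q : pt K n) :
  (forall a, a \notin J -> q.1 ord0 a = (gam a).[q.2]) -> subst J gam q = q.1.
Proof. by move=> h; apply/rowP => a; rewrite mxE; case: ifPn => // /h. Qed.

(** Division with remainder by the ideal of the subspace where q_a = gam_a for a not in J: the
    functions whose difference with their restriction lies in that ideal are closed under sums and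
    products. The terms with a in J are zero. *)
Lemma divide_subst n J gam (f : pt K n -> K) : ispoly f ->
  exists H : 'I_n -> pt K n -> K, (forall a, ispoly (H a)) /\
    forall q, f q - f (subst J gam q, q.2) =
      \sum_a (q.1 ord0 a - subst J gam q ord0 a) * H a q.
Proof.
move: f; apply: ispoly_ind => [f g fg [H [hH e]]|c|i|f g fp gp [H [hH e]] [G [hG k]]
   |f g fp gp [H [hH e]] [G [hG k]]].
- by exists H; split=> // q; rewrite !fg e.
- exists (fun _ _ => 0); split=> [a|q]; first exact: ispoly_c.
  by rewrite subrr big1 // => a _; rewrite mulr0.
- exists (fun a _ => (a == i)%:R); split=> [a|q]; first exact: ispoly_c.
  rewrite (bigD1 i) //= eqxx mulr1 big1 ?addr0 // => a /negbTE ->.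
  by rewrite mulr0.
- exists (fun a q => H a q + G a q); split=> [a|q]; first exact: ispolyD.
  rewrite opprD addrACA e k -big_split; apply: eq_bigr => a _ /=.
  by rewrite mulrDr.
- exists (fun a q => H a q * g q + f (subst J gam q, q.2) * G a q); split=> [a|q].
    apply: ispolyD; apply: ispolyM => //.
    exact: (ispoly_comp fp (@polyv_subst _ J gam)).
  transitivity ((f q - f (subst J gam q, q.2)) * g q +
     f (subst J gam q, q.2) * (g q - g (subst J gam q, q.2))); first by ring.
  rewrite e k mulr_suml mulr_sumr -big_split; apply: eq_bigr => a _ /=.
  by ring.
Qed.


(** Near p0 the variety is a graph: the ratios p_(idx a) / p_l with a in J are free, the other
    arguments of [P] are functions of t, and the remaining homogeneous coordinates are determined
    through [P]. A full J gives the smoothness of a model, a smaller one that of the centre of a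
    blow-up. *)
Lemma local_graph n N (W : set (pt K N)) p0 (P : pt K n -> 'rV[K]_N) l
    (J : {set 'I_n}) idx gam h0 d0 :
  let lam a (p : pt K N) :=
    if a \in J then p.1 ord0 (idx a) else (gam a).[p.2] * p.1 ord0 l in
  let kk p : pt K n := (\row_a (lam a p / p.1 ord0 l), p.2) in
  polyv P -> hpoly d0 h0 -> h0 p0 != 0 -> p0.1 ord0 l != 0 -> P (kk p0) ord0 l != 0 ->
  (forall a, a \in J -> idx a != l) ->
  {in J &, injective idx} ->
  (forall a q, a \in J -> P q ord0 (idx a) = q.1 ord0 a * P q ord0 l) ->
  (forall p : pt K N, p.1 ord0 l != 0 -> h0 p != 0 -> P (kk p) ord0 l != 0 ->
     (W p <-> para p.1 (P (kk p)))) ->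
  exists r (g : 'I_r -> rpoly K N), [/\ local_equations W p0 g,
    row_free (jacobian_z g p0) & (r + #|J|).+1 = N].
Proof.
move=> lam kk pP [h0p hh0 h0E] h00 p0l Pl idxl idxI Pidx WP.
have [Pm PmE] := polyv_pevalv pP.
pose X i : rpoly K N := mpoly.mpolyX _ (mpoly.mnm1 i).
pose lamp a : rpoly K N :=
  if a \in J then X (idx a) else mpoly.mpolyC N (gam a) * X l.
have lampE a (p : pt K N) : peval (lamp a) p = lam a p.
  by rewrite /lamp /lam; case: ifP => _; rewrite ?pevalM ?pevalC pevalX.
have hlamp a : homog_deg 1 (lamp a).
  rewrite /lamp; case: ifP => _; first exact: homog_degX.
  by rewrite -[1%N]add0n; apply: homog_degM; [apply: homog_degC|apply: homog_degX].
have /choice[DR DRP] : forall i, exists DR : nat * rpoly K N,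
  [/\ homog_deg DR.1 DR.2,
    forall q, peval (X l) q != 0 -> peval DR.2 q = peval (X l) q ^+ DR.1 *
      peval (Pm i) (\row_a (peval (lamp a) q / peval (X l) q), q.2) &
    forall i, (forall a, mpoly.mderiv i (lamp a) = 0) -> mpoly.mderiv i (X l) = 0 ->
      mpoly.mderiv i DR.2 = 0].
  move=> i; have [D [R h]] := homogenize_mpoly (Pm i) hlamp (homog_degX K l).
  by exists (D, R).
have RE i (p : pt K N) : p.1 ord0 l != 0 ->
    peval (DR i).2 p = p.1 ord0 l ^+ (DR i).1 * P (kk p) ord0 i.
  move=> pl; have [_ e _] := DRP i; rewrite e ?pevalX // PmE mxE; congr (_ * peval _ (_, _)).
  by apply/rowP => a; rewrite !mxE lampE ?pevalX.
(* One equation for each homogeneous coordinate that is neither the denominator nor free. *)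
pose I := [pred i | (i != l) && (i \notin idx @: J)].
pose g (k : 'I_#|I|) : rpoly K N := let i := enum_val k in
  X i * ((DR l).2 * X l ^+ (DR i).1) - X l * ((DR i).2 * X l ^+ (DR l).1).
have pevalXn k p : peval (X l ^+ k) p = p.1 ord0 l ^+ k.
  elim: k => [|k IH]; last by rewrite !exprS pevalM pevalX IH.
  by rewrite !expr0 -mpoly.mpolyC1 pevalC hornerC.
have gE k (p : pt K N) : p.1 ord0 l != 0 -> peval (g k) p = p.1 ord0 l ^+ ((DR l).1 + (DR (enum_val k)).1) *
    (p.1 ord0 (enum_val k) * P (kk p) ord0 l - p.1 ord0 l * P (kk p) ord0 (enum_val k)).
  move=> pl; rewrite /g pevalD pevalN !pevalM !pevalX !pevalXn !RE // exprD; ring.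
have hX k : homog_deg k (X l ^+ k).
  by rewrite -[k in homog_deg k]mul1n; apply/homog_degXn/homog_degX.
have hg k : homog (g k).
  exists (1 + ((DR l).1 + (DR (enum_val k)).1))%N; apply: homog_degD.
    apply: homog_degM; first exact: homog_degX.
    by apply: homog_degM => //; have [] := DRP l.
  apply/homog_degE; rewrite mpoly.dhomogN; apply/homog_degE.
  rewrite (addnC (DR l).1); apply: homog_degM; first exact: homog_degX.
  by apply: homog_degM => //; have [] := DRP (enum_val k).
exists #|I|, g; split.
- split=> //; exists (X l * (h0p * (DR l).2)); split.
  + have [hl _ _] := DRP l.
    by exists (1 + (d0 + (DR l).1))%N; apply: homog_degM; [exact: homog_degX|exact: homog_degM].
  + split; first exact: rV_neq0 p0l.
    by rewrite !pevalM pevalX -h0E RE // !mulf_neq0 // expf_neq0.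
  + move=> p [_]; rewrite !pevalM pevalX -h0E mulf_eq0 negb_or => /andP[pl].
    rewrite RE // !mulf_eq0 !negb_or => /and3P[h0q _ Plq].
    rewrite WP //; split=> [h k|h].
      by rewrite gE // h mulrC [p.1 _ l * _]mulrC subrr mul0r.
    have key i : p.1 ord0 i * P (kk p) ord0 l = p.1 ord0 l * P (kk p) ord0 i.
      case: (boolP (i \in I)) => [iI|].
        have := h (enum_rank_in iI i); rewrite gE // enum_rankK_in //.
        move/eqP; rewrite mulf_eq0 expf_eq0 (negbTE pl) andbF /= subr_eq0.
        by move/eqP.
      rewrite inE negb_and !negbK => /orP[/eqP -> //|/imsetP[a aJ ->]].
      by rewrite Pidx // !mxE /lam aJ mulrA [p.1 ord0 l * _]mulrC divfK.
    move=> i j; apply: (mulfI pl); apply: (mulfI Plq).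
    transitivity ((p.1 ord0 i * P (kk p) ord0 l) * (p.1 ord0 l * P (kk p) ord0 j)).
      by ring.
    by rewrite -key key; ring.
(* The forms built from [P] involve only the free coordinates and the denominator. With respect to
   the remaining coordinates the Jacobian is therefore diagonal, with nonzero entries. *)
- have dX i j : i != j -> mpoly.mderiv i (X j) = 0.
    move=> ij; rewrite /X mpoly.mderivX mpoly.mnm1E eq_sym (negbTE ij).
    by rewrite scale0r.
  have dlam i a : i \in I -> mpoly.mderiv i (lamp a) = 0.
    rewrite inE => /andP[il iJ]; rewrite /lamp; case: ifP => aJ.
      by apply: dX; apply: contraNneq iJ => ->; apply: imset_f.
    by rewrite mpoly.mderivM mpoly.mderivC mul0r add0r dX ?mulr0.
  have dR i j : i \in I -> mpoly.mderiv i (DR j).2 = 0.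
    move=> iI; have [_ _ h] := DRP j; apply: h => [a|]; first exact: dlam.
    by apply: dX; move: iI; rewrite inE => /andP[].
  have dXl i k : i \in I -> mpoly.mderiv i (X l ^+ k) = 0.
    rewrite inE => /andP[il _]; elim: k => [|k IH].
      by rewrite expr0 -mpoly.mpolyC1 mpoly.mderivC.
    by rewrite exprS mpoly.mderivM IH dX // mul0r mulr0 addr0.
  apply: inj_row_free => v /rowP v0; apply/rowP => k; rewrite mxE.
  have := v0 (enum_val k); rewrite !mxE (bigD1 k) //= big1 ?addr0.
    rewrite mxE /g mpoly.mderivB !mpoly.mderivM !dR ?enum_valP // dXl ?enum_valP //.
    rewrite !dXl ?enum_valP // [mpoly.mderiv _ (X l)]dX; last by have := enum_valP k; rewrite inE => /andP[].
    rewrite !(mulr0, mul0r, addr0, subr0).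
    rewrite /X mpoly.mderivX mpoly.mnm1E eqxx scale1r.
    rewrite !pevalM pevalXn RE // (_ : mpoly.mnm_sub _ _ = mpoly.mnm0); last first.
      by apply/mpoly.mnmP => j; rewrite mpoly.mnmBE subnn mpoly.mnm0E.
    rewrite mpoly.mpolyX0 -mpoly.mpolyC1 pevalC hornerC mul1r => /eqP.
    by rewrite !mulf_eq0 !expf_eq0 (negbTE p0l) (negbTE Pl) !andbF !orbF => /eqP.
  move=> j jk; rewrite mxE /g mpoly.mderivB !mpoly.mderivM !dR ?enum_valP //.
  rewrite !dXl ?enum_valP // [mpoly.mderiv _ (X l)]dX; last first.
    by have := enum_valP k; rewrite inE => /andP[].
  rewrite dX; last by apply: contra_neq jk => /enum_val_inj.
  by rewrite !(mulr0, mul0r, addr0, subr0) peval0 mulr0.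
- have cJ : #|l |: idx @: J| = #|J|.+1.
    rewrite cardsU1 card_in_imset // (_ : l \notin _) ?add1n //.
    by apply/imsetP => -[a aJ e]; have := idxl a aJ; rewrite -e eqxx.
  rewrite -addnS -cJ addnC -[RHS](card_ord N) -(cardC (mem (l |: idx @: J))).
  by congr (_ + _)%N; apply: eq_card => i; rewrite !inE negb_or.
Qed.
End Charts.

(** * Charts of closures and a criterion for blow-ups *)

Section Blowups.
Variable K : numClosedFieldType.

(** Generic points of the image of [B] are reached by [P], and generic points of [P] come from [B].
    The second condition is imposed for each t, which gives density fibre by fibre. *)
Definition xchart n N (B P : pt K n -> 'rV[K]_N) : Prop :=
  [/\ polyv P,
      exists w, [/\ ispoly w, exists u, w u != 0 & forall u, w u != 0 ->
        exists q, [/\ q.2 = u.2, P q != 0 & para (P q) (B u)]] &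
      exists d, [/\ ispoly d, forall t, exists2 q, q.2 = t & d q != 0 &
        forall q, d q != 0 -> exists2 u, u.2 = q.2 & para (B u) (P q)]].

(** The coordinates of the chart are ratios of homogeneous coordinates with common denominator
    [l]. *)
Definition standard n N (P : pt K n -> 'rV[K]_N) l (idx : 'I_n -> 'I_N) : Prop :=
  forall q a, P q ord0 (idx a) = q.1 ord0 a * P q ord0 l.

Definition xchart_at n N (B P : pt K n -> 'rV[K]_N) p l idx (q : pt K n) : Prop :=
  [/\ xchart B P, standard P l idx, q.2 = p.2, peq p.1 (P q) & P q ord0 l != 0].

Definition covered_by_xcharts n N (B : pt K n -> 'rV[K]_N) : Prop :=
  forall p, model B p -> exists P l idx q, xchart_at B P p l idx q.

Definition coords n N l (idx : 'I_n -> 'I_N) (p : pt K N) : pt K n :=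
  (\row_a (p.1 ord0 (idx a) / p.1 ord0 l), p.2).

Lemma xchart_vanish_fiber n N (B P : pt K n -> 'rV[K]_N) t d g :
  xchart B P -> (forall u, B u != 0) -> hpoly d g ->
  (forall u, u.2 = t -> g (B u, u.2) = 0) -> forall q, q.2 = t -> g (P q, q.2) = 0.
Proof.
move=> [pP _ [w [pw nw wP]]] B0 hg g0.
have pg : ispoly (fun q : pt K n => g (P q, q.2)).
  exact: (ispoly_comp (hpoly_ispoly hg)).
apply: (density_fiber pg pw (nw t)) => q qt /wP[u ut /(para_colinear (B0 u))[c ->]].
by rewrite (hpoly_scale _ _ _ hg) -ut g0 ?mulr0 // ut.
Qed.

Lemma xchart_vanish n N (B P : pt K n -> 'rV[K]_N) d g :
  xchart B P -> (forall u, B u != 0) -> hpoly d g ->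
  (forall u, g (B u, u.2) = 0) -> forall q, g (P q, q.2) = 0.
Proof.
by move=> cP B0 hg g0 q; apply: (@xchart_vanish_fiber _ _ B P q.2 d g).
Qed.

Lemma xchart_model n N (B P : pt K n -> 'rV[K]_N) q :
  xchart B P -> (forall u, B u != 0) -> P q != 0 -> model B (P q, q.2).
Proof.
move=> cP B0 Pq; apply/modelP; split=> // d g hg g0.
exact: (xchart_vanish cP B0 hg).
Qed.

Lemma standard_coords n N (P : pt K n -> 'rV[K]_N) l idx (q : pt K n) p :
  standard P l idx -> q.2 = p.2 -> para p.1 (P q) -> P q ord0 l != 0 ->
  p.1 != 0 -> coords l idx p = q /\ p.1 ord0 l != 0.
Proof.
move=> sP qt /para_sym pq Pl p0.
have P0 : P q != 0 by apply: rV_neq0 Pl.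
have [c e] := para_colinear P0 pq.
have c0 : c != 0 by apply: contra_neq p0; rewrite e => ->; rewrite scale0r.
have pl : p.1 ord0 l != 0 by rewrite e mxE mulf_neq0.
split=> //; rewrite /coords -qt [RHS]surjective_pairing; congr pair.
by apply/rowP => a; rewrite !mxE e !mxE sP mulrCA mulfK // mulf_neq0.
Qed.

(* A point of the closure with [p l != 0] lies on the chart with coordinates
   [p (idx a) / p l], unless the chart degenerates there. *)
Lemma xchart_coords n N (B P : pt K n -> 'rV[K]_N) l idx p :
  xchart B P -> standard P l idx -> polyv B -> (forall u, B u != 0) ->
  model B p -> p.1 ord0 l != 0 -> para p.1 (P (coords l idx p)).
Proof.
move=> [pP [w [pw nw wP]] _] sP pB B0 mp pl i j.
have [D [R [hR RE]]] := homogenize_family pP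
  (fun a => hpoly_x K (idx a)) (hpoly_x K l).
(* The factor p_l makes the form vanish where the chart coordinates are undefined, so that it can be
   tested at every point of the image. *)
pose g (p : pt K N) := p.1 ord0 l * (p.1 ord0 i * R j p - p.1 ord0 j * R i p).
have hg : hpoly (1 + (1 + D)) g.
  apply: hpolyM; first exact: hpoly_x.
  by apply: hpolyB; apply: hpolyM => //; apply: hpoly_x.
have g0 u : g (B u, u.2) = 0.
  apply: (@density_all _ _ (fun u => g (B u, u.2)) w) => // [|v wv].
    exact: (ispoly_comp (hpoly_ispoly hg)).
  rewrite /g /=; case: (eqVneq (B v ord0 l) 0) => [->|Bl]; first by rewrite mul0r.
  have [q [qt Pq ePB]] := wP v wv.
  have [c e] := para_colinear Pq ePB.
  have c0 : c != 0 by apply: contra_neq (B0 v); rewrite e => ->; rewrite scale0r.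
  have Pl : P q ord0 l != 0.
    by apply: contraNneq Bl => Pl; rewrite e mxE Pl mulr0.
  have [kE _] := @standard_coords _ _ P l idx q (B v, v.2) sP qt (para_sym ePB) Pl (B0 v).
  rewrite !RE (_ : (\row_a _, v.2) = q) /=; last exact: kE.
  by rewrite e !mxE; ring.
have := model_vanish hg g0 mp.
rewrite /g !RE => /eqP; rewrite mulf_eq0 (negbTE pl) /= subr_eq0 => /eqP.
rewrite !(mulrCA _ (_ ^+ _)); apply: mulfI.
by rewrite expf_neq0.
Qed.

(** If two coordinates shared an index, (q_a - q_b) P_l would vanish identically; if one had index
    [l], (q_a - 1) P_l would. Both contradict [nonzero_mul]. *)
Lemma standard_idx_inj n N (B P : pt K n -> 'rV[K]_N) l idx :
  xchart B P -> standard P l idx -> (exists q, P q ord0 l != 0) ->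
  injective idx /\ forall a, idx a != l.
Proof.
move=> [pP _ _] sP Pl; split=> [a b e|a].
  apply/eqP/negPn/negP => ab.
  have pab : ispoly (fun q : pt K n => q.1 ord0 a - q.1 ord0 b).
    by apply: ispolyB; apply: ispoly_x.
  have nab : exists q : pt K n, q.1 ord0 a - q.1 ord0 b != 0.
    exists (\row_c (c == a)%:R, 0); rewrite !mxE eqxx [b == a]eq_sym (negbTE ab) subr0.
    exact: oner_neq0.
  have [q] := nonzero_mul pab (pP l) nab Pl.
  by rewrite mulrBl -!sP e subrr eqxx.
apply/negP => /eqP e.
have pa : ispoly (fun q : pt K n => q.1 ord0 a - 1).
  by apply: ispolyB; [apply: ispoly_x|apply: ispoly_c].
have na : exists q : pt K n, q.1 ord0 a - 1 != 0.
  by exists (0, 0); rewrite mxE sub0r oppr_eq0 oner_neq0.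
have [q] := nonzero_mul pa (pP l) na Pl.
by rewrite mulrBl mul1r -sP e subrr eqxx.
Qed.

Lemma xchart_smooth n N (B : pt K n -> 'rV[K]_N) :
  polyv B -> (forall u, B u != 0) -> covered_by_xcharts B ->
  forall p, model B p -> exists r (g : 'I_r -> rpoly K N),
    [/\ local_equations (model B) p g, row_free (jacobian_z g p) & (r + n).+1 = N].
Proof.
move=> pB B0 cov p mp; have [P [l [idx [q [cP sP qt pq Pl]]]]] := cov p mp.
have [pP _ _] := cP.
have [idxI idxl] := standard_idx_inj cP sP (ex_intro _ q Pl).
have [kE pl] := standard_coords sP qt (peq_para pq) Pl (model_neq0 mp).
have lamE (p' : pt K N) : (\row_a ((if a \in [set: 'I_n]%SET then p'.1 ord0 (idx a)
    else (0 : {poly K}).[p'.2] * p'.1 ord0 l) / p'.1 ord0 l), p'.2) = coords l idx p'.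
  by congr pair; apply/rowP => a; rewrite !mxE inE.
have := @local_graph K n N (model B) p P l [set: 'I_n]%SET idx (fun=> 0) (fun=> 1) 0 pP
  (hpoly_c N 1) (oner_neq0 K) pl.
rewrite lamE kE => /(_ Pl).
case=> [a _|a b _ _|a q' _|p' pl' _|r [g [h1 h2 h3]]] //; last first.
- by exists r, g; split=> //; rewrite -h3 cardsT card_ord.
- rewrite lamE => Pl'; split=> [mp'|pp].
    exact: (xchart_coords cP sP pB B0).
  have P0 : P (coords l idx p') != 0 by apply: rV_neq0 Pl'.
  have := xchart_model cP B0 P0; rewrite [p' in model B p']surjective_pairing.
  by apply: model_peq; apply/peq_sym/para_peq => //; apply: rV_neq0 pl'.
- exact: idxI.
Qed.

Lemma row_free_row_mx N M r (A : 'M[K]_(r, N)) (C : 'M[K]_(r, M)) :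
  row_free A -> row_free (row_mx A C).
Proof.
move=> fA; apply: inj_row_free => v; rewrite mul_mx_row -row_mx0.
by move=> /eq_row_mx[+ _]; rewrite -(mul0mx _ A) => /(row_free_inj fA).
Qed.

Lemma xchart_nonsingular n N (B : pt K n -> 'rV[K]_N) :
  polyv B -> (forall u, B u != 0) -> covered_by_xcharts B -> nonsingular (model B).
Proof.
move=> pB B0 cov p /(xchart_smooth pB B0 cov)[r [g [h1 h2 _]]].
by exists r, g; split=> //; apply/eqP; apply: row_free_row_mx.
Qed.

Lemma xchart_smooth_over_base n N (B : pt K n -> 'rV[K]_N) :
  polyv B -> (forall u, B u != 0) -> covered_by_xcharts B ->
  smooth_over_base n (model B).
Proof.
move=> pB B0 cov p /(xchart_smooth pB B0 cov)[r [g [h1 h2 h3]]].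
by exists r, g; split=> //; apply/eqP.
Qed.

(* Near [p] the forms [F] generate the ideal of [{q a = gam a | a \notin J}]. *)
Definition center_at n N M (B P : pt K n -> 'rV[K]_N) (F : pt K N -> 'rV[K]_M)
    (q0 : pt K n) : Prop :=
  exists (J : {set 'I_n}) (gam : 'I_n -> {poly K}) (U : 'I_n -> pt K n -> K) (m : 'I_n -> 'I_M),
  [/\ forall q : pt K n, (forall a, a \notin J -> q.1 ord0 a = (gam a).[q.2]) ->
        F (P q, q.2) = 0,
      forall (q : pt K n) a, a \notin J -> F (P q, q.2) ord0 (m a) =
        (q.1 ord0 a - (gam a).[q.2]) * U a q,
      forall a, ispoly (U a) & forall a, U a q0 != 0].

Section BlowupLemma.
Variables (n N M e : nat) (B : pt K n -> 'rV[K]_N) (F : pt K N -> 'rV[K]_M).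
Hypothesis pB : polyv B.
Hypothesis B0 : forall u, B u != 0.
Hypothesis hF : hvec e F.
Hypothesis FB0 : forall u, F (B u, u.2) != 0.
Hypothesis cov : covered_by_xcharts B.
Hypothesis covZ : forall p, model B p -> F p = 0 ->
  exists P l idx q, xchart_at B P p l idx q /\ center_at B P F q.

Let Z : set (pt K N) := model B `&` [set p | F p = 0].

Lemma center_zclosed : zclosed Z.
Proof.
rewrite (_ : Z = model B `&` [set q | q.1 != 0 /\ forall i, F q ord0 i = 0]).
  apply: zclosedI; first exact: model_zclosed.
  by apply: (@zclosed_hpoly _ _ _ (fun=> e)) => i; apply: hF.
apply/seteqP; split=> p [mp h]; split=> //.
  by split=> [|i]; [exact: model_neq0 mp|rewrite h mxE].
by apply/rowP => i; rewrite mxE h.2.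
Qed.

Lemma center_dense : dense_in (model B) (model B `\` Z).
Proof.
move=> p mp; apply/zclosureP; split=> [|d g hg g0]; first exact: model_neq0 mp.
apply: (model_vanish hg _ mp) => u; apply: g0; split; first exact: model_pt.
by move=> [_ /= Fu]; have := FB0 u; rewrite Fu eqxx.
Qed.

Lemma center_nonsingular : nonsingular Z.
Proof.
move=> p [mp Fp]; have [P [l [idx [q [[cP sP qt pq Pl]]]]]] := covZ mp Fp.
move=> [J [gam [U [m [cF cm pU U0]]]]]; have [pP _ _] := cP.
have [idxI idxl] := standard_idx_inj cP sP (ex_intro _ q Pl).
have [kE pl] := standard_coords sP qt (peq_para pq) Pl (model_neq0 mp).
have [D [R [hR RE]]] := homogenize_family pU
  (fun a => hpoly_x K (idx a)) (hpoly_x K l).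
(* Localization at the product of the units: where it is nonzero, F = 0 forces all the equations q_a
   = gam_a. *)
pose h0 (p : pt K N) := \prod_a R a p.
have hh0 : hpoly (\sum_(a < n) D) h0.
  rewrite /h0; elim: (index_enum _) => [|a s IH].
    by rewrite big_nil; apply: hpoly_ext (hpoly_c N 1) => ?; rewrite big_nil.
  rewrite big_cons; apply: (hpoly_ext _ (hpolyM (hR a) IH)) => ?.
  by rewrite big_cons.
have h0P (p' : pt K N) : p'.1 ord0 l != 0 ->
    (h0 p' != 0) = [forall a, U a (coords l idx p') != 0].
  move=> pl'; apply/prodf_neq0/forallP => h a; [have := h a isT|move=> _; have := h a].
    by rewrite RE mulf_eq0 negb_or => /andP[].
  by rewrite RE mulf_eq0 negb_or expf_neq0.
have FP (p' : pt K N) : para p'.1 (P (coords l idx p')) -> F p' = 0 -> p'.1 != 0 ->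
    F (P (coords l idx p'), p'.2) = 0.
  move=> h Fp' p0; have [c ->] := para_colinear p0 h.
  by rewrite (hvec_scale _ _ _ hF) -surjective_pairing Fp' scaler0.
have zc (p' : pt K N) : model B p' -> F p' = 0 -> p'.1 ord0 l != 0 -> h0 p' != 0 ->
    forall a, a \notin J -> p'.1 ord0 (idx a) = (gam a).[p'.2] * p'.1 ord0 l.
  move=> mp' Fp' pl'; rewrite h0P // => /forallP Up a aJ.
  have := cm (coords l idx p') a aJ.
  rewrite (FP p' (xchart_coords cP sP pB B0 mp' pl') Fp' (model_neq0 mp')) mxE => /esym/eqP.
  rewrite mulf_eq0 (negbTE (Up a)) orbF !mxE subr_eq0 => /eqP <- /=.
  by rewrite divfK.
have h0p : h0 p != 0 by rewrite h0P // kE; apply/forallP.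
pose lam a (p' : pt K N) :=
  if a \in J then p'.1 ord0 (idx a) else (gam a).[p'.2] * p'.1 ord0 l.
have lamE (p' : pt K N) : p'.1 ord0 l != 0 ->
    (forall a, a \notin J -> p'.1 ord0 (idx a) = (gam a).[p'.2] * p'.1 ord0 l) ->
    (\row_a (lam a p' / p'.1 ord0 l), p'.2) = coords l idx p'.
  move=> pl' h; congr pair; apply/rowP => a; rewrite !mxE /lam.
  by case: (boolP (a \in J)) => aJ //; rewrite h.
have := @local_graph K n N Z p P l J idx gam h0 _ pP hh0 h0p pl.
rewrite -/lam lamE ?kE //; last exact: zc.
move=> /(_ Pl); case=> [a _|a b _ _|a q' _|p' pl' h0p'|r [g [h1 h2 h3]]] //; last first.
- by exists r, g; split=> //; apply/eqP/row_free_row_mx.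
- move=> Pl'.
  split=> [[mp' Fp']|pp].
    have zp := zc p' mp' Fp' pl' h0p'.
    by rewrite lamE //; exact: (xchart_coords cP sP pB B0 mp' pl').
  set q' := (_, p'.2) in Pl' pp.
  have P0 : P q' != 0 by apply: rV_neq0 Pl'.
  have p'0 : p'.1 != 0 by apply: rV_neq0 pl'.
  have mq := xchart_model cP B0 P0.
  have pe : peq (P q') p'.1 by apply/peq_sym/para_peq.
  split; first by rewrite [p']surjective_pairing; apply: model_peq mq.
  have Fq : F (P q', q'.2) = 0.
    by apply: cF => a aJ; rewrite !mxE /lam (negbTE aJ) mulfK.
  have /peqP[_ [c _ ec]] := pe.
  by rewrite /= [p']surjective_pairing ec (hvec_scale _ _ _ hF) [X in _ *: X]Fq scaler0.
- exact: idxI.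
Qed.

(** Off the centre some form f_i is nonzero and may serve as denominator. At a point of the centre,
    g in chart coordinates vanishes on the linear subspace, so [divide_subst] writes it through the
    q_a - gam_a, and these are entries of [F] divided by units. *)
Lemma center_ideal f : (forall i, homog_deg e (f i)) -> F =1 pevalv f ->
  generate_ideal (model B) Z f.
Proof.
move=> hf fE; split; [by exists e|by move=> p [_ Fp]; rewrite -fE|].
move=> g [d hg] gZ p mp.
have hg' : hpoly d (peval g) by exists g.
have feE i q : peval (f i) q = F q ord0 i by rewrite fE mxE.
case: (eqVneq (F p) 0) => [Fp|/rV_neq0P[i Fi]]; last first.
  exists (f i), (fun j => if j == i then g else 0); split.
  - by exists e; apply: hf.
  - by split; [exact: model_neq0 mp|rewrite feE].
  - move=> q mq; rewrite (bigD1 i) //= eqxx big1 ?addr0; first by rewrite mulrC.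
    by move=> j /negbTE ->; rewrite peval0 mul0r.
have [P [l [idx [q0 [[cP sP qt pq Pl]]]]]] := covZ mp Fp.
move=> [J [gam [U [m [cF cm pU U0]]]]]; have [pP _ _] := cP.
have [kE pl] := standard_coords sP qt (peq_para pq) Pl (model_neq0 mp).
have [c ec] := para_colinear (model_neq0 mp) (peq_para pq).
have c0 : c != 0 by apply: contraNneq Pl => c0; rewrite ec c0 scale0r mxE.
pose G (q : pt K n) := peval g (P q, q.2).
have pG : ispoly G by apply: (ispoly_comp (ispoly_peval g)).
have sub0 : subst J gam q0 = q0.1.
  apply: subst_id => a aJ; have := cm q0 a aJ.
  rewrite qt ec (hvec_scale _ _ _ hF) -surjective_pairing Fp scaler0 mxE => /esym/eqP.
  by rewrite mulf_eq0 (negbTE (U0 a)) orbF subr_eq0 => /eqP.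
have psub := @polyv_subst K n J gam.
have G0 q : G (subst J gam q, q.2) = 0.
  apply: (@density_all _ _ (fun q => G (subst J gam q, q.2))
     (fun q => P (subst J gam q, q.2) ord0 l)).
  - exact: ispoly_comp pG psub.
  - exact: ispoly_comp (pP l) psub.
  - by exists q0; rewrite sub0 -surjective_pairing.
  - move=> q' Pq'; have Pq'0 := rV_neq0 Pq'.
    apply: gZ; split; first exact: (xchart_model cP B0 Pq'0).
    by apply: cF => a aJ; rewrite mxE (negbTE aJ).
have [H [pH HE]] := divide_subst J gam pG.
pose V a q := if a \in J then 1 else U a q.
have pV a : ispoly (V a).
  by rewrite /V; case: (a \in J); [apply: ispoly_c|apply: pU].
(* [None] gives the denominator and [Some a] the coefficient of the form with index m a. The powers
   of P_l absorb the scalar b between q and P k, since g is scaled by b^d and F by b^e. *)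
pose L (o : option 'I_n) (q : pt K n) :=
  if o is Some a then (if a \in J then 0 else
     P q ord0 l ^+ e * (H a q * \prod_(b | b != a) V b q))
  else P q ord0 l ^+ d * \prod_b V b q.
have pL o : ispoly (L o).
  case: o => [a|] /=; last by apply: ispolyM; [apply: ispolyX|apply: ispoly_prod].
  rewrite /L; case: (a \in J); first exact: ispoly_c.
  apply: ispolyM; first exact: ispolyX.
  by apply: ispolyM => //; apply: ispoly_prod.
have LE q : G q * \prod_b V b q = \sum_(a | a \notin J)
    F (P q, q.2) ord0 (m a) * (H a q * \prod_(b | b != a) V b q).
  have := HE q; rewrite G0 subr0 => ->; rewrite (bigID (mem J)) /= big1 ?add0r.
    rewrite mulr_suml; apply: eq_bigr => a aJ.
    rewrite (bigD1 a) //= cm // mxE (negbTE aJ) /V (negbTE aJ) -!mulrA.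
    by congr (_ * _); rewrite mulrCA.
  by move=> a aJ; rewrite mxE aJ subrr mul0r.
have [D [R [hR RE]]] := homogenize_family pL
  (fun a => hpoly_x K (idx a)) (hpoly_x K l).
have hX k : hpoly k (fun p : pt K N => p.1 ord0 l ^+ k).
  by rewrite -[k in hpoly k]mul1n; apply/hpolyXn/hpoly_x.
(* The exponents [e.+1] here and [d.+1] below balance those of P_l in [L]; the extra 1 makes both
   sides vanish where q_l = 0. *)
have [h hh hE] := hpolyM (hR None) (hX e.+1).
have /choice[ap apE] : forall i, exists a : rpoly K N, forall p, peval a p =
    \sum_(a | (a \notin J) && (m a == i)) R (Some a) p * p.1 ord0 l ^+ d.+1.
  move=> i; have [a ae] : ispoly (fun p => \sum_(a | (a \notin J) && (m a == i))
      R (Some a) p * p.1 ord0 l ^+ d.+1).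
    apply: ispoly_sum => a; apply: ispolyM; first exact: hpoly_ispoly (hR _).
    by apply: ispolyX; apply: ispoly_x.
  by exists a.
exists h, ap; split.
- by exists (D + e.+1)%N.
- split; first exact: model_neq0 mp.
  rewrite -hE RE -/(coords l idx p) kE /L !mulf_neq0 ?expf_neq0 //.
  by apply/prodf_neq0 => b _; rewrite /V; case: (b \in J); rewrite ?oner_neq0.
- move=> q mq; rewrite -hE.
  transitivity (\sum_i \sum_(a | (a \notin J) && (m a == i))
      R (Some a) q * q.1 ord0 l ^+ d.+1 * F q ord0 (m a)); last first.
    apply: eq_bigr => i _; rewrite apE mulr_suml; apply: eq_bigr => a /andP[_ /eqP ->].
    by rewrite feE.
  rewrite -(@partition_big _ _ _ _ _ _ (fun a => a \notin J) m predT) //.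
  case: (eqVneq (q.1 ord0 l) 0) => [ql0|ql].
    rewrite ql0 expr0n mulr0 mul0r big1 // => a _.
    by rewrite expr0n mulr0 mul0r.
  have qk := xchart_coords cP sP pB B0 mq ql.
  set k := coords l idx q in qk.
  have [b eb] := para_colinear (model_neq0 mq) qk.
  have bE : P k ord0 l = b * q.1 ord0 l by rewrite eb mxE.
  have GE : G k = b ^+ d * peval g q.
    by rewrite /G eb (hpoly_scale _ _ _ hg') -surjective_pairing.
  have FE : F (P k, k.2) = b ^+ e *: F q.
    by rewrite eb (hvec_scale _ _ _ hF) -surjective_pairing.
  rewrite RE -/(coords l idx q) -/k /L bE.
  transitivity (q.1 ord0 l ^+ (D + d + e.+1) * (G k * \prod_b V b k)).
    by rewrite GE exprMn !exprD; ring.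
  rewrite LE mulr_sumr; apply: eq_bigr => a aJ.
  rewrite RE -/(coords l idx q) -/k /L (negbTE aJ) bE FE mxE exprMn !exprD !exprS; ring.
Qed.

(** The image of [B] is dense in [model B], and a form on the graph pulls back to a form on
    [model B]; so the graphs over both have the same closure. *)
Lemma graph_closureE f : F =1 pevalv f ->
  graph_closure (model B) f = model (tens B (fun u => F (B u, u.2))).
Proof.
move=> fE; apply/seteqP; split.
  apply: zclosure_min; first exact: model_zclosed.
  move=> _ [q [mq Fq ->]]; apply/modelP => /=; rewrite -fE in Fq *.
  split=> [|d g hg g0]; first by rewrite segre_neq0 (model_neq0 mq).
  have := hpoly_comp hg (hvec_tens (@hvec_id K N) hF).
  by move/(@model_vanish _ _ _ B q); apply=> // u; apply: g0.
apply: zclosure_min; first exact: zclosure_zclosed.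
move=> _ [u ->]; apply/zclosureP; split.
  by rewrite /tens segre_neq0 B0 FB0.
move=> d g hg; apply; exists (B u, u.2).
by split; [exact: model_pt|rewrite -fE|rewrite -fE].
Qed.

(** By [graph_closureE] the blow-up is the closure of the image of B tensored with F o B. It is
    enough that [B'] and this vector are regular functions of each other on the closures. *)
Lemma is_blowup_model N' (B' : pt K n -> 'rV[K]_N') b :
  (forall u, B' u != 0) ->
  resolves B' (tens B (fun u => F (B u, u.2))) ->
  resolves (tens B (fun u => F (B u, u.2))) B' ->
  res_map B' B b -> is_blowup (model B') (model B) b.
Proof.
move=> B'0 r1 r2 [_ _ hb]; have [f [hf fE]] := hvec_pevalv hF.
have BF0 u : tens B (fun u => F (B u, u.2)) u != 0.
  by rewrite /tens segre_neq0 B0 FB0.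
split; [exact: model_zclosed|exact: model_zclosed|exact: xchart_nonsingular|].
exists Z, M, f; split.
- split; [exact: center_zclosed|by move=> p []|exact: center_dense|].
  exact: center_nonsingular.
- exact: center_ideal.
- have [h hh] := res_mapP BF0 r1; exists h.
    by rewrite graph_closureE //; apply: resolves_iso.
  (* Compatibility with the projection: the first factor of the Segre point is a second
     representative of the map to [B], hence proportional to b q. *)
  move=> q mq; have [_ mh hhP] := hh; have mhq := mh q mq.
  have [G rG Gq] := r1 q mq.
  have mG := resolves_by_model BF0 rG mq Gq.
  have [s [w [eG ms mw]]] := model_tens mG.
  have [k wk] := rV_neq0P (model_neq0 mw).
  exists w; apply: peq_trans (hhP q G mq rG Gq) _; rewrite [G q]eG.
  apply: segre_peq; last by apply: peq_refl; exact: model_neq0 mw.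
  have s0 : s != 0 by exact: model_neq0 ms.
  have cG : colv k (G q) = w ord0 k *: s by rewrite [G q]eG colv_segre.
  apply: peq_sym; apply: peq_trans (hb q (fun q => colv k (G q)) mq _ _) _.
  + have [[d hG] GB] := rG; split=> [|u].
      by exists (1 * d)%N; apply: hvec_comp (@hvec_colv K N M k) hG.
    have [a ->] := para_colinear (BF0 u) (para_sym (GB u)).
    rewrite (_ : colv k _ = a *: colv k (tens B (fun u => F (B u, u.2)) u)); last first.
      by apply/rowP => i; rewrite !mxE.
    by rewrite /tens colv_segre scalerA; apply/para_sym/paraZ/para_refl.
  + by rewrite cG scaler_eq0 negb_or wk.
  + by rewrite cG; apply/peq_sym/peqZ.
Qed.

End BlowupLemma.

End Blowups.

(** * Charts of a P^1-bundle over a surface *)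

Section BundleCharts.
Variable K : numClosedFieldType.

Definition row2 (a b : K) : 'rV[K]_2 := \row_i [:: a; b]`_i.
Definition k1 (q : pt K 2) : K := q.1 ord0 (inord 0).
Definition k2 (q : pt K 2) : K := q.1 ord0 (inord 1).

Lemma forall_I2 (P : 'I_2 -> Prop) : P (inord 0) -> P (inord 1) -> forall i, P i.
Proof.
move=> P0 P1 [[|[|//]] h].
  by rewrite (_ : Ordinal h = inord 0) //; apply: val_inj; rewrite /= inordK.
by rewrite (_ : Ordinal h = inord 1) //; apply: val_inj; rewrite /= inordK.
Qed.

Lemma forall_I3 (P : 'I_3 -> Prop) :
  P (inord 0) -> P (inord 1) -> P (inord 2) -> forall i, P i.
Proof.
move=> P0 P1 P2 [[|[|[|//]]] h].
- by rewrite (_ : Ordinal h = inord 0) //; apply: val_inj; rewrite /= inordK.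
- by rewrite (_ : Ordinal h = inord 1) //; apply: val_inj; rewrite /= inordK.
- by rewrite (_ : Ordinal h = inord 2) //; apply: val_inj; rewrite /= inordK.
Qed.

Lemma row2_k1 a b t : k1 (row2 a b, t) = a. Proof. by rewrite /k1 mxE inordK. Qed.
Lemma row2_k2 a b t : k2 (row2 a b, t) = b. Proof. by rewrite /k2 mxE inordK. Qed.
Lemma row3_xc (a b c t : K) : xc (row3 a b c, t) = a.
Proof. by rewrite /xc mxE inordK. Qed.
Lemma row3_yc (a b c t : K) : yc (row3 a b c, t) = b.
Proof. by rewrite /yc mxE inordK. Qed.
Lemma row3_zc (a b c t : K) : zc (row3 a b c, t) = c.
Proof. by rewrite /zc mxE inordK. Qed.

Lemma row2_eta (q : pt K 2) : row2 (k1 q) (k2 q) = q.1.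
Proof.
by apply/rowP; apply: forall_I2; rewrite mxE inordK.
Qed.

Lemma row3_eta (q : pt K 3) : row3 (xc q) (yc q) (zc q) = q.1.
Proof.
by apply/rowP; apply: forall_I3; rewrite mxE inordK.
Qed.

Lemma pt2P (q q' : pt K 2) : k1 q = k1 q' -> k2 q = k2 q' -> q.2 = q'.2 -> q = q'.
Proof.
move=> h1 h2 h3; rewrite [q]surjective_pairing [q']surjective_pairing h3.
by rewrite -row2_eta -[q'.1]row2_eta h1 h2.
Qed.

Lemma pt3P (q q' : pt K 3) :
  xc q = xc q' -> yc q = yc q' -> zc q = zc q' -> q.2 = q'.2 -> q = q'.
Proof.
move=> h1 h2 h4 h3; rewrite [q]surjective_pairing [q']surjective_pairing h3.
by rewrite -row3_eta -[q'.1]row3_eta h1 h2 h4.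
Qed.

Lemma ispoly_k1 : ispoly k1. Proof. exact: ispoly_x. Qed.
Lemma ispoly_k2 : ispoly k2. Proof. exact: ispoly_x. Qed.
Lemma ispoly_xc : ispoly (@xc K). Proof. exact: ispoly_x. Qed.
Lemma ispoly_yc : ispoly (@yc K). Proof. exact: ispoly_x. Qed.
Lemma ispoly_zc : ispoly (@zc K). Proof. exact: ispoly_x. Qed.

Lemma polyv_row2 n (f g : pt K n -> K) :
  ispoly f -> ispoly g -> polyv (fun q => row2 (f q) (g q)).
Proof.
move=> pf pg; apply: forall_I2.
  by apply: ispoly_ext pf => q; rewrite mxE inordK.
by apply: ispoly_ext pg => q; rewrite mxE inordK.
Qed.

Lemma polyv_row3 n (f g h : pt K n -> K) :
  ispoly f -> ispoly g -> ispoly h -> polyv (fun q => row3 (f q) (g q) (h q)).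
Proof.
move=> pf pg ph; apply: forall_I3.
- by apply: ispoly_ext pf => q; rewrite mxE inordK.
- by apply: ispoly_ext pg => q; rewrite mxE inordK.
- by apply: ispoly_ext ph => q; rewrite mxE inordK.
Qed.

(* A chart of the surface [model A], with coordinates (k1, k2), and a frame
   [fa + xi fb] of the line bundle coordinate on the fibres of [tens A Phi]. *)
Record fdata N M := FData {
  fE : pt K 2 -> 'rV[K]_N; fa : pt K 2 -> 'rV[K]_M; fb : pt K 2 -> 'rV[K]_M }.

Definition fpoly N M (D : fdata N M) := [/\ polyv (fE D), polyv (fa D) & polyv (fb D)].

Definition fcor N M (A : pt K 3 -> 'rV[K]_N) (Phi : pt K 3 -> 'rV[K]_M)
    (D : fdata N M) (u : pt K 3) (q : pt K 2) xi : Prop :=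
  [/\ u.2 = q.2, peq (A u) (fE D q) & peq (Phi u) (fa D q + xi *: fb D q)].

Definition fcompat N M (A : pt K 3 -> 'rV[K]_N) (Phi : pt K 3 -> 'rV[K]_M)
    (D : fdata N M) : Prop :=
  (exists w, [/\ ispoly w, exists u, w u != 0 & forall u, w u != 0 ->
     exists q xi, fcor A Phi D u q xi]) /\
  (exists d, [/\ ispoly d, forall t, exists2 q, q.2 = t & d q != 0 &
     forall q xi, d q != 0 -> exists u, fcor A Phi D u q xi]).

(** Normalization under which k1, k2 and xi are ratios of homogeneous coordinates: in the vector fa
    + xi fb the entry j1 is xi times the entry j0. It makes both charts of the fibre [standard]. *)
Definition fstd N M (D : fdata N M) l i1 i2 j0 j1 : Prop :=
  (forall q, fE D q ord0 i1 = k1 q * fE D q ord0 l /\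
             fE D q ord0 i2 = k2 q * fE D q ord0 l) /\
  (forall q, [/\ fb D q ord0 j1 = fa D q ord0 j0, fa D q ord0 j1 = 0 &
             fb D q ord0 j0 = 0]).

(** [T] restricts the index j1 that reads off xi. It will be a set of indices at which [fa]
    vanishes, so that masking the vector to [T] isolates the multiple of xi. *)
Definition goodat N M (T : pred 'I_M) (D : fdata N M) q : Prop :=
  exists l i1 i2 j0 j1, [/\ fstd D l i1 i2 j0 j1, T j1,
    fE D q ord0 l != 0 & fa D q ord0 j0 != 0].

Definition scoords N l i1 i2 (p : pt K N) : pt K 2 :=
  (row2 (p.1 ord0 i1 / p.1 ord0 l) (p.1 ord0 i2 / p.1 ord0 l), p.2).

Lemma scoords_peq N M (D : fdata N M) l i1 i2 j0 j1 q (p : pt K N) :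
  fstd D l i1 i2 j0 j1 -> q.2 = p.2 -> peq p.1 (fE D q) ->
  p.1 ord0 l != 0 -> scoords l i1 i2 p = q.
Proof.
move=> [std _] qt /peqP[_ [c c0 e]] pl; have [e1 e2] := std q.
have El : fE D q ord0 l != 0 by rewrite e mxE mulf_neq0.
have pE i : p.1 ord0 i = c^-1 * fE D q ord0 i by rewrite e mxE mulKf.
apply: pt2P; rewrite /scoords ?row2_k1 ?row2_k2 // !pE ?e1 ?e2 -mulf_div divff ?mul1r ?mulfK ?invr_neq0 //.
Qed.

(** After homogenizing its coefficients the relation is the vanishing of a form on the Segre
    product, so it passes from C^3 to every point of the closure that lies over the chart. *)
Lemma relation_closed N M L (A : pt K 3 -> 'rV[K]_N) (W : pt K 3 -> 'rV[K]_M)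
    (D : fdata N L) l i1 i2 j0' j1' (x y z : pt K 2 -> K) j j0 j1 p s w q :
  polyv A -> polyv W -> fstd D l i1 i2 j0' j1' ->
  ispoly x -> ispoly y -> ispoly z ->
  (exists w, [/\ ispoly w, exists u, w u != 0 & forall u, w u != 0 ->
     exists q, [/\ u.2 = q.2, peq (A u) (fE D q) &
       x q * W u ord0 j = y q * W u ord0 j0 + z q * W u ord0 j1]]) ->
  model (tens A W) p -> p.1 = segre s w -> peq s (fE D q) -> q.2 = p.2 ->
  fE D q ord0 l != 0 ->
  x q * w ord0 j = y q * w ord0 j0 + z q * w ord0 j1.
Proof.
move=> pA pW std px py pz [v [pv nv vP]] mp ep sq qt El.
have [m wm] : exists m, w ord0 m != 0.
  by apply: rV_neq0P; move: (model_neq0 mp); rewrite ep segre_neq0 => /andP[].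
pose lam (a : 'I_2) (p : pt K (N * M)) :=
  p.1 ord0 (mxvec_index (if a == inord 0 then i1 else i2) m).
pose ll (p : pt K (N * M)) := p.1 ord0 (mxvec_index l m).
pose xyz (k : 'I_3) := if k == inord 0 then x else if k == inord 1 then y else z.
have pxyz k : ispoly (xyz k) by rewrite /xyz; case: ifP => // _; case: ifP.
have [D' [R [hR RE]]] := homogenize_family pxyz
  (fun a => hpoly_x K _ : hpoly 1 (lam a)) (hpoly_x K _ : hpoly 1 ll).
have lamE (p' : pt K (N * M)) :
    (\row_a (lam a p' / ll p'), p'.2) = scoords l i1 i2 (colv m p'.1, p'.2).
  have I2 : (inord 1 == inord 0 :> 'I_2) = false.
    by apply/eqP => /(congr1 val); rewrite /= !inordK.
  rewrite /scoords; congr pair; apply/rowP.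
  by apply: forall_I2; rewrite !mxE inordK //= /lam ?eqxx ?I2 ?mxE.
have I10 : (inord 1 == inord 0 :> 'I_3) = false.
  by apply/eqP => /(congr1 val); rewrite /= !inordK.
have I20 : (inord 2 == inord 0 :> 'I_3) = false.
  by apply/eqP => /(congr1 val); rewrite /= !inordK.
have I21 : (inord 2 == inord 1 :> 'I_3) = false.
  by apply/eqP => /(congr1 val); rewrite /= !inordK.
pose g (p : pt K (N * M)) := ll p * (R (inord 0) p * p.1 ord0 (mxvec_index l j) -
  (R (inord 1) p * p.1 ord0 (mxvec_index l j0) +
   R (inord 2) p * p.1 ord0 (mxvec_index l j1))).
have hg : hpoly (1 + (D' + 1)) g.
  apply: hpolyM; first exact: hpoly_x.
  by apply: hpolyB; [|apply: hpolyD]; apply: hpolyM => //; apply: hpoly_x.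
have g0 u : g (tens A W u, u.2) = 0.
  apply: (@density_all _ _ (fun u => g (tens A W u, u.2)) v) => // [|u' /vP[q' [ut Aq rel]]].
    exact: (ispoly_comp (hpoly_ispoly hg) (polyv_tens pA pW)).
  rewrite /g; case: (eqVneq (ll (tens A W u', u'.2)) 0) => [->|]; first by rewrite mul0r.
  rewrite !RE lamE /ll /= /tens !segreE mulf_eq0 negb_or => /andP[Al Wm].
  rewrite colv_segre (scoords_peq std (q := q')) //=; last first.
  - by rewrite mxE mulf_neq0.
  - have /peqP[A0 _] := Aq; apply: peq_trans Aq.
    by apply: peq_sym; apply: peqZ.
  rewrite /xyz !eqxx I10 I20 I21; set c := _ ^+ D'.
  transitivity (A u' ord0 l * W u' ord0 m * c * A u' ord0 l *
    (x q' * W u' ord0 j - (y q' * W u' ord0 j0 + z q' * W u' ord0 j1))); first by ring.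
  by rewrite rel subrr mulr0.
have := model_vanish hg g0 mp.
have sl : s ord0 l != 0 by apply: peq_neq0 (peq_sym sq) El.
have s0 : s != 0 by apply: rV_neq0 sl.
have llp : ll p != 0 by rewrite /ll ep segreE mulf_neq0.
rewrite /g !RE lamE ep colv_segre (scoords_peq std (q := q)) //=; last first.
- by rewrite mxE mulf_neq0.
- by apply: peq_trans sq; apply: peq_sym; apply: peqZ.
rewrite !segreE /xyz !eqxx I10 I20 I21 => /eqP.
rewrite mulf_eq0 (negbTE llp) /= => e.
have : ll p ^+ D' * s ord0 l *
    (x q * w ord0 j - (y q * w ord0 j0 + z q * w ord0 j1)) == 0.
  by rewrite -(eqP e); apply/eqP; ring.
by rewrite !mulf_eq0 expf_eq0 (negbTE llp) (negbTE sl) andbF /= subr_eq0 => /eqP.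
Qed.

Definition base (q : pt K 3) : pt K 2 := (row2 (yc q) (zc q), q.2).
Definition over (q : pt K 2) xi : pt K 3 := (row3 xi (k1 q) (k2 q), q.2).

Lemma base_over q xi : base (over q xi) = q.
Proof. by apply: pt2P; rewrite ?row2_k1 ?row2_k2 ?row3_yc ?row3_zc. Qed.

Lemma xc_over q xi : xc (over q xi) = xi.
Proof. by rewrite row3_xc. Qed.

Lemma ispoly_base f : ispoly f -> ispoly (fun q => f (base q)).
Proof.
by move=> pf; apply: (ispoly_comp pf); apply: polyv_row2;
  [apply: ispoly_yc|apply: ispoly_zc].
Qed.

Lemma polyv_base N (f : pt K 2 -> 'rV[K]_N) : polyv f -> polyv (fun q => f (base q)).
Proof. by move=> pf i; apply: (ispoly_base (pf i)). Qed.

Lemma polyvD n N (f g : pt K n -> 'rV[K]_N) :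
  polyv f -> polyv g -> polyv (fun q => f q + g q).
Proof.
move=> pf pg i; apply: (ispoly_ext _ (ispolyD (pf i) (pg i))) => q.
by rewrite mxE.
Qed.

Lemma polyvZ n N (c : pt K n -> K) (g : pt K n -> 'rV[K]_N) :
  ispoly c -> polyv g -> polyv (fun q => c q *: g q).
Proof.
move=> pc pg i; apply: (ispoly_ext _ (ispolyM pc (pg i))) => q.
by rewrite mxE.
Qed.

Definition xfin N M (D : fdata N M) (q : pt K 3) : 'rV[K]_(N * M) :=
  segre (fE D (base q)) (fa D (base q) + xc q *: fb D (base q)).

Definition xinf N M (D : fdata N M) (q : pt K 3) : 'rV[K]_(N * M) :=
  segre (fE D (base q)) (xc q *: fa D (base q) + fb D (base q)).

Lemma polyv_xfin N M (D : fdata N M) : fpoly D -> polyv (xfin D).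
Proof.
move=> [pE pa pb]; apply: polyv_tens; first exact: polyv_base.
apply: polyvD; first exact: polyv_base.
by apply: polyvZ; [exact: ispoly_xc|exact: polyv_base].
Qed.

Lemma polyv_xinf N M (D : fdata N M) : fpoly D -> polyv (xinf D).
Proof.
move=> [pE pa pb]; apply: polyv_tens; first exact: polyv_base.
apply: polyvD; last exact: polyv_base.
by apply: polyvZ; [exact: ispoly_xc|exact: polyv_base].
Qed.

Section OneChart.
Variables (N M : nat) (A : pt K 3 -> 'rV[K]_N) (Phi : pt K 3 -> 'rV[K]_M).
Variable D : fdata N M.
Hypotheses (pA : polyv A) (pPhi : polyv Phi) (pD : fpoly D) (cD : fcompat A Phi D).

Lemma xchart_xfin : xchart (tens A Phi) (xfin D).
Proof.
have [[w [pw nw wP]] [d [pd nd dP]]] := cD; split; first exact: polyv_xfin.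
- exists w; split=> // u /wP[q [xi [ut Aq Pq]]]; exists (over q xi).
  have e := peq_sym (segre_peq Aq Pq).
  rewrite /xfin base_over xc_over; split=> //; last exact: peq_para.
  by case: e.
- exists (fun q => d (base q)); split; first exact: ispoly_base.
    by move=> t; have [q qt dq] := nd t; exists (over q 0); rewrite ?base_over.
  move=> q /(dP _ (xc q))[u [ut Aq Pq]]; exists u => //.
  by apply: peq_para; apply: segre_peq.
Qed.

(** The extra factor Phi_{j1}, which is xi fa_{j0} up to a scalar, excludes xi = 0; elsewhere fa +
    xi fb is proportional to xi^{-1} fa + fb. *)
Lemma xchart_xinf j0 j1 l i1 i2 q : fstd D l i1 i2 j0 j1 ->
  fa D q ord0 j0 != 0 -> xchart (tens A Phi) (xinf D).
Proof.
move=> [_ std] aq; have [[w [pw nw wP]] [d [pd nd dP]]] := cD.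
have [pE pa pb] := pD.
have inv xi q' : xi != 0 -> xi^-1 *: fa D q' + fb D q' =
    xi^-1 *: (fa D q' + xi *: fb D q').
  by move=> x0; rewrite scalerDr scalerA mulVf // scale1r.
have aneq : exists u, Phi u ord0 j1 != 0.
  have ha : exists2 q' : pt K 2, q'.2 = q.2 & fa D q' ord0 j0 != 0 by exists q.
  have [q2 q2t] := nonzero_fiber_mul pd (pa j0) (nd q.2) ha.
  rewrite mulf_eq0 negb_or => /andP[dq2 aq2].
  have [u [_ _ /peq_sym Pq]] := dP q2 1 dq2; exists u; apply: (peq_neq0 Pq).
  by have [e1 e2 _] := std q2; rewrite !mxE e1 e2 add0r mul1r.
split; first exact: polyv_xinf.
- exists (fun u => w u * Phi u ord0 j1); split; first exact: ispolyM.
    exact: nonzero_mul.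
  move=> u; rewrite mulf_eq0 negb_or => /andP[/wP[q' [xi [ut Aq Pq]]] Pu].
  have xi0 : xi != 0.
    have := peq_neq0 Pq Pu; have [_ e2 _] := std q'; rewrite !mxE e2 add0r.
    by rewrite mulf_eq0 negb_or => /andP[].
  exists (over q' xi^-1); rewrite /xinf base_over xc_over inv //.
  have e : peq (segre (fE D q') (xi^-1 *: (fa D q' + xi *: fb D q'))) (tens A Phi u).
    apply: segre_peq; first exact: peq_sym.
    apply: peq_trans (peq_sym Pq); apply: peq_sym; apply: peqZ.
      by case: Pq.
    by rewrite invr_neq0.
  by split=> //; [case: e|exact: peq_para].
- exists (fun q => d (base q) * xc q); split.
  + by apply: ispolyM; [exact: ispoly_base|exact: ispoly_xc].
  + move=> t; have [q' qt dq] := nd t; exists (over q' 1) => //.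
    by rewrite base_over xc_over mulr1.
  + move=> q'; rewrite mulf_eq0 negb_or => /andP[dq x0].
    have [u [ut Aq Pq]] := dP (base q') (xc q')^-1 dq; exists u => //.
    rewrite /xinf -{1}[xc q']invrK inv ?invr_neq0 // invrK.
    have [_ Pq0 _] := Pq.
    apply: peq_para; apply: segre_peq => //; apply: peq_trans Pq _.
    by apply: peqZ => //; rewrite invr_neq0.
Qed.

Definition idx_fin (l i1 i2 : 'I_N) (j0 j1 : 'I_M) (a : 'I_3) : 'I_(N * M) :=
  nth (mxvec_index l j1) [:: mxvec_index l j1; mxvec_index i1 j0; mxvec_index i2 j0] a.

Definition idx_inf (l i1 i2 : 'I_N) (j0 j1 : 'I_M) (a : 'I_3) : 'I_(N * M) :=
  nth (mxvec_index l j0) [:: mxvec_index l j0; mxvec_index i1 j1; mxvec_index i2 j1] a.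

Lemma standard_xfin l i1 i2 j0 j1 : fstd D l i1 i2 j0 j1 ->
  standard (xfin D) (mxvec_index l j0) (idx_fin l i1 i2 j0 j1).
Proof.
move=> [std1 std2] q; have [e1 e2] := std1 (base q); have [e3 e4 e5] := std2 (base q).
rewrite row2_k1 in e1; rewrite row2_k2 in e2.
apply: forall_I3; rewrite /idx_fin inordK //= /xfin !segreE !mxE ?e1 ?e2 ?e3 ?e4 ?e5;
  rewrite -/(xc _) -/(yc _) -/(zc _); ring.
Qed.

Lemma standard_xinf l i1 i2 j0 j1 : fstd D l i1 i2 j0 j1 ->
  standard (xinf D) (mxvec_index l j1) (idx_inf l i1 i2 j0 j1).
Proof.
move=> [std1 std2] q; have [e1 e2] := std1 (base q); have [e3 e4 e5] := std2 (base q).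
rewrite row2_k1 in e1; rewrite row2_k2 in e2.
apply: forall_I3; rewrite /idx_inf inordK //= /xinf !segreE !mxE ?e1 ?e2 ?e3 ?e4 ?e5;
  rewrite -/(xc _) -/(yc _) -/(zc _); ring.
Qed.

(** On C^3 the vector w is a multiple of fa + xi fb, for which the relation follows from [fstd].
    Being closed, it forces the whole fibre over q into the line spanned by fa and fb. *)
Lemma bundle_fiber l i1 i2 j0 j1 p s w q : fstd D l i1 i2 j0 j1 ->
  model (tens A Phi) p -> p.1 = segre s w -> peq s (fE D q) -> q.2 = p.2 ->
  fE D q ord0 l != 0 ->
  fa D q ord0 j0 *: w = w ord0 j0 *: fa D q + w ord0 j1 *: fb D q.
Proof.
move=> std mp ep sq qt El; apply/rowP => j; rewrite !mxE.
have [pE pa pb] := pD; have [[v [pv nv vP]] _] := cD.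
rewrite (mulrC (w ord0 j0)) (mulrC (w ord0 j1)).
apply: (@relation_closed N M M A Phi D l i1 i2 j0 j1 (fun q => fa D q ord0 j0)
  (fun q => fa D q ord0 j) (fun q => fb D q ord0 j) j j0 j1 p s w q) => //.
exists v; split=> // u /vP[q' [xi [ut Aq /peq_sym/peqP[_ [c _ ePhi]]]]]; exists q'.
split=> //; have [_ /(_ q')[e3 e4 e5]] := std.
by rewrite ePhi !mxE e3 e4 e5; ring.
Qed.

Lemma bundle_charts l i1 i2 j0 j1 p s w q : fstd D l i1 i2 j0 j1 ->
  model (tens A Phi) p -> p.1 = segre s w -> peq s (fE D q) -> q.2 = p.2 ->
  fE D q ord0 l != 0 -> fa D q ord0 j0 != 0 ->
  (w ord0 j0 != 0 /\ xchart_at (tens A Phi) (xfin D) p (mxvec_index l j0)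
     (idx_fin l i1 i2 j0 j1) (over q (w ord0 j1 / w ord0 j0))) \/
  (w ord0 j1 != 0 /\ xchart_at (tens A Phi) (xinf D) p (mxvec_index l j1)
     (idx_inf l i1 i2 j0 j1) (over q (w ord0 j0 / w ord0 j1))).
Proof.
move=> std mp ep sq qt El aj; have ew := bundle_fiber std mp ep sq qt El.
have w0 : w != 0 by move: (model_neq0 mp); rewrite ep segre_neq0 => /andP[].
have [_ /(_ q)[e3 e4 e5]] := std.
case: (eqVneq (w ord0 j0) 0) => [wj0|wj0]; [right|left].
  have wj1 : w ord0 j1 != 0.
    apply: contra_neq w0 => wj1; move: ew; rewrite wj0 wj1 !scale0r addr0.
    by move=> /eqP; rewrite scaler_eq0 (negbTE aj) => /eqP.
  split=> //; split=> //.
  - exact: xchart_xinf std aj.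
  - exact: standard_xinf.
  - rewrite /xinf base_over xc_over wj0 mul0r scale0r add0r ep.
    apply: segre_peq => //; apply/peqP; split=> //.
    exists (fa D q ord0 j0 / w ord0 j1); first by rewrite mulf_neq0 ?invr_neq0.
    rewrite mulrC -scalerA ew wj0 scale0r add0r scalerA mulVf // scale1r //.
  - by rewrite /xinf base_over xc_over segreE !mxE e3 e4 mulr0 add0r mulf_neq0.
split=> //; split=> //.
- exact: xchart_xfin.
- exact: standard_xfin.
- rewrite /xfin base_over xc_over ep.
  apply: segre_peq => //; apply/peqP; split=> //.
  exists (fa D q ord0 j0 / w ord0 j0); first by rewrite mulf_neq0 ?invr_neq0.
  rewrite [in RHS]mulrC -[RHS]scalerA ew scalerDr !scalerA mulVf // scale1r.
  by rewrite [w ord0 j1 / _]mulrC.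
- by rewrite /xfin base_over xc_over segreE !mxE e5 mulr0 addr0 mulf_neq0.
Qed.

End OneChart.

End BundleCharts.

(** * The open part C^3 x B and chains of modifications *)

Section Modifications.
Variable K : numClosedFieldType.

(** The denominator may depend on the point: after a blow-up no single homogeneous coordinate need
    be nonzero on all of C^3. *)
Definition affine_chart N (B : pt K 3 -> 'rV[K]_N) : Prop :=
  forall u, exists l idx, standard B l idx /\ B u ord0 l != 0.

Definition affine_part N (B : pt K 3 -> 'rV[K]_N) : set (pt K N) :=
  [set p | exists2 u, u.2 = p.2 & peq p.1 (B u)].

Lemma affine_chart_neq0 N (B : pt K 3 -> 'rV[K]_N) u : affine_chart B -> B u != 0.
Proof. by move=> /(_ u)[l [idx [_ /rV_neq0]]]. Qed.

Lemma affine_chart_inj N (B : pt K 3 -> 'rV[K]_N) u u' :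
  affine_chart B -> u.2 = u'.2 -> peq (B u) (B u') -> u = u'.
Proof.
move=> cB ut e; have [l [idx [sB Bl]]] := cB u'.
have [e1 _] := @standard_coords K _ _ B l idx u' (B u, u.2) sB (esym ut) (peq_para e) Bl
  (affine_chart_neq0 u cB).
have Bl' := peq_neq0 (peq_sym e) Bl.
have [e2 _] := @standard_coords K _ _ B l idx u (B u, u.2) sB erefl (@para_refl _ _ _) Bl'
  (affine_chart_neq0 u cB).
exact: etrans (esym e2) e1.
Qed.

Lemma affine_chart_self N (B : pt K 3 -> 'rV[K]_N) :
  polyv B -> affine_chart B -> xchart B B.
Proof.
move=> pB cB; split=> //.
  exists (fun=> 1); split; [exact: ispoly_c|by exists (0, 0); apply: oner_neq0|].
  by move=> u _; exists u; split=> //; [exact: affine_chart_neq0|exact: para_refl].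
exists (fun=> 1); split; [exact: ispoly_c|by move=> t; exists (0, t) => //; apply: oner_neq0|].
by move=> u _; exists u => //; exact: para_refl.
Qed.

Lemma affine_partP N (B : pt K 3 -> 'rV[K]_N) p l idx :
  polyv B -> affine_chart B -> model B p -> standard B l idx -> p.1 ord0 l != 0 ->
  peq p.1 (B (coords l idx p)).
Proof.
move=> pB cB mp sB pl; apply: para_peq; first exact: model_neq0 mp.
  exact: affine_chart_neq0.
by apply: (xchart_coords (affine_chart_self pB cB)) => // u; apply: affine_chart_neq0.
Qed.

Lemma affine_part_model N (B : pt K 3 -> 'rV[K]_N) : affine_chart B ->
  affine_part B `<=` model B.
Proof.
move=> cB p [u ut e]; rewrite [p]surjective_pairing -ut.
by apply: model_peq (peq_sym e) _; apply: model_pt; apply: affine_chart_neq0.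
Qed.

(** The complement is cut out by all the coordinates [l] in which [B] is standard: where one of them
    is nonzero, [affine_partP] recovers the point from its coordinates. *)
Lemma affine_part_open N (B : pt K 3 -> 'rV[K]_N) :
  polyv B -> affine_chart B -> zopen_in (model B) (affine_part B).
Proof.
move=> pB cB.
exists (model B `&` [set q : pt K N | q.1 != 0 /\
    forall l : {l | exists idx, standard B l idx}, q.1 ord0 (sval l) = 0]).
  apply: zclosedI; first exact: model_zclosed.
  by apply: (@zclosed_hpoly _ _ _ (fun=> 1%N)) => l; apply: hpoly_x.
apply/seteqP; split=> p.
  move=> /[dup] /(affine_part_model cB) mp [u ut e]; split=> // -[_ [_ h]].
  have [l [idx [sB Bl]]] := cB u.
  have := peq_neq0 (peq_sym e) Bl.
  by rewrite (h (exist _ l (ex_intro _ idx sB))) eqxx.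
move=> [mp np]; apply: contrapT => nU; apply: np; split=> //; split.
  exact: model_neq0 mp.
move=> [l [idx sB]] /=; apply/eqP/negPn/negP => pl; apply: nU.
by exists (coords l idx p) => //; apply: affine_partP.
Qed.

Lemma affine_part_dense N (B : pt K 3 -> 'rV[K]_N) :
  affine_chart B -> dense_in (model B) (affine_part B).
Proof.
move=> cB p mp; apply/zclosureP; split=> [|d g hg g0]; first exact: model_neq0 mp.
apply: (model_vanish hg _ mp) => u; apply: g0; exists u => //.
by apply: peq_refl; apply: affine_chart_neq0.
Qed.

Definition homog_coords N (B : pt K 3 -> 'rV[K]_N) (phi : pt K N -> 'rV[K]_4) : Prop :=
  forall p u, u.2 = p.2 -> peq p.1 (B u) -> peq (phi p) (row_mx 1 u.1 : 'rV_(1 + 3)).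

Lemma row_mx1_neq0 (v : 'rV[K]_3) : (row_mx 1 v : 'rV[K]_(1 + 3)) != 0.
Proof.
apply: (@rV_neq0 _ _ _ (lshift 3 ord0)); rewrite row_mxEl mxE eqxx.
exact: oner_neq0.
Qed.

Lemma homog_coords_exists N (B : pt K 3 -> 'rV[K]_N) :
  affine_chart B -> exists phi, homog_coords B phi.
Proof.
move=> cB; have /choice[phi phiP] : forall p : pt K N, exists v : 'rV[K]_4,
    forall u, u.2 = p.2 -> peq p.1 (B u) -> peq v (row_mx 1 u.1 : 'rV_(1 + 3)).
  move=> p; case: (pselect (affine_part B p)) => [[u ut e]|np].
    exists (row_mx 1 u.1 : 'rV_(1 + 3)) => u' ut' e'.
    rewrite (@affine_chart_inj _ B u u') ?ut //.
      by apply: peq_refl; apply: row_mx1_neq0.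
    exact: peq_trans (peq_sym e) e'.
  by exists 0 => u ut e; case: np; exists u.
by exists phi => p u; apply: phiP.
Qed.

Lemma homog_coords_regular N (B : pt K 3 -> 'rV[K]_N) phi :
  polyv B -> affine_chart B -> homog_coords B phi -> regular_map (affine_part B) phi.
Proof.
move=> pB cB hphi p [u ut e]; have [l [idx [sB Bl]]] := cB u.
pose G (q : pt K N) : 'rV[K]_(1 + 3) :=
  row_mx (q.1 ord0 l)%:M (\row_a q.1 ord0 (idx a)).
have GE q u' c : q.1 = c *: B u' -> G q = (c * B u' ord0 l) *: row_mx 1 u'.1.
  move=> eq'; rewrite scale_row_mx; congr row_mx.
    by rewrite -scalemx1 eq' mxE.
  by apply/rowP => a; rewrite !mxE eq' mxE sB; ring.
have hG : hvec 1 G.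
  move=> i; rewrite -(splitK (i : 'I_(1 + 3))); case: (fintype.split _) => j /=.
    apply: (hpoly_ext _ (hpoly_x K l)) => q.
    by rewrite row_mxEl mxE !ord1.
  apply: (hpoly_ext _ (hpoly_x K (idx j))) => q.
  by rewrite row_mxEr mxE.
have [P [hP GP]] := hvec_pevalv hG.
exists 1%N, P; split=> //.
  rewrite -GP; have /peqP[_ [c c0 e']] := peq_sym e.
  by rewrite (GE _ u c) // scaler_eq0 negb_or row_mx1_neq0 mulf_neq0.
move=> q [u' ut' e'] Gq; apply: peq_trans (hphi _ u' ut' e') _.
have /peqP[_ [c c0 e'']] := peq_sym e'.
move: Gq; rewrite -GP (GE _ u' c) // scaler_eq0 negb_or => /andP[h _].
by apply: peqZ => //; apply: row_mx1_neq0.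
Qed.

Lemma homog_coords_rational N (B : pt K 3 -> 'rV[K]_N) phi :
  polyv B -> affine_chart B -> homog_coords B phi -> rational_map (model B) phi.
Proof.
move=> pB cB hphi; exists (affine_part B); last exact: homog_coords_regular.
by split; [exact: affine_part_open|exact: affine_part_dense].
Qed.

(** Prescribing the birational map as (1 : x : y : z) on C^3 makes the maps of successive stages
    compatible automatically, because they agree on the dense affine part. *)
Definition modification N (B : pt K 3 -> 'rV[K]_N) : Prop :=
  exists2 phi, modification_of_P3 (model B) phi & homog_coords B phi.

Lemma res_map_pt N M (B : pt K 3 -> 'rV[K]_N) (B' : pt K 3 -> 'rV[K]_M) b p u :
  affine_chart B -> affine_chart B' -> resolves B B' -> res_map B B' b ->
  u.2 = p.2 -> peq p.1 (B u) -> peq (b p) (B' u).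
Proof.
move=> cB cB' r [_ _ h] ut e.
have mp : model B p by apply: affine_part_model => //; exists u.
have [F rF Fp] := r p mp; apply: peq_trans (h p F mp rF Fp) _.
have [[d hF] FB] := rF.
have /peqP[_ [c c0 ep]] := peq_sym e.
apply: para_peq => //; first exact: affine_chart_neq0.
rewrite [p]surjective_pairing ep -ut (hvec_scale _ _ _ hF).
by apply/para_sym/paraZ/para_sym.
Qed.

Lemma modification_blowup N N' (B : pt K 3 -> 'rV[K]_N) (B' : pt K 3 -> 'rV[K]_N') b :
  polyv B' -> affine_chart B -> affine_chart B' -> resolves B' B ->
  res_map B' B b -> is_blowup (model B') (model B) b ->
  modification B -> modification B'.
Proof.
move=> pB' cB cB' r hb bl [phi hphi cphi].
have [phi' cphi'] := homog_coords_exists cB'.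
exists phi' => //; apply: (Modif_blowup hphi bl).
  exact: homog_coords_rational.
exists (affine_part B').
  by split; [exact: affine_part_open|exact: affine_part_dense].
move=> q [u ut e]; apply: peq_trans (cphi' _ u ut e) _; apply: peq_sym.
by apply: cphi => //; apply: (res_map_pt cB' cB r hb ut e).
Qed.

Lemma modification_blowdown N N' (B : pt K 3 -> 'rV[K]_N) (B' : pt K 3 -> 'rV[K]_N') b :
  polyv B -> polyv B' -> affine_chart B -> affine_chart B' -> resolves B B' ->
  res_map B B' b -> is_blowup (model B) (model B') b ->
  modification B -> modification B'.
Proof.
move=> pB pB' cB cB' r hb bl [phi hphi cphi].
have [phi' cphi'] := homog_coords_exists cB'.
exists phi' => //; apply: (Modif_blowdown hphi bl).
  exact: homog_coords_rational.
exists (affine_part B).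
  by split; [exact: affine_part_open|exact: affine_part_dense].
move=> q [u ut e]; apply: peq_trans (cphi _ u ut e) _; apply: peq_sym.
by apply: cphi' => //; apply: (res_map_pt cB cB' r hb ut e).
Qed.

(** Applies [f] to each column of an N x M matrix. For linear [f] it sends [segre s w] to the Segre
    product of f(s) and w, so forms on the base of a bundle become forms on its total space. *)
Definition colmap N M R (f : pt K N -> 'rV[K]_R) (p : pt K (N * M)) : 'rV[K]_(R * M) :=
  mxvec (\matrix_(k < R, m < M) f (colv m p.1, p.2) ord0 k).

Lemma colmapE N M R (f : pt K N -> 'rV[K]_R) (p : pt K (N * M)) k m :
  colmap f p ord0 (mxvec_index k m) = f (colv m p.1, p.2) ord0 k.
Proof. by rewrite mxvecE mxE. Qed.

Lemma hvec_colmap N M R d (f : pt K N -> 'rV[K]_R) :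
  hvec d f -> hvec d (@colmap N M R f).
Proof.
move=> hf k; case/mxvec_indexP: k => k m.
have := hpoly_comp (hf k) (@hvec_colv K N M m); rewrite muln1.
by apply: hpoly_ext => p; rewrite colmapE.
Qed.

Lemma colmap_segre N M R (f : pt K N -> 'rV[K]_R) s (w : 'rV[K]_M) t :
  hvec 1 f -> colmap f (segre s w, t) = segre (f (s, t)) w.
Proof.
move=> hf; apply/rowP => k; case/mxvec_indexP: k => k m.
by rewrite colmapE segreE colv_segre (hvec_scale _ _ _ hf) mxE expr1 mulrC.
Qed.

(* The affine part C^3 of [tens A Phi], before any blow-up at infinity *)
Definition affineS N M (A : pt K 3 -> 'rV[K]_N) (Phi : pt K 3 -> 'rV[K]_M) : Prop :=
  forall u, exists l iy iz j jx,
  [/\ forall u, A u ord0 iy = yc u * A u ord0 l /\ A u ord0 iz = zc u * A u ord0 l,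
      forall u, Phi u ord0 jx = xc u * Phi u ord0 j,
      A u ord0 l != 0 & Phi u ord0 j != 0].

Lemma affineS_chart N M (A : pt K 3 -> 'rV[K]_N) (Phi : pt K 3 -> 'rV[K]_M) :
  affineS A Phi -> affine_chart (tens A Phi).
Proof.
move=> cS u; have [l [iy [iz [j [jx [h1 h2 Al Pj]]]]]] := cS u.
exists (mxvec_index l j), (fun a : 'I_3 => nth (mxvec_index l j)
  [:: mxvec_index l jx; mxvec_index iy j; mxvec_index iz j] a).
split; last by rewrite /tens segreE mulf_neq0.
move=> q; have [e1 e2] := h1 q.
by apply: forall_I3; rewrite inordK //= /tens !segreE ?h2 ?e1 ?e2 -/(xc _) -/(yc _) -/(zc _); ring.
Qed.

Lemma affineS_neq0 N M (A : pt K 3 -> 'rV[K]_N) (Phi : pt K 3 -> 'rV[K]_M) :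
  affineS A Phi -> (forall u, A u != 0) /\ (forall u, Phi u != 0).
Proof.
move=> cS; split=> u; have [l [iy [iz [j [jx [h1 h2 Al Pj]]]]]] := cS u.
  exact: rV_neq0 Al.
exact: rV_neq0 Pj.
Qed.

End Modifications.

(** * Blowing up a section of the surface over B, and its preimage in the bundle *)

Section SectionBlowup.
Variable K : numClosedFieldType.

(** The local data carried along the tower: near each point of the surface a chart with a frame, and
    a function eta such that, where nu is nonzero, O is given by eta != 0. Smoothness of X comes
    from the charts, the equation of the boundary divisor from eta. *)
Definition bcovered N M (A : pt K 3 -> 'rV[K]_N) (Phi : pt K 3 -> 'rV[K]_M)
    (O : set (pt K N)) : Prop :=
  forall s, model A s -> exists (D : fdata K N M) q eta nu,
  [/\ fpoly D, fcompat A Phi D, q.2 = s.2, peq s.1 (fE D q) & goodat predT D q] /\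
  [/\ ispoly eta, ispoly nu, nu q != 0 & forall q', nu q' != 0 ->
      fE D q' != 0 /\ (O (fE D q', q'.2) <-> eta q' != 0)].

Lemma bcovered_xcharts N M (A : pt K 3 -> 'rV[K]_N) (Phi : pt K 3 -> 'rV[K]_M) O :
  polyv A -> polyv Phi -> bcovered A Phi O -> covered_by_xcharts (tens A Phi).
Proof.
move=> pA pPhi cov p mp; have [s [w [ep ms mw]]] := model_tens mp.
have [D [q [eta [nu [[pD cD qt sq [l [i1 [i2 [j0 [j1 [std _ El aj]]]]]]] _]]]]] := cov _ ms.
have := bundle_charts pA pPhi pD cD std mp ep sq qt El aj.
by case=> -[_ h]; do 4!eexists; apply: h.
Qed.

Lemma ispoly_curve n (f : pt K n -> K) (v : K -> 'rV[K]_n) :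
  ispoly f -> (forall a, exists P : {poly K}, forall t, v t ord0 a = P.[t]) ->
  exists P : {poly K}, forall t, f (v t, t) = P.[t].
Proof.
move=> + hv; move: f.
apply: ispoly_ind => [f g fg [P h]|c|i|f g _ _ [P h1] [Q h2]|f g _ _ [P h1] [Q h2]].
- by exists P => t; rewrite fg h.
- by exists c.
- exact: hv.
- by exists (P + Q) => t; rewrite h1 h2 hornerD.
- by exists (P * Q) => t; rewrite h1 h2 hornerM.
Qed.

Lemma sum_I2 (V : nmodType) (F : 'I_2 -> V) :
  \sum_a F a = F (inord 0) + F (inord 1).
Proof.
rewrite !big_ord_recl big_ord0 addr0; congr (F _ + F _).
  by apply: val_inj; rewrite /= inordK.
by apply: val_inj; rewrite /= inordK.
Qed.

Section TheBlowup.
Variables (N M : nat) (A : pt K 3 -> 'rV[K]_N) (Phi : pt K 3 -> 'rV[K]_M).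
Variables (D : fdata K N M) (T : pred 'I_M) (gam : {poly K}).
Hypotheses (pA : polyv A) (pPhi : polyv Phi) (cS : affineS A Phi).
Hypotheses (pD : fpoly D) (cD : fcompat A Phi D).
Hypothesis offbd : forall u q, u.2 = q.2 -> peq (A u) (fE D q) -> k1 q != 0.
Hypothesis gD : forall t, goodat T D (row2 0 gam.[t], t).

Definition center_pt t : pt K 2 := (row2 0 gam.[t], t).
Definition center t : 'rV[K]_N := fE D (center_pt t).
(** The linear forms p_i c_j - c_i p_j generate the ideal of the point c of projective space. Here c
    moves with t along the curve k1 = 0, which C^3 does not meet. *)
Definition minors (p : pt K N) : 'rV[K]_(N * N) :=
  segre p.1 (center p.2) - segre (center p.2) p.1.

Lemma minorsE p i j : minors p ord0 (mxvec_index i j) =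
  p.1 ord0 i * center p.2 ord0 j - center p.2 ord0 i * p.1 ord0 j.
Proof. by rewrite /minors mxE segreE [X in _ + X]mxE segreE. Qed.

Lemma center_neq0 t : center t != 0.
Proof. by have [l [i1 [i2 [j0 [j1 [_ _ /rV_neq0]]]]]] := gD t. Qed.

Lemma hvec_minors : hvec 1 minors.
Proof.
have [pE _ _] := pD.
have hc j : exists P : {poly K}, forall t, center t ord0 j = P.[t].
  apply: (ispoly_curve (pE j)); apply: forall_I2.
    by exists 0 => t; rewrite mxE inordK // horner0.
  by exists gam => t; rewrite mxE inordK.
move=> k; case/mxvec_indexP: k => i j.
have [[P hP] [Q hQ]] := (hc i, hc j).
apply: (@hpoly_ext _ _ _ _ (fun p => p.1 ord0 i * Q.[p.2] - P.[p.2] * p.1 ord0 j)).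
  by move=> p; rewrite minorsE hP hQ.
apply: hpolyB; first exact: (hpolyM (hpoly_x K i) (hpoly_tp N Q)).
exact: (hpolyM (hpoly_tp N P) (hpoly_x K j)).
Qed.

Lemma minors_eq0 p : minors p = 0 <-> para p.1 (center p.2).
Proof.
split=> [/rowP h i j|h].
  have := h (mxvec_index i j); rewrite minorsE mxE => /eqP.
  by rewrite subr_eq0 => /eqP ->; rewrite mulrC.
apply/rowP => k; case/mxvec_indexP: k => i j; rewrite minorsE mxE h.
by rewrite mulrC subrr.
Qed.

Lemma minors_peq v w t : peq v w -> minors (v, t) != 0 ->
  peq (minors (v, t)) (minors (w, t)).
Proof.
move=> /peqP[_ [c c0 ->]] h; rewrite (hvec_scale _ _ _ hvec_minors).
by apply: peqZ.
Qed.

Lemma minors_A u : minors (A u, u.2) != 0.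
Proof.
apply/eqP => /minors_eq0 /= h.
have /(offbd (erefl u.2 : u.2 = (center_pt u.2).2)) : peq (A u) (fE D (center_pt u.2)).
  by apply: para_peq => //; [apply: (affineS_neq0 cS).1|apply: center_neq0].
by rewrite row2_k1 eqxx.
Qed.

Definition blownup u := tens A (fun u => minors (A u, u.2)) u.

Lemma polyv_minors m (B : pt K m -> 'rV[K]_N) :
  polyv B -> polyv (fun u => minors (B u, u.2)).
Proof. by move=> pB; apply: polyv_comp pB; apply: hvec_polyv hvec_minors. Qed.

Lemma polyv_blownup : polyv blownup.
Proof. by apply: polyv_tens => //; apply: polyv_minors. Qed.

Lemma blownup_neq0 u : blownup u != 0.
Proof. by rewrite /blownup /tens segre_neq0 minors_A (affineS_neq0 cS).1. Qed.

Lemma affineS_blownup : affineS blownup Phi.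
Proof.
move=> u; have [l [iy [iz [j [jx [h1 h2 Al Pj]]]]]] := cS u.
have [b mb] := rV_neq0P (minors_A u).
exists (mxvec_index l b), (mxvec_index iy b), (mxvec_index iz b), j, jx.
split=> //; last by rewrite /blownup /tens segreE mulf_neq0.
by move=> u'; rewrite /blownup /tens !segreE; have [-> ->] := h1 u'; rewrite !mulrA.
Qed.

(** The minors vanish at the centre, so [divide_subst] with no free coordinate writes them through
    k1 and k2 - gam. *)
Lemma minors_frame : exists ab : (pt K 2 -> 'rV[K]_(N * N)) * (pt K 2 -> 'rV[K]_(N * N)),
  [/\ polyv ab.1, polyv ab.2 & forall q, minors (fE D q, q.2) =
    k1 q *: ab.1 q + (k2 q - gam.[q.2]) *: ab.2 q].
Proof.
have [pE _ _] := pD; have pm := polyv_minors pE.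
pose g (a : 'I_2) : {poly K} := if a == inord 0 then 0 else gam.
have /choice[H HP] : forall k, exists H : 'I_2 -> pt K 2 -> K,
    (forall a, ispoly (H a)) /\ forall q : pt K 2, minors (fE D q, q.2) ord0 k =
      k1 q * H (inord 0) q + (k2 q - gam.[q.2]) * H (inord 1) q.
  move=> k; have [H [pH HE]] := divide_subst finset.set0 g (pm k).
  exists H; split=> // q; have := HE q; rewrite sum_I2.
  have sE : subst finset.set0 g q = row2 0 gam.[q.2].
    apply/rowP; apply: forall_I2; rewrite !mxE inE /g ?eqxx ?horner0 inordK //=.
    by rewrite (_ : (_ == _) = false) //; apply/eqP => /(congr1 val); rewrite /= !inordK.
  have m0 : minors (fE D (subst finset.set0 g q, q.2), q.2) ord0 k = 0.
    have h : para (fE D (subst finset.set0 g q, q.2)) (center q.2).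
      by rewrite sE; apply: para_refl.
    by rewrite (minors_eq0 (_, q.2)).2 // mxE.
  by rewrite /= m0 subr0 sE => ->; rewrite !mxE !inordK //= subr0.
exists (fun q => \row_k H k (inord 0) q, fun q => \row_k H k (inord 1) q); split=> /=.
- by move=> k; apply: ispoly_ext ((HP k).1 _) => q; rewrite mxE.
- by move=> k; apply: ispoly_ext ((HP k).1 _) => q; rewrite mxE.
- by move=> q; apply/rowP => k; rewrite (HP k).2 !mxE.
Qed.

(** The quotients are not unique; they are fixed once here so that the charts of the blow-up are
    definite functions. *)
Definition frame_pair := xget (fun=> 0, fun=> 0)
  [set ab : (pt K 2 -> 'rV[K]_(N * N)) * (pt K 2 -> 'rV[K]_(N * N)) |
  [/\ polyv ab.1, polyv ab.2 & forall q, minors (fE D q, q.2) =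
    k1 q *: ab.1 q + (k2 q - gam.[q.2]) *: ab.2 q]].
Definition dm1 := frame_pair.1.
Definition dm2 := frame_pair.2.

Lemma dmP : [/\ polyv dm1, polyv dm2 & forall q, minors (fE D q, q.2) =
    k1 q *: dm1 q + (k2 q - gam.[q.2]) *: dm2 q].
Proof.
rewrite /dm1 /dm2 /frame_pair; case: xgetP => [ab -> //|h].
by have [ab /h] := minors_frame.
Qed.

(** The two charts of the blow-up of (0, gam): the exceptional curve is k1 = 0 in the first and k2 =
    gam in the second. [mf1] and [mf2] are the minors divided by its equation. *)
Definition th1 (q : pt K 2) : pt K 2 := (row2 (k1 q) (gam.[q.2] + k1 q * k2 q), q.2).
Definition th2 (q : pt K 2) : pt K 2 := (row2 (k1 q * (k2 q - gam.[q.2])) (k2 q), q.2).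
Definition mf1 (q : pt K 2) := dm1 (th1 q) + k2 q *: dm2 (th1 q).
Definition mf2 (q : pt K 2) := k1 q *: dm1 (th2 q) + dm2 (th2 q).

Lemma mf1E q : k1 q *: mf1 q = minors (fE D (th1 q), q.2).
Proof.
have [_ _ h] := dmP; rewrite (h (th1 q)) row2_k1 row2_k2 /= /mf1 scalerDr scalerA.
by rewrite addrAC subrr add0r.
Qed.

Lemma mf2E q : (k2 q - gam.[q.2]) *: mf2 q = minors (fE D (th2 q), q.2).
Proof.
have [_ _ h] := dmP; rewrite (h (th2 q)) row2_k1 row2_k2 /= /mf2 scalerDr scalerA.
by rewrite [k1 q * _]mulrC.
Qed.

Lemma polyv_th1 : polyv (fun q => (th1 q).1).
Proof.
apply: polyv_row2; first exact: ispoly_k1.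
by apply: ispolyD; [apply: ispoly_tp|apply: ispolyM; [apply: ispoly_k1|apply: ispoly_k2]].
Qed.

Lemma polyv_th2 : polyv (fun q => (th2 q).1).
Proof.
apply: polyv_row2; last exact: ispoly_k2.
apply: ispolyM; first exact: ispoly_k1.
by apply: ispolyB; [apply: ispoly_k2|apply: ispoly_tp].
Qed.

Lemma ispoly_th1 f : ispoly f -> ispoly (fun q => f (th1 q)).
Proof. by move=> pf; apply: (ispoly_comp pf polyv_th1). Qed.

Lemma ispoly_th2 f : ispoly f -> ispoly (fun q => f (th2 q)).
Proof. by move=> pf; apply: (ispoly_comp pf polyv_th2). Qed.

Definition chart1 : fdata K N M -> fdata K (N * (N * N)) M := fun D =>
  FData (tens (fun q => fE D (th1 q)) mf1) (fun q => fa D (th1 q)) (fun q => fb D (th1 q)).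
Definition chart2 : fdata K N M -> fdata K (N * (N * N)) M := fun D =>
  FData (tens (fun q => fE D (th2 q)) mf2) (fun q => fa D (th2 q)) (fun q => fb D (th2 q)).
Definition lift M' (D' : fdata K N M') : fdata K (N * (N * N)) M' :=
  FData (tens (fE D') (fun q => minors (fE D' q, q.2))) (fa D') (fb D').

Lemma fpoly_chart1 : fpoly (chart1 D).
Proof.
have [[pE pa pb] [p1 p2 _]] := (pD, dmP); split=> /=.
- apply: polyv_tens; first by move=> i; apply: (ispoly_th1 (pE i)).
  apply: polyvD; first by move=> i; apply: (ispoly_th1 (p1 i)).
  by apply: polyvZ; [apply: ispoly_k2|move=> i; apply: (ispoly_th1 (p2 i))].
- by move=> i; apply: (ispoly_th1 (pa i)).
- by move=> i; apply: (ispoly_th1 (pb i)).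
Qed.

Lemma fpoly_chart2 : fpoly (chart2 D).
Proof.
have [[pE pa pb] [p1 p2 _]] := (pD, dmP); split=> /=.
- apply: polyv_tens; first by move=> i; apply: (ispoly_th2 (pE i)).
  apply: polyvD; last by move=> i; apply: (ispoly_th2 (p2 i)).
  by apply: polyvZ; [apply: ispoly_k1|move=> i; apply: (ispoly_th2 (p1 i))].
- by move=> i; apply: (ispoly_th2 (pa i)).
- by move=> i; apply: (ispoly_th2 (pb i)).
Qed.

Lemma fpoly_lift M' (D' : fdata K N M') : fpoly D' -> fpoly (lift D').
Proof.
by move=> [pE pa pb]; split=> //=; apply: polyv_tens => //; apply: polyv_minors.
Qed.

Lemma fcor_lift (D' : fdata K N M) u q xi :
  fcor A Phi D' u q xi -> fcor blownup Phi (lift D') u q xi.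
Proof.
move=> [ut Aq Pq]; split=> //=; apply: segre_peq => //.
by rewrite -ut; apply: minors_peq => //; apply: minors_A.
Qed.

Lemma fcor1 u q xi :
  fcor A Phi D u (th1 q) xi -> fcor blownup Phi (chart1 D) u q xi.
Proof.
move=> [ut Aq Pq]; split=> //=; apply: segre_peq => //.
have k0 : k1 q != 0 by have := offbd ut Aq; rewrite row2_k1.
have h : peq (minors (A u, u.2)) (k1 q *: mf1 q).
  have ut' : u.2 = q.2 := ut.
  by rewrite mf1E -ut'; apply: minors_peq => //; apply: minors_A.
apply: (peq_trans h); apply: peq_sym; apply: peqZ => //.
by have [_ +] := h; rewrite scaler_eq0 negb_or => /andP[].
Qed.

Lemma fcor2 u q xi :
  fcor A Phi D u (th2 q) xi -> fcor blownup Phi (chart2 D) u q xi.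
Proof.
move=> [ut Aq Pq]; split=> //=; apply: segre_peq => //.
have k0 : k2 q - gam.[q.2] != 0.
  by have := offbd ut Aq; rewrite row2_k1 mulf_eq0 negb_or => /andP[].
have h : peq (minors (A u, u.2)) ((k2 q - gam.[q.2]) *: mf2 q).
  have ut' : u.2 = q.2 := ut.
  by rewrite mf2E -ut'; apply: minors_peq => //; apply: minors_A.
apply: (peq_trans h); apply: peq_sym; apply: peqZ => //.
by have [_ +] := h; rewrite scaler_eq0 negb_or => /andP[].
Qed.

Lemma fcompat_lift (D' : fdata K N M) :
  fcompat A Phi D' -> fcompat blownup Phi (lift D').
Proof.
move=> [[w [pw nw wP]] [d [pd nd dP]]]; split.
  exists w; split=> // u /wP[q [xi h]]; exists q, xi; exact: fcor_lift.
by exists d; split=> // q xi /(dP _ xi)[u h]; exists u; apply: fcor_lift.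
Qed.

Lemma th1_inv q : k1 q != 0 ->
  th1 (row2 (k1 q) ((k2 q - gam.[q.2]) / k1 q), q.2) = q.
Proof.
move=> k0; apply: pt2P; rewrite /th1 ?row2_k1 ?row2_k2 //=.
by rewrite mulrC divfK // addrC subrK.
Qed.

Lemma th2_inv q : k2 q - gam.[q.2] != 0 ->
  th2 (row2 (k1 q / (k2 q - gam.[q.2])) (k2 q), q.2) = q.
Proof. by move=> k0; apply: pt2P; rewrite /th2 ?row2_k1 ?row2_k2 //= divfK. Qed.

Lemma fcompat_chart1 : fcompat blownup Phi (chart1 D).
Proof.
have [[w [pw nw wP]] [d [pd nd dP]]] := cD; split.
  exists w; split=> // u /wP[q [xi h]].
  have k0 : k1 q != 0 by case: h => ut Aq _; apply: (offbd ut Aq).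
  exists (row2 (k1 q) ((k2 q - gam.[q.2]) / k1 q), q.2), xi.
  by apply: fcor1; rewrite th1_inv.
exists (fun q => d (th1 q)); split; first exact: ispoly_th1.
  move=> t; have [q qt dq] := nd t; have [u [ut Aq _]] := dP q 0 dq.
  exists (row2 (k1 q) ((k2 q - gam.[q.2]) / k1 q), q.2) => //.
  by rewrite th1_inv //; apply: (offbd ut Aq).
by move=> q xi /(dP _ xi)[u h]; exists u; apply: fcor1.
Qed.

Lemma ispoly_k2gam : ispoly (fun q : pt K 2 => k2 q - gam.[q.2]).
Proof. by apply: ispolyB; [apply: ispoly_k2|apply: ispoly_tp]. Qed.

Lemma k2gam_neq0 t : exists2 q : pt K 2, q.2 = t & k2 q - gam.[q.2] != 0.
Proof.
exists (row2 0 (gam.[t] + 1), t) => //.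
by rewrite row2_k2 /= addrAC subrr add0r oner_neq0.
Qed.

Lemma fcompat_chart2 : fcompat blownup Phi (chart2 D).
Proof.
have [[w [pw nw wP]] [d [pd nd dP]]] := cD.
have [l [i1 [i2 [j0 [j1 [[std _] _ El _]]]]]] := gD 0.
split.
  (* Up to a nonzero scalar this is (k2 - gam) E_l, read off the homogeneous coordinates of [A]. It
     discards the points with k2 = gam, where [th2_inv] does not apply. *)
  pose v u := A u ord0 i2 - gam.[u.2] * A u ord0 l.
  have pv : ispoly v by apply: ispolyB => //; apply: ispolyM => //; apply: ispoly_tp.
  have vq u q xi : fcor A Phi D u q xi ->
      v u != 0 <-> (k2 q - gam.[q.2]) * fE D q ord0 l != 0.
    move=> [ut /peq_sym/peqP[_ [c c0 eA]] _].
    rewrite /v eA !mxE (std q).2 ut.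
    have -> : c * (k2 q * fE D q ord0 l) - gam.[q.2] * (c * fE D q ord0 l) =
      c * ((k2 q - gam.[q.2]) * fE D q ord0 l) by ring.
    by rewrite mulf_eq0 (negbTE c0).
  exists (fun u => w u * v u); split; first exact: ispolyM.
    apply: nonzero_mul => //; have [pE _ _] := pD.
    have hE : exists2 q : pt K 2, q.2 = 0 & fE D q ord0 l != 0.
      by exists (row2 0 gam.[0], 0).
    have [q qt] := nonzero_fiber_mul pd (ispolyM ispoly_k2gam (pE l)) (nd 0)
      (nonzero_fiber_mul ispoly_k2gam (pE l) (k2gam_neq0 0) hE).
    rewrite mulf_eq0 negb_or => /andP[dq h].
    by have [u hu] := dP q 0 dq; exists u; apply/(vq _ _ _ hu).
  move=> u; rewrite mulf_eq0 negb_or => /andP[/wP[q [xi h]] /(vq _ _ _ h)].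
  rewrite mulf_eq0 negb_or => /andP[k0 _].
  exists (row2 (k1 q / (k2 q - gam.[q.2])) (k2 q), q.2), xi.
  by apply: fcor2; rewrite th2_inv.
exists (fun q => d (th2 q)); split; first exact: ispoly_th2.
  move=> t; have [q qt] := nonzero_fiber_mul pd ispoly_k2gam (nd t) (k2gam_neq0 t).
  rewrite mulf_eq0 negb_or => /andP[dq k0].
  exists (row2 (k1 q / (k2 q - gam.[q.2])) (k2 q), q.2) => //.
  by rewrite th2_inv.
by move=> q xi /(dP _ xi)[u h]; exists u; apply: fcor2.
Qed.

(** These two minors are k1 and k2 - gam times the common factor E_l c_l. They generate the ideal
    near the centre, and their ratio becomes the coordinate of the exceptional curve. *)
Lemma minors_std l i1 i2 j0 j1 q : fstd D l i1 i2 j0 j1 ->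
  minors (fE D q, q.2) ord0 (mxvec_index i1 l) =
    k1 q * (fE D q ord0 l * center q.2 ord0 l) /\
  minors (fE D q, q.2) ord0 (mxvec_index i2 l) =
    (k2 q - gam.[q.2]) * (fE D q ord0 l * center q.2 ord0 l).
Proof.
move=> [std _]; rewrite !minorsE /= /center.
have [e1 e2] := std q; have [e3 e4] := std (center_pt q.2).
by rewrite e1 e2 e3 e4 /center_pt row2_k1 row2_k2; split; ring.
Qed.

(* The identities hold after multiplication by the equation of the exceptional
   curve, hence everywhere. *)
Lemma mf1_std l i1 i2 j0 j1 q : fstd D l i1 i2 j0 j1 ->
  mf1 q ord0 (mxvec_index i1 l) = fE D (th1 q) ord0 l * center q.2 ord0 l /\
  mf1 q ord0 (mxvec_index i2 l) = k2 q * (fE D (th1 q) ord0 l * center q.2 ord0 l).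
Proof.
move=> std; have [pE1 _ _] := fpoly_chart1; have [pE _ _] := pD.
have [p1 p2 _] := dmP.
have pmf i : ispoly (fun q => mf1 q ord0 i).
  apply: polyvD; first by move=> k; apply: (ispoly_th1 (p1 k)).
  by apply: polyvZ; [apply: ispoly_k2|move=> k; apply: (ispoly_th1 (p2 k))].
have pc : ispoly (fun q : pt K 2 => fE D (th1 q) ord0 l * center q.2 ord0 l).
  apply: ispolyM; first exact: (ispoly_th1 (pE l)).
  apply: (ispoly_comp (pE l) (g := fun q : pt K 2 => row2 0 gam.[q.2])).
  by apply: polyv_row2; [apply: ispoly_c|apply: ispoly_tp].
have nk : exists q : pt K 2, k1 q != 0.
  by exists (row2 1 0, 0); rewrite row2_k1 oner_neq0.
have key q' : k1 q' != 0 ->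
    mf1 q' ord0 (mxvec_index i1 l) - fE D (th1 q') ord0 l * center q'.2 ord0 l = 0 /\
    mf1 q' ord0 (mxvec_index i2 l) -
      k2 q' * (fE D (th1 q') ord0 l * center q'.2 ord0 l) = 0.
  move=> k0; have [e1 e2] := minors_std (th1 q') std.
  move: e1 e2; rewrite /= -mf1E !mxE !row2_k1 !row2_k2 => e1 e2.
  split; apply: (mulfI k0); rewrite mulr0 mulrBr ?e1 ?e2; ring.
have d1 := density_all (ispolyB (pmf _) pc) (ispoly_k1 K) nk (fun q h => (key q h).1) q.
have d2 := density_all (ispolyB (pmf _) (ispolyM (ispoly_k2 K) pc)) (ispoly_k1 K) nk
  (fun q h => (key q h).2) q.
by split; apply/eqP; rewrite -subr_eq0; apply/eqP.
Qed.

Lemma mf2_std l i1 i2 j0 j1 q : fstd D l i1 i2 j0 j1 ->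
  mf2 q ord0 (mxvec_index i1 l) = k1 q * (fE D (th2 q) ord0 l * center q.2 ord0 l) /\
  mf2 q ord0 (mxvec_index i2 l) = fE D (th2 q) ord0 l * center q.2 ord0 l.
Proof.
move=> std; have [pE _ _] := pD.
have [p1 p2 _] := dmP.
have pmf i : ispoly (fun q => mf2 q ord0 i).
  apply: polyvD; last by move=> k; apply: (ispoly_th2 (p2 k)).
  by apply: polyvZ; [apply: ispoly_k1|move=> k; apply: (ispoly_th2 (p1 k))].
have pc : ispoly (fun q : pt K 2 => fE D (th2 q) ord0 l * center q.2 ord0 l).
  apply: ispolyM; first exact: (ispoly_th2 (pE l)).
  apply: (ispoly_comp (pE l) (g := fun q : pt K 2 => row2 0 gam.[q.2])).
  by apply: polyv_row2; [apply: ispoly_c|apply: ispoly_tp].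
have nk : exists q : pt K 2, k2 q - gam.[q.2] != 0.
  by have [q' _ h] := k2gam_neq0 0; exists q'.
have key q' : k2 q' - gam.[q'.2] != 0 ->
    mf2 q' ord0 (mxvec_index i1 l) -
      k1 q' * (fE D (th2 q') ord0 l * center q'.2 ord0 l) = 0 /\
    mf2 q' ord0 (mxvec_index i2 l) - fE D (th2 q') ord0 l * center q'.2 ord0 l = 0.
  move=> k0; have [e1 e2] := minors_std (th2 q') std.
  move: e1 e2; rewrite /= -mf2E !mxE !row2_k1 !row2_k2 => e1 e2.
  split; apply: (mulfI k0); rewrite mulr0 mulrBr ?e1 ?e2; ring.
have d1 := density_all (ispolyB (pmf _) (ispolyM (ispoly_k1 K) pc)) ispoly_k2gam nk
  (fun q h => (key q h).1) q.
have d2 := density_all (ispolyB (pmf _) pc) ispoly_k2gam nk (fun q h => (key q h).2) q.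
by split; apply/eqP; rewrite -subr_eq0; apply/eqP.
Qed.

Lemma th1_center (q : pt K 2) : k1 q = 0 -> th1 q = center_pt q.2.
Proof. by move=> k0; apply: pt2P; rewrite /th1 ?row2_k1 ?row2_k2 //= k0 mul0r addr0. Qed.

Lemma th2_center (q : pt K 2) : k2 q = gam.[q.2] -> th2 q = center_pt q.2.
Proof. by move=> k0; apply: pt2P; rewrite /th2 ?row2_k1 ?row2_k2 //= k0 subrr mulr0. Qed.

Lemma fstd_chart1 l i1 i2 j0 j1 : fstd D l i1 i2 j0 j1 ->
  fstd (chart1 D) (mxvec_index l (mxvec_index i1 l))
    (mxvec_index i1 (mxvec_index i1 l)) (mxvec_index l (mxvec_index i2 l)) j0 j1.
Proof.
move=> std; split=> q /=; last by have [_ h] := std; apply: h.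
have [h _] := std; have [e1 _] := h (th1 q).
have [m1 m2] := mf1_std q std.
by rewrite /tens !segreE m1 m2 e1 /th1 row2_k1; split; ring.
Qed.

Lemma fstd_chart2 l i1 i2 j0 j1 : fstd D l i1 i2 j0 j1 ->
  fstd (chart2 D) (mxvec_index l (mxvec_index i2 l))
    (mxvec_index l (mxvec_index i1 l)) (mxvec_index i2 (mxvec_index i2 l)) j0 j1.
Proof.
move=> std; split=> q /=; last by have [_ h] := std; apply: h.
have [h _] := std; have [_ e2] := h (th2 q).
have [m1 m2] := mf2_std q std.
by rewrite /tens !segreE m1 m2 e2 /th2 row2_k2; split; ring.
Qed.

Lemma goodat_chart1 q : k1 q = 0 -> goodat T (chart1 D) q.
Proof.
move=> k0; have [l [i1 [i2 [j0 [j1 [std Tj El aj]]]]]] := gD q.2.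
do 5!eexists; split; [exact: fstd_chart1 std|exact: Tj| |].
  have [m1 _] := mf1_std q std.
  by rewrite /= /tens segreE m1 (th1_center k0) !mulf_neq0.
by rewrite /= (th1_center k0).
Qed.

Lemma goodat_chart2 q : k2 q = gam.[q.2] -> goodat T (chart2 D) q.
Proof.
move=> k0; have [l [i1 [i2 [j0 [j1 [std Tj El aj]]]]]] := gD q.2.
do 5!eexists; split; [exact: fstd_chart2 std|exact: Tj| |].
  have [_ m2] := mf2_std q std.
  by rewrite /= /tens segreE m2 (th2_center k0) !mulf_neq0.
by rewrite /= (th2_center k0).
Qed.

Lemma goodat_lift M' (D' : fdata K N M') (T' : pred 'I_M') q :
  goodat T' D' q -> minors (fE D' q, q.2) != 0 -> goodat T' (lift D') q.
Proof.
move=> [l [i1 [i2 [j0 [j1 [[std1 std2] Tj El aj]]]]]] /rV_neq0P[b mb].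
exists (mxvec_index l b), (mxvec_index i1 b), (mxvec_index i2 b), j0, j1.
split=> //; last by rewrite /= /tens segreE mulf_neq0.
split=> // q'; have [e1 e2] := std1 q'.
by rewrite /= /tens !segreE e1 e2 !mulrA.
Qed.

(** By a closed relation the second factor over the centre is a combination of dm1 and dm2 whose
    coefficients are its entries (i1, l) and (i2, l). Their ratio is the coordinate of the
    exceptional curve; only its value at infinity requires the second chart. *)
Lemma exceptional_points p s w : model blownup p -> p.1 = segre s w ->
  para s (center p.2) ->
  (exists q, [/\ q.2 = p.2, k1 q = 0 & peq p.1 (fE (chart1 D) q)]) \/
  (exists q, [/\ q.2 = p.2, k1 q = 0, k2 q = gam.[q.2] & peq p.1 (fE (chart2 D) q)]).
Proof.
move=> mp ep sc.
have [l [i1 [i2 [j0 [j1 [std Tj El aj]]]]]] := gD p.2.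
have [s0 w0] : s != 0 /\ w != 0.
  by move: (model_neq0 mp); rewrite ep segre_neq0 => /andP[].
have sq : peq s (fE D (center_pt p.2)) by apply: para_peq => //; apply: center_neq0.
have [pm1 pm2 dmE] := dmP; have [pE _ _] := pD.
have [[v [pv nv vP]] _] := cD.
have rel k : fE D (center_pt p.2) ord0 l * center p.2 ord0 l * w ord0 k =
    dm1 (center_pt p.2) ord0 k * w ord0 (mxvec_index i1 l) +
    dm2 (center_pt p.2) ord0 k * w ord0 (mxvec_index i2 l).
  apply: (@relation_closed K N (N * N) M A (fun u => minors (A u, u.2)) D l i1 i2 j0 j1
    (fun q => fE D q ord0 l * center q.2 ord0 l) (fun q => dm1 q ord0 k)
    (fun q => dm2 q ord0 k) k _ _ p s w (center_pt p.2)) => //.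
  - exact: polyv_minors.
  - apply: ispolyM => //.
    apply: (ispoly_comp (pE l) (g := fun q : pt K 2 => row2 0 gam.[q.2])).
    by apply: polyv_row2; [apply: ispoly_c|apply: ispoly_tp].
  - exists v; split=> // u /vP[q [xi [ut Aq _]]]; exists q; split=> //.
    have /peqP[_ [c _ eA]] := peq_sym Aq.
    have [m1 m2] := minors_std q std.
    rewrite eA ut (hvec_scale _ _ _ hvec_minors) !rVZ m1 m2 dmE rVD !rVZ; ring.
set c := fE D (center_pt p.2) ord0 l * center p.2 ord0 l in rel.
have c0 : c != 0 by rewrite mulf_neq0.
case: (eqVneq (w ord0 (mxvec_index i1 l)) 0) => [w1|w1]; [right|left].
  have w2 : w ord0 (mxvec_index i2 l) != 0.
    apply: contra_neq w0 => w2; apply/rowP => k; apply: (mulfI c0).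
    by rewrite rel w1 w2 mxE !mulr0 addr0.
  pose q := center_pt p.2.
  exists q; split; rewrite /q ?row2_k1 ?row2_k2 // ep /= /tens th2_center ?row2_k2 //.
  apply: segre_peq => //; apply/peqP; split=> //.
  exists (c / w ord0 (mxvec_index i2 l)); first by rewrite mulf_neq0 ?invr_neq0.
  apply/rowP => k; rewrite /mf2 row2_k1 th2_center ?row2_k2 // scale0r add0r mxE.
  by rewrite mulrAC rel w1 mulr0 add0r mulfK.
pose q : pt K 2 := (row2 0 (w ord0 (mxvec_index i2 l) / w ord0 (mxvec_index i1 l)), p.2).
exists q; split; rewrite /q ?row2_k1 // ep /= /tens th1_center ?row2_k1 //.
apply: segre_peq => //; apply/peqP; split=> //.
exists (c / w ord0 (mxvec_index i1 l)); first by rewrite mulf_neq0 ?invr_neq0.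
apply/rowP => k; rewrite /mf1 row2_k2 th1_center ?row2_k1 // !mxE.
by rewrite [RHS]mulrAC rel; field.
Qed.

(** Proportionality of w to the minors of s is a closed condition, and it determines w where the
    minors do not all vanish. *)
Lemma blownup_factor p s w : model blownup p -> p.1 = segre s w ->
  minors (s, p.2) != 0 -> peq w (minors (s, p.2)).
Proof.
move=> mp ep ms.
have [s0 w0] : s != 0 /\ w != 0.
  by move: (model_neq0 mp); rewrite ep segre_neq0 => /andP[].
apply: para_peq => // i j; have [m wm] := rV_neq0P w0; have [k sk] := rV_neq0P s0.
pose g (p : pt K (N * (N * N))) :=
  rowv k p.1 ord0 i * minors (colv m p.1, p.2) ord0 j -
  rowv k p.1 ord0 j * minors (colv m p.1, p.2) ord0 i.
have hg : hpoly (1 + 1 * 1) g.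
  have hm x := hpoly_comp (hvec_minors x) (@hvec_colv K N (N * N) m).
  have hr x := @hvec_rowv K N (N * N) k x.
  by apply: hpolyB; [exact: (hpolyM (hr i) (hm j))|exact: (hpolyM (hr j) (hm i))].
have := model_vanish hg _ mp; rewrite /g ep rowv_segre colv_segre.
rewrite (hvec_scale _ _ _ hvec_minors) !rVZ => h; apply/eqP; rewrite -subr_eq0.
have : s ord0 k * w ord0 m *
  (w ord0 i * minors (s, p.2) ord0 j - w ord0 j * minors (s, p.2) ord0 i) == 0.
  rewrite -[X in _ == X]h; first by apply/eqP; ring.
  move=> u; rewrite /= /blownup /tens rowv_segre colv_segre.
  by rewrite (hvec_scale _ _ _ hvec_minors) !rVZ; ring.
by rewrite !mulf_eq0 (negbTE sk) (negbTE wm).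
Qed.

Variable O : set (pt K N).
Hypothesis Opeq : forall v w t, peq v w -> O (v, t) -> O (w, t).
Hypothesis On0 : forall v t, O (v, t) -> v != 0.
Hypothesis OA : forall u, O (A u, u.2).
Hypothesis OD : forall q, O (fE D q, q.2) <-> k1 q != 0.
Hypothesis cov : bcovered A Phi O.

Definition blownup_set : set (pt K (N * (N * N))) :=
  [set p | p.1 != 0 /\ exists s w, p.1 = segre s w /\ O (s, p.2)].

Lemma blownup_set_peq v w t : peq v w -> blownup_set (v, t) -> blownup_set (w, t).
Proof.
move=> /peqP[v0 [c c0 ->]] [_ [s [x [/= e Os]]]]; split=> /=.
  by rewrite scaler_eq0 negb_or c0.
exists s, (c *: x); split=> //.
by apply/rowP => k; case/mxvec_indexP: k => i j; rewrite mxE e !segreE mxE; ring.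
Qed.

Lemma blownup_set_segre s w t : segre s w != 0 ->
  blownup_set (segre s w, t) <-> O (s, t).
Proof.
move=> sw0; split=> [[_ [s' [w' [/= e Os]]]]|Os]; last by split=> //; exists s, w.
have [h _] : peq s' s /\ peq w' w by apply: segre_peq_inv; rewrite -e; apply: peq_refl.
exact: Opeq h Os.
Qed.

Lemma blownup_set_A u : blownup_set (blownup u, u.2).
Proof. by apply/blownup_set_segre; [exact: blownup_neq0|exact: OA]. Qed.

Lemma notO_center v t : O (v, t) -> minors (v, t) != 0.
Proof.
move=> Ov; apply/eqP => /minors_eq0 /= h; have v0 : v != 0 by apply: On0 Ov.
have e : peq v (center t) by apply: para_peq => //; apply: center_neq0.
by move: (Opeq e Ov) => /(OD (center_pt t)); rewrite row2_k1 eqxx.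
Qed.

Lemma OD_chart1 q : blownup_set (fE (chart1 D) q, q.2) <-> k1 q != 0.
Proof.
split=> [[/= n0 [s [w [e Os]]]]|k0].
  have /segre_peq_inv[h _] : peq (segre s w) (tens (fun q => fE D (th1 q)) mf1 q).
    by rewrite -e; apply: peq_refl.
  by move: (Opeq h Os) => /(OD (th1 q)); rewrite row2_k1.
have Oq : O (fE D (th1 q), q.2) by apply/(OD (th1 q)); rewrite row2_k1.
apply/blownup_set_segre => //; rewrite segre_neq0 (On0 Oq) /=.
by move: (notO_center Oq); rewrite -mf1E scaler_eq0 negb_or => /andP[].
Qed.

(** Here the complement has two branches: the exceptional curve k2 = gam and the proper transform k1
    = 0. *)
Lemma OD_chart2 q :
  blownup_set (fE (chart2 D) q, q.2) <-> k1 q * (k2 q - gam.[q.2]) != 0.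
Proof.
split=> [[/= n0 [s [w [e Os]]]]|k0].
  have /segre_peq_inv[h _] : peq (segre s w) (tens (fun q => fE D (th2 q)) mf2 q).
    by rewrite -e; apply: peq_refl.
  by move: (Opeq h Os) => /(OD (th2 q)); rewrite row2_k1.
have Oq : O (fE D (th2 q), q.2) by apply/(OD (th2 q)); rewrite row2_k1.
apply/blownup_set_segre => //; rewrite segre_neq0 (On0 Oq) /=.
by move: (notO_center Oq); rewrite -mf2E scaler_eq0 negb_or => /andP[].
Qed.

Lemma OD_lift M' (D' : fdata K N M') q :
  blownup_set (fE (lift D') q, q.2) <-> O (fE D' q, q.2).
Proof.
split=> [[/= n0 [s [w [e Os]]]]|Oq].
  have /segre_peq_inv[h _] :
      peq (segre s w) (tens (fE D') (fun q => minors (fE D' q, q.2)) q).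
    by rewrite -e; apply: peq_refl.
  exact: Opeq h Os.
by apply/blownup_set_segre => //; rewrite segre_neq0 (On0 Oq) notO_center.
Qed.

Lemma bcovered_blownup : bcovered blownup Phi blownup_set.
Proof.
move=> p mp; have [s [w [ep ms mw]]] := model_tens mp.
case: (eqVneq (minors (s, p.2)) 0) => [/minors_eq0 /= sc|m0].
  case: (exceptional_points mp ep sc) => [[q [qt k0 pq]]|[q [qt k0 k0' pq]]].
  - have gq := goodat_chart1 k0; have pD1 := fpoly_chart1; have [pE _ _] := pD1.
    have [l' [i1' [i2' [j0' [j1' [std' _ El' aj']]]]]] := gq.
    exists (chart1 D), q, (@k1 K), (fun q => fE (chart1 D) q ord0 l'); split.
      split=> //; first exact: fcompat_chart1.
      by exists l', i1', i2', j0', j1'.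
    split=> //; first exact: ispoly_k1.
    by move=> q' /rV_neq0 h; split=> //; apply: OD_chart1.
  - have gq := goodat_chart2 k0'; have pD2 := fpoly_chart2; have [pE _ _] := pD2.
    have [l' [i1' [i2' [j0' [j1' [std' _ El' aj']]]]]] := gq.
    exists (chart2 D), q, (fun q => k1 q * (k2 q - gam.[q.2])),
      (fun q => fE (chart2 D) q ord0 l'); split.
      split=> //; first exact: fcompat_chart2.
      by exists l', i1', i2', j0', j1'.
    split=> //; first by apply: ispolyM; [apply: ispoly_k1|apply: ispoly_k2gam].
    by move=> q' /rV_neq0 h; split=> //; apply: OD_chart2.
have [D' [q [eta [nu [[pD' cD' qt sq gq] [peta pnu nuq hO]]]]]] := cov ms.
have mq := minors_peq sq m0; have [_ mq0 _] := mq.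
have [b mb] := rV_neq0P mq0; rewrite -[p.2]/((s, p.2).2) -qt in mb mq0.
have [pE' _ _] := pD'; have pm := polyv_minors pE'.
exists (lift D'), q, eta, (fun q => nu q * minors (fE D' q, q.2) ord0 b); split.
  split=> //; [exact: fpoly_lift|exact: fcompat_lift| |exact: goodat_lift].
  rewrite ep /= /tens; apply: segre_peq => //.
  by apply: peq_trans (blownup_factor mp ep m0) _; rewrite qt.
split=> //; [exact: ispolyM|by rewrite mulf_neq0|move=> q'].
rewrite mulf_eq0 negb_or => /andP[/hO[E0 hO'] /rV_neq0 m1].
split; first by rewrite /= /tens segre_neq0 E0.
by rewrite OD_lift.
Qed.

(** The 3-fold is blown up along the preimage of the centre. In either chart of the fibre its ideal
    is (k1, k2 - gam) with the fibre coordinate free, which is [center_at] for J reduced to that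
    coordinate. The remaining conditions say that the vectors involved resolve one another. *)
Lemma modification_blownup :
  modification (tens A Phi) -> modification (tens blownup Phi).
Proof.
have pB := polyv_tens pA pPhi; have pB' := polyv_tens polyv_blownup pPhi.
have cB := affineS_chart cS; have cB' := affineS_chart affineS_blownup.
have B0 u : tens A Phi u != 0 by apply: affine_chart_neq0.
have B'0 u : tens blownup Phi u != 0 by apply: affine_chart_neq0.
have hm := hvec_minors; have hF := @hvec_colmap K N M _ _ _ hm.
have Phi0 u : Phi u != 0 by apply: (affineS_neq0 cS).2.
have FBE u : colmap minors (tens A Phi u, u.2) =
    tens (fun u => minors (A u, u.2)) Phi u by rewrite /tens colmap_segre.
have FB0 u : colmap minors (tens A Phi u, u.2) != 0.
  by rewrite FBE /tens segre_neq0 minors_A Phi0.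
have res1 : resolves (tens blownup Phi) blownup by apply: resolves_tensl.
have res2 : resolves (tens blownup Phi) A.
  by apply: (resolves_trans _ res1) => [u|]; [exact: blownup_neq0|exact: resolves_tensl].
have res3 : resolves (tens blownup Phi) (fun u => minors (A u, u.2)).
  by apply: (resolves_trans _ res1) => [u|]; [exact: blownup_neq0|exact: resolves_tensr].
have res4 : resolves (tens blownup Phi) Phi by apply: resolves_tensr.
have resB : resolves (tens blownup Phi) (tens A Phi) by apply: resolves_pair.
have [b hb] := res_mapP B0 resB.
move=> hmod; apply: (modification_blowup pB' cB cB' resB hb) => //.
have FBf : (fun u => colmap minors (tens A Phi u, u.2)) =
    tens (fun u => minors (A u, u.2)) Phi by apply/funext => u; rewrite FBE.
apply: (@is_blowup_model K 3 _ _ _ (tens A Phi) (colmap minors) pB B0 hF FB0) => //.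
- exact: (bcovered_xcharts pA pPhi cov).
- move=> p mp Fp; have [s [w [ep ms mw]]] := model_tens mp.
  have sc : para s (center p.2).
    apply/(minors_eq0 (s, p.2)); apply/eqP/negPn/negP => m0.
    move: Fp; rewrite [p]surjective_pairing ep colmap_segre // => /eqP.
    by apply/negP; rewrite segre_neq0 m0; exact: model_neq0 mw.
  have [l [i1 [i2 [j0 [j1 [std Tj El aj]]]]]] := gD p.2.
  have s0 : s != 0 by exact: model_neq0 ms.
  have sq : peq s (fE D (center_pt p.2)) by apply: para_peq => //; apply: center_neq0.
  have [pE pa pb] := pD.
  have I : (inord 0 == inord 1 :> 'I_3) = false /\ (inord 0 == inord 2 :> 'I_3) = false /\
      (inord 1 == inord 2 :> 'I_3) = false /\ (inord 2 == inord 1 :> 'I_3) = false.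
    by do !split; apply/eqP => /(congr1 val); rewrite /= !inordK.
  have [I01 [I02 [I12 I21]]] := I.
  pose g (a : 'I_3) : {poly K} := if a == inord 2 then gam else 0.
  pose U (a : 'I_3) (q : pt K 3) :=
    fE D (base q) ord0 l * center q.2 ord0 l * fa D (base q) ord0 j0.
  have pU a : ispoly (U a).
    apply: ispolyM; last exact: (ispoly_base (pa j0)).
    apply: ispolyM; first exact: (ispoly_base (pE l)).
    apply: (ispoly_comp (pE l) (g := fun q : pt K 3 => row2 0 gam.[q.2])).
    by apply: polyv_row2; [apply: ispoly_c|apply: ispoly_tp].
  (* [j] is j0 in the finite chart and j1 in the infinite one: in both, the entry [j] of the fibre
     vector is fa_{j0}, which enters the unit. *)
  have key j v (P : pt K 3 -> 'rV[K]_(N * M)) q0 : base q0 = center_pt p.2 ->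
      (forall q, P q = segre (fE D (base q)) (v q)) ->
      (forall q, v q ord0 j = fa D (base q) ord0 j0) ->
      center_at (tens A Phi) P (colmap minors) q0.
    move=> q0E PE vE.
    have FPE q : colmap minors (P q, q.2) = segre (minors (fE D (base q), q.2)) (v q).
      by rewrite PE colmap_segre.
    exists [set inord 0]%SET, g, U, (fun a => mxvec_index
      (if a == inord 1 then mxvec_index i1 l else mxvec_index i2 l) j); split=> //.
    + move=> q h; rewrite FPE.
      have h1 : yc q = 0 by rewrite /yc h ?inE ?[_ == inord 0]eq_sym ?I01 // /g I12 horner0.
      have h2 : zc q = gam.[q.2] by rewrite /zc h ?inE ?[_ == inord 0]eq_sym ?I02 // /g eqxx.
      have -> : base q = center_pt q.2 by rewrite /base h1 h2.
      rewrite (minors_eq0 (_, q.2)).2; last exact: para_refl.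
      by apply/rowP => k; case/mxvec_indexP: k => k m; rewrite segreE !mxE mul0r.
    + move=> q a; rewrite inE FPE segreE vE /U; have [m1 m2] := minors_std (base q) std.
      move: a; apply: forall_I3; rewrite ?eqxx // => _.
      * by rewrite m1 row2_k1 /g I12 horner0 subr0 -/(yc q); ring.
      * by rewrite I21 m2 row2_k2 /g eqxx -/(zc q) /=; ring.
    + move=> a; rewrite /U q0E.
      have -> : q0.2 = p.2 by rewrite -[q0.2]/((base q0).2) q0E.
      by rewrite !mulf_neq0.
  case: (bundle_charts pA pPhi pD cD std mp ep sq erefl El aj) => -[wj h].
  + do 4!eexists; split; first exact: h.
    apply: (key j0 (fun q => fa D (base q) + xc q *: fb D (base q))) => //.
      by rewrite base_over.
    by move=> q; have [_ /(_ (base q))[_ _ e]] := std; rewrite rVD rVZ e mulr0 addr0.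
  + do 4!eexists; split; first exact: h.
    apply: (key j1 (fun q => xc q *: fa D (base q) + fb D (base q))) => //.
      by rewrite base_over.
    by move=> q; have [_ /(_ (base q))[e e' _]] := std; rewrite rVD rVZ e e' mulr0 add0r.
- by rewrite FBf; apply: resolves_pair => //; apply: resolves_pair.
- rewrite FBf; apply: resolves_pair; [apply: resolves_pair|].
  + by apply: (resolves_trans B0) (@resolves_tensl _ _ _ _ _ _) => //; apply: resolves_tensl.
  + apply: (@resolves_trans _ _ _ _ _ _ (tens (fun u => minors (A u, u.2)) Phi)).
    * by move=> u; rewrite -FBE.
    * exact: resolves_tensr.
    * exact: resolves_tensl.
  + by apply: (resolves_trans B0) (@resolves_tensr _ _ _ _ _ _) => //; apply: resolves_tensl.
Qed.
End TheBlowup. End SectionBlowup.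

(** * Elementary transformations along an exceptional curve *)

Section Elementary.
Variable K : numClosedFieldType.

(** The chart expression [V], homogenized, is the local representative; the factor p_l keeps it
    proportional to [W] also where the chart coordinates are undefined. *)
Lemma resolves_chart N M R (A : pt K 3 -> 'rV[K]_N) (Phi : pt K 3 -> 'rV[K]_M)
    (D : fdata K N M) l i1 i2 j0 j1 (V : pt K 2 -> 'rV[K]_R) (W : pt K 3 -> 'rV[K]_R)
    s q :
  polyv A -> polyv W -> fcompat A Phi D -> fstd D l i1 i2 j0 j1 -> polyv V ->
  (forall u q xi, fcor A Phi D u q xi -> para (V q) (W u)) ->
  q.2 = s.2 -> peq s.1 (fE D q) -> fE D q ord0 l != 0 -> V q != 0 ->
  exists2 F, resolves_by A W F & F s != 0.
Proof.
move=> pA pW [[w [pw nw wP]] _] std pV VW qt sq El Vq.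
pose lam (a : 'I_2) (p : pt K N) := p.1 ord0 (if a == inord 0 then i1 else i2).
have [D' [G [hG GE]]] := homogenize_family pV
  (fun a => hpoly_x K _ : hpoly 1 (lam a)) (hpoly_x K l).
have I2 : (inord 1 == inord 0 :> 'I_2) = false.
  by apply/eqP => /(congr1 val); rewrite /= !inordK.
have lamE (p : pt K N) : (\row_a (lam a p / p.1 ord0 l), p.2) = scoords l i1 i2 p.
  rewrite /scoords; congr pair; apply/rowP.
  by apply: forall_I2; rewrite !mxE inordK //= /lam ?eqxx ?I2.
pose F (p : pt K N) : 'rV[K]_R := \row_k (p.1 ord0 l * G k p).
have hF : hvec (1 + D') F.
  move=> k; apply: (hpoly_ext _ (hpolyM (hpoly_x K l) (hG k))) => p.
  by rewrite mxE.
have FE (p : pt K N) : F p = (p.1 ord0 l * p.1 ord0 l ^+ D') *: V (scoords l i1 i2 p).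
  by apply/rowP => k; rewrite !mxE GE lamE mulrA.
exists F; last first.
  have sl : s.1 ord0 l != 0 by apply: peq_neq0 (peq_sym sq) El.
  rewrite FE (scoords_peq std qt sq sl) scaler_eq0 negb_or Vq andbT.
  by rewrite mulf_neq0 // expf_neq0.
split; first by exists (1 + D')%N.
move=> u i j; apply/eqP; rewrite -subr_eq0; apply/eqP.
have pF k : ispoly (fun u => F (A u, u.2) ord0 k).
  exact: (ispoly_comp (hpoly_ispoly (hF k)) pA).
apply: (@density_all _ _ (fun u => F (A u, u.2) ord0 i * W u ord0 j -
    F (A u, u.2) ord0 j * W u ord0 i) w) => // [|v /wP[q' [xi h]]].
  by apply: ispolyB; apply: ispolyM.
rewrite FE /=; case: (eqVneq (A v ord0 l) 0) => [->|Al].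
  by rewrite !mul0r !scale0r !mxE !mul0r subrr.
have [vt Aq _] := h; rewrite (@scoords_peq K _ _ D l i1 i2 j0 j1 q') //.
by rewrite !rVZ -!mulrA (VW _ _ _ h) subrr.
Qed.

Definition mask M (T : pred 'I_M) (v : 'rV[K]_M) : 'rV[K]_M :=
  \row_j (if T j then v ord0 j else 0).

Lemma maskE M (T : pred 'I_M) (v : 'rV[K]_M) j : T j -> mask T v ord0 j = v ord0 j.
Proof. by move=> Tj; rewrite mxE Tj. Qed.

Lemma mask_if M (T : pred 'I_M) (v : 'rV[K]_M) j :
  mask T v ord0 j = if T j then v ord0 j else 0.
Proof. by rewrite mxE. Qed.

Lemma polyv_mask n M (T : pred 'I_M) (v : pt K n -> 'rV[K]_M) :
  polyv v -> polyv (fun q => mask T (v q)).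
Proof.
move=> pv j; case Tj: (T j).
  by apply: ispoly_ext (pv j) => q; rewrite mxE Tj.
by apply: ispoly_ext (ispoly_c n 0) => q; rewrite mxE Tj.
Qed.

Lemma polyv_row_mx n M M' (v : pt K n -> 'rV[K]_M) (w : pt K n -> 'rV[K]_M') :
  polyv v -> polyv w -> polyv (fun q => row_mx (v q) (w q)).
Proof.
move=> pv pw k; rewrite -(splitK k); case: (fintype.split k) => j.
  by apply: ispoly_ext (pv j) => q; rewrite row_mxEl.
by apply: ispoly_ext (pw j) => q; rewrite row_mxEr.
Qed.

Lemma hvec_row_mx n M M' d (v : pt K n -> 'rV[K]_M) (w : pt K n -> 'rV[K]_M') :
  hvec d v -> hvec d w -> hvec d (fun q => row_mx (v q) (w q)).
Proof.
move=> pv pw k; rewrite -(splitK k); case: (fintype.split k) => j.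
  by apply: hpoly_ext (pv j) => q; rewrite row_mxEl.
by apply: hpoly_ext (pw j) => q; rewrite row_mxEr.
Qed.

Definition snd_idx H M (k : 'I_(H * M)) : 'I_M :=
  (enum_val (cast_ord (esym (mxvec_cast H M)) k)).2.

Lemma snd_idxE H M (b : 'I_H) (j : 'I_M) : snd_idx (mxvec_index b j) = j.
Proof. by rewrite /snd_idx /mxvec_index cast_ordK enum_rankK. Qed.

Lemma segreZl N M c (v : 'rV[K]_N) (w : 'rV[K]_M) : segre (c *: v) w = c *: segre v w.
Proof. by apply/rowP => k; case/mxvec_indexP: k => i j; rewrite segreE !rVZ segreE mulrA. Qed.

Lemma segreZr N M c (v : 'rV[K]_N) (w : 'rV[K]_M) : segre v (c *: w) = c *: segre v w.
Proof. by apply/rowP => k; case/mxvec_indexP: k => i j; rewrite segreE !rVZ segreE mulrCA. Qed.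

Lemma segreDr N M (v : 'rV[K]_N) (w w' : 'rV[K]_M) :
  segre v (w + w') = segre v w + segre v w'.
Proof. by apply/rowP => k; case/mxvec_indexP: k => i j; rewrite rVD !segreE rVD mulrDr. Qed.

Lemma segre0r N M (v : 'rV[K]_N) : segre v (0 : 'rV[K]_M) = 0.
Proof. by apply/rowP => k; case/mxvec_indexP: k => i j; rewrite segreE !mxE mulr0. Qed.

Lemma maskZ M (T : pred 'I_M) c (v : 'rV[K]_M) : mask T (c *: v) = c *: mask T v.
Proof. by apply/rowP => j; rewrite !mxE; case: (T j); rewrite ?mulr0. Qed.

Lemma maskD M (T : pred 'I_M) (v w : 'rV[K]_M) : mask T (v + w) = mask T v + mask T w.
Proof. by apply/rowP => j; rewrite !mxE; case: (T j); rewrite ?addr0. Qed.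

Lemma mask_eq0 M (T : pred 'I_M) (v : 'rV[K]_M) : (forall j, T j -> v ord0 j = 0) -> mask T v = 0.
Proof. by move=> h; apply/rowP => j; rewrite !mxE; case: (boolP (T j)) => // /h. Qed.

Section TheTransformation.
Variables (N M R H : nat) (A : pt K 3 -> 'rV[K]_N) (Phi : pt K 3 -> 'rV[K]_M).
Variables (g : pt K N -> 'rV[K]_R) (h : pt K N -> 'rV[K]_H) (T : pred 'I_M).
Variables (Dd : bool -> fdata K N M) (gam : {poly K}) (gh : bool -> pt K 2 -> 'rV[K]_R).
Variable O : set (pt K N).

(** The equation of the exceptional curve in its second ([true]) and first ([false]) chart. *)
Definition ecurve (d : bool) (q : pt K 2) : K := if d then k2 q - gam.[q.2] else k1 q.

Hypotheses (pA : polyv A) (pPhi : polyv Phi) (cS : affineS A Phi).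
Hypotheses (hg : hvec 1 g) (hh : hvec 1 h).
Hypothesis gA : forall u, g (A u, u.2) != 0.
Hypothesis hS : forall s, model A s -> h s != 0.
Hypothesis pDd : forall d, fpoly (Dd d).
Hypothesis cDd : forall d, fcompat A Phi (Dd d).
Hypothesis pgh : forall d, polyv (gh d).
Hypothesis ghE : forall d q, g (fE (Dd d) q, q.2) = ecurve d q *: gh d q.
Hypothesis gDd : forall d q, ecurve d q = 0 -> goodat T (Dd d) q.
Hypothesis rb : forall d q, ecurve d q = 0 -> exists r b,
  (forall q', gh d q' ord0 r = h (fE (Dd d) q', q'.2) ord0 b) /\
  h (fE (Dd d) q, q.2) ord0 b != 0.
Hypothesis Tz : forall d q j, T j -> fa (Dd d) q ord0 j = 0.
Hypothesis onC : forall s, model A s -> g s = 0 -> exists d q,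
  [/\ q.2 = s.2, ecurve d q = 0 & peq s.1 (fE (Dd d) q)].
Hypothesis ODd : forall d q, ecurve d q = 0 -> exists eta nu,
  [/\ ispoly eta, ispoly nu, nu q != 0 & forall q', nu q' != 0 ->
      fE (Dd d) q' != 0 /\ (O (fE (Dd d) q', q'.2) <-> eta q' != 0)].
Hypothesis cov : bcovered A Phi O.

(** It is used with a = g, vanishing on the curve e = 0, and b = h, of the same degree and nowhere
    zero. Since the mask of fa + xi fb is a multiple of xi, the entries cut out the section xi = 0
    over the curve. The same vector provides the forms of the blow-up and the fibre vector after the
    blow-down. *)
Definition etvec (a : 'rV[K]_R) (b : 'rV[K]_H) (v : 'rV[K]_M) : 'rV[K]_(R * M + H * M) :=
  row_mx (segre a v) (segre b (mask T v)).

Definition etPhi u := etvec (g (A u, u.2)) (h (A u, u.2)) (Phi u).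

Definition etlift (D : fdata K N M) : fdata K N (R * M + H * M) :=
  FData (fE D)
    (fun q => etvec (g (fE D q, q.2)) (h (fE D q, q.2)) (fa D q))
    (fun q => etvec (g (fE D q, q.2)) (h (fE D q, q.2)) (fb D q)).

(** This is [etvec] at fa + xi fb, divided by e and written in the coordinate xi / e. The mask of fa
    is zero, whence the zero block of the new [fa]. *)
Definition etchart d : fdata K N (R * M + H * M) :=
  FData (fE (Dd d))
    (fun q => row_mx (segre (gh d q) (fa (Dd d) q)) 0)
    (fun q => row_mx (ecurve d q *: segre (gh d q) (fb (Dd d) q))
       (segre (h (fE (Dd d) q, q.2)) (mask T (fb (Dd d) q)))).

(** The next set of indices at which [fa] vanishes: part of the masked block for charts along the
    curve. [etTlift] is its analogue for charts carried along away from the curve. *)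
Definition etT (k : 'I_(R * M + H * M)) : bool :=
  if fintype.split k is inr m then T (snd_idx m) else false.
Definition etTlift (T' : pred 'I_M) (k : 'I_(R * M + H * M)) : bool :=
  if fintype.split k is inl m then T' (snd_idx m) else false.

Lemma etT_r b j : etT (rshift (R * M) (mxvec_index b j)) = T j.
Proof. by rewrite /etT (unsplitK (inr _)) snd_idxE. Qed.

Lemma etTlift_l T' r j : etTlift T' (lshift (H * M) (mxvec_index r j)) = T' j.
Proof. by rewrite /etTlift (unsplitK (inl _)) snd_idxE. Qed.

Lemma etvec_l a b v r j :
  etvec a b v ord0 (lshift (H * M) (mxvec_index r j)) = a ord0 r * v ord0 j.
Proof. by rewrite /etvec row_mxEl segreE. Qed.

Lemma etvec_r a b v k j :
  etvec a b v ord0 (rshift (R * M) (mxvec_index k j)) = b ord0 k * mask T v ord0 j.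
Proof. by rewrite /etvec row_mxEr segreE. Qed.

Lemma etvecZ a b v c : etvec a b (c *: v) = c *: etvec a b v.
Proof. by rewrite /etvec maskZ !segreZr scale_row_mx. Qed.

Lemma etvecZl a b v c : etvec (c *: a) (c *: b) v = c *: etvec a b v.
Proof. by rewrite /etvec !segreZl scale_row_mx. Qed.

Lemma etvecD a b v w : etvec a b (v + w) = etvec a b v + etvec a b w.
Proof. by rewrite /etvec maskD !segreDr add_row_mx. Qed.

Lemma polyv_etvec n (a : pt K n -> 'rV[K]_R) (b : pt K n -> 'rV[K]_H) v :
  polyv a -> polyv b -> polyv v -> polyv (fun q => etvec (a q) (b q) (v q)).
Proof.
move=> pa pb pv; apply: polyv_row_mx; apply: polyv_tens => //.
exact: polyv_mask.
Qed.

Lemma polyv_gh n L (f : pt K N -> 'rV[K]_L) (B : pt K n -> 'rV[K]_N) :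
  hvec 1 f -> polyv B -> polyv (fun u => f (B u, u.2)).
Proof. by move=> hf pB; apply: polyv_comp pB; apply: hvec_polyv hf. Qed.

Lemma polyv_etPhi : polyv etPhi.
Proof. by apply: polyv_etvec => //; apply: polyv_gh. Qed.

Lemma affineS_et : affineS A etPhi.
Proof.
move=> u; have [l [iy [iz [j [jx [h1 h2 Al Pj]]]]]] := cS u.
have [r gr] := rV_neq0P (gA u).
exists l, iy, iz, (lshift _ (mxvec_index r j)), (lshift _ (mxvec_index r jx)).
split=> //; last by rewrite /etPhi etvec_l mulf_neq0.
by move=> u'; rewrite /etPhi !etvec_l h2 mulrCA.
Qed.

Lemma etPhi_neq0 u : etPhi u != 0.
Proof. exact: (affineS_neq0 affineS_et).2. Qed.

Lemma fpoly_etlift D : fpoly D -> fpoly (etlift D).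
Proof. by move=> [pE pa pb]; split=> //=; apply: polyv_etvec => //; apply: polyv_gh. Qed.

Lemma ispoly_ecurve d : ispoly (ecurve d).
Proof. by case: d; [apply: ispoly_k2gam|apply: ispoly_k1]. Qed.

Lemma fpoly_etchart d : fpoly (etchart d).
Proof.
have [pE pa pb] := pDd d; split=> //=.
  by apply: polyv_row_mx; [exact: polyv_tens|move=> i; apply: ispoly_ext (ispoly_c _ 0) => q; rewrite mxE].
apply: polyv_row_mx.
  by apply: polyvZ; [exact: ispoly_ecurve|exact: polyv_tens].
by apply: polyv_tens; [exact: polyv_gh|exact: polyv_mask].
Qed.

Lemma peq_of_scale L (v w : 'rV[K]_L) c : v != 0 -> v = c *: w -> peq v w.
Proof.
move=> v0 e; have c0 : c != 0 by apply: contra_neq v0 => c0; rewrite e c0 scale0r.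
have w0 : w != 0 by apply: contra_neq v0 => w0; rewrite e w0 scaler0.
by rewrite e; apply/peq_sym/peqZ.
Qed.

Lemma fcor_etlift D u q xi : fcor A Phi D u q xi -> fcor A etPhi (etlift D) u q xi.
Proof.
move=> [ut Aq Pq]; split=> //=.
have /peqP[_ [c c0 eA]] := peq_sym Aq; have /peqP[_ [c' c'0 eP]] := peq_sym Pq.
apply: (@peq_of_scale _ _ _ (c' * c)); first exact: etPhi_neq0.
rewrite /etPhi eA eP ut (hvec_scale _ _ _ hg) (hvec_scale _ _ _ hh) expr1.
by rewrite etvecZ etvecZl scalerA etvecD etvecZ.
Qed.

Lemma fcompat_etlift D : fcompat A Phi D -> fcompat A etPhi (etlift D).
Proof.
move=> [[w [pw nw wP]] [d [pd nd dP]]]; split.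
  exists w; split=> // u /wP[q [xi hc]]; exists q, xi; exact: fcor_etlift.
by exists d; split=> // q xi /(dP _ xi)[u hc]; exists u; apply: fcor_etlift.
Qed.

Lemma ecurve_neq0 d u q : u.2 = q.2 -> peq (A u) (fE (Dd d) q) -> ecurve d q != 0.
Proof.
move=> ut /peq_sym/peqP[_ [c c0 eA]]; apply: contra_neq (gA u) => e0.
by rewrite eA ut (hvec_scale _ _ _ hg) ghE e0 scale0r scaler0.
Qed.

(* The fibre coordinate is divided by the equation of the curve. *)
Lemma fcor_etchart d u q xi : fcor A Phi (Dd d) u q xi ->
  fcor A etPhi (etchart d) u q (xi / ecurve d q).
Proof.
move=> [ut Aq Pq]; have e0 := ecurve_neq0 ut Aq; split=> //=.
have /peqP[_ [c c0 eA]] := peq_sym Aq; have /peqP[_ [c' c'0 eP]] := peq_sym Pq.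
apply: (@peq_of_scale _ _ _ (c' * c * ecurve d q)); first exact: etPhi_neq0.
rewrite /etPhi eA eP ut (hvec_scale _ _ _ hg) (hvec_scale _ _ _ hh) expr1 ghE.
rewrite etvecZ etvecZl scalerA -[RHS]scalerA; congr (_ *: _).
rewrite /etvec maskD maskZ (mask_eq0 (fun j => @Tz d q j)) add0r segreZl.
rewrite scale_row_mx add_row_mx scale_row_mx add0r; congr row_mx.
  by rewrite segreDr segreZr scalerA divfK.
by rewrite segreZr scalerA mulrCA divff // mulr1.
Qed.

Lemma fcompat_etchart d : fcompat A etPhi (etchart d).
Proof.
have [[w [pw nw wP]] [e [pe ne eP]]] := cDd d; split.
  by exists w; split=> // u /wP[q [xi hc]]; exists q, (xi / ecurve d q); apply: fcor_etchart.
exists e; split=> // q xi /(eP _ (xi * ecurve d q))[u hc]; exists u.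
have e0 : ecurve d q != 0 by have [ut Aq _] := hc; apply: ecurve_neq0 ut Aq.
by have := fcor_etchart hc; rewrite mulfK.
Qed.

Lemma goodat_etlift D (T' : pred 'I_M) q :
  goodat T' D q -> g (fE D q, q.2) != 0 -> goodat (etTlift T') (etlift D) q.
Proof.
move=> [l [i1 [i2 [j0 [j1 [[std1 std2] Tj El aj]]]]]] /rV_neq0P[r gr].
exists l, i1, i2, (lshift _ (mxvec_index r j0)), (lshift _ (mxvec_index r j1)).
split=> //; [|by rewrite etTlift_l|by rewrite /= etvec_l mulf_neq0].
split=> // q'; have [e1 e2 e3] := std2 q'.
by rewrite /= !etvec_l e1 e2 e3 !mulr0.
Qed.

(** The transformation multiplies fa_{j0} by gh_r and fb_{j1} by h_b; the equality of these entries,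
    provided by [rb], preserves the normalization. *)
Lemma fstd_etchart d l i1 i2 j0 j1 r b : fstd (Dd d) l i1 i2 j0 j1 -> T j1 ->
  (forall q', gh d q' ord0 r = h (fE (Dd d) q', q'.2) ord0 b) ->
  fstd (etchart d) l i1 i2 (lshift _ (mxvec_index r j0)) (rshift _ (mxvec_index b j1)).
Proof.
move=> [std1 std2] Tj e; split=> // q; have [e1 e2 e3] := std2 q.
rewrite /= !row_mxEl !row_mxEr !rVZ !segreE maskE // e1 e3 e mxE !mulr0.
by split.
Qed.

Lemma goodat_etchart d q : ecurve d q = 0 -> goodat etT (etchart d) q.
Proof.
move=> e0; have [l [i1 [i2 [j0 [j1 [std Tj El aj]]]]]] := gDd e0.
have [r [b [e hb]]] := rb e0.
do 5!eexists; split; [exact: (fstd_etchart std Tj e)|by rewrite etT_r|exact: El|].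
by rewrite /= row_mxEl segreE e mulf_neq0.
Qed.

Lemma etchart_zero d q j : etT j -> fa (etchart d) q ord0 j = 0.
Proof.
rewrite /etT -{2}(splitK j); case: (fintype.split j) => //= m _.
by rewrite row_mxEr mxE.
Qed.

Lemma etlift_zero D (T' : pred 'I_M) q k :
  (forall j, T' j -> fa D q ord0 j = 0) -> etTlift T' k -> fa (etlift D) q ord0 k = 0.
Proof.
move=> hT; rewrite /etTlift -{2}(splitK k); case: (fintype.split k) => //= m.
by case/mxvec_indexP: m => r j; rewrite snd_idxE => /hT e; rewrite etvec_l e mulr0.
Qed.

Lemma bcovered_et : bcovered A etPhi O.
Proof.
move=> s ms; case: (eqVneq (g s) 0) => [gs0|gs0].
  have [d [q [qt e0 sq]]] := onC ms gs0.
  have [eta [nu h3]] := ODd e0.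
  exists (etchart d), q, eta, nu; split=> //; split=> //.
  - exact: fpoly_etchart.
  - exact: fcompat_etchart.
  - have [l [i1 [i2 [j0 [j1 [h1 h2 h4 h5]]]]]] := goodat_etchart e0.
    by exists l, i1, i2, j0, j1.
have [D [q [eta [nu [[pD cD qt sq gq] h3]]]]] := cov ms.
exists (etlift D), q, eta, nu; split=> //; split=> //.
- exact: fpoly_etlift.
- exact: fcompat_etlift.
- have gq0 : g (fE D q, q.2) != 0.
    have /peqP[_ [c c0 ->]] := sq.
    by rewrite qt (hvec_scale _ _ _ hg) -surjective_pairing scaler_eq0 negb_or expf_neq0.
  have [l [i1 [i2 [j0 [j1 [h1 h2 h4 h5]]]]]] := goodat_etlift gq gq0.
  by exists l, i1, i2, j0, j1.
Qed.

(** The curve is a Cartier divisor of the surface: near it, g divided by the equation is [gh], which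
    is nonzero on the curve. So the rational map given by g extends regularly. *)
Lemma resolves_g : resolves A (fun u => g (A u, u.2)).
Proof.
move=> s ms; case: (eqVneq (g s) 0) => [gs0|gs0].
  have [d [q [qt e0 sq]]] := onC ms gs0.
  have [l [i1 [i2 [j0 [j1 [std Tj El aj]]]]]] := gDd e0.
  have [r [b [e hb]]] := rb e0.
  apply: (resolves_chart (V := gh d) pA _ (cDd d) std _ _ qt sq El) => //.
  - exact: polyv_gh.
  - move=> u q' xi [ut /peq_sym/peqP[_ [c c0 ->]] _].
    rewrite ut (hvec_scale _ _ _ hg) ghE.
    by do 2!apply: paraZ; apply: para_refl.
  - by apply: (@rV_neq0 _ _ _ r); rewrite e.
by exists g => //; split; [exists 1%N|move=> u; apply: para_refl].
Qed.

(** [B] is the bundle before the transformation, [B'] the one after it, and [BL] the common blow-up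
    of both. *)
Let B := tens A Phi.
Let BL := tens B etPhi.
Let B' := tens A etPhi.

Lemma et_I3 : (inord 0 == inord 1 :> 'I_3) = false /\ (inord 0 == inord 2 :> 'I_3) = false /\
    (inord 1 == inord 2 :> 'I_3) = false /\ (inord 2 == inord 1 :> 'I_3) = false /\
    (inord 1 == inord 0 :> 'I_3) = false /\ (inord 2 == inord 0 :> 'I_3) = false.
Proof. by do !split; apply/eqP => /(congr1 val); rewrite /= !inordK. Qed.

(* Both projections of the intermediate space blow up a section of the ruled
   3-fold over the curve. *)
Lemma et_center N' L (C : pt K 3 -> 'rV[K]_N') (P : pt K 3 -> 'rV[K]_N')
    (F : pt K N' -> 'rV[K]_L) d q0 (U : pt K 3 -> K) m0 m1 :
  (forall q, xc q = 0 -> ecurve d (base q) = 0 -> F (P q, q.2) = 0) ->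
  (forall q, F (P q, q.2) ord0 m0 = xc q * U q) ->
  (forall q, F (P q, q.2) ord0 m1 = ecurve d (base q) * U q) ->
  ispoly U -> U q0 != 0 -> center_at C P F q0.
Proof.
move=> h0 h1 h2 pU U0; have [I01 [I02 [I12 [I21 [I10 I20]]]]] := et_I3.
pose gm (a : 'I_3) : {poly K} := if a == inord 2 then gam else 0.
exists [set (if d then inord 1 else inord 2)]%SET, gm, (fun=> U),
  (fun a => if a == inord 0 then m0 else m1); split=> //.
- move=> q hq; have x0 : xc q = 0.
    by rewrite /xc hq ?inE /gm ?I02 ?horner0 //; case: (d); rewrite ?I01 ?I02.
  apply: h0 => //; rewrite /ecurve; case: (d) hq => hq.
    by rewrite row2_k2 /zc hq ?inE ?I21 // /gm eqxx subrr.
  by rewrite row2_k1 /yc hq ?inE ?I12 // /gm I12 horner0.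
- move=> q; apply: forall_I3; rewrite inE /gm ?eqxx ?I02 ?I12 ?I10 ?I20.
  + by rewrite h1 horner0 subr0.
  + case: (d) h2 => h2 /=; first by rewrite eqxx.
    by rewrite I12 h2 /ecurve row2_k1 horner0 subr0.
  + case: (d) h2 => h2 /=; last by rewrite eqxx.
    by rewrite I21 h2 /ecurve row2_k2.
Qed.

(** Vanishing of the forms forces g = 0, hence a point over the curve, and a zero masked vector,
    hence w_{j1} = 0. So only the finite chart meets the centre, and there the centre is e = xi =
    0. *)
Lemma modification_et_up : modification B -> modification BL.
Proof.
have pB : polyv B := polyv_tens pA pPhi; have pBL : polyv BL := polyv_tens pB polyv_etPhi.
have cB : affine_chart B := affineS_chart cS.
have B0 u : B u != 0 by apply: affine_chart_neq0.
have BL0 u : BL u != 0 by rewrite /BL /tens segre_neq0 B0 etPhi_neq0.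
have cBL : affine_chart BL.
  move=> u; have [l [idx [sB Bl]]] := cB u; have [k Pk] := rV_neq0P (etPhi_neq0 u).
  exists (mxvec_index l k), (fun a => mxvec_index (idx a) k); split.
    by move=> q a; rewrite /BL /tens !segreE sB mulrA.
  by rewrite /BL /tens segreE mulf_neq0.
pose F (p : pt K (N * M)) : 'rV[K]_(R * M + H * M) :=
  row_mx (colmap g p) (mask (fun k => T (snd_idx k)) (colmap h p)).
have FE s w t : F (segre s w, t) = etvec (g (s, t)) (h (s, t)) w.
  rewrite /F !colmap_segre // /etvec; congr row_mx.
  apply/rowP => k; case/mxvec_indexP: k => b j; rewrite mxE snd_idxE !segreE mxE.
  by case: (T j); rewrite ?mulr0.
have hF : hvec 1 F.
  apply: hvec_row_mx; first exact: hvec_colmap.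
  move=> k; case Tk: (T (snd_idx k)).
    by apply: hpoly_ext (hvec_colmap (M := M) hh k) => q; rewrite mxE Tk.
  by apply: hpoly_ext (hpoly0 K _ 1) => q; rewrite mxE Tk.
have FB u : F (B u, u.2) = etPhi u by rewrite FE.
have FBf : (fun u => F (B u, u.2)) = etPhi by apply/funext.
have r1 : resolves BL B by apply: resolves_tensl.
have [b hb] := res_mapP B0 r1.
move=> hm; apply: (modification_blowup pBL cB cBL r1 hb) => //.
apply: (@is_blowup_model K 3 _ _ _ B F pB B0 hF) => //; rewrite ?FBf; try exact: resolves_id.
- by move=> u; rewrite FB etPhi_neq0.
- exact: (bcovered_xcharts pA pPhi cov).
move=> p mp Fp; have [s [w [ep ms mw]]] := model_tens mp.
have [s0 w0] := (model_neq0 ms, model_neq0 mw).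
have : etvec (g (s, p.2)) (h (s, p.2)) w = row_mx 0 0.
  by rewrite row_mx0 -FE -ep -surjective_pairing Fp.
move=> /eq_row_mx[/eqP gw /eqP hw].
have gs0 : g (s, p.2) = 0.
  by apply: contraTeq gw => gs; rewrite segre_neq0 gs w0.
have mw0 : mask T w = 0.
  by apply: contraTeq hw => m0; rewrite segre_neq0 m0 andbT; apply: hS ms.
have [d [q [qt e0 sq]]] := onC ms gs0.
have [l [i1 [i2 [j0 [j1 [std Tj El aj]]]]]] := gDd e0.
have [r [bb [e hbb]]] := rb e0; have [pE pa pb] := pDd d.
have wj1 : w ord0 j1 = 0 by rewrite -(maskE w Tj) mw0 mxE.
have [std1 std2] := std.
case: (bundle_charts pA pPhi (pDd d) (cDd d) std mp ep sq qt El aj) => -[wj hx];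
  last by rewrite wj1 eqxx in wj.
do 4!eexists; split; first exact: hx.
apply: (@et_center _ _ B _ F d _
  (fun q => h (fE (Dd d) (base q), q.2) ord0 bb * fa (Dd d) (base q) ord0 j0)
  (rshift _ (mxvec_index bb j1)) (lshift _ (mxvec_index r j0))).
- move=> q' x0 e0'; rewrite /xfin FE x0 scale0r addr0 -[q'.2]/((base q').2) ghE e0' scale0r.
  rewrite /etvec (mask_eq0 (fun j => @Tz d _ j)) segre0r.
  rewrite (_ : segre 0 _ = 0) ?row_mx0 //.
  by rewrite -[X in segre X _](scale0r (0 : 'rV[K]_R)) segreZl scale0r.
- move=> q'; have [h1 h2 h3] := std2 (base q').
  by rewrite /xfin FE etvec_r maskE // rVD rVZ h1 h2 add0r /=; ring.
- move=> q'; have [h1 h2 h3] := std2 (base q').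
  rewrite /xfin FE etvec_l rVD rVZ h3 mulr0 addr0 -[q'.2]/((base q').2) ghE rVZ e.
  by rewrite mulrA.
- apply: ispolyM; last exact: (ispoly_base (pa j0)).
  apply: (ispoly_base (f := fun q => h (fE (Dd d) q, q.2) ord0 bb)).
  exact: (polyv_gh hh pE bb).
- by rewrite base_over -[(over _ _).2]/(q.2) mulf_neq0.
Qed.

(** The first block of the fibre vector. Over the curve it vanishes exactly at infinity of the new
    fibre, so it provides the forms that exhibit [BL] as a blow-up of [B']. *)
Definition leftcols (p : pt K (N * (R * M + H * M))) : 'rV[K]_(N * (R * M)) :=
  mxvec (\matrix_(i < N, k < R * M) p.1 ord0 (mxvec_index i (lshift (H * M) k))).

Lemma leftcolsE s w t : leftcols (segre s w, t) = segre s (lsubmx w).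
Proof.
apply/rowP => k; case/mxvec_indexP: k => i k.
by rewrite mxvecE mxE !segreE mxE.
Qed.

Lemma hvec_leftcols : hvec 1 leftcols.
Proof.
move=> k; case/mxvec_indexP: k => i k.
apply: (hpoly_ext _ (hpoly_x K (mxvec_index i (lshift (H * M) k)))) => p.
by rewrite mxvecE mxE.
Qed.

(** Both blocks carry the same vector, weighted by g and by h. The resulting closed relation shows
    that off the curve a vanishing first block would annihilate the second one as well. *)
Lemma et_relation p s w r k j : model B' p -> p.1 = segre s w ->
  g (s, p.2) ord0 r * w ord0 (rshift (R * M) (mxvec_index k j)) =
  if T j then h (s, p.2) ord0 k * w ord0 (lshift (H * M) (mxvec_index r j)) else 0.
Proof.
move=> mp ep; have w0 : w != 0.
  by move: (model_neq0 mp); rewrite ep segre_neq0 => /andP[].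
have s0 : s != 0 by move: (model_neq0 mp); rewrite ep segre_neq0 => /andP[].
have [m wm] := rV_neq0P w0; have [i si] := rV_neq0P s0.
pose Gf (p : pt K (N * (R * M + H * M))) :=
  g (colv m p.1, p.2) ord0 r * rowv i p.1 ord0 (rshift (R * M) (mxvec_index k j)) -
  (if T j then h (colv m p.1, p.2) ord0 k *
     rowv i p.1 ord0 (lshift (H * M) (mxvec_index r j)) else 0).
have hc L (f : pt K N -> 'rV[K]_L) x : hvec 1 f -> hpoly (1 * 1)
    (fun p : pt K (N * (R * M + H * M)) => f (colv m p.1, p.2) ord0 x).
  by move=> hf; exact: (hpoly_comp (hf x) (@hvec_colv K N _ m)).
have hr x := @hvec_rowv K N (R * M + H * M) i x.
have hG : hpoly (1 * 1 + 1) Gf.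
  apply: hpolyB; first exact: (hpolyM (hc _ _ r hg) (hr _)).
  case: (T j); last exact: hpoly0.
  exact: (hpolyM (hc _ _ k hh) (hr _)).
have := model_vanish hG _ mp; rewrite /Gf ep rowv_segre colv_segre.
rewrite (hvec_scale _ _ _ hg) (hvec_scale _ _ _ hh) !rVZ => e.
have wsi : w ord0 m * s ord0 i != 0 by rewrite mulf_neq0.
apply: (mulfI wsi); apply/eqP; rewrite -subr_eq0; apply/eqP.
rewrite -[RHS]e; first by case: (T j); ring.
move=> u; rewrite /= /B' /tens rowv_segre colv_segre.
rewrite (hvec_scale _ _ _ hg) (hvec_scale _ _ _ hh) !rVZ /etPhi etvec_l etvec_r mask_if.
by case: (T j); ring.
Qed.

(** Both [BL] and the graph of [leftcols] over [B'] determine A, Phi and etPhi. The vector g enters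
    the latter, and [resolves_g] recovers it from [A]. *)
Lemma modification_et_down : modification BL -> modification B'.
Proof.
have pB : polyv B := polyv_tens pA pPhi; have pBL : polyv BL := polyv_tens pB polyv_etPhi.
have pB' : polyv B' := polyv_tens pA polyv_etPhi.
have cB : affine_chart B := affineS_chart cS.
have cB' : affine_chart B' := affineS_chart affineS_et.
have B0 u : B u != 0 by apply: affine_chart_neq0.
have B'0 u : B' u != 0 by apply: affine_chart_neq0.
have BL0 u : BL u != 0 by rewrite /BL /tens segre_neq0 B0 etPhi_neq0.
have cBL : affine_chart BL.
  move=> u; have [l [idx [sB Bl]]] := cB u; have [k Pk] := rV_neq0P (etPhi_neq0 u).
  exists (mxvec_index l k), (fun a => mxvec_index (idx a) k); split.
    by move=> q a; rewrite /BL /tens !segreE sB mulrA.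
  by rewrite /BL /tens segreE mulf_neq0.
have A0 u : A u != 0 by apply: (affineS_neq0 cS).1.
have Phi0 u : Phi u != 0 by apply: (affineS_neq0 cS).2.
pose Gt := tens A (tens (fun u => g (A u, u.2)) Phi).
have FBf : (fun u => leftcols (B' u, u.2)) = Gt.
  by apply/funext => u; rewrite leftcolsE /etPhi /etvec row_mxKl.
have FB0 u : leftcols (B' u, u.2) != 0.
  by rewrite leftcolsE /etPhi /etvec row_mxKl !segre_neq0 A0 gA Phi0.
have rA : resolves BL A.
  by apply: (resolves_trans B0) (@resolves_tensl _ _ _ _ _ _) _; apply: resolves_tensl.
have rPhi : resolves BL Phi.
  by apply: (resolves_trans B0) (@resolves_tensl _ _ _ _ _ _) _; apply: resolves_tensr.
have rEt : resolves BL etPhi by apply: resolves_tensr.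
have rg : resolves BL (fun u => g (A u, u.2)) by apply: (resolves_trans A0 rA resolves_g).
have rB' : resolves BL B' by apply: resolves_pair.
have Gt0 u : Gt u != 0 by rewrite -FBf.
have rGA : resolves (tens B' Gt) A.
  by apply: (resolves_trans B'0) (@resolves_tensl _ _ _ _ _ _) _; apply: resolves_tensl.
have rGE : resolves (tens B' Gt) etPhi.
  by apply: (resolves_trans B'0) (@resolves_tensl _ _ _ _ _ _) _; apply: resolves_tensr.
have rGP : resolves (tens B' Gt) Phi.
  apply: (resolves_trans Gt0) (@resolves_tensr _ _ _ _ _ _) _.
  apply: (@resolves_trans _ _ _ _ _ _ (tens (fun u => g (A u, u.2)) Phi)).
  - by move=> u; rewrite /tens segre_neq0 gA Phi0.
  - exact: resolves_tensr.
  - exact: resolves_tensr.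
have [b hb] := res_mapP B'0 rB'.
move=> hm; apply: (modification_blowdown pBL pB' cBL cB' rB' hb) => //.
apply: (@is_blowup_model K 3 _ _ _ B' leftcols pB' B'0 hvec_leftcols) => //.
- exact: (bcovered_xcharts pA polyv_etPhi bcovered_et).
- move=> p mp Fp; have [s [w [ep ms mw]]] := model_tens mp.
  have [s0 w0] := (model_neq0 ms, model_neq0 mw).
  have lw0 : lsubmx w = 0.
    move/eqP: Fp; rewrite [p]surjective_pairing ep leftcolsE.
    by apply: contraTeq => lw; rewrite segre_neq0 s0 lw.
  have lwE k : w ord0 (lshift (H * M) k) = 0.
    by have := congr1 (fun v : 'rV_(R * M) => v ord0 k) lw0; rewrite /= !mxE.
  have gs0 : g (s, p.2) = 0.
    apply/eqP/negPn/negP => /rV_neq0P[r gr]; case/eqP: w0; apply/rowP => k.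
    rewrite -(splitK k); case: (fintype.split k) => m /=; first by rewrite lwE mxE.
    case/mxvec_indexP: m => k' j; apply: (mulfI gr); rewrite (et_relation _ _ _ mp ep) mxE.
    by rewrite lwE !mulr0 if_same.
  have [d [q [qt e0 sq]]] := onC ms gs0.
  have [l [i1 [i2 [j0 [j1 [std Tj El aj]]]]]] := gDd e0.
  have [r [bb [e hbb]]] := rb e0; have [pE pa pb] := pDd d.
  have std' := fstd_etchart std Tj e; have [std1 std2] := std.
  have aj' : fa (etchart d) q ord0 (lshift _ (mxvec_index r j0)) != 0.
    by rewrite /= row_mxEl segreE e mulf_neq0.
  case: (bundle_charts pA polyv_etPhi (fpoly_etchart d) (fcompat_etchart d) std' mp ep sq qt
    El aj') => -[wj hx]; first by rewrite lwE eqxx in wj.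
  do 4!eexists; split; first exact: hx.
  apply: (@et_center _ _ B' _ leftcols d _
    (fun q => fE (Dd d) (base q) ord0 l * (gh d (base q) ord0 r * fa (Dd d) (base q) ord0 j0))
    (mxvec_index l (mxvec_index r j0)) (mxvec_index l (mxvec_index r j1))).
  + move=> q' x0 e0'; rewrite /xinf leftcolsE x0 scale0r add0r /= e0' scale0r row_mxKl.
    exact: segre0r.
  + move=> q'; have [h1 h2 h3] := std2 (base q').
    rewrite /xinf leftcolsE segreE mxE rVD rVZ /= !row_mxEl rVZ !segreE h3 !mulr0 addr0.
    by ring.
  + move=> q'; have [h1 h2 h3] := std2 (base q').
    rewrite /xinf leftcolsE segreE mxE rVD rVZ /= !row_mxEl rVZ !segreE h2 h1 !mulr0 add0r.
    by ring.
  + apply: ispolyM; first exact: (ispoly_base (pE l)).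
    by apply: ispolyM; [exact: (ispoly_base (pgh d r))|exact: (ispoly_base (pa j0))].
  + by rewrite base_over e !mulf_neq0.
- by rewrite FBf; do !apply: resolves_pair.
- by rewrite FBf; do !apply: resolves_pair.
Qed.

Lemma modification_et : modification (tens A Phi) -> modification (tens A etPhi).
Proof. by move=> hm; apply/modification_et_down/modification_et_up. Qed.

End TheTransformation.

End Elementary.

(** * Invariants carried along a tower of modifications *)

Section Towers.
Variable K : numClosedFieldType.

Definition sstate N M (A : pt K 3 -> 'rV[K]_N) (Phi : pt K 3 -> 'rV[K]_M)
    (O : set (pt K N)) : Prop :=
  [/\ polyv A, polyv Phi, affineS A Phi, bcovered A Phi O & modification (tens A Phi)] /\
  [/\ forall v w t, peq v w -> O (v, t) -> O (w, t), forall v t, O (v, t) -> v != 0 &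
      forall u, O (A u, u.2)].

(* A chart of [model A] given by the birational map [chi] on [dom], with fibre
   coordinate [xi], and meeting [O] outside [k1 = 0] only. *)
Definition schart N M (A : pt K 3 -> 'rV[K]_N) (Phi : pt K 3 -> 'rV[K]_M)
    (O : set (pt K N)) (D : fdata K N M) (T : pred 'I_M) (dom : set (pt K 3))
    (chi : pt K 3 -> pt K 2) (xi : pt K 3 -> K) : Prop :=
  [/\ fpoly D, forall q j, T j -> fa D q ord0 j = 0 &
      forall q, O (fE D q, q.2) <-> k1 q != 0] /\
  [/\ exists w, [/\ ispoly w, exists u, w u != 0 & forall u, w u != 0 -> dom u],
      forall u, dom u -> fcor A Phi D u (chi u) (xi u) &
      forall q x, k1 q != 0 -> exists u, [/\ dom u, chi u = q & xi u = x]].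

Lemma schart_compat N M (A : pt K 3 -> 'rV[K]_N) (Phi : pt K 3 -> 'rV[K]_M) O
    (D : fdata K N M) T dom chi xi :
  schart A Phi O D T dom chi xi -> fcompat A Phi D.
Proof.
move=> [_ [[w [pw nw wP]] hf hs]]; split.
  by exists w; split=> // u /wP du; exists (chi u), (xi u); apply: hf.
exists (@k1 K); split; first exact: ispoly_k1.
  by move=> t; exists (row2 1 0, t) => //; rewrite row2_k1 oner_neq0.
by move=> q x /(hs q x)[u [du <- <-]]; exists u; apply: hf.
Qed.

Lemma schart_offbd N M (A : pt K 3 -> 'rV[K]_N) (Phi : pt K 3 -> 'rV[K]_M) O
    (D : fdata K N M) T dom chi xi :
  sstate A Phi O -> schart A Phi O D T dom chi xi ->
  forall u q, u.2 = q.2 -> peq (A u) (fE D q) -> k1 q != 0.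
Proof.
move=> [_ [Op _ OA]] [[_ _ OD] _] u q ut e; apply/OD.
by rewrite -ut; apply: Op e _.
Qed.

Lemma goodat_predT N M (D : fdata K N M) T q : goodat T D q -> goodat predT D q.
Proof.
by move=> [l [i1 [i2 [j0 [j1 [h1 h2 h3 h4]]]]]]; exists l, i1, i2, j0, j1.
Qed.

(** How the charts belonging to other chains survive a step: they keep their coordinates, the
    vanishing of [fa] on the index set and their trace on O, and outside [bad] also their good
    frames. The last clause lets a coincidence of points be traced back to the earlier surface. *)
Definition transform N M N' M' (A : pt K 3 -> 'rV[K]_N) (Phi : pt K 3 -> 'rV[K]_M)
    (O : set (pt K N)) (A' : pt K 3 -> 'rV[K]_N') (Phi' : pt K 3 -> 'rV[K]_M')
    (O' : set (pt K N')) (L : fdata K N M -> fdata K N' M')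
    (Tm : pred 'I_M -> pred 'I_M') (bad : pt K N -> Prop) : Prop :=
  [/\ forall D, fpoly D -> fpoly (L D),
      forall D u q x, fcor A Phi D u q x -> fcor A' Phi' (L D) u q x,
      forall D (T : pred 'I_M) q, goodat T D q -> ~ bad (fE D q, q.2) -> goodat (Tm T) (L D) q &
      forall D (T : pred 'I_M), (forall q j, T j -> fa D q ord0 j = 0) ->
        forall q j, Tm T j -> fa (L D) q ord0 j = 0] /\
  (forall D q, O' (fE (L D) q, q.2) <-> O (fE D q, q.2)) /\
  (forall D1 D2 q1 q2, q1.2 = q2.2 -> peq (fE (L D1) q1) (fE (L D2) q2) ->
     peq (fE D1 q1) (fE D2 q2)).

Lemma schart_transform N M N' M' (A : pt K 3 -> 'rV[K]_N) (Phi : pt K 3 -> 'rV[K]_M)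
    O (A' : pt K 3 -> 'rV[K]_N') (Phi' : pt K 3 -> 'rV[K]_M') O' L Tm bad D T dom chi xi :
  transform A Phi O A' Phi' O' L Tm bad ->
  schart A Phi O D T dom chi xi -> schart A' Phi' O' (L D) (Tm T) dom chi xi.
Proof.
move=> [[t1 t2 _ t4] [t5 _]] [[pD Tz OD] [hw hf hs]]; split; split=> //.
- exact: t1.
- exact: t4.
- by move=> q; rewrite t5.
- by move=> u du; apply/t2/hf.
Qed.

Lemma transform_comp N1 M1 N2 M2 N3 M3
    (A1 : pt K 3 -> 'rV[K]_N1) (Phi1 : pt K 3 -> 'rV[K]_M1) O1
    (A2 : pt K 3 -> 'rV[K]_N2) (Phi2 : pt K 3 -> 'rV[K]_M2) O2
    (A3 : pt K 3 -> 'rV[K]_N3) (Phi3 : pt K 3 -> 'rV[K]_M3) O3 L Tm bad L' Tm' bad' :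
  transform A1 Phi1 O1 A2 Phi2 O2 L Tm bad ->
  transform A2 Phi2 O2 A3 Phi3 O3 L' Tm' bad' ->
  (forall D q, ~ bad (fE D q, q.2) -> ~ bad' (fE (L D) q, q.2)) ->
  transform A1 Phi1 O1 A3 Phi3 O3 (fun D => L' (L D)) (fun T => Tm' (Tm T)) bad.
Proof.
move=> [[a1 a2 a3 a4] [a5 a6]] [[b1 b2 b3 b4] [b5 b6]] hb; split; [split|split].
- by move=> D /a1/b1.
- by move=> D u q x /a2/b2.
- by move=> D T q gq nb; apply: b3; [exact: a3|exact: hb].
- by move=> D T /a4/b4.
- by move=> D q; rewrite b5 a5.
- by move=> D1 D2 q1 q2 e /(b6 _ _ _ _ e)/(a6 _ _ _ _ e).
Qed.

Definition blowup_coords (gam : {poly K}) (q : pt K 2) : pt K 2 :=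
  (row2 (k1 q) ((k2 q - gam.[q.2]) / k1 q), q.2).

Section OneBlowup.
Variables (N M : nat) (A : pt K 3 -> 'rV[K]_N) (Phi : pt K 3 -> 'rV[K]_M).
Variables (O : set (pt K N)) (D : fdata K N M) (T : pred 'I_M).
Variables (dom : set (pt K 3)) (chi : pt K 3 -> pt K 2) (xi : pt K 3 -> K).
Variable gam : {poly K}.
Hypothesis hst : sstate A Phi O.
Hypothesis hch : schart A Phi O D T dom chi xi.
Hypothesis gD : forall t, goodat T D (row2 0 gam.[t], t).

Let A' := blownup A D gam.
Let O' := blownup_set O.

Lemma sstate_blownup : sstate A' Phi O'.
Proof.
have [[pA pPhi cS cov hm] [Op On OA]] := hst.
have [[pD Tz OD] _] := hch; have cD := schart_compat hch; have off := schart_offbd hst hch.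
split; split.
- exact: (polyv_blownup gam pA pD).
- exact: pPhi.
- exact: (affineS_blownup cS off gD).
- exact: (bcovered_blownup pA cS pD cD off gD Op On OD cov).
- exact: (modification_blownup pA pPhi cS pD cD off gD cov).
- exact: blownup_set_peq.
- by move=> v t [].
- exact: (blownup_set_A cS off gD Op OA).
Qed.

Lemma blowup_coordsK q : k1 q != 0 -> th1 gam (blowup_coords gam q) = q.
Proof. exact: th1_inv. Qed.

Lemma schart_blownup :
  schart A' Phi O' (chart1 D gam D) T dom (fun u => blowup_coords gam (chi u)) xi.
Proof.
have [[pA pPhi cS cov hm] [Op On OA]] := hst.
have [[pD Tz OD] [hw hf hs]] := hch; have off := schart_offbd hst hch.
split; split=> //.
- exact: (fpoly_chart1 gam pD).
- by move=> q j Tj; apply: Tz.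
- exact: (OD_chart1 pD gD Op On OD).
- move=> u du; apply: (fcor1 cS pD off gD); rewrite blowup_coordsK; first exact: hf.
  by have [ut Aq _] := hf u du; apply: off ut Aq.
- move=> q x k0; have [|u [du e1 e2]] := hs (th1 gam q) x; first by rewrite row2_k1.
  exists u; split=> //; rewrite e1; apply: pt2P; rewrite /= ?row2_k1 ?row2_k2 //.
  by rewrite ?row2_k1 ?row2_k2 addrAC subrr add0r mulrAC divff // mul1r.
Qed.

Lemma transform_lift :
  transform A Phi O A' Phi O' (@lift K N M D gam M) id
    (fun p => peq p.1 (center D gam p.2)).
Proof.
have [[pA pPhi cS cov hm] [Op On OA]] := hst.
have [[pD Tz OD] [hw hf hs]] := hch; have off := schart_offbd hst hch.
split; [split|split] => //.
- by move=> D'; apply: (fpoly_lift gam pD).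
- by move=> D' u q x; apply: (fcor_lift cS pD off gD).
- move=> D' T' q gq nb; apply: goodat_lift => //; apply/eqP => /minors_eq0 /= h; apply: nb.
  have [l [i1 [i2 [j0 [j1 [_ _ El _]]]]]] := gq.
  by apply: para_peq => //; [exact: rV_neq0 El|exact: (center_neq0 gD)].
- by move=> D' q; apply: (OD_lift gD Op On OD).
- by move=> D1 D2 q1 q2 _ /segre_peq_inv[].
Qed.

(** A lifted chart meets the exceptional curve only above the centre. Centres chosen later on that
    curve therefore do not affect charts that avoid the first centre. *)
Lemma lift_notin (D' : fdata K N M) q q1 : q.2 = q1.2 -> k1 q1 = 0 ->
  peq (fE (lift D gam D') q) (fE (chart1 D gam D) q1) ->
  peq (fE D' q) (center D gam q.2).
Proof.
move=> qt k0 /segre_peq_inv[h _]; apply: (peq_trans h).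
rewrite th1_center // -qt; apply: peq_refl; exact: (center_neq0 gD).
Qed.

Lemma lift_cover p : model A' p -> O' p -> exists s : pt K N,
  [/\ model A s, s.2 = p.2, O s & forall (D' : fdata K N M) q,
     q.2 = s.2 -> peq s.1 (fE D' q) -> peq p.1 (fE (lift D gam D') q)].
Proof.
have [[pA pPhi cS cov hm] [Op On OA]] := hst.
have [[pD Tz OD] _] := hch.
move=> mp [_ [s' [w' [e' Os']]]]; have [s [w [ep ms mw]]] := model_tens mp.
have [h _] : peq s' s /\ peq w' w.
  by apply: segre_peq_inv; rewrite -e' ep; apply: peq_refl; rewrite -ep; apply: model_neq0 mp.
have Os : O (s, p.2) by apply: Op h Os'.
have m0 := notO_center gD Op On OD Os.
exists (s, p.2); split=> // D' q qt sq; rewrite ep /= /tens; apply: segre_peq => //.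
apply: (peq_trans (blownup_factor pD mp ep m0)).
by rewrite qt; exact: (minors_peq pD sq m0).
Qed.

End OneBlowup.

Section ElementaryIteration.
Variables (N R H : nat) (A : pt K 3 -> 'rV[K]_N) (O : set (pt K N)).
Variables (g : pt K N -> 'rV[K]_R) (h : pt K N -> 'rV[K]_H).
Variables (E : bool -> pt K 2 -> 'rV[K]_N) (gam : {poly K}) (gh : bool -> pt K 2 -> 'rV[K]_R).
Hypotheses (hg : hvec 1 g) (hh : hvec 1 h).
Hypothesis gA : forall u, g (A u, u.2) != 0.
Hypothesis hS : forall s, model A s -> h s != 0.
Hypothesis pgh : forall d, polyv (gh d).
Hypothesis ghE : forall d q, g (E d q, q.2) = ecurve gam d q *: gh d q.
Hypothesis rb : forall d q, ecurve gam d q = 0 -> exists r b,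
  (forall q', gh d q' ord0 r = h (E d q', q'.2) ord0 b) /\ h (E d q, q.2) ord0 b != 0.
Hypothesis onC : forall s, model A s -> g s = 0 -> exists d q,
  [/\ q.2 = s.2, ecurve gam d q = 0 & peq s.1 (E d q)].
Hypothesis ODd : forall d q, ecurve gam d q = 0 -> exists eta nu,
  [/\ ispoly eta, ispoly nu, nu q != 0 & forall q', nu q' != 0 ->
      E d q' != 0 /\ (O (E d q', q'.2) <-> eta q' != 0)].

Definition etstate M (Phi : pt K 3 -> 'rV[K]_M) (Dd : bool -> fdata K N M)
    (T : pred 'I_M) : Prop :=
  [/\ sstate A Phi O, forall d, fE (Dd d) = E d, forall d, fpoly (Dd d),
      forall d, fcompat A Phi (Dd d) &
      forall d q, ecurve gam d q = 0 -> goodat T (Dd d) q] /\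
  (forall d q j, T j -> fa (Dd d) q ord0 j = 0).

(** An elementary transformation leaves the surface and its charts [E] unchanged, so the same g, h
    and gh serve each time; every round divides the fibre coordinate once more by the equation of
    the curve. *)
Lemma etstate_iter r M (Phi : pt K 3 -> 'rV[K]_M) Dd T : etstate Phi Dd T ->
  exists M' (Phi' : pt K 3 -> 'rV[K]_M') Dd' T' L Tm,
  [/\ etstate Phi' Dd' T',
      forall d u q x, fcor A Phi (Dd d) u q x ->
        fcor A Phi' (Dd' d) u q (x / ecurve gam d q ^+ r),
      transform A Phi O A Phi' O L Tm (fun p => p.1 != 0 /\ g p = 0) &
      forall D q, fE (L D) q = fE D q].
Proof.
elim: r M Phi Dd T => [|r IH] M Phi Dd T.
  move=> hs; exists M, Phi, Dd, T, id, id; split=> //.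
  by move=> d u q x; rewrite expr0 divr1.
move=> [[[[pA pPhi cS cov hm] hO] EE pDd cDd gDd] Tz].
have ghE' d q : g (fE (Dd d) q, q.2) = ecurve gam d q *: gh d q by rewrite EE ghE.
have rb' d q : ecurve gam d q = 0 -> exists r b,
    (forall q', gh d q' ord0 r = h (fE (Dd d) q', q'.2) ord0 b) /\
    h (fE (Dd d) q, q.2) ord0 b != 0 by rewrite EE; apply: rb.
have onC' s : model A s -> g s = 0 -> exists d q,
    [/\ q.2 = s.2, ecurve gam d q = 0 & peq s.1 (fE (Dd d) q)].
  by move=> ms gs; have [d [q h3]] := onC ms gs; exists d, q; rewrite EE.
have ODd' d q : ecurve gam d q = 0 -> exists eta nu,
    [/\ ispoly eta, ispoly nu, nu q != 0 & forall q', nu q' != 0 ->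
      fE (Dd d) q' != 0 /\ (O (fE (Dd d) q', q'.2) <-> eta q' != 0)].
  by rewrite EE; apply: ODd.
pose Dd1 := etchart h T Dd gam gh.
have hs1 : etstate (etPhi A Phi g h T) Dd1 (@etT M R H T).
  split; last by move=> d q j; apply: etchart_zero.
  split=> //.
  - split=> //; split=> //.
    + exact: (polyv_etPhi T pA pPhi hg hh).
    + exact: (affineS_et h T cS gA).
    + exact: (bcovered_et cS hg hh gA pDd cDd pgh ghE' gDd rb' Tz onC' ODd' cov).
    + exact: (modification_et pA pPhi cS hg hh gA hS pDd cDd pgh ghE' gDd rb' Tz onC' ODd' cov).
  - exact: (fpoly_etchart T gam hh pDd pgh).
  - exact: (fcompat_etchart cS hg hh gA cDd ghE' Tz).
  - by move=> d q e0; apply: (goodat_etchart gDd rb' e0).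
have [M' [Phi' [Dd' [T' [L [Tm [hs' hf ht LE]]]]]]] := IH _ _ _ _ hs1.
exists M', Phi', Dd', T', (fun D => L (etlift g h T D)), (fun T' => Tm (etTlift T')); split=> //.
  move=> d u q x hc; have := hf d u q _ (fcor_etchart cS hg hh gA ghE' Tz hc).
  by rewrite exprS invfM mulrA.
pose bad := fun p : pt K N => p.1 != 0 /\ g p = 0.
apply: (@transform_comp _ _ _ _ _ _ _ _ O _ _ O _ _ O (etlift g h T) _ bad L Tm bad _ ht) => //.
split; last by split.
split.
- by move=> D; apply: (fpoly_etlift T hg hh).
- by move=> D u q x; apply: (fcor_etlift T cS hg hh gA).
- move=> D T1 q gq nb; apply: goodat_etlift => //; apply/eqP => g0; apply: nb.
  have [l [i1 [i2 [j0 [j1 [_ _ El _]]]]]] := gq.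
  by split=> //; exact: rV_neq0 El.
- by move=> D T1 hT q j Tj; apply: etlift_zero Tj => j' /hT.
Qed.

End ElementaryIteration.
End Towers.

(** * The last blow-up of a chain and its elementary transformations *)

Section LastSteps.
Variable K : numClosedFieldType.
Variables (N M : nat) (A : pt K 3 -> 'rV[K]_N) (Phi : pt K 3 -> 'rV[K]_M).
Variables (O : set (pt K N)) (D : fdata K N M) (T : pred 'I_M).
Variables (dom : set (pt K 3)) (chi : pt K 3 -> pt K 2) (xi : pt K 3 -> K).
Variable gam : {poly K}.
Hypothesis hst : sstate A Phi O.
Hypothesis hch : schart A Phi O D T dom chi xi.
Hypothesis gD : forall t, goodat T D (row2 0 gam.[t], t).

Let A' := blownup A D gam.
Let Dx : bool -> fdata K (N * (N * N)) M :=
  fun d => if d then chart2 D gam D else chart1 D gam D.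
Let mfx (d : bool) : pt K 2 -> 'rV[K]_(N * N) := if d then mf2 D gam else mf1 D gam.
(** At [segre s w] this is the Segre product of the minors of s with w. In the exceptional charts
    the minors are e mf and w is mf, so [gx] is e times the Segre square of mf; [hx] has the same
    degree and vanishes nowhere on the surface. *)
Let gx : pt K (N * (N * N)) -> 'rV[K]_(N * N * (N * N)) := colmap (minors D gam).
Let hx (p : pt K (N * (N * N))) : 'rV[K]_(N * (N * N) * N) :=
  segre p.1 (center D gam p.2).

(** The exceptional curve without the point where the proper transform of k1 = 0 meets it: the
    affine line that the chain adds to the open set. *)
Definition exceptional_line : set (pt K (N * (N * N))) :=
  [set p | exists q, [/\ q.2 = p.2, k1 q = 0 & peq p.1 (fE (chart1 D gam D) q)]].

Let O' := blownup_set O `|` exceptional_line.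

Lemma hvec_hx : hvec 1 hx.
Proof.
have [[[pE _ _] _ _] _] := hch.
have hc j : exists P : {poly K}, forall t, center D gam t ord0 j = P.[t].
  apply: (ispoly_curve (pE j)); apply: forall_I2.
    by exists 0 => t; rewrite mxE inordK // horner0.
  by exists gam => t; rewrite mxE inordK.
move=> k; case/mxvec_indexP: k => i j; have [P hP] := hc j.
apply: (@hpoly_ext _ _ _ _ (fun p => p.1 ord0 i * P.[p.2])).
  by move=> p; rewrite /hx segreE hP.
exact: (hpolyM (hpoly_x K i) (hpoly_tp _ P)).
Qed.

Lemma center_goodat t : exists l i1 i2 j0 j1, fstd D l i1 i2 j0 j1 /\
  center D gam t ord0 l != 0.
Proof. by have [l [i1 [i2 [j0 [j1 [std _ El _]]]]]] := gD t; exists l, i1, i2, j0, j1. Qed.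

Lemma gx_segre s w t : gx (segre s w, t) = segre (minors D gam (s, t)) w.
Proof.
by have [[pD _ _] _] := hch; rewrite /gx colmap_segre //; apply: (hvec_minors gam pD).
Qed.

Lemma gx_line p : exceptional_line p -> gx p = 0.
Proof.
have [[pD _ _] _] := hch.
have hg := hvec_colmap (hvec_minors gam pD) : hvec 1 gx.
move=> [q [qt k0 /peq_sym/peqP[_ [c _ e]]]].
rewrite [p]surjective_pairing e (hvec_scale _ _ _ hg) -qt gx_segre.
by rewrite -(mf1E gam pD) segreZl k0 scale0r scaler0.
Qed.

Lemma mf2_notline q q1 : q.2 = q1.2 -> k1 q = 0 -> k1 q1 = 0 ->
  ~ peq (fE (chart2 D gam D) q) (fE (chart1 D gam D) q1).
Proof.
have [[pD _ _] _] := hch.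
move=> qt k0 k01 /segre_peq_inv[_ e].
have [l [i1 [i2 [j0 [j1 [std El]]]]]] := center_goodat q1.2.
have [m1 _] := mf1_std gam pD q1 std; have [m2 _] := mf2_std gam pD q std.
have : mf2 D gam q ord0 (mxvec_index i1 l) != 0.
  by apply: (peq_neq0 (peq_sym e)); rewrite m1 (th1_center gam k01) mulf_neq0.
by rewrite m2 k0 mul0r eqxx.
Qed.

Lemma chart2_line q : k2 q = gam.[q.2] -> k1 q != 0 -> fE (chart2 D gam D) q != 0 ->
  exceptional_line (fE (chart2 D gam D) q, q.2).
Proof.
move=> k2g k0 E0; exists (row2 0 (k1 q)^-1, q.2); split; rewrite ?row2_k1 //=.
move: E0; rewrite /= /tens segre_neq0 => /andP[E0 m0].
rewrite (th1_center gam (q := (row2 0 (k1 q)^-1, q.2))) ?row2_k1 // -(th2_center k2g).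
apply: segre_peq; first exact: peq_refl.
have -> : mf1 D gam (row2 0 (k1 q)^-1, q.2) = (k1 q)^-1 *: mf2 D gam q.
  rewrite /mf1 /mf2 (th1_center gam (q := (row2 0 (k1 q)^-1, q.2))) ?row2_k1 //.
  by rewrite (th2_center k2g) row2_k2 scalerDr scalerA mulVf // scale1r.
by apply: peqZ => //; rewrite invr_neq0.
Qed.

Lemma last_steps r : exists M' (Phi' : pt K 3 -> 'rV[K]_M') (D' : fdata K (N * (N * N)) M')
    L Tm,
  [/\ sstate A' Phi' O',
      [/\ fpoly D', forall q, k1 q = 0 -> goodat predT D' q & forall q, O' (fE D' q, q.2)],
      forall u, dom u ->
        fcor A' Phi' D' u (blowup_coords gam (chi u)) (xi u / k1 (chi u) ^+ r),
      transform A Phi O A' Phi' O' L Tm (fun p => peq p.1 (center D gam p.2)) &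
      forall p, model A' p -> O' p ->
      (exists q, [/\ q.2 = p.2, k1 q = 0 & peq p.1 (fE D' q)]) \/
      exists s : pt K N, [/\ model A s, s.2 = p.2, O s & forall (D' : fdata K N M) q,
        q.2 = s.2 -> peq s.1 (fE D' q) -> peq p.1 (fE (L D') q)]].
Proof.
have hst' := sstate_blownup hst hch gD; have hch' := schart_blownup hst hch gD.
have [[pA pPhi cS cov hm] [Op On OA]] := hst.
have [[pD Tz OD] _] := hch; have cD := schart_compat hch; have off := schart_offbd hst hch.
have [pE pa pb] := pD.
have hmin := hvec_minors gam pD.
have hgx : hvec 1 gx by apply: hvec_colmap.
have OD1 := OD_chart1 pD gD Op On OD; have OD2 := OD_chart2 pD gD Op On OD.
have pmf d : polyv (mfx d).
  have [p1 p2 _] := dmP gam pD; case: d; apply: polyvD.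
  - by apply: polyvZ; [apply: ispoly_k1|move=> k; apply: (ispoly_th2 gam (p1 k))].
  - by move=> k; apply: (ispoly_th2 gam (p2 k)).
  - by move=> k; apply: (ispoly_th1 gam (p1 k)).
  - by apply: polyvZ; [apply: ispoly_k2|move=> k; apply: (ispoly_th1 gam (p2 k))].
have gA u : gx (A' u, u.2) != 0.
  rewrite gx_segre; rewrite segre_neq0 andbb. exact: (minors_A cS off gD).
have hS s : model A' s -> hx s != 0.
  by move=> ms; rewrite /hx segre_neq0 (model_neq0 ms) (center_neq0 gD).
have ghE d q : gx (fE (Dx d) q, q.2) = ecurve gam d q *: segre (mfx d q) (mfx d q).
  rewrite -segreZl; case: d; rewrite /= /tens gx_segre.
    by rewrite (mf2E gam pD).
  by rewrite (mf1E gam pD).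
have rb d q : ecurve gam d q = 0 -> exists r b,
    (forall q', segre (mfx d q') (mfx d q') ord0 r = hx (fE (Dx d) q', q'.2) ord0 b) /\
    hx (fE (Dx d) q, q.2) ord0 b != 0.
  have [l [i1 [i2 [j0 [j1 [std El]]]]]] := center_goodat q.2.
  move=> e0; pose m := mxvec_index (if d then i2 else i1) l.
  (* By [mf1_std] and [mf2_std] the entry m of mf is E_l c_l, so its square equals the entry E_l
     mf_m c_l of [hx]. This is why [hx] contains the centre as a factor. *)
  exists (mxvec_index m m), (mxvec_index (mxvec_index l m) l).
  case: d e0 @m => /= [/eqP|] e0; rewrite /hx /= /tens !segreE.
    rewrite subr_eq0 in e0; move/eqP: e0 => e0.
    split=> [q'|]; rewrite ?segreE.
      by have [_ m2] := mf2_std gam pD q' std; rewrite [X in X * _]m2 mulrAC.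
    by have [_ m2] := mf2_std gam pD q std; rewrite m2 (th2_center e0) !mulf_neq0.
  split=> [q'|]; rewrite ?segreE.
    by have [m1 _] := mf1_std gam pD q' std; rewrite [X in X * _]m1 mulrAC.
  by have [m1 _] := mf1_std gam pD q std; rewrite m1 (th1_center gam e0) !mulf_neq0.
have onC s : model A' s -> gx s = 0 -> exists d q,
    [/\ q.2 = s.2, ecurve gam d q = 0 & peq s.1 (fE (Dx d) q)].
  move=> ms gs; have [s' [w [es ms' mw]]] := model_tens ms.
  have sc : para s' (center D gam s.2).
    apply/(minors_eq0 D gam (s', s.2)); apply/eqP/negPn/negP => m0.
    move/eqP: gs; rewrite [s]surjective_pairing es gx_segre; apply/negP.
    by rewrite segre_neq0 m0; exact: model_neq0 mw.
  case: (exceptional_points pA pD cD gD ms es sc) => -[q].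
    by move=> [qt k0 e]; exists false, q.
  by move=> [qt k0 k0' e]; exists true, q; split=> //=; rewrite k0' subrr.
have ODd d q : ecurve gam d q = 0 -> exists eta nu,
    [/\ ispoly eta, ispoly nu, nu q != 0 & forall q', nu q' != 0 ->
      fE (Dx d) q' != 0 /\ (blownup_set O (fE (Dx d) q', q'.2) <-> eta q' != 0)].
  case: d => /= e0.
    have k0 : k2 q = gam.[q.2] by apply/eqP; rewrite -subr_eq0 e0.
    have [l [_ [_ [_ [_ [_ _ El _]]]]]] := goodat_chart2 pD gD k0.
    have [p2 _ _] := fpoly_chart2 gam pD.
    exists (fun q => k1 q * (k2 q - gam.[q.2])), (fun q => fE (chart2 D gam D) q ord0 l).
    split=> //; first by apply: ispolyM; [apply: ispoly_k1|apply: ispoly_k2gam].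
    by move=> q' /rV_neq0 h; split=> //; apply: OD2.
  have [l [_ [_ [_ [_ [_ _ El _]]]]]] := goodat_chart1 pD gD e0.
  have [p2 _ _] := fpoly_chart1 gam pD.
  exists (@k1 K), (fun q => fE (chart1 D gam D) q ord0 l).
  split=> //; first by apply: ispoly_k1.
  by move=> q' /rV_neq0 h; split=> //; apply: OD1.
have et0 : etstate A' (blownup_set O) (fun d => fE (Dx d)) gam Phi Dx T.
  split; last by case=> q j Tj; apply: Tz.
  split=> //.
  - by case; [apply: (fpoly_chart2 gam pD)|apply: (fpoly_chart1 gam pD)].
  - by case; [apply: (fcompat_chart2 pA cS pD cD off gD)|apply: (fcompat_chart1 cS pD cD off gD)].
  - case=> q /= e0; last exact: (goodat_chart1 pD gD e0).
    by apply: (goodat_chart2 pD gD); apply/eqP; rewrite -subr_eq0 e0.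
have [M' [Phi' [Dd' [T' [L [Tm [[[hs' EE pDd' cDd' gDd'] _] hf ht LE]]]]]]] :=
  etstate_iter hgx hvec_hx gA hS (fun d => polyv_tens (pmf d) (pmf d)) ghE rb onC ODd r et0.
have [[pA' pPhi' cS' cov' hm'] [Op' On' OA']] := hs'.
have E1 q : fE (Dd' false) q = fE (chart1 D gam D) q by rewrite EE.
have E2 q : fE (Dd' true) q = fE (chart2 D gam D) q by rewrite EE.
exists M', Phi', (Dd' false), (fun D' => L (lift D gam D')), Tm; split=> //.
- split; split=> //.
  + move=> s ms; case: (eqVneq (gx s) 0) => [gs0|gs0].
      have [d [q [qt e0 sq]]] := onC s ms gs0.
      have [l [i1 [i2 [j0 [j1 [std Tj El aj]]]]]] := gDd' d q e0.
      have [pE' _ _] := pDd' d.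
      case: d e0 sq std El aj pE' => /= e0 sq std El aj pE'.
        (* In the second chart only k1 = 0 is now missing, since k2 = gam has joined the open set.
           In the first chart nothing is missing, and the equation is the constant 1. *)
        exists (Dd' true), q, (@k1 K), (fun q => fE (Dd' true) q ord0 l); split.
          by split=> //; [rewrite E2|exists l, i1, i2, j0, j1].
        split=> //; first exact: ispoly_k1.
        move=> q' /rV_neq0 h; split=> //; rewrite E2 in h *; split.
          move=> [|[q1 /= [qt' k01 e]]]; last by apply/eqP => k0'; exact: (mf2_notline (esym qt') k0' k01 e).
          by move=> /OD2; rewrite mulf_eq0 negb_or => /andP[].
        move=> k0'; case: (eqVneq (k2 q' - gam.[q'.2]) 0) => [k2g|k2g]; [right|left].
          by apply: chart2_line => //; apply/eqP; rewrite -subr_eq0 k2g.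
        by apply/OD2; rewrite mulf_neq0.
      exists (Dd' false), q, (fun=> 1), (fun q => fE (Dd' false) q ord0 l); split.
        by split=> //; [rewrite E1|exists l, i1, i2, j0, j1].
      split=> //; first exact: ispoly_c.
      move=> q' /rV_neq0 h; split=> //; rewrite E1 in h *; split; first by rewrite oner_neq0.
      move=> _; case: (eqVneq (k1 q') 0) => [k0'|k0']; [right|left]; last by apply/OD1.
      by exists q'; split=> //; apply: peq_refl.
    have [D' [q [eta [nu [[pD' cD' qt sq gq] [peta pnu nuq hO]]]]]] := cov' s ms.
    have /peqP[_ [c c0 e]] := sq.
    have [x gx0] : exists x, gx (fE D' q, q.2) ord0 x != 0.
      apply: rV_neq0P; rewrite e qt (hvec_scale _ _ _ hgx) -surjective_pairing.
      by rewrite scaler_eq0 negb_or expf_neq0.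
    have [pE' _ _] := pD'.
    exists D', q, eta, (fun q => nu q * gx (fE D' q, q.2) ord0 x); split=> //.
    split=> //; first by apply: ispolyM => //; apply: (polyv_gh hgx pE').
      by rewrite mulf_neq0.
    move=> q'; rewrite mulf_eq0 negb_or => /andP[/hO[E0 hO'] g0]; split=> //.
    rewrite -hO'; split=> [[//|/gx_line h]|]; last by left.
    by move: g0; rewrite h mxE eqxx.
  + move=> v w t e [h|[q /= [qt k0 e']]]; [left|right].
      exact: blownup_set_peq e h.
    by exists q; split=> //; apply: peq_trans e'; apply: peq_sym.
  + move=> v t [/On' //|[q /= [_ _ e]]]; by case: e.
  + by move=> u; left.
- split=> //.
  + move=> q k0; apply: (goodat_predT (T := T')); exact: gDd'.
  + move=> q; case: (eqVneq (k1 q) 0) => [k0|k0]; rewrite E1; last by left; apply/OD1.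
    right; exists q; split=> //; apply: peq_refl.
    have [l [_ [_ [_ [_ [_ _ El _]]]]]] := goodat_chart1 pD gD k0.
    exact: rV_neq0 El.
- move=> u du; have [_ [_ hf' _]] := hch'.
  by have := hf false u _ _ (hf' u du); rewrite /= row2_k1.
- have tr : transform A Phi O A' Phi' (blownup_set O) (fun D' => L (lift D gam D')) Tm
      (fun p => peq p.1 (center D gam p.2)).
    apply: (transform_comp (transform_lift hst hch gD) ht) => D' q nb [/= E0] g0; apply: nb.
    move: E0; rewrite /= /tens segre_neq0 => /andP[E0 m0].
    by exfalso; move/eqP: g0; rewrite gx_segre; apply/negP; rewrite segre_neq0 m0.
  have [t1 [t2 t3]] := tr; split=> //; split=> // D' q; rewrite -t2; split; last by left.
  move=> [//|[q1 /= [qt k0 /peq_sym e]]]; exfalso; move: e; rewrite LE.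
  move=> /[dup] /segre_peq_inv[_ [_ m0 _]] e; move/eqP: m0; apply.
  apply/(minors_eq0 D gam (fE D' q, q.2)); apply: peq_para.
  apply: (lift_notin gD (esym qt) k0); exact: peq_sym.
- move=> p mp [/(lift_cover hst hch gD mp)[s [ms st Os hs0]]|[q [qt k0 e]]]; [right|left].
    by exists s; split=> // D1 q qt e; rewrite LE; apply: hs0.
  by exists q; rewrite E1.
Qed.

End LastSteps.

(** * Chains of three blow-ups *)

Section Towers2.
Variable K : numClosedFieldType.

(* A chart of the phase space, read off a chart of the surface: it is contained
   in [O], and regular over [V]. *)
Definition nchart N M (A : pt K 3 -> 'rV[K]_N) (Phi : pt K 3 -> 'rV[K]_M)
    (O : set (pt K N)) (D : fdata K N M) (G V : set (pt K 2)) (dom : set (pt K 3))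
    (chi : pt K 3 -> pt K 2) (xi : pt K 3 -> K) : Prop :=
  [/\ fpoly D, forall q, G q -> goodat predT D q & forall q, O (fE D q, q.2)] /\
  [/\ exists w, [/\ ispoly w, exists u, w u != 0 & forall u, w u != 0 -> dom u],
      forall u, dom u -> fcor A Phi D u (chi u) (xi u) &
      forall q x, V q -> exists u, [/\ dom u, chi u = q & xi u = x]].

Lemma nchart_transform N M N' M' (A : pt K 3 -> 'rV[K]_N) (Phi : pt K 3 -> 'rV[K]_M)
    O (A' : pt K 3 -> 'rV[K]_N') (Phi' : pt K 3 -> 'rV[K]_M') O' L Tm bad D G V dom chi xi :
  transform A Phi O A' Phi' O' L Tm bad -> (forall p, O p -> ~ bad p) ->
  nchart A Phi O D G V dom chi xi -> nchart A' Phi' O' (L D) G V dom chi xi.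
Proof.
move=> [[t1 t2 t3 t4] [t5 _]] hb [[pD hG hO] [hw hf hs]]; split; split=> //.
- exact: t1.
- by move=> q /hG h; apply: (goodat_predT (T := Tm predT)); apply: t3 h _; apply: hb.
- by move=> q; rewrite t5.
- by move=> u du; apply/t2/hf.
Qed.

(** Each later centre lies on the exceptional curve just created, so by [lift_notin] a chart that
    avoids the first centre avoids all three. The other chains therefore need to know g1 only. *)
Lemma tower N M (A : pt K 3 -> 'rV[K]_N) (Phi : pt K 3 -> 'rV[K]_M) O (D : fdata K N M)
    T dom chi xi (g1 g2 g3 : {poly K}) r :
  sstate A Phi O -> schart A Phi O D T dom chi xi ->
  (forall t, goodat T D (row2 0 g1.[t], t)) ->
  exists N' M' (A' : pt K 3 -> 'rV[K]_N') (Phi' : pt K 3 -> 'rV[K]_M') O'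
    (D' : fdata K N' M') L Tm,
  [/\ sstate A' Phi' O',
      nchart A' Phi' O' D' [set q | k1 q = 0] [set q | k1 q != 0] dom
        (fun u => blowup_coords g3 (blowup_coords g2 (blowup_coords g1 (chi u))))
        (fun u => xi u / k1 (chi u) ^+ r),
      transform A Phi O A' Phi' O' L Tm (fun p => peq p.1 (center D g1 p.2)),
      forall p, O p -> ~ peq p.1 (center D g1 p.2) &
      forall p, model A' p -> O' p ->
      (exists q, [/\ q.2 = p.2, k1 q = 0 & peq p.1 (fE D' q)]) \/
      exists s : pt K N, [/\ model A s, s.2 = p.2, O s & forall (D' : fdata K N M) q,
        q.2 = s.2 -> peq s.1 (fE D' q) -> peq p.1 (fE (L D') q)]].
Proof.
move=> st0 ch0 gd0.
have [[pD0 _ OD0] _] := ch0; have [_ [Op0 On0 _]] := st0.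
have st1 := sstate_blownup st0 ch0 gd0; have ch1 := schart_blownup st0 ch0 gd0.
have gd1 t : goodat T (chart1 D g1 D) (row2 0 g2.[t], t).
  by apply: (goodat_chart1 pD0 gd0); rewrite row2_k1.
have tr1 := transform_lift st0 ch0 gd0.
have [[pD1 _ _] _] := ch1.
have st2 := sstate_blownup st1 ch1 gd1; have ch2 := schart_blownup st1 ch1 gd1.
have gd2 t : goodat T (chart1 (chart1 D g1 D) g2 (chart1 D g1 D)) (row2 0 g3.[t], t).
  by apply: (goodat_chart1 pD1 gd1); rewrite row2_k1.
have tr2 := transform_lift st1 ch1 gd1.
have [M' [Phi' [D' [L [Tm [st3 [pD' gD' OD'] hf tr3 cov3]]]]]] := last_steps st2 ch2 gd2 r.
have nb1 (D'' : fdata K N M) q : ~ peq (fE D'' q) (center D g1 q.2) ->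
    ~ peq (fE (lift D g1 D'') q) (center (chart1 D g1 D) g2 q.2).
  move=> nb e; apply: nb; apply: (lift_notin gd0 (q1 := (row2 0 g2.[q.2], q.2))) e => //.
  exact: row2_k1.
have tr12 := transform_comp tr1 tr2 nb1.
have nb2 (D'' : fdata K N M) q : ~ peq (fE D'' q) (center D g1 q.2) ->
    ~ peq (fE (lift (chart1 D g1 D) g2 (lift D g1 D'')) q)
        (center (chart1 (chart1 D g1 D) g2 (chart1 D g1 D)) g3 q.2).
  move=> nb e; apply: nb; apply: (lift_notin gd0 (q1 := (row2 0 g2.[q.2], q.2))) => //.
    exact: row2_k1.
  apply: (lift_notin gd1 (q1 := (row2 0 g3.[q.2], q.2))) e => //.
  exact: row2_k1.
have tr := transform_comp tr12 tr3 nb2.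
have hb (p : pt K N) : O p -> ~ peq p.1 (center D g1 p.2).
  case: p => v t Ov e; have := Op0 _ _ _ e Ov.
  by move=> /(OD0 (center_pt g1 t)); rewrite row2_k1 eqxx.
have cov p : model (blownup (blownup (blownup A D g1) (chart1 D g1 D) g2)
      (chart1 (chart1 D g1 D) g2 (chart1 D g1 D)) g3) p ->
    (blownup_set (blownup_set (blownup_set O)) `|`
      exceptional_line (chart1 (chart1 D g1 D) g2 (chart1 D g1 D)) g3) p ->
    (exists q, [/\ q.2 = p.2, k1 q = 0 & peq p.1 (fE D' q)]) \/
      exists s : pt K N, [/\ model A s, s.2 = p.2, O s & forall (D'' : fdata K N M) q,
        q.2 = s.2 -> peq s.1 (fE D'' q) ->
        peq p.1 (fE (L (lift (chart1 D g1 D) g2 (lift D g1 D''))) q)].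
  move=> mp Op; case: (cov3 p mp Op) => [|[s [ms st Os hs0]]]; [by left|right].
  have [s1 [ms1 st1' Os1 hs1]] := lift_cover st1 ch1 gd1 ms Os.
  have [s2 [ms2 st2' Os2 hs2]] := lift_cover st0 ch0 gd0 ms1 Os1.
  exists s2; split=> //; first by rewrite st2' st1' st.
  move=> D'' q qt e; apply: hs0; first by rewrite qt st2' st1'.
  by apply: hs1; [rewrite qt st2'|exact: hs2].
have [_ [hw _ _]] := ch0; have [_ [_ _ hs]] := ch2.
clear - st3 pD' gD' OD' hf tr hb hw hs cov.
exists _, _, (blownup (blownup (blownup A D g1) (chart1 D g1 D) g2) (chart1 (chart1 D g1 D) g2 (chart1 D g1 D)) g3), Phi',
  (blownup_set (blownup_set (blownup_set O)) `|`
   exceptional_line (chart1 (chart1 D g1 D) g2 (chart1 D g1 D)) g3), D', (fun D'' => L (lift (chart1 D g1 D) g2 (lift D g1 D''))), Tm; split; [exact: st3| |exact: tr|exact: hb|exact: cov].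
split; first by split; [exact: pD'|exact: gD'|exact: OD'].
split; first exact: hw.
  by move=> u du; have := hf u du; rewrite /= !row2_k1; exact.
move=> q x k0.
have k0' : k1 (th1 g3 q) != 0 by rewrite row2_k1.
have [u [du e1 e2]] := hs (th1 g3 q) (x * k1 q ^+ r) k0'.
have ek : k1 (chi u) = k1 q by move/(congr1 (@k1 K)): e1; rewrite /= !row2_k1.
exists u; split; [exact: du| |by rewrite e2 ek mulfK // expf_neq0].
rewrite e1; apply: pt2P; rewrite /= ?row2_k1 ?row2_k2 //.
by rewrite ?row2_k1 ?row2_k2 addrAC subrr add0r mulrAC divff // mul1r.
Qed.

End Towers2.

Ltac ispoly_tac := solve [do 40?first
  [ exact: ispoly_xc | exact: ispoly_yc | exact: ispoly_zc | exact: ispoly_k1 | exact: ispoly_k2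
  | exact: ispoly_c | exact: ispoly_t | apply: ispolyB | apply: ispolyD
  | apply: ispolyN | apply: ispolyM ] ].

(** * The blow-up of P^3 at a point as a P^1-bundle over P^2 *)

Section Start.
Variable K : numClosedFieldType.
Variables a1 a2 a3 : K.

Ltac polyv_tac := case; (do 7?[case=> [hi|]; first
  by eapply ispoly_ext; [move=> q; rewrite mxE /=; reflexivity|ispoly_tac]]); by [].

Definition startA (u : pt K 3) : 'rV[K]_3 := \row_i [:: 1; yc u; zc u]`_i.
(** Over P^2 with coordinates (1 : y : z) these are built from forms of degree 2 and x times forms
    of degree 1. They are chosen so that the sections x = 0, x + z = 0 and xz = a1, along which the
    elementary transformations take place, are read off the single entries xy, z(x + z) and xz -
    a1. *)
Definition startPhi (u : pt K 3) : 'rV[K]_7 := \row_i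
  [:: 1; yc u * yc u; zc u * zc u; xc u; xc u * yc u; zc u * (xc u + zc u);
      xc u * zc u - a1]`_i.
Definition startO : set (pt K 3) := [set p : pt K 3 | p.1 ord0 (inord 0) != 0].

Definition chart0 : fdata K 3 7 := FData
  (fun q => \row_i [:: 1; k1 q; k2 q]`_i)
  (fun q => \row_i [:: 1; k1 q * k1 q; k2 q * k2 q; 0; 0; k2 q * k2 q; - a1]`_i)
  (fun q => \row_i [:: 0; 0; 0; 1; k1 q; k2 q; k2 q]`_i).

Definition charty : fdata K 3 7 := FData
  (fun q => \row_i [:: k1 q; 1; k2 q]`_i)
  (fun q => \row_i [:: k1 q * k1 q; 1; k2 q * k2 q; 0; 0; k2 q * k2 q; - a1 * (k1 q * k1 q)]`_i)
  (fun q => \row_i [:: 0; 0; 0; k1 q; 1; k2 q; k2 q]`_i).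

Definition chartz : fdata K 3 7 := FData
  (fun q => \row_i [:: k1 q; k2 q; 1]`_i)
  (fun q => \row_i [:: k1 q * k1 q; k2 q * k2 q; 1; - k1 q; - k2 q; 0;
                       - (1 + a1 * (k1 q * k1 q))]`_i)
  (fun q => \row_i [:: 0; 0; 0; k1 q; k2 q; 1; 1]`_i).

(** The same chart of P^2 as [chartz], with a frame whose zero section is xz = a1 instead of x + z =
    0. *)
Definition chartw : fdata K 3 7 := FData
  (fun q => \row_i [:: k1 q; k2 q; 1]`_i)
  (fun q => \row_i [:: k1 q * k1 q; k2 q * k2 q; 1; a1 * (k1 q * k1 q) * k1 q;
                       a1 * (k1 q * k1 q) * k2 q; a1 * (k1 q * k1 q) + 1; 0]`_i)
  (fun q => \row_i [:: 0; 0; 0; k1 q; k2 q; 1; 1]`_i).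

Lemma polyv_startA : polyv startA. Proof. polyv_tac. Qed.
Lemma polyv_startPhi : polyv startPhi. Proof. polyv_tac. Qed.
Lemma fpoly_chart0 : fpoly chart0. Proof. by split; polyv_tac. Qed.
Lemma fpoly_charty : fpoly charty. Proof. by split; polyv_tac. Qed.
Lemma fpoly_chartz : fpoly chartz. Proof. by split; polyv_tac. Qed.
Lemma fpoly_chartw : fpoly chartw. Proof. by split; polyv_tac. Qed.

Lemma affineS_start : affineS startA startPhi.
Proof.
move=> u; exists (inord 0), (inord 1), (inord 2), (inord 0), (inord 3).
by split=> [u'|u'||]; rewrite !mxE !inordK //= ?mulr1 ?oner_neq0.
Qed.

Lemma std_chart0 : fstd chart0 (inord 0) (inord 1) (inord 2) (inord 0) (inord 3).
Proof. by split=> q; rewrite !mxE !inordK //= ?mulr1. Qed.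
Lemma std_charty : fstd charty (inord 1) (inord 0) (inord 2) (inord 1) (inord 4).
Proof. by split=> q; rewrite !mxE !inordK //= ?mulr1. Qed.
Lemma std_chartz : fstd chartz (inord 2) (inord 0) (inord 1) (inord 2) (inord 5).
Proof. by split=> q; rewrite !mxE !inordK //= ?mulr1. Qed.
Lemma std_chartw : fstd chartw (inord 2) (inord 0) (inord 1) (inord 2) (inord 6).
Proof. by split=> q; rewrite !mxE !inordK //= ?mulr1. Qed.

Lemma goodat_chart0 q : goodat predT chart0 q.
Proof.
do 5!eexists; split; [exact: std_chart0|by []| |]; by rewrite mxE inordK //= oner_neq0.
Qed.
Lemma goodat_charty q : goodat (pred1 (inord 4)) charty q.
Proof.
do 5!eexists; split; [exact: std_charty|exact: eqxx| |]; by rewrite mxE inordK //= oner_neq0.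
Qed.
Lemma goodat_chartz q : goodat (pred1 (inord 5)) chartz q.
Proof.
do 5!eexists; split; [exact: std_chartz|exact: eqxx| |]; by rewrite mxE inordK //= oner_neq0.
Qed.
Lemma goodat_chartw q : goodat (pred1 (inord 6)) chartw q.
Proof.
do 5!eexists; split; [exact: std_chartw|exact: eqxx| |]; by rewrite mxE inordK //= oner_neq0.
Qed.

Lemma peq_of_eq N (v w : 'rV[K]_N) c : c != 0 -> w != 0 -> v = c *: w -> peq v w.
Proof. by move=> c0 w0 ->; apply: peq_sym; apply: peqZ. Qed.

Definition chi0 (u : pt K 3) : pt K 2 := (row2 (yc u) (zc u), u.2).
Definition chiy (u : pt K 3) : pt K 2 := (row2 (1 / yc u) (zc u / yc u), u.2).
Definition chiz (u : pt K 3) : pt K 2 := (row2 (1 / zc u) (yc u / zc u), u.2).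

Lemma row_neq0 N (v : 'rV[K]_N) i : v ord0 i = 1 -> v != 0.
Proof. by move=> e; apply: (@rV_neq0 _ _ _ i); rewrite e oner_neq0. Qed.

Lemma fcor_chart0 u : fcor startA startPhi chart0 u (chi0 u) (xc u).
Proof.
have e1 : fE chart0 (chi0 u) = startA u.
  apply/rowP; apply: forall_I3; by rewrite !mxE !inordK //= ?row2_k1 ?row2_k2.
split=> //; first by rewrite e1; apply: peq_refl; exact: (affineS_neq0 affineS_start).1.
apply: (@peq_of_eq _ _ _ 1); rewrite ?oner_neq0 //.
  by apply: (@row_neq0 _ _ (inord 0)); rewrite !mxE !inordK //= mulr0 addr0.
apply/rowP => -[[|[|[|[|[|[|[|//]]]]]]] hi]; rewrite !mxE /= ?row2_k1 ?row2_k2; ring.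
Qed.

Lemma fcor_charty u : yc u != 0 -> fcor startA startPhi charty u (chiy u) (xc u / yc u).
Proof.
move=> y0; split=> //; [apply: (@peq_of_eq _ _ _ (yc u))|apply: (@peq_of_eq _ _ _ (yc u * yc u))];
  rewrite ?mulf_neq0 //.
- by apply: (@row_neq0 _ _ (inord 1)); rewrite !mxE !inordK.
- by apply/rowP => -[[|[|[|//]]] hi]; rewrite !mxE /= ?row2_k1 ?row2_k2; field.
- by apply: (@row_neq0 _ _ (inord 1)); rewrite !mxE !inordK //= mulr0 addr0.
- by apply/rowP => -[[|[|[|[|[|[|[|//]]]]]]] hi]; rewrite !mxE /= ?row2_k1 ?row2_k2; field.
Qed.

Lemma fcor_chartz u : zc u != 0 ->
  fcor startA startPhi chartz u (chiz u) ((xc u + zc u) / zc u).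
Proof.
move=> y0; split=> //; [apply: (@peq_of_eq _ _ _ (zc u))|apply: (@peq_of_eq _ _ _ (zc u * zc u))];
  rewrite ?mulf_neq0 //.
- by apply: (@row_neq0 _ _ (inord 2)); rewrite !mxE !inordK.
- by apply/rowP => -[[|[|[|//]]] hi]; rewrite !mxE /= ?row2_k1 ?row2_k2; field.
- by apply: (@row_neq0 _ _ (inord 2)); rewrite !mxE !inordK //= mulr0 addr0.
- by apply/rowP => -[[|[|[|[|[|[|[|//]]]]]]] hi]; rewrite !mxE /= ?row2_k1 ?row2_k2; field.
Qed.

Lemma fcor_chartw u : zc u != 0 ->
  fcor startA startPhi chartw u (chiz u) ((xc u * zc u - a1) / (zc u * zc u)).
Proof.
move=> y0; split=> //; [apply: (@peq_of_eq _ _ _ (zc u))|apply: (@peq_of_eq _ _ _ (zc u * zc u))];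
  rewrite ?mulf_neq0 //.
- by apply: (@row_neq0 _ _ (inord 2)); rewrite !mxE !inordK.
- by apply/rowP => -[[|[|[|//]]] hi]; rewrite !mxE /= ?row2_k1 ?row2_k2; field.
- by apply: (@row_neq0 _ _ (inord 2)); rewrite !mxE !inordK //= mulr0 addr0.
- by apply/rowP => -[[|[|[|[|[|[|[|//]]]]]]] hi]; rewrite !mxE /= ?row2_k1 ?row2_k2; field.
Qed.

Lemma dense_dom (f : pt K 3 -> K) (u0 : 'rV[K]_3) : ispoly f -> f (u0, 0) != 0 ->
  exists w, [/\ ispoly w, exists u, w u != 0 & forall u, w u != 0 -> f u != 0].
Proof. by move=> pf h; exists f; split=> //; exists (u0, 0). Qed.

Lemma schart_y : schart startA startPhi startO charty (pred1 (inord 4)) [set u | yc u != 0]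
  chiy (fun u => xc u / yc u).
Proof.
split; split.
- exact: fpoly_charty.
- by move=> q j /eqP->; rewrite mxE inordK.
- by move=> q; rewrite /startO /= mxE inordK.
- apply: (@dense_dom _ (row3 0 1 0)); first exact: ispoly_yc.
  by rewrite row3_yc oner_neq0.
- exact: fcor_charty.
- move=> q x k0; exists (row3 (x / k1 q) (1 / k1 q) (k2 q / k1 q), q.2).
  rewrite /chiy /= row3_xc row3_yc row3_zc mul1r invr_neq0 //; split=> //.
    by apply: pt2P; rewrite ?row2_k1 ?row2_k2 //= ?row2_k1 ?row2_k2 ?invrK ?divrr ?mul1r ?divfK.
  by rewrite invrK divfK.
Qed.

Lemma schart_z : schart startA startPhi startO chartz (pred1 (inord 5)) [set u | zc u != 0]
  chiz (fun u => (xc u + zc u) / zc u).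
Proof.
split; split.
- exact: fpoly_chartz.
- by move=> q j /eqP->; rewrite mxE inordK.
- by move=> q; rewrite /startO /= mxE inordK.
- apply: (@dense_dom _ (row3 0 0 1)); first exact: ispoly_zc.
  by rewrite row3_zc oner_neq0.
- exact: fcor_chartz.
- move=> q x k0; exists (row3 ((x - 1) / k1 q) (k2 q / k1 q) (1 / k1 q), q.2).
  rewrite /chiz /= row3_xc row3_yc row3_zc mul1r invr_neq0 //; split=> //.
    by apply: pt2P; rewrite ?row2_k1 ?row2_k2 //= ?row2_k1 ?row2_k2 ?invrK ?divrr ?mul1r ?divfK.
  by field.
Qed.

Lemma schart_w : schart startA startPhi startO chartw (pred1 (inord 6)) [set u | zc u != 0]
  chiz (fun u => (xc u * zc u - a1) / (zc u * zc u)).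
Proof.
split; split.
- exact: fpoly_chartw.
- by move=> q j /eqP->; rewrite mxE inordK.
- by move=> q; rewrite /startO /= mxE inordK.
- apply: (@dense_dom _ (row3 0 0 1)); first exact: ispoly_zc.
  by rewrite row3_zc oner_neq0.
- exact: fcor_chartw.
- move=> q x k0; exists (row3 ((x + a1 * (k1 q * k1 q)) / k1 q) (k2 q / k1 q) (1 / k1 q), q.2).
  rewrite /chiz /= row3_xc row3_yc row3_zc mul1r invr_neq0 //; split=> //.
    by apply: pt2P; rewrite ?row2_k1 ?row2_k2 //= ?row2_k1 ?row2_k2 ?invrK ?divrr ?mul1r ?divfK.
  by field.
Qed.

Lemma nchart0 : nchart startA startPhi startO chart0 setT setT setT chi0 (@xc K).
Proof.
split; split.
- exact: fpoly_chart0.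
- by move=> q _; apply: goodat_chart0.
- by move=> q; rewrite /startO /= mxE inordK //= oner_neq0.
- exists (fun=> 1); split=> //; [exact: ispoly_c|].
  by exists (0, 0); rewrite oner_neq0.
- by move=> u _; apply: fcor_chart0.
- move=> q x _; exists (row3 x (k1 q) (k2 q), q.2); split=> //; last by rewrite row3_xc.
  by rewrite /chi0 row3_yc row3_zc; apply: pt2P; rewrite ?row2_k1 ?row2_k2.
Qed.

Lemma startO_peq v w t : peq v w -> startO (v, t) -> startO (w, t).
Proof. exact: peq_neq0. Qed.

Lemma startO_A u : startO (startA u, u.2).
Proof. by rewrite /startO /= mxE inordK //= oner_neq0. Qed.

Lemma nchart_compat N M (A : pt K 3 -> 'rV[K]_N) (Phi : pt K 3 -> 'rV[K]_M) O D G V dom chi xi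
    (d : pt K 2 -> K) :
  ispoly d -> (forall t, exists2 q, q.2 = t & d q != 0) -> (forall q, d q != 0 -> V q) ->
  nchart A Phi O D G V dom chi xi -> fcompat A Phi D.
Proof.
move=> pd nd dV [_ [[w [pw nw wP]] hf hs]]; split.
  by exists w; split=> // u /wP du; exists (chi u), (xi u); apply: hf.
exists d; split=> // q x /dV/(hs q x)[u [du <- <-]]; exists u; exact: hf.
Qed.

Lemma start_cover (s : pt K 3) : s.1 != 0 ->
  (exists q, [/\ s.1 ord0 (inord 0) != 0, q.2 = s.2 & peq s.1 (fE chart0 q)]) \/
  (exists q, [/\ s.1 ord0 (inord 1) != 0, q.2 = s.2 & peq s.1 (fE charty q)]) \/
  (exists q, [/\ s.1 ord0 (inord 2) != 0, q.2 = s.2 & peq s.1 (fE chartz q)]).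
Proof.
move=> s0; set x := s.1 ord0 (inord 0); set y := s.1 ord0 (inord 1).
set z := s.1 ord0 (inord 2).
have sE : s.1 = \row_i [:: x; y; z]`_i.
  by apply/rowP; apply: forall_I3; rewrite mxE inordK.
case: (eqVneq x 0) => [x0|x0]; [right|left]; last first.
  exists (row2 (y / x) (z / x), s.2); split=> //; apply: (@peq_of_eq _ _ _ x) => //.
    by apply: (@row_neq0 _ _ (inord 0)); rewrite !mxE !inordK.
  by rewrite sE; apply/rowP => -[[|[|[|//]]] hi]; rewrite !mxE /= ?row2_k1 ?row2_k2; field.
case: (eqVneq y 0) => [y0|y0]; [right|left]; last first.
  exists (row2 (x / y) (z / y), s.2); split=> //; apply: (@peq_of_eq _ _ _ y) => //.
    by apply: (@row_neq0 _ _ (inord 1)); rewrite !mxE !inordK.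
  by rewrite sE; apply/rowP => -[[|[|[|//]]] hi]; rewrite !mxE /= ?row2_k1 ?row2_k2; field.
have z0 : z != 0.
  apply: contra_neq s0 => z0; rewrite sE x0 y0 z0.
  by apply/rowP => -[[|[|[|//]]] hi]; rewrite !mxE.
exists (row2 (x / z) (y / z), s.2); split=> //; apply: (@peq_of_eq _ _ _ z) => //.
  by apply: (@row_neq0 _ _ (inord 2)); rewrite !mxE !inordK.
by rewrite sE; apply/rowP => -[[|[|[|//]]] hi]; rewrite !mxE /= ?row2_k1 ?row2_k2; field.
Qed.

Lemma compat_chart0 : fcompat startA startPhi chart0.
Proof.
apply: (nchart_compat (ispoly_c 2 1) _ _ nchart0) => // t.
by exists (0, t); rewrite ?oner_neq0.
Qed.

Lemma bcovered_start : bcovered startA startPhi startO.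
Proof.
move=> s /model_neq0/start_cover[[q [_ qt sq]]|[[q [_ qt sq]]|[q [_ qt sq]]]].
- exists chart0, q, (fun=> 1), (fun=> 1); split.
    by split; [exact: fpoly_chart0|exact: compat_chart0| | |exact: goodat_chart0].
  split; [exact: ispoly_c|exact: ispoly_c|exact: oner_neq0|move=> q' _].
  split; first by apply: (@row_neq0 _ _ (inord 0)); rewrite mxE inordK.
  by rewrite /startO /= mxE inordK.
- exists charty, q, (@k1 K), (fun=> 1); split.
    split; [exact: fpoly_charty|exact: (schart_compat schart_y)|by []|by []|].
    exact: goodat_predT (goodat_charty q).
  split; [exact: ispoly_k1|exact: ispoly_c|exact: oner_neq0|move=> q' _].
  split; first by apply: (@row_neq0 _ _ (inord 1)); rewrite mxE inordK.
  by rewrite /startO /= mxE inordK.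
- exists chartz, q, (@k1 K), (fun=> 1); split.
    split; [exact: fpoly_chartz|exact: (schart_compat schart_z)|by []|by []|].
    exact: goodat_predT (goodat_chartz q).
  split; [exact: ispoly_k1|exact: ispoly_c|exact: oner_neq0|move=> q' _].
  split; first by apply: (@row_neq0 _ _ (inord 2)); rewrite mxE inordK.
  by rewrite /startO /= mxE inordK.
Qed.

Definition P3 (u : pt K 3) : 'rV[K]_4 := \row_i [:: 1; xc u; yc u; zc u]`_i.
(** The coordinates other than x: they vanish together at the single point (0 : 1 : 0 : 0) at
    infinity, and the projection from it forgets x. *)
Definition P3F (p : pt K 4) : 'rV[K]_3 :=
  \row_i [:: p.1 ord0 (inord 0); p.1 ord0 (inord 2); p.1 ord0 (inord 3)]`_i.

Lemma polyv_P3 : polyv P3.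
Proof. polyv_tac. Qed.

Lemma P3_row u : P3 u = row_mx 1 u.1 :> 'rV[K]_(1 + 3).
Proof.
apply/rowP => i; rewrite -(splitK (i : 'I_(1 + 3))); case: (fintype.split _) => j /=.
  by rewrite row_mxEl !mxE !ord1.
rewrite row_mxEr mxE /=; move: j; apply: forall_I3; by rewrite inordK.
Qed.

Lemma P3F_P3 u : P3F (P3 u, u.2) = startA u.
Proof.
apply/rowP => -[[|[|[|//]]] hi]; rewrite !mxE /= inordK //.
Qed.

(** Up to scalars every point with nonzero first coordinate is in the image, and a form vanishing at
    those points vanishes identically. *)
Lemma model_P3 : model P3 = @Proj K 4.
Proof.
apply/seteqP; split=> [p /model_neq0 //|p p0]; apply/modelP; split=> // d g hg g0.
have key (v : 'rV[K]_4) t : v ord0 (inord 0) != 0 -> g (v, t) = 0.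
  move=> v0; pose u : pt K 3 := (row3 (v ord0 (inord 1) / v ord0 (inord 0))
    (v ord0 (inord 2) / v ord0 (inord 0)) (v ord0 (inord 3) / v ord0 (inord 0)), t).
  have -> : v = v ord0 (inord 0) *: P3 u.
    have e k (hk : (k < 4)%N) : v ord0 (Ordinal hk) = v ord0 (inord k).
      by congr (v _ _); apply: val_inj; rewrite /= inordK.
    apply/rowP => -[[|[|[|[|//]]]] hi]; rewrite !mxE /= ?row3_xc ?row3_yc ?row3_zc e.
    - by rewrite mulr1.
    - by rewrite mulrC divfK.
    - by rewrite mulrC divfK.
    - by rewrite mulrC divfK.
  by rewrite (hpoly_scale _ _ _ hg) -[t]/(u.2) g0 mulr0.
rewrite [p]surjective_pairing.
apply: (@density_all K 4 g (fun p => p.1 ord0 (inord 0)) (hpoly_ispoly hg)).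
- exact: ispoly_x.
- by exists (\row_i 1, 0); rewrite mxE oner_neq0.
- by move=> [v t] /key.
Qed.

Lemma modification_P3 : modification P3.
Proof.
exists (fun q => q.1); first by rewrite model_P3; exact: Modif_start.
by move=> p u _; rewrite P3_row.
Qed.
Definition projchart (l : 'I_4) (q : pt K 3) : 'rV[K]_4 :=
  \row_i (if unlift l i is Some j then q.1 ord0 j else 1).

Lemma standard_projchart l : standard (projchart l) l (fintype.lift l).
Proof. by move=> q a; rewrite !mxE liftK unlift_none mulr1. Qed.

Lemma projchartP l (v : 'rV[K]_4) t : v ord0 l != 0 ->
  v = v ord0 l *: projchart l (coords l (fintype.lift l) (v, t)).
Proof.
move=> v0; apply/rowP => i; rewrite !mxE; case: unliftP => [j ->|->]; last by rewrite mulr1.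
by rewrite mxE mulrC divfK.
Qed.

Lemma xchart_projchart l : xchart P3 (projchart l).
Proof.
have P0 q : projchart l q != 0.
  by apply: (@row_neq0 _ _ l); rewrite mxE unlift_none.
split.
- move=> i; case: (unliftP l i) => [j ->|->].
    by apply: ispoly_ext (ispoly_x K j) => q; rewrite mxE liftK.
  by apply: ispoly_ext (ispoly_c 3 1) => q; rewrite mxE unlift_none.
- exists (fun u => P3 u ord0 l); split; first exact: polyv_P3.
    by exists (row3 1 1 1, 0); move: l {P0}; case=> -[|[|[|[|//]]]] hi;
      rewrite mxE /= ?row3_xc ?row3_yc ?row3_zc oner_neq0.
  move=> u Pl; exists (coords l (fintype.lift l) (P3 u, u.2)); split=> //.
  by rewrite [in X in para _ X](projchartP u.2 Pl); apply: paraZ; apply: para_refl.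
- exists (fun q => projchart l q ord0 (inord 0)); split.
  + case: (unliftP l (inord 0)) => [j ->|->].
      by apply: ispoly_ext (ispoly_x K j) => q; rewrite mxE liftK.
    by apply: ispoly_ext (ispoly_c 3 1) => q; rewrite mxE unlift_none.
  + move=> t; exists (\row_i 1, t) => //; rewrite mxE.
    by case: unlift => [j|]; rewrite ?mxE oner_neq0.
  + move=> q v0; move: (projchart l q) v0 => v v0.
    exists (row3 (v ord0 (inord 1) / v ord0 (inord 0))
      (v ord0 (inord 2) / v ord0 (inord 0)) (v ord0 (inord 3) / v ord0 (inord 0)), q.2) => //.
    apply: para_sym; apply/peq_para/(@peq_of_eq _ _ _ (v ord0 (inord 0))) => //.
      by apply: (@row_neq0 _ _ (inord 0)); rewrite mxE inordK.
    have e k (hk : (k < 4)%N) : v ord0 (Ordinal hk) = v ord0 (inord k).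
      by congr (v _ _); apply: val_inj; rewrite /= inordK.
    apply/rowP => -[[|[|[|[|//]]]] hi]; rewrite !mxE /= ?row3_xc ?row3_yc ?row3_zc e.
    - by rewrite mulr1.
    - by rewrite mulrC divfK.
    - by rewrite mulrC divfK.
    - by rewrite mulrC divfK.
Qed.

Lemma xchart_at_P3 (p : pt K 4) l : p.1 ord0 l != 0 ->
  xchart_at P3 (projchart l) p l (fintype.lift l) (coords l (fintype.lift l) p).
Proof.
move=> pl; split=> //; [exact: xchart_projchart|exact: standard_projchart| |].
  apply: (@peq_of_eq _ _ _ (p.1 ord0 l)) => //; last first.
    by rewrite [p]surjective_pairing; apply: projchartP.
  by apply: (@row_neq0 _ _ l); rewrite mxE unlift_none.
by rewrite mxE unlift_none oner_neq0.
Qed.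

(** In the affine chart around (0 : 1 : 0 : 0) the three forms are the coordinates themselves: no
    coordinate is free and all units are 1. *)
Lemma center_P3 q : center_at P3 (projchart (inord 1)) P3F q.
Proof.
have u0 : unlift (inord 1 : 'I_4) (inord 0) = Some (inord 0 : 'I_3).
  rewrite (_ : inord 0 = fintype.lift (inord 1 : 'I_4) (inord 0 : 'I_3)) ?liftK //.
  by apply: val_inj; rewrite /= /bump !inordK.
have u2 : unlift (inord 1 : 'I_4) (inord 2) = Some (inord 1 : 'I_3).
  rewrite (_ : inord 2 = fintype.lift (inord 1 : 'I_4) (inord 1 : 'I_3)) ?liftK //.
  by apply: val_inj; rewrite /= /bump !inordK.
have u3 : unlift (inord 1 : 'I_4) (inord 3) = Some (inord 2 : 'I_3).
  rewrite (_ : inord 3 = fintype.lift (inord 1 : 'I_4) (inord 2 : 'I_3)) ?liftK //.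
  by apply: val_inj; rewrite /= /bump !inordK.
have FE q' a : P3F (projchart (inord 1) q', q'.2) ord0 a = q'.1 ord0 a.
  by move: a; apply: forall_I3; rewrite mxE inordK //= mxE ?u0 ?u2 ?u3.
exists finset.set0, (fun=> 0), (fun _ _ => 1), id; split.
- move=> q' h; apply/rowP => a; rewrite FE mxE h ?horner0 //.
  by rewrite finset.in_set0.
- by move=> q' a _; rewrite FE horner0 subr0 mulr1.
- by move=> a; apply: ispoly_c.
- by move=> a; rewrite oner_neq0.
Qed.

Lemma hvec_P3F : hvec 1 P3F.
Proof.
by case=> -[|[|[|//]]] hi; (eapply hpoly_ext; [move=> q; rewrite mxE /=; reflexivity|exact: hpoly_x]).
Qed.

Let sE (a b : nat) (p : pt K (3 * 7)) : K := p.1 ord0 (mxvec_index (inord a) (inord b)).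

Lemma startE (a b : nat) u : (a < 3)%N -> (b < 7)%N ->
  sE a b (tens startA startPhi u, u.2) = [:: 1; yc u; zc u]`_a *
  [:: 1; yc u * yc u; zc u * zc u; xc u; xc u * yc u; zc u * (xc u + zc u);
      xc u * zc u - a1]`_b.
Proof. by move=> ha hb; rewrite /sE /tens segreE !mxE !inordK. Qed.

(** Over the three charts of P^2 the representatives are (1 : x : y : z) multiplied by 1, y^2 and
    z^2, all linear in the Segre coordinates. *)
Lemma resolves_start_P3 : resolves (tens startA startPhi) P3.
Proof.
have pA := polyv_startA; have pPhi := polyv_startPhi.
have hs a b : hpoly 1 (sE a b) by apply: hpoly_x.
move=> p mp; have [s [w [ep ms mw]]] := model_tens mp.
have pE a b : sE a b p = s ord0 (inord a) * w ord0 (inord b) by rewrite /sE ep segreE.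
case: (start_cover (model_neq0 ms)) => [[q [si qt sq]]|[[q [si qt sq]]|[q [si qt sq]]]].
- exists (fun p => \row_i [:: sE 0 0 p; sE 0 3 p; sE 1 0 p; sE 2 0 p]`_i).
    split; first exists 1%N.
      by case=> -[|[|[|[|//]]]] hi; (eapply hpoly_ext; [move=> ?; rewrite mxE /=; reflexivity|exact: hs]).
    move=> u; rewrite (_ : (\row_i _) = P3 u); first exact: para_refl.
    by apply/rowP => -[[|[|[|[|//]]]] hi]; rewrite !mxE /= startE //=; ring.
  have := bundle_charts pA pPhi fpoly_chart0 compat_chart0 std_chart0 mp ep sq qt
    ltac:(by rewrite mxE inordK //= oner_neq0) ltac:(by rewrite mxE inordK //= oner_neq0).
  move=> [] [wj _]; [apply: (@rV_neq0 _ _ _ (inord 0))|apply: (@rV_neq0 _ _ _ (inord 1))];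
    by rewrite mxE inordK //= pE mulf_neq0.
- exists (fun p => \row_i [:: sE 0 1 p; sE 1 4 p; sE 1 1 p; sE 2 1 p]`_i).
    split; first exists 1%N.
      by case=> -[|[|[|[|//]]]] hi; (eapply hpoly_ext; [move=> ?; rewrite mxE /=; reflexivity|exact: hs]).
    move=> u; rewrite (_ : (\row_i _) = (yc u * yc u) *: P3 u).
      by apply: para_sym; apply: paraZ; apply: para_refl.
    by apply/rowP => -[[|[|[|[|//]]]] hi]; rewrite !mxE /= startE //=; ring.
  have := bundle_charts pA pPhi fpoly_charty (schart_compat schart_y) std_charty mp ep sq qt
    ltac:(by rewrite mxE inordK //= oner_neq0) ltac:(by rewrite mxE inordK //= oner_neq0).
  move=> [] [wj _]; [apply: (@rV_neq0 _ _ _ (inord 2))|apply: (@rV_neq0 _ _ _ (inord 1))];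
    by rewrite mxE inordK //= pE mulf_neq0.
(* The second entry is z times z(x + z) minus z times z^2, that is x z^2. *)
- exists (fun p => \row_i [:: sE 0 2 p; sE 2 5 p - sE 2 2 p; sE 1 2 p; sE 2 2 p]`_i).
    split; first exists 1%N.
      by case=> -[|[|[|[|//]]]] hi; (eapply hpoly_ext; [move=> ?; rewrite mxE /=; reflexivity|]);
        [exact: hs|exact: hpolyB|exact: hs|exact: hs].
    move=> u; rewrite (_ : (\row_i _) = (zc u * zc u) *: P3 u).
      by apply: para_sym; apply: paraZ; apply: para_refl.
    by apply/rowP => -[[|[|[|[|//]]]] hi]; rewrite !mxE /= !startE //=; ring.
  have := bundle_charts pA pPhi fpoly_chartz (schart_compat schart_z) std_chartz mp ep sq qt
    ltac:(by rewrite mxE inordK //= oner_neq0) ltac:(by rewrite mxE inordK //= oner_neq0).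
  move=> [] [wj _]; first by apply: (@rV_neq0 _ _ _ (inord 3)); rewrite mxE inordK //= pE mulf_neq0.
  apply/eqP => /rowP h; have := h (inord 1); have := h (inord 3).
  rewrite !mxE !inordK //= => ->; rewrite subr0 pE => /eqP.
  by rewrite mulf_eq0 (negbTE si) (negbTE wj).
Qed.

Let tE (a b : nat) (p : pt K (4 * 3)) : K := p.1 ord0 (mxvec_index (inord a) (inord b)).

Lemma P3E (a b : nat) u : (a < 4)%N -> (b < 3)%N ->
  tE a b (tens P3 startA u, u.2) = [:: 1; xc u; yc u; zc u]`_a * [:: 1; yc u; zc u]`_b.
Proof. by move=> ha hb; rewrite /tE /tens segreE !mxE !inordK. Qed.

(** The entries of [startPhi] are combinations of products of a coordinate of P^3 and one of P^2. A
    common zero on the closure is excluded by the relations s_a w_b = s_c w_d between the two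
    factors. *)
Lemma resolves_P3_start : resolves (tens P3 startA) startPhi.
Proof.
have ht a b : hpoly 1 (tE a b) by apply: hpoly_x.
move=> p mp; have [s [w [ep ms mw]]] := model_tens mp.
have pE a b : tE a b p = s ord0 (inord a) * w ord0 (inord b) by rewrite /tE ep segreE.
exists (fun p => \row_i [:: tE 0 0 p; tE 2 1 p; tE 3 2 p; tE 1 0 p; tE 1 1 p;
    tE 1 2 p + tE 3 2 p; tE 1 2 p - a1 * tE 0 0 p]`_i).
  split; first exists 1%N.
    case=> -[|[|[|[|[|[|[|//]]]]]]] hi; (eapply hpoly_ext; [move=> ?; rewrite mxE /=; reflexivity|]);
      [exact: ht|exact: ht|exact: ht|exact: ht|exact: ht|exact: hpolyD|apply: hpolyB => //].
    by apply: (@hpolyM K (4 * 3) 0 1) => //; exact: hpoly_c.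
  move=> u; rewrite (_ : (\row_i _) = startPhi u); first exact: para_refl.
  by apply/rowP => -[[|[|[|[|[|[|[|//]]]]]]] hi]; rewrite !mxE /= !P3E //=; ring.
apply/eqP => /rowP h.
have h0 := h (inord 0); have h1 := h (inord 1); have h2 := h (inord 2).
have h3 := h (inord 3); have h4 := h (inord 4); have h5 := h (inord 5).
move: h0 h1 h2 h3 h4 h5; rewrite !mxE !inordK //= !pE => h0 h1 h2 h3 h4 h5.
have h6 : s ord0 (inord 1) * w ord0 (inord 2) = 0 by move: h5; rewrite h2 addr0.
have w0 := model_neq0 mw; have s0 := model_neq0 ms.
have sx : s ord0 (inord 1) = 0.
  apply/eqP/negPn/negP => sx; case/eqP: w0; apply/rowP; apply: forall_I3; rewrite mxE;
    by apply: (mulfI sx); rewrite mulr0.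
have rel (a b c d : nat) : (a < 4)%N -> (b < 3)%N -> (c < 4)%N -> (d < 3)%N ->
    (forall u : pt K 3, [:: 1; xc u; yc u; zc u]`_a * [:: 1; yc u; zc u]`_b =
       [:: 1; xc u; yc u; zc u]`_c * [:: 1; yc u; zc u]`_d) ->
    s ord0 (inord a) * w ord0 (inord b) = s ord0 (inord c) * w ord0 (inord d).
  move=> ha hb hc hd e; rewrite -!pE; apply/eqP; rewrite -subr_eq0; apply/eqP.
  apply: (model_vanish (hpolyB (ht a b) (ht c d)) _ mp) => u.
  rewrite (P3E u ha hb) (P3E u hc hd); apply/eqP; rewrite subr_eq0; apply/eqP; exact: e.
have r1 := rel 0 1 2 0 isT isT isT isT (fun u => mulrC _ _).
have r2 := rel 0 2 3 0 isT isT isT isT (fun u => mulrC _ _).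
have r3 := rel 2 2 3 1 isT isT isT isT (fun u => mulrC _ _).
have sq0 (x : K) : x * x = 0 -> x = 0 by move/eqP; rewrite mulf_eq0 orbb => /eqP.
have sz : s = 0.
  have k0 : s ord0 (inord 0) = 0.
    apply/eqP/negPn/negP => sx0.
    have w00 : w ord0 (inord 0) = 0 by apply: (mulfI sx0); rewrite h0 mulr0.
    case/eqP: w0; apply/rowP; apply: forall_I3; rewrite mxE //; apply: (mulfI sx0);
      by rewrite mulr0 ?r1 ?r2 w00 mulr0.
  have k2 : s ord0 (inord 2) = 0.
    apply/eqP/negPn/negP => sx0.
    have w00 : w ord0 (inord 1) = 0 by apply: (mulfI sx0); rewrite h1 mulr0.
    case/eqP: w0; apply/rowP; apply: forall_I3; rewrite mxE //; apply: (mulfI sx0);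
      by rewrite mulr0 -?r1 ?r3 ?k0 ?w00 ?mul0r ?mulr0.
  have k3 : s ord0 (inord 3) = 0.
    apply/eqP/negPn/negP => sx0.
    have w00 : w ord0 (inord 2) = 0 by apply: (mulfI sx0); rewrite h2 mulr0.
    case/eqP: w0; apply/rowP; apply: forall_I3; rewrite mxE //; apply: (mulfI sx0);
      by rewrite mulr0 -?r2 -?r3 ?k0 ?k2 ?w00 ?mul0r ?mulr0.
  apply/rowP => -[[|[|[|[|//]]]] hi]; rewrite mxE.
  - by rewrite -k0; congr (s _ _); apply: val_inj; rewrite /= inordK.
  - by rewrite -sx; congr (s _ _); apply: val_inj; rewrite /= inordK.
  - by rewrite -k2; congr (s _ _); apply: val_inj; rewrite /= inordK.
  - by rewrite -k3; congr (s _ _); apply: val_inj; rewrite /= inordK.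
by rewrite sz eqxx in s0.
Qed.

Lemma affine_chart_P3 : affine_chart P3.
Proof.
move=> u; exists (inord 0), (fintype.lift (inord 0)); split; last first.
  by rewrite mxE inordK //= oner_neq0.
move=> q; apply: forall_I3; rewrite !mxE /bump !inordK //= /bump !inordK //=;
  by rewrite mulr1.
Qed.

Lemma modification_start : modification (tens startA startPhi).
Proof.
have cS := affineS_start; have [A0 Phi0] := affineS_neq0 cS.
have cB := affineS_chart cS; have pB := polyv_tens polyv_startA polyv_startPhi.
have P0 u : P3 u != 0 := affine_chart_neq0 u affine_chart_P3.
have B0 u := affine_chart_neq0 u cB.
have FE : (fun u : pt K 3 => P3F (P3 u, u.2)) = startA by apply/funext => u; exact: P3F_P3.
have FB0 u : P3F (P3 u, u.2) != 0 by rewrite P3F_P3.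
have [b hb] := res_mapP P0 resolves_start_P3.
apply: (modification_blowup pB affine_chart_P3 cB resolves_start_P3 hb) => //; last first.
  exact: modification_P3.
apply: (@is_blowup_model K 3 _ _ _ P3 P3F polyv_P3 P0 hvec_P3F FB0) => //.
- move=> p /model_neq0/rV_neq0P[l pl]; exists (projchart l), l, (fintype.lift l).
  by exists (coords l (fintype.lift l) p); apply: xchart_at_P3.
- move=> p mp /rowP Fp.
  have p1 : p.1 ord0 (inord 1) != 0.
    apply: contra_neq (model_neq0 mp) => p1; apply/rowP => -[[|[|[|[|//]]]] hi]; rewrite mxE.
    + have := Fp (inord 0); rewrite !mxE inordK //= => <-.
      by congr (p.1 _ _); apply: val_inj; rewrite /= inordK.
    + by rewrite -p1; congr (p.1 _ _); apply: val_inj; rewrite /= inordK.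
    + have := Fp (inord 1); rewrite !mxE inordK //= => <-.
      by congr (p.1 _ _); apply: val_inj; rewrite /= inordK.
    + have := Fp (inord 2); rewrite !mxE inordK //= => <-.
      by congr (p.1 _ _); apply: val_inj; rewrite /= inordK.
  exists (projchart (inord 1)), (inord 1), (fintype.lift (inord 1)).
  exists (coords (inord 1) (fintype.lift (inord 1)) p); split; first exact: xchart_at_P3.
  exact: center_P3.
- rewrite FE; apply: resolves_pair; first exact: resolves_start_P3.
  exact: resolves_tensl.
- rewrite FE; apply: resolves_pair; first exact: resolves_tensr.
  exact: resolves_P3_start.
Qed.

Lemma sstate_start : sstate startA startPhi startO.
Proof.
split; split.
- exact: polyv_startA.
- exact: polyv_startPhi.
- exact: affineS_start.
- exact: bcovered_start.
- exact: modification_start.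
- exact: startO_peq.
- by move=> v t h; apply: rV_neq0 h.
- exact: startO_A.
Qed.
End Start.

(** * The three chains at infinity *)

Section PhaseSpace.
Variable K : numClosedFieldType.
Variables a1 a2 a3 : K.

Lemma nchart_ext N M (A : pt K 3 -> 'rV[K]_N) (Phi : pt K 3 -> 'rV[K]_M) O D G V
    (dom : set (pt K 3)) chi xi chi' xi' :
  (forall u, dom u -> chi u = chi' u) -> (forall u, dom u -> xi u = xi' u) ->
  nchart A Phi O D G V dom chi xi -> nchart A Phi O D G V dom chi' xi'.
Proof.
move=> ec ex [h [hw hf hs]]; split=> //; split=> // [u du|q x Vq].
  by rewrite -ec // -ex //; apply: hf.
by have [u [du e1 e2]] := hs q x Vq; exists u; rewrite -ec // -ex.
Qed.

Definition chi6 (u : pt K 3) : pt K 2 :=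
  (row2 (1 / yc u) ((yc u * zc u - a3) * yc u), u.2).
Definition chi2 (u : pt K 3) : pt K 2 :=
  (row2 (1 / zc u) ((yc u * zc u + a2) * zc u), u.2).
Definition chi4 (u : pt K 3) : pt K 2 :=
  (row2 (1 / zc u) (((yc u + zc u - u.2) * zc u + 1 - a2 - a3) * zc u), u.2).

Let zero2 : set (pt K 2) := [set q | k1 q = 0].
Let nz2 : set (pt K 2) := [set q | k1 q != 0].

Lemma phase_space : exists N M (A : pt K 3 -> 'rV[K]_N) (Phi : pt K 3 -> 'rV[K]_M) O
    (D0 D2 D4 D6 : fdata K N M),
  [/\ sstate A Phi O,
      nchart A Phi O D0 setT setT setT (@chi0 K) (@xc K),
      nchart A Phi O D2 zero2 nz2 [set u | zc u != 0] chi2 (fun u => xc u + zc u),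
      nchart A Phi O D4 zero2 nz2 [set u | zc u != 0] chi4
        (fun u => (xc u * zc u - a1) * zc u) &
      nchart A Phi O D6 zero2 nz2 [set u | yc u != 0] chi6 (@xc K)] /\
  forall s, model A s -> O s ->
    (exists q, q.2 = s.2 /\ peq s.1 (fE D0 q)) \/
    exists q, [/\ q.2 = s.2, k1 q = 0 &
      [\/ peq s.1 (fE D2 q), peq s.1 (fE D4 q) | peq s.1 (fE D6 q)]].
Proof.
(* Subtracting the centres 0, 0, a3 and dividing each time by 1/y turns z/y into z, yz and (yz -
   a3)y; one elementary transformation turns x/y into x. *)
have [N1 [M1 [A1 [Phi1 [U1 [D6 [L1 [Tm1 [st1 n6 tr1 hb1 cov1]]]]]]]]] :=
  tower 0 a3%:P 1 (sstate_start a1) (schart_y a1)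
    (fun t => goodat_charty a1 (row2 0 (0 : {poly K}).[t], t)).
have n01 := nchart_transform tr1 hb1 (nchart0 a1).
have [[_ _ tg1 _] [_ tp1]] := tr1.
(* The chains start at the distinct points (0 : 1 : 0), (0 : 0 : 1) and (0 : -1 : 1) of the line at
   infinity of P^2, so each of them leaves the frames at the starting points of the next ones
   good. *)
have gz t : goodat (Tm1 (pred1 (inord 5))) (L1 (chartz a1)) (row2 0 (0 : {poly K}).[t], t).
  apply: tg1; first exact: goodat_chartz.
  move=> /peq_sym/peqP[_ [c c0 /rowP /(_ (inord 2))]].
  by rewrite !mxE !inordK //= row2_k2 horner0 mulr0 => /eqP; rewrite oner_eq0.
(* The centres 0, 0, -a2 turn y/z into y, yz and (yz + a2)z, and the fibre coordinate (x + z)/z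
   becomes x + z. *)
have [N2 [M2 [A2 [Phi2 [U2 [D2 [L2 [Tm2 [st2 n2 tr2 hb2 cov2]]]]]]]]] :=
  tower 0 (- a2)%:P 1 st1 (schart_transform tr1 (schart_z a1)) gz.
have n02 := nchart_transform tr2 hb2 n01; have n62 := nchart_transform tr2 hb2 n6.
have [[_ _ tg2 _] [_ tp2]] := tr2.
have gw t : goodat (Tm2 (Tm1 (pred1 (inord 6)))) (L2 (L1 (chartw a1)))
    (row2 0 (- 1)%:P.[t], t).
  apply: tg2; first apply: tg1; first exact: goodat_chartw.
    move=> /peq_sym/peqP[_ [c c0 /rowP /(_ (inord 2))]].
    by rewrite !mxE !inordK //= row2_k2 horner0 mulr0 => /eqP; rewrite oner_eq0.
  move=> /tp1 h; have /peq_sym/peqP[_ [c c0 /rowP /(_ (inord 1))]] := h erefl.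
  rewrite !mxE !inordK //= !row2_k2 horner0 hornerC mulr0 => /eqP.
  by rewrite oppr_eq0 oner_eq0.
(* The centres -1, t, -(1 - a2 - a3) turn y/z into y + z, (y + z - t)z and ((y + z - t)z + 1 - a2 -
   a3)z. The fibre coordinate (xz - a1)/z^2 has to be divided by z^{-3} to give (xz - a1)z. *)
have [N3 [M3 [A3 [Phi3 [U3 [D4 [L3 [Tm3 [st3 n4 tr3 hb3 cov3]]]]]]]]] :=
  tower 'X (- (1 - a2 - a3))%:P 3 st2
    (schart_transform tr2 (schart_transform tr1 (schart_w a1))) gw.
have n03 := nchart_transform tr3 hb3 n02; have n63 := nchart_transform tr3 hb3 n62.
have n23 := nchart_transform tr3 hb3 n2.
exists N3, M3, A3, Phi3, U3, (L3 (L2 (L1 (chart0 a1)))), (L3 D2), D4, (L3 (L2 D6)).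
split; first split=> //.
- apply: nchart_ext n23 => u /= z0; last by rewrite row2_k1 expr1; field.
  apply: pt2P; rewrite /= ?row2_k1 ?row2_k2 //= ?row2_k1 ?row2_k2 ?hornerC ?horner0 //=; by field.
- apply: nchart_ext n4 => u /= z0; last by rewrite row2_k1; field.
  apply: pt2P; rewrite /= ?row2_k1 ?row2_k2 //= ?row2_k1 ?row2_k2 ?hornerC ?hornerX //=; by field.
- apply: nchart_ext n63 => u /= z0; last by rewrite row2_k1 expr1; field.
  apply: pt2P; rewrite /= ?row2_k1 ?row2_k2 //= ?row2_k1 ?row2_k2 ?hornerC ?horner0 //=; by field.
- move=> s ms Os; case: (cov3 s ms Os) => [[q [qt k0 e]]|[s2 [ms2 s2t Os2 h3]]].
    by right; exists q; split=> //; apply: Or32.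
  case: (cov2 s2 ms2 Os2) => [[q [qt k0 e]]|[s1 [ms1 s1t Os1 h2]]].
    by right; exists q; split; [rewrite -s2t|by []|apply: Or31; apply: h3].
  case: (cov1 s1 ms1 Os1) => [[q [qt k0 e]]|[s0 [ms0 s0t Os0 h1]]].
    right; exists q; split; [by rewrite -s2t -s1t|by []|apply: Or33].
    by apply: h3; rewrite ?qt ?s1t //; apply: h2.
  left; case: (start_cover a1 (model_neq0 ms0)) => [[q [_ qt e]]|h].
    exists q; split; first by rewrite qt s0t s1t.
    by apply: h3; rewrite ?qt ?s0t ?s1t //; apply: h2; rewrite ?qt ?s0t //; apply: h1.
  have x0 : s0.1 ord0 (inord 0) != 0 := Os0.
  exists (row2 (s0.1 ord0 (inord 1) / s0.1 ord0 (inord 0))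
    (s0.1 ord0 (inord 2) / s0.1 ord0 (inord 0)), s0.2); split=> /=; first by rewrite s0t s1t.
  have e : peq s0.1 (fE (chart0 a1) (row2 (s0.1 ord0 (inord 1) / s0.1 ord0 (inord 0))
    (s0.1 ord0 (inord 2) / s0.1 ord0 (inord 0)), s0.2)).
    apply: (@peq_of_eq _ _ _ _ (s0.1 ord0 (inord 0))) => //.
      by apply: (@row_neq0 _ _ _ (inord 0)); rewrite mxE inordK.
    apply/rowP; apply: forall_I3; rewrite !mxE inordK //= ?row2_k1 ?row2_k2 ?mulr1 //;
      by rewrite mulrC divfK.
  apply: h3; first by rewrite /= s0t s1t.
  by apply: h2; [rewrite /= s0t|exact: h1].
Qed.
End PhaseSpace.

(** * Atlases: local inverses of charts and identities on overlaps *)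

Section Atlas.
Variable K : numClosedFieldType.

(** Ratios G/H of forms of degree m are handled by homogenizing in independent variables (H, G) and
    substituting afterwards; the identity remains valid where H vanishes. *)
Lemma homogenize_forms n N m (I : finType) (f : I -> pt K n -> K)
    (G : 'I_n -> pt K N -> K) (H : pt K N -> K) :
  (forall i, ispoly (f i)) -> (forall a, hpoly m (G a)) -> hpoly m H ->
  exists D (R : I -> pt K N -> K), (forall i, hpoly D (R i)) /\
    exists e, forall i q, R i q = H q ^+ e * f i (\row_a (G a q / H q), q.2).
Proof.
move=> fp hG hH.
have [D [R [hR RE]]] := homogenize_family fp
  (fun a => hpoly_x K (fintype.lift ord0 a)) (hpoly_x K (ord0 : 'I_n.+1)).
pose V (q : pt K N) : 'rV[K]_n.+1 := \row_i (if unlift ord0 i is Some a then G a q else H q).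
have hV : hvec m V.
  move=> i; case: (unliftP ord0 i) => [a ->|->].
    by apply: hpoly_ext (hG a) => q; rewrite mxE liftK.
  by apply: hpoly_ext hH => q; rewrite mxE unlift_none.
exists (D * m)%N, (fun i q => R i (V q, q.2)); split=> [i|].
  exact: hpoly_comp (hR i) hV.
exists D => i q; rewrite RE /= mxE unlift_none; congr (_ * f i (_, _)).
by apply/rowP => a; rewrite !mxE liftK.
Qed.

(** A local inverse near the point of parameter c, by forms of any degree. It generalizes
    [standard], which the frames provide for most charts only along the exceptional line. *)
Definition regular_inverse N (P : pt K 3 -> 'rV[K]_N) (c : pt K 3) : Prop :=
  exists m (G : 'I_3 -> pt K N -> K) (H : pt K N -> K),
  [/\ forall a, hpoly m (G a), hpoly m H, H (P c, c.2) != 0 &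
      forall q a, G a (P q, q.2) = q.1 ord0 a * H (P q, q.2)].

Section Charts.
Variables (N : nat) (B : pt K 3 -> 'rV[K]_N).
Hypotheses (pB : polyv B) (B0 : forall u, B u != 0).

Definition achart (P : pt K 3 -> 'rV[K]_N) (dom : set (pt K 3))
    (chi : pt K 3 -> 'rV[K]_3) : Prop :=
  [/\ xchart B P, forall q, P q != 0,
      exists w, [/\ ispoly w, exists u, w u != 0 & forall u, w u != 0 -> dom u],
      forall u, dom u -> peq (B u) (P (chi u, u.2)) &
      forall c, regular_inverse P c].

Lemma frac_inverse m (P : pt K 3 -> 'rV[K]_N) (G : 'I_3 -> pt K N -> K) H v c :
  (forall a, hpoly m (G a)) -> hpoly m H ->
  (forall q a, G a (P q, q.2) = q.1 ord0 a * H (P q, q.2)) ->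
  peq v (P c) -> H (v, c.2) != 0 ->
  (\row_a (G a (v, c.2) / H (v, c.2))) = c.1.
Proof.
move=> hG hH e /peq_sym/peqP[_ [k k0 ->]] H0; apply/rowP => a; rewrite mxE.
move: H0; rewrite (hpoly_scale _ _ _ (hG a)) (hpoly_scale _ _ _ hH) e.
rewrite mulf_eq0 negb_or => /andP[h1 h2].
by rewrite mulrCA mulfK // mulf_neq0.
Qed.

Lemma local_inverse m (P : pt K 3 -> 'rV[K]_N) (G : 'I_3 -> pt K N -> K) H p :
  xchart B P -> (forall q, P q != 0) -> (forall a, hpoly m (G a)) -> hpoly m H ->
  (forall q a, G a (P q, q.2) = q.1 ord0 a * H (P q, q.2)) ->
  model B p -> H p != 0 -> peq p.1 (P (\row_a (G a p / H p), p.2)).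
Proof.
move=> [pP [w [pw nw wP]] _] P0 hG hH e mp Hp.
have [D [R [hR [k RE]]]] := homogenize_forms pP hG hH.
apply: para_peq => //; first exact: model_neq0 mp.
move=> i j.
pose g (p : pt K N) := H p * (p.1 ord0 i * R j p - p.1 ord0 j * R i p).
have hg : hpoly (m + (1 + D)) g.
  by apply: hpolyM => //; apply: hpolyB; apply: hpolyM => //; apply: hpoly_x.
have g0 u : g (B u, u.2) = 0.
  apply: (@density_all _ _ (fun u => g (B u, u.2)) w) => // [|v wv].
    exact: (ispoly_comp (hpoly_ispoly hg)).
  rewrite /g /=; case: (eqVneq (H (B v, v.2)) 0) => [->|Bl]; first by rewrite mul0r.
  have [q [qt Pq ePB]] := wP v wv.
  have ePq : peq (B v) (P q) by apply: para_peq => //; apply: para_sym.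
  have -> : R i (B v, v.2) = H (B v, v.2) ^+ k * P q ord0 i.
    by rewrite RE /= -qt (frac_inverse hG hH e) ?qt // -qt -surjective_pairing.
  have -> : R j (B v, v.2) = H (B v, v.2) ^+ k * P q ord0 j.
    by rewrite RE /= -qt (frac_inverse hG hH e) ?qt // -qt -surjective_pairing.
  have := peq_para ePq; move=> /(_ i j) h.
  rewrite (mulrCA (B v ord0 i)) (mulrCA (B v ord0 j)) -mulrBr h subrr !mulr0 //.
have := model_vanish hg g0 mp.
rewrite /g !RE => /eqP; rewrite mulf_eq0 (negbTE Hp) /= subr_eq0 => /eqP.
rewrite !(mulrCA _ (_ ^+ _)); apply: mulfI.
by rewrite expf_neq0.
Qed.

(** The coordinates [chi] are not polynomial in u, so density does not apply on C^3 directly: the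
    identity is turned into a form on the closure by a local inverse, tested on the image of [B],
    and brought back to the chart. *)
Lemma density_chart P dom chi (f w : pt K 3 -> K) :
  achart P dom chi -> ispoly f -> ispoly w -> (exists u, w u != 0) ->
  (forall u, dom u -> w u != 0 -> f (chi u, u.2) = 0) -> forall q, f q = 0.
Proof.
move=> [xP P0 [w' [pw' nw' wd]] hB hR] pf pw nw h q.
have [pP _ _] := xP; have [m [G [H [hG hH Hc e]]]] := hR (0, 0).
have [D [R [hR' [k RE]]]] := homogenize_forms (fun _ : 'I_1 => pf) hG hH.
have RP q' : R ord0 (P q', q'.2) = 0 \/ H (P q', q'.2) = 0.
  case: (eqVneq (H (P q', q'.2)) 0) => [->|Hq]; [by right|left].
  pose F p := H p * R ord0 p.
  have hF : hpoly (m + D) F by apply: hpolyM.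
  have F0 u : F (B u, u.2) = 0.
    apply: (@density_all _ _ (fun u => F (B u, u.2)) (fun u => w' u * w u)).
    - exact: (ispoly_comp (hpoly_ispoly hF)).
    - exact: ispolyM.
    - exact: nonzero_mul.
    move=> v; rewrite mulf_eq0 negb_or => /andP[/wd dv wv]; rewrite /F.
    case: (eqVneq (H (B v, v.2)) 0) => [->|Hv]; first by rewrite mul0r.
    rewrite RE /= -[X in f (_, X)]/((chi v, v.2).2).
    have := frac_inverse hG hH e (c := (chi v, v.2)) (hB v dv) Hv => /= ->.
    by rewrite (h v dv wv) !mulr0.
  have := model_vanish hF F0 (xchart_model xP B0 (P0 q')).
  by rewrite /F => /eqP; rewrite mulf_eq0 (negbTE Hq) => /eqP.
apply: (@density_all _ _ f (fun q => H (P q, q.2)) pf).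
- exact: (ispoly_comp (hpoly_ispoly hH)).
- by exists (0, 0).
move=> q' Hq; case: (RP q') => [|h0]; last by rewrite h0 eqxx in Hq.
rewrite RE /= (frac_inverse hG hH e) //; last exact: peq_refl.
rewrite -surjective_pairing => /eqP.
by rewrite mulf_eq0 expf_eq0 (negbTE Hq) andbF /= => /eqP.
Qed.

Section TwoCharts.
Variables (Pi Pj : pt K 3 -> 'rV[K]_N) (di dj : set (pt K 3)).
Variables (ci cj : pt K 3 -> 'rV[K]_3).
Hypotheses (hi : achart Pi di ci) (hj : achart Pj dj cj).

Lemma charts_peq u : di u -> dj u -> peq (Pi (ci u, u.2)) (Pj (cj u, u.2)).
Proof.
have [_ _ _ h _] := hi; have [_ _ _ h' _] := hj.
by move=> /h e /h'; apply: peq_trans; apply: peq_sym.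
Qed.

(** Identities between the coordinates of two charts extend from C^3 to all pairs of parameters with
    the same image. Points are later proved distinct by an identity whose two sides would differ
    there. *)
Lemma overlap_identity f g h p q : ispoly f -> ispoly g -> ispoly h ->
  (forall u, di u -> dj u -> f (ci u, u.2) * g (cj u, u.2) = h (ci u, u.2)) ->
  p.2 = q.2 -> peq (Pi p) (Pj q) -> f p * g q = h p.
Proof.
move=> pf pg ph id pq e.
have [[pP _ _] _ _ _ _] := hi; have [xj Pj0 [w [pw nw wd]] _ Rj] := hj.
have [m [G [H [hG hH Hc eG]]]] := Rj q.
have [D [R [hR [k RE]]]] := homogenize_forms (fun _ : 'I_1 => pg) hG hH.
have pH : ispoly (fun a => H (Pi a, a.2)) by apply: (ispoly_comp (hpoly_ispoly hH)).
have pR : ispoly (fun a => R ord0 (Pi a, a.2)).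
  exact: (ispoly_comp (hpoly_ispoly (hR ord0))).
pose F a := H (Pi a, a.2) * (f a * R ord0 (Pi a, a.2) - h a * H (Pi a, a.2) ^+ k).
have pHk j : ispoly (fun a => H (Pi a, a.2) ^+ j).
  elim: j => [|j IH]; first by apply: ispoly_ext (ispoly_c _ 1) => x; rewrite expr0.
  by apply: (ispoly_ext _ (ispolyM pH IH)) => x; rewrite exprS.
have F0 := @density_chart _ _ _ F w hi _ pw nw _ p.
have Hp : H (Pi p, p.2) != 0.
  have /peqP[_ [c c0 ->]] := peq_sym e.
  by rewrite pq (hpoly_scale _ _ _ hH) mulf_neq0 ?expf_neq0.
have := F0 _ _; rewrite /F.
have eR : R ord0 (Pi p, p.2) = H (Pi p, p.2) ^+ k * g q.
  by rewrite RE /= pq (frac_inverse hG hH eG e) -?pq // pq -surjective_pairing.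
rewrite eR => /(_ _ _)/eqP; rewrite mulf_eq0 (negbTE Hp) /= mulrCA [h p * _]mulrC -mulrBr.
rewrite mulf_eq0 expf_eq0 (negbTE Hp) andbF /= subr_eq0 => h1.
apply/eqP; apply: h1.
- apply: ispolyM => //; apply: ispolyB; apply: ispolyM => //; exact: pHk.
- move=> u du /wd du'; case: (eqVneq (H (Pi (ci u, u.2), u.2)) 0) => [->|Hu].
    by rewrite mul0r.
  rewrite RE /=.
  have /= -> := frac_inverse hG hH eG (charts_peq du du') Hu.
  by rewrite mulrCA id // [h _ * _]mulrC subrr mulr0.
Qed.

(** The transition map is [Pi] followed by the local inverse of [Pj]. *)
Lemma transition_regular p q : p.2 = q.2 -> peq (Pi p) (Pj q) ->
  exists (G : 'I_3 -> rpoly K 3) H, [/\ peval H p != 0, fracv G H p = q.1 &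
    forall u, di u -> dj u -> peval H (ci u, u.2) != 0 ->
      fracv G H (ci u, u.2) = cj u].
Proof.
move=> pq e; have [[pP _ _] _ _ _ _] := hi; have [_ _ _ _ Rj] := hj.
have [m [G [H [hG hH Hc eG]]]] := Rj q.
have pH : ispoly (fun a => H (Pi a, a.2)) by apply: (ispoly_comp (hpoly_ispoly hH)).
have pG a : ispoly (fun c => G a (Pi c, c.2)).
  exact: (ispoly_comp (hpoly_ispoly (hG a))).
have [H' H'E] := pH; have /choice[G' G'E] := pG.
have fE c : fracv G' H' c = \row_a (G a (Pi c, c.2) / H (Pi c, c.2)).
  by apply/rowP => a; rewrite !mxE -G'E -H'E.
have Hp : H (Pi p, p.2) != 0.
  have /peqP[_ [c c0 ->]] := peq_sym e.
  by rewrite pq (hpoly_scale _ _ _ hH) mulf_neq0 ?expf_neq0.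
exists G', H'; split.
- by rewrite -H'E.
- by rewrite fE pq (frac_inverse hG hH eG e) // -pq.
- move=> u du du'; rewrite fE -H'E => Hu.
  exact: (frac_inverse hG hH eG (charts_peq du du') Hu).
Qed.

(** The two parametrizations are proportional on C^3, and this condition, cleared of the denominator
    H, is polynomial in the chart. So the rational transition map identifies points wherever it is
    defined. *)
Lemma transition_peq (G : 'I_3 -> rpoly K 3) H p :
  (forall u, di u -> dj u -> peval H (ci u, u.2) != 0 ->
     fracv G H (ci u, u.2) = cj u) ->
  peval H p != 0 -> peq (Pi p) (Pj (fracv G H p, p.2)).
Proof.
move=> id Hp; have [[pP _ _] Pi0 _ _ _] := hi.
have [[pPj _ _] Pj0 [w [pw nw wd]] _ _] := hj.
apply: para_peq => // a b.
(* The forms are taken on P^4, at the point (H : G). *)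
pose V (c : pt K 3) : 'rV[K]_4 :=
  \row_i (if unlift ord0 i is Some a then peval (G a) c else peval H c).
have pV : polyv V.
  move=> i; case: (unliftP ord0 i) => [j ->|->].
    by exists (G j) => q; rewrite mxE liftK.
  by exists H => q; rewrite mxE unlift_none.
have [D [R [hR RE]]] := homogenize_family pPj
  (fun a => hpoly_x K (fintype.lift ord0 a)) (hpoly_x K (ord0 : 'I_4)).
have RV i c : R i (V c, c.2) = peval H c ^+ D * Pj (fracv G H c, c.2) ord0 i.
  rewrite RE /= mxE unlift_none; congr (_ * Pj (_, _) _ _).
  by apply/rowP => j; rewrite !mxE liftK.
have pR i : ispoly (fun c => R i (V c, c.2)).
  exact: (ispoly_comp (hpoly_ispoly (hR i))).
pose F c := peval H c * (Pi c ord0 a * R b (V c, c.2) - Pi c ord0 b * R a (V c, c.2)).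
have : F p = 0.
  apply: (@density_chart _ _ _ F w hi) => //.
    apply: ispolyM; first by exists H.
    by apply: ispolyB; apply: ispolyM.
  move=> u du /wd du'; rewrite /F; case: (eqVneq (peval H (ci u, u.2)) 0) => [->|Hu].
    by rewrite mul0r.
  rewrite !RV id //; have := peq_para (charts_peq du du') => /(_ a b) h.
  by rewrite !(mulrCA (Pi _ _ _)) -mulrBr h subrr !mulr0.
rewrite /F !RV => /eqP; rewrite mulf_eq0 (negbTE Hp) /= !(mulrCA (Pi _ _ _)) -mulrBr.
by rewrite mulf_eq0 expf_eq0 (negbTE Hp) andbF /= subr_eq0 => /eqP.
Qed.

End TwoCharts.
End Charts.
End Atlas.

(** * The family, its boundary and the phase space *)

Section Geometry.
Variable K : numClosedFieldType.

Lemma zopen_local N (X U : set (pt K N)) : U `<=` X -> (forall q, X q -> q.1 != 0) ->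
  (forall p, U p -> exists d h, [/\ hpoly d h, h p != 0 & forall q, X q -> h q != 0 -> U q]) ->
  zopen_in X U.
Proof.
move=> UX X0 h.
exists [set q : pt K N | q.1 != 0 /\ forall i : {dh : nat * (pt K N -> K) |
    hpoly dh.1 dh.2 /\ forall q, X q -> dh.2 q != 0 -> U q}, (sval i).2 q = 0].
  by apply: (zclosed_hpoly (d := fun i => (sval i).1)) => i; have [] := svalP i.
apply/seteqP; split=> [p Up|p [Xp np]].
  split; first exact: UX.
  have [d [g [hg gp gU]]] := h p Up => -[_ /(_ (exist _ (d, g) (conj hg gU)))] /= e.
  by rewrite e eqxx in gp.
apply: contrapT => nU; apply: np; split; first exact: X0.
move=> i; have [_ gU] := svalP i; apply/eqP/negPn/negP => gp; apply: nU; exact: gU gp.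
Qed.

Section Images.
Variables (N : nat) (B : pt K 3 -> 'rV[K]_N).
Hypotheses (pB : polyv B) (B0 : forall u, B u != 0).
Variables (P : pt K 3 -> 'rV[K]_N) (dom : set (pt K 3)) (chi : pt K 3 -> 'rV[K]_3).
Hypothesis hP : achart B P dom chi.

Lemma image_model : image_over setT P `<=` model B.
Proof.
have [xP P0 _ _ _] := hP; move=> q [_ [c e]]; rewrite [q]surjective_pairing.
by apply: model_peq e _; apply: (xchart_model (q := (c, q.2)) xP B0).
Qed.

Lemma image_open : zopen_in (model B) (image_over setT P).
Proof.
have [xP P0 _ _ hR] := hP; apply: zopen_local; first exact: image_model.
  by move=> q /model_neq0.
move=> p [_ [c e]]; have [m [G [H [hG hH Hc eG]]]] := hR (c, p.2).
exists m, H; split=> //.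
  have /peqP[_ [k k0 e']] := e.
  by rewrite [p]surjective_pairing e' (hpoly_scale _ _ _ hH) mulf_neq0 ?expf_neq0.
move=> q mq Hq; split=> //; exists (\row_a (G a q / H q)).
apply: peq_sym; exact: (local_inverse pB B0 xP P0 hG hH eG mq Hq).
Qed.

Lemma chart_inj c c' t : peq (P (c, t)) (P (c', t)) -> c = c'.
Proof.
have [xP P0 _ _ hR] := hP; move=> e.
have [m [G [H [hG hH Hc eG]]]] := hR (c, t).
rewrite -[LHS]/((c, t).1) -(frac_inverse hG hH eG (peq_refl (P0 (c, t))) Hc).
apply/esym; rewrite -[LHS]/((c', t).1).
by rewrite -(frac_inverse (c := (c', t)) hG hH eG e Hc).
Qed.

(** Strata are coordinate subspaces of charts: [emb] will insert zeros and [sel] pick the free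
    coordinates. With the identity it gives the charts themselves. *)
Lemma slice_affine d (emb : 'rV[K]_d -> 'rV[K]_3) (sel : 'I_d -> 'I_3) T :
  polyv (fun q : pt K d => emb q.1) ->
  (forall c a, emb c ord0 (sel a) = c ord0 a) ->
  affine_iso T (fun q : pt K d => P (emb q.1, q.2))
    (image_over T (fun q : pt K d => P (emb q.1, q.2))).
Proof.
have [[pP _ _] P0 _ _ hR] := hP; move=> pe es; split=> //.
  move=> p Tp; have [F FE] := polyv_pevalv (polyv_comp pP pe).
  exists F; rewrite -FE; split=> [|q _ _]; first exact: P0.
  by rewrite -FE; apply: peq_refl.
have ei c c' t : peq (P (emb c, t)) (P (emb c', t)) -> c = c'.
  by move=> /chart_inj e; apply/rowP => a; rewrite -!es e.
have /choice[k kP] : forall p : pt K N, exists v : 'rV[K]_d,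
    forall c, peq (P (emb c, p.2)) p.1 -> c = v.
  move=> p; case: (pselect (exists c, peq (P (emb c, p.2)) p.1)) => [[c e]|n].
    by exists c => c' e'; apply: (ei _ _ p.2); apply: peq_trans e' (peq_sym e).
  by exists 0 => c e; case: n; exists c.
exists k; split=> [q _|p [Tp [c e]]].
  by apply/esym/kP; rewrite /=; exact: peq_refl.
have [m [G [H [hG hH Hc eG]]]] := hR (emb c, p.2).
have [H' [hH' H'E]] := hH.
have /choice[G' G'P] : forall a, exists g, homog_deg m g /\ forall q, G (sel a) q = peval g q.
  by move=> a; have [g hg ge] := hG (sel a); exists g.
exists m, G', H'; split=> [a||| q [Tq [c' e']]].
- by have [] := G'P a.
- by [].
- rewrite -H'E; have /peqP[_ [k' k0 e']] := e.
  by rewrite [p]surjective_pairing e' (hpoly_scale _ _ _ hH) mulf_neq0 ?expf_neq0.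
rewrite -H'E => Hq; rewrite -(kP q c' e'); apply/rowP => a; rewrite mxE.
have [_ <-] := G'P a; rewrite -H'E -es.
have Hq' : H (q.1, (emb c', q.2).2) != 0 by rewrite -surjective_pairing.
have := frac_inverse (c := (emb c', q.2)) hG hH eG (peq_sym e') Hq' => /= /rowP/(_ (sel a)).
by rewrite mxE -surjective_pairing.
Qed.

End Images.

Section Family.
Variables (N M : nat) (A : pt K 3 -> 'rV[K]_N) (Phi : pt K 3 -> 'rV[K]_M).
Variable O : set (pt K N).
Hypothesis hst : sstate A Phi O.

Let B := tens A Phi.

Definition phase : set (pt K (N * M)) :=
  [set p | model B p /\ exists s w, p.1 = segre s w /\ O (s, p.2)].

Lemma state_affine : affine_chart B /\ polyv B.
Proof. by have [[pA pPhi cS _ _] _] := hst; split; [exact: affineS_chart|exact: polyv_tens]. Qed.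

Lemma state_neq0 u : B u != 0.
Proof. by have [cB _] := state_affine; apply: affine_chart_neq0. Qed.

Lemma phase_segre s w t : model B (segre s w, t) -> phase (segre s w, t) <-> O (s, t).
Proof.
have [_ [Op _ _]] := hst; move=> mp; split=> [[_ [s' [w' [/= e Os]]]]|Os].
  have [h _] : peq s' s /\ peq w' w.
    by apply: segre_peq_inv; rewrite -e; apply: peq_refl; exact: model_neq0 mp.
  exact: Op h Os.
by split=> //; exists s, w.
Qed.

Lemma affine_phase : affine_part B `<=` phase.
Proof.
have [cB pB] := state_affine; have [_ [Op On OA]] := hst.
move=> p Bp; split; first exact: affine_part_model.
have [u ut /peq_sym/peqP[_ [c c0 e]]] := Bp.
exists (c *: A u), (Phi u); rewrite e /B /tens segreZl; split=> //.
rewrite -ut; apply: Op (OA u); apply: peqZ => //.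
exact: On (OA u).
Qed.

(** If neither closed set contains the fibre, two forms are nonzero somewhere on that fibre of C^3;
    by fibrewise density both are nonzero at a common point, which lies in neither set. *)
Lemma fibre_irreducible t : irreducible (fiber (model B) t).
Proof.
have [cB pB] := state_affine; have B0 := state_neq0.
have [[pA pPhi cS cov _] _] := hst; have covX := bcovered_xcharts pA pPhi cov.
split; first by exists (B (0, t), t); split=> //; apply: (model_pt (u := (0, t))).
move=> C1 C2 /zclosedP[I1 [hI1 C1E]] /zclosedP[I2 [hI2 C2E]] sub.
case: (pselect (fiber (model B) t `<=` C1)) => [|n1]; [by left|right].
case: (pselect (fiber (model B) t `<=` C2)) => // n2; exfalso.
have wit (C : set (pt K (N * M))) (I : nat -> (pt K (N * M) -> K) -> Prop) :
    (forall d g, I d g -> hpoly d g) ->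
    (forall q, C q <-> q.1 != 0 /\ forall d g, I d g -> g q = 0) ->
    ~ fiber (model B) t `<=` C ->
    exists d g, [/\ I d g, hpoly d g & exists2 u : pt K 3, u.2 = t & g (B u, u.2) != 0].
  move=> hI CE nC; apply: contrapT => h; apply: nC => p [mp pt]; apply/CE.
  split; first exact: model_neq0 mp.
  move=> d g Ig; have hg := hI d g Ig.
  have [P [l [idx [q [xP _ qt pq _]]]]] := covX p mp.
  have g0 u : u.2 = t -> g (B u, u.2) = 0.
    move=> ut; apply/eqP/negPn/negP => gu; apply: h; exists d, g; split=> //.
    by exists u.
  have := xchart_vanish_fiber xP B0 hg g0 (q := q); rewrite qt => /(_ pt) e.
  have /peqP[_ [c c0 ep]] := peq_sym pq.
  by rewrite [p]surjective_pairing ep (hpoly_scale _ _ _ hg) e mulr0.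
have [d1 [g1 [I1g hg1 w1]]] := wit _ _ hI1 C1E n1.
have [d2 [g2 [I2g hg2 w2]]] := wit _ _ hI2 C2E n2.
have [u ut] := nonzero_fiber_mul (ispoly_comp (hpoly_ispoly hg1) pB)
  (ispoly_comp (hpoly_ispoly hg2) pB) w1 w2.
rewrite mulf_eq0 negb_or => /andP[h1 h2].
have : fiber (model B) t (B u, u.2) by split=> //; apply: model_pt.
move=> /sub[/C1E[_ /(_ _ _ I1g) e]|/C2E[_ /(_ _ _ I2g) e]].
  by rewrite e eqxx in h1.
by rewrite e eqxx in h2.
Qed.

Lemma smooth_family : smooth_projective_family 3 (model B).
Proof.
have [cB pB] := state_affine; have B0 := state_neq0.
have [[pA pPhi cS cov _] _] := hst; have covX := bcovered_xcharts pA pPhi cov.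
split; [exact: model_zclosed|exact: xchart_smooth_over_base|exact: fibre_irreducible].
Qed.

Lemma affine_map_exists n M' (C : pt K 3 -> 'rV[K]_n) (C' : pt K 3 -> 'rV[K]_M') :
  affine_chart C -> (forall u, C' u != 0) ->
  exists f : pt K n -> 'rV[K]_M', forall p u, u.2 = p.2 -> peq p.1 (C u) -> peq (f p) (C' u).
Proof.
move=> cC C'0; have /choice[f fP] : forall p : pt K n, exists v : 'rV[K]_M',
    forall u, u.2 = p.2 -> peq p.1 (C u) -> peq v (C' u).
  move=> p; case: (pselect (affine_part C p)) => [[u ut e]|np].
    exists (C' u) => u' ut' e'.
    rewrite (@affine_chart_inj _ _ C u u') ?ut //; first exact: peq_refl.
    exact: peq_trans (peq_sym e) e'.
  by exists 0 => u ut e; case: np; exists u.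
by exists f => p u; apply: fP.
Qed.

Lemma affine_map_regular n M' (C : pt K 3 -> 'rV[K]_n) (C' : pt K 3 -> 'rV[K]_M') f :
  affine_chart C -> polyv C' -> (forall u, C' u != 0) ->
  (forall p u, u.2 = p.2 -> peq p.1 (C u) -> peq (f p) (C' u)) ->
  regular_map (affine_part C) f.
Proof.
move=> cC pC' C'0 hf p [u ut e]; have [l [idx [sC Cl]]] := cC u.
have [D [R [hR RE]]] := homogenize_family pC'
  (fun a => hpoly_x K (idx a)) (hpoly_x K l).
have RC q u' : u'.2 = q.2 -> peq q.1 (C u') -> q.1 ord0 l != 0 ->
    \row_i (q.1 ord0 l * R i q) = (q.1 ord0 l * q.1 ord0 l ^+ D) *: C' u'.
  move=> ut' e' ql; apply/rowP => i; rewrite !mxE RE (_ : (\row_a _, q.2) = u') ?mulrA //.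
  have Cl' := peq_neq0 e' ql; have /peqP[q0 _] := e'.
  by have [] := standard_coords sC ut' (peq_para e') Cl' q0.
have [F [hF FE]] : exists G, (forall i, homog_deg (1 + D) (G i)) /\
    (fun q : pt K n => \row_i (q.1 ord0 l * R i q)) =1 pevalv G.
  apply: hvec_pevalv => i; apply: hpoly_ext (hpolyM (hpoly_x K l) (hR i)) => q.
  by rewrite mxE.
exists (1 + D)%N, F; split=> //.
  have pl := peq_neq0 (peq_sym e) Cl.
  by rewrite -FE (RC p u) // scaler_eq0 negb_or C'0 mulf_neq0 ?expf_neq0.
move=> q [u' ut' e']; rewrite -FE => Fq; apply: (peq_trans (hf q u' ut' e')).
have ql : q.1 ord0 l != 0.
  by apply: contra_neq Fq => ql; apply/rowP => i; rewrite !mxE ql mul0r.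
by rewrite (RC q u') //; apply: peqZ => //; rewrite mulf_neq0 ?expf_neq0.
Qed.

Lemma birational_P3 (phi : pt K (N * M) -> 'rV[K]_4) : homog_coords B phi ->
  birational_map (model B) (@Proj K 4) phi.
Proof.
have [cB pB] := state_affine; move=> hphi.
have cP := @affine_chart_P3 K; have P0 u : P3 u != 0 := affine_chart_neq0 u cP.
have [g gP] := affine_map_exists cP state_neq0.
exists (affine_part B), (affine_part (@P3 K)); split.
- by split; [exact: affine_part_open|exact: affine_part_dense].
- rewrite -model_P3; split; last exact: affine_part_dense.
  by apply: affine_part_open => //; exact: polyv_P3.
exists g; split.
- exact: homog_coords_regular.
- by apply: affine_map_regular gP => //; exact: state_neq0.
- move=> q [u ut e]; have e' : peq (phi q) (P3 u) by rewrite P3_row; apply: hphi.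
  split; first by exists u.
  by apply: peq_trans (peq_sym e); apply: gP.
- move=> q [u ut e]; have e' := gP q u ut e.
  split; first by exists u.
  by apply: peq_trans (peq_sym e); rewrite P3_row; apply: hphi.
Qed.

(** The boundary is the preimage of the complement of O in the surface, so the function eta of
    [bcovered], homogenized, is its local equation. *)
Lemma local_boundary p : model B p -> exists d1 h d2 g,
  [/\ hpoly d1 h, hpoly d2 g, h p != 0 &
      forall q, model B q -> h q != 0 -> phase q <-> g q != 0].
Proof.
have [cB pB] := state_affine; have B0 := state_neq0.
have [[pA pPhi cS cov _] _] := hst.
move=> mp; have [s [w [ep ms mw]]] := model_tens mp.
have [D [q [eta [nu [[pD cD qt sq [l [i1 [i2 [j0 [j1 [std _ El aj]]]]]]]
  [peta pnu nuq hO]]]]]] := cov _ ms.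
suff key (P v : pt K 3 -> _) l' idx q0 : xchart_at B P p l' idx q0 -> base q0 = q ->
    (forall c, P c = segre (fE D (base c)) (v c)) ->
    exists d1 h d2 g, [/\ hpoly d1 h, hpoly d2 g, h p != 0 &
      forall q, model B q -> h q != 0 -> phase q <-> g q != 0].
  case: (bundle_charts pA pPhi pD cD std mp ep sq qt El aj) => -[_ hx].
    by apply: (key _ (fun c => fa D (base c) + xc c *: fb D (base c)) _ _ _ hx); rewrite ?base_over.
  by apply: (key _ (fun c => xc c *: fa D (base c) + fb D (base c)) _ _ _ hx); rewrite ?base_over.
move=> [xP sP q0t pq0 Pl] bq0 PE; have [pP _ _] := xP.
(* The functions eta, nu and P_l', with indices 0, 1 and 2, are homogenized to one common degree. *)
pose f (k : 'I_3) : pt K 3 -> K := if k == ord0 then fun c => eta (base c) else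
  if k == ord_max then fun c => P c ord0 l' else fun c => nu (base c).
have pf k : ispoly (f k).
  rewrite /f; case: ifP => _; first exact: (ispoly_base peta).
  by case: ifP => _; [exact: pP|exact: (ispoly_base pnu)].
have [d [R [hR RE]]] := homogenize_family pf
  (fun a => hpoly_x K (idx a)) (hpoly_x K l').
pose i1' : 'I_3 := inord 1.
have f0 c : f ord0 c = eta (base c) by [].
have f2 c : f ord_max c = P c ord0 l' by [].
have f1 c : f i1' c = nu (base c) by rewrite /f -!val_eqE /= inordK.
exists (1 + (d + d))%N, (fun p : pt K (N * M) => p.1 ord0 l' * (R i1' p * R ord_max p)), d, (R ord0).
split=> //.
- by apply: hpolyM; [exact: hpoly_x|apply: hpolyM].
- have [ec pl] := standard_coords sP q0t (peq_para pq0) Pl (model_neq0 mp).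
  rewrite !RE -[(\row_a _, _)]/(coords l' idx p) ec f1 f2 bq0.
  by rewrite !mulf_neq0 // expf_neq0.
move=> q' mq'; rewrite !RE -[(\row_a _, _)]/(coords l' idx q').
rewrite f0 f1 f2 !mulf_eq0 !negb_or => /andP[ql /andP[/andP[qd nuq'] /andP[_ Plq]]].
set c := coords l' idx q' in nuq' Plq *; rewrite qd /=.
have e : peq q'.1 (P c).
  apply: para_peq; [exact: model_neq0 mq'|exact: rV_neq0 Plq|].
  exact: (xchart_coords xP sP pB B0 mq' ql).
have [_ hOc] := hO (base c) nuq'; rewrite -hOc.
have [_ [Op _ _]] := hst; rewrite -[(base c).2]/(q'.2).
have /peqP[_ [k k0 e']] := peq_sym e.
have eq' : q' = (segre (fE D (base c)) (k *: v c), q'.2).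
  by rewrite segreZr -PE -e' -surjective_pairing.
by rewrite [in X in X <-> _]eq'; apply: phase_segre; rewrite -eq'.
Qed.

Lemma phase_open : zopen_in (model B) phase.
Proof.
apply: zopen_local; [by move=> p []|by move=> q /model_neq0|move=> p ph].
have [mp _] := ph; have [d1 [h [d2 [g [hh hg hp hP]]]]] := local_boundary mp.
exists (d1 + d2)%N, (fun q => h q * g q); split.
- exact: hpolyM.
- by rewrite mulf_neq0 //; apply/hP.
- by move=> q mq; rewrite mulf_eq0 negb_or => /andP[hq gq]; apply/(hP q mq hq).
Qed.

Lemma phase_divisor : divisor (model B) (model B `\` phase).
Proof.
have [cB pB] := state_affine.
have XDD : model B `\` (model B `\` phase) = phase.
  apply/seteqP; split=> [p [mp np]|p ph]; first by apply: contrapT => nph; apply: np.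
  by split; [case: ph|move=> [_ /(_ ph)]].
split.
- have [C zC e] := phase_open.
  have -> : model B `\` phase = model B `&` C.
    apply/seteqP; split=> p [mp]; first by rewrite e => np; split=> //; apply: contrapT => nC; apply: np.
    by move=> Cp; split=> //; rewrite e => -[].
  by apply: zclosedI => //; exact: model_zclosed.
- by move=> p [].
- rewrite XDD => p mp; have := affine_part_dense cB mp.
  apply: zclosure_min; first exact: zclosure_zclosed.
  move=> q /affine_phase ph; apply/zclosureP; split=> [|d g hg g0]; last exact: g0.
  by case: ph => /model_neq0.
- move=> p mp; have [d1 [h [d2 [g [[h' hh' h'E] [g' hg' g'E] hp hP]]]]] := local_boundary mp.
  exists h', g'; split; [by exists d1|by exists d2|by split; [exact: model_neq0 mp|rewrite -h'E]|].
  move=> q mq [_]; rewrite -h'E -g'E => /(hP q mq) e; split=> [[_ np]|g0].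
    by apply/eqP/negPn/negP => /e.
  by split=> // /e; rewrite g0 eqxx.
Qed.
End Family.
End Geometry.

(** * Charts from frames: nonvanishing and transport of local inverses *)

Section Charts8.
Variable K : numClosedFieldType.

(** The frames have the boundary coordinate k1 = 1/z before k2, while the charts of the statement
    have z_j = 1/z last. *)
Definition swap (q : pt K 3) : pt K 3 := (row3 (xc q) (zc q) (yc q), q.2).

Lemma swapK q : swap (swap q) = q.
Proof. by apply: pt3P; rewrite /swap ?row3_xc ?row3_yc ?row3_zc ?row3_xc ?row3_yc ?row3_zc. Qed.

Lemma polyv_swap : polyv (fun q => (swap q).1).
Proof. by apply: polyv_row3; [apply: ispoly_xc|apply: ispoly_zc|apply: ispoly_yc]. Qed.

Lemma xchart_swap N (B P : pt K 3 -> 'rV[K]_N) :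
  xchart B P -> xchart B (fun q => P (swap q)).
Proof.
move=> [pP [w [pw nw wP]] [d [pd nd dP]]]; split.
- exact: (polyv_comp pP polyv_swap).
- exists w; split=> // u /wP[q [qt Pq e]]; exists (swap q); rewrite swapK; by split.
- exists (fun q => d (swap q)); split; first exact: (ispoly_comp pd polyv_swap).
    by move=> t; have [q qt dq] := nd t; exists (swap q) => //; rewrite swapK.
  by move=> q /dP[u ut e]; exists u.
Qed.

Lemma row3_ord (a b c : K) : [/\ row3 a b c ord0 (inord 0) = a,
  row3 a b c ord0 (inord 1) = b & row3 a b c ord0 (inord 2) = c].
Proof. by split; rewrite mxE inordK. Qed.

Lemma regular_inverse_swap N (P : pt K 3 -> 'rV[K]_N) c :
  regular_inverse P (swap c) -> regular_inverse (fun q => P (swap q)) c.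
Proof.
move=> [m [G [H [hG hH Hc e]]]].
exists m, (fun a => G (nth (inord 0) [:: inord 0; inord 2; inord 1] a)), H.
split=> // q; apply: forall_I3; rewrite inordK //= -[q.2]/((swap q).2) e;
  have [e0 e1 e2] := row3_ord (xc q) (zc q) (yc q); by rewrite /swap /= ?e0 ?e1 ?e2.
Qed.

Lemma regular_inverse_standard N (P : pt K 3 -> 'rV[K]_N) l idx c :
  standard P l idx -> P c ord0 l != 0 -> regular_inverse P c.
Proof.
move=> sP Pc; exists 1%N, (fun a (p : pt K N) => p.1 ord0 (idx a)), (fun p : pt K N => p.1 ord0 l).
by split=> // [a|]; exact: hpoly_x.
Qed.

(* [T] is given by its numerators [R] and denominator [S]. *)
Definition ratmap (R : 'I_3 -> pt K 3 -> K) (S : pt K 3 -> K) (q : pt K 3) : pt K 3 :=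
  (\row_a (R a q / S q), q.2).

Lemma para_transfer N (P Q : pt K 3 -> 'rV[K]_N) R S d c :
  polyv P -> polyv Q -> (forall a, ispoly (R a)) -> ispoly S -> ispoly d ->
  (exists q, d q != 0) -> (forall q, d q != 0 -> peq (P q) (Q (ratmap R S q))) ->
  S c != 0 -> para (P c) (Q (ratmap R S c)).
Proof.
move=> pP pQ pR pS pd nd h Sc i j.
have [D [W [hW WE]]] := homogenize_family pQ
  (fun a => hpoly_x K (fintype.lift ord0 a)) (hpoly_x K (ord0 : 'I_4)).
pose V (c : pt K 3) : 'rV[K]_4 :=
  \row_i (if unlift ord0 i is Some a then R a c else S c).
have pV : polyv V.
  move=> k; case: (unliftP ord0 k) => [a ->|->].
    by apply: ispoly_ext (pR a) => q; rewrite mxE liftK.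
  by apply: ispoly_ext pS => q; rewrite mxE unlift_none.
have WV k q : W k (V q, q.2) = S q ^+ D * Q (ratmap R S q) ord0 k.
  rewrite WE /= mxE unlift_none; congr (_ * Q (_, _) _ _).
  by apply/rowP => a; rewrite !mxE liftK.
have pW k : ispoly (fun c => W k (V c, c.2)).
  exact: (ispoly_comp (hpoly_ispoly (hW k))).
have F0 := @density_all _ _ (fun q => P q ord0 i * W j (V q, q.2) - P q ord0 j * W i (V q, q.2))
  d (ispolyB (ispolyM (pP i) (pW j)) (ispolyM (pP j) (pW i))) pd nd _ c.
have := F0 _; rewrite !WV => /(_ _)/eqP.
rewrite !(mulrCA (P _ _ _)) -mulrBr mulf_eq0 expf_eq0 (negbTE Sc) andbF /= subr_eq0.
move=> h1; apply/eqP; apply: h1 => q /h/peq_para/(_ i j) e.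
by rewrite !WV !(mulrCA (P _ _ _)) -mulrBr e subrr mulr0.
Qed.

(** A local inverse of [Q], followed by the inverse R'/S' of the coordinate change R/S, inverts [P].
    This transports invertibility from charts where it is known everywhere. *)
Lemma regular_inverse_transfer N (P Q : pt K 3 -> 'rV[K]_N) R S R' S' d c :
  polyv P -> polyv Q -> (forall q, P q != 0) -> (forall q, Q q != 0) ->
  (forall q, regular_inverse Q q) ->
  (forall a, ispoly (R a)) -> ispoly S -> (forall a, ispoly (R' a)) -> ispoly S' ->
  ispoly d -> (exists q, d q != 0) ->
  (forall q, d q != 0 -> peq (P q) (Q (ratmap R S q)) /\
     forall a, R' a (ratmap R S q) = q.1 ord0 a * S' (ratmap R S q)) ->
  S c != 0 -> S' (ratmap R S c) != 0 -> regular_inverse P c.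
Proof.
move=> pP pQ P0 Q0 hQ pR pS pR' pS' pd nd h Sc S'c.
have ec : peq (P c) (Q (ratmap R S c)).
  by apply: para_peq => //; apply: (para_transfer pP pQ pR pS pd nd _ Sc) => q /h[].
have [m [G [H [hG hH Hc e]]]] := hQ (ratmap R S c).
pose f (i : option 'I_3) : pt K 3 -> K := if i is Some a then R' a else S'.
have pf i : ispoly (f i) by case: i.
have [D [W [hW [k WE]]]] := homogenize_forms pf hG hH.
exists (m + D)%N, (fun a p => H p * W (Some a) p), (fun p => H p * W None p).
split=> [a| | |q a]; try exact: hpolyM.
  have Hc' : H (P c, c.2) != 0.
    have /peqP[_ [x x0 ->]] := peq_sym ec.
    by rewrite (hpoly_scale _ _ _ hH) mulf_neq0 ?expf_neq0.
  have /= fi := frac_inverse hG hH e ec Hc'.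
  rewrite WE /= fi -/(ratmap R S c).
  by rewrite !mulf_neq0 ?expf_neq0.
have pH : ispoly (fun q => H (P q, q.2)) := ispoly_comp (hpoly_ispoly hH) pP.
have pW i : ispoly (fun q => W i (P q, q.2)) := ispoly_comp (hpoly_ispoly (hW i)) pP.
apply/eqP; rewrite -subr_eq0; apply/eqP.
apply: (@density_all _ _ (fun q => H (P q, q.2) * W (Some a) (P q, q.2) -
    q.1 ord0 a * (H (P q, q.2) * W None (P q, q.2))) d) => //.
  apply: ispolyB; first exact: ispolyM.
  by apply: ispolyM; [exact: ispoly_x|exact: ispolyM].
move=> q' /h[e' eR]; case: (eqVneq (H (P q', q'.2)) 0) => [->|Hq].
  by rewrite !mul0r mulr0 subrr.
have /= fi := frac_inverse hG hH e e' Hq.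
rewrite !WE /= fi -/(ratmap R S q') eR; ring.
Qed.

Section NChart.
Variables (N M : nat) (A : pt K 3 -> 'rV[K]_N) (Phi : pt K 3 -> 'rV[K]_M).
Variables (O : set (pt K N)) (D : fdata K N M) (G V : set (pt K 2)).
Variables (dom : set (pt K 3)) (chi : pt K 3 -> pt K 2) (xi : pt K 3 -> K).
Hypothesis hst : sstate A Phi O.
Hypothesis hD : nchart A Phi O D G V dom chi xi.
Hypothesis GV : forall q, G q \/ V q.

Lemma fE_neq0 q : fE D q != 0.
Proof. by have [_ [_ On _]] := hst; have [[_ _ hO] _] := hD; apply: On (hO q). Qed.

Lemma peq_xfin u c : dom u -> chi u = base c -> xi u = xc c ->
  peq (tens A Phi u) (xfin D c).
Proof.
have [_ [_ hf _]] := hD; move=> du ec ex; have [_ e1 e2] := hf u du.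
by rewrite /xfin -ec -ex; apply: segre_peq.
Qed.

Lemma peq_xinf u c : dom u -> chi u = base c -> xi u != 0 -> (xi u)^-1 = xc c ->
  peq (tens A Phi u) (xinf D c).
Proof.
have [_ [_ hf _]] := hD; move=> du ec x0 ex; have [_ e1 e2] := hf u du.
rewrite /xinf -ec -ex; apply: segre_peq => //.
have -> : (xi u)^-1 *: fa D (chi u) + fb D (chi u) =
    (xi u)^-1 *: (fa D (chi u) + xi u *: fb D (chi u)).
  by rewrite scalerDr scalerA mulVf // scale1r.
apply: (peq_trans e2); apply: peqZ; last by rewrite invr_neq0.
by case: e2.
Qed.

(** A zero [fb] would make xi = 0 and xi = 1 the same point over q, against the injectivity of the
    affine part. *)
Lemma fb_neq0 q : V q -> fb D q != 0.
Proof.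
have [cB pB] := state_affine hst.
have [_ [_ hf hs]] := hD; move=> Vq; apply/eqP => b0.
have [u [du eu xu]] := hs q 0 Vq; have [u' [du' eu' xu']] := hs q 1 Vq.
have [t1 a1 p1] := hf u du; have [t2 a2 p2] := hf u' du'.
have e : peq (tens A Phi u) (tens A Phi u').
  apply: segre_peq; first by rewrite eu in a1; rewrite eu' in a2; exact: peq_trans (peq_sym a2).
  rewrite eu xu b0 scaler0 addr0 in p1; rewrite eu' xu' b0 scaler0 addr0 in p2.
  exact: peq_trans (peq_sym p2).
have uu := affine_chart_inj cB _ e; have := oner_neq0 K.
by rewrite -xu' -uu ?xu ?eqxx // t1 t2 eu eu'.
Qed.

Lemma xfin_neq0 c : xfin D c != 0.
Proof.
have [[_ hG _] [_ hf hs]] := hD.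
rewrite /xfin segre_neq0 fE_neq0 /=; case: (GV (base c)) => [/hG|/hs].
  move=> [l [i1 [i2 [j0 [j1 [[_ /(_ (base c))[_ _ e]] _ _ aj]]]]]].
  by apply: (@rV_neq0 _ _ _ j0); rewrite rVD rVZ e mulr0 addr0.
by move=> /(_ (xc c))[u [du <- <-]]; have [_ _ []] := hf u du.
Qed.

Lemma xinf_neq0 c : xinf D c != 0.
Proof.
have [[_ hG _] [_ hf hs]] := hD.
rewrite /xinf segre_neq0 fE_neq0 /=; case: (GV (base c)) => [/hG|Vc].
  move=> [l [i1 [i2 [j0 [j1 [[_ /(_ (base c))[e e' _]] _ _ aj]]]]]].
  by apply: (@rV_neq0 _ _ _ j1); rewrite rVD rVZ e' e mulr0 add0r.
case: (eqVneq (xc c) 0) => [->|x0]; first by rewrite scale0r add0r fb_neq0.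
have [u [du <- xu]] := hs (base c) (xc c)^-1 Vc; have [_ _ [_ + _]] := hf u du.
rewrite xu => h; apply: contra_neq h => h.
apply: (scalerI x0); rewrite scaler0 scalerDr scalerA divff // scale1r.
exact: h.
Qed.

Lemma regular_inverse_xfin c : G (base c) -> regular_inverse (xfin D) c.
Proof.
have [[_ hG _] _] := hD; move=> /hG[l [i1 [i2 [j0 [j1 [std _ El aj]]]]]].
apply: regular_inverse_standard; first exact: standard_xfin std.
have [_ /(_ (base c))[_ _ e]] := std.
by rewrite /xfin segreE rVD rVZ e mulr0 addr0 mulf_neq0.
Qed.

Lemma regular_inverse_xinf c : G (base c) -> regular_inverse (xinf D) c.
Proof.
have [[_ hG _] _] := hD; move=> /hG[l [i1 [i2 [j0 [j1 [std _ El aj]]]]]].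
apply: regular_inverse_standard; first exact: standard_xinf std.
have [_ /(_ (base c))[e e' _]] := std.
by rewrite /xinf segreE rVD rVZ e e' mulr0 add0r mulf_neq0.
Qed.

Hypothesis GT : exists q, G q.
Hypothesis hV : exists d, [/\ ispoly d, forall t, exists2 q, q.2 = t & d q != 0 &
  forall q, d q != 0 -> V q].

Lemma nchart_xfin : xchart (tens A Phi) (xfin D).
Proof.
have [[pA pPhi _ _ _] _] := hst; have [[pD _ _] _] := hD.
have [d [pd nd dV]] := hV.
exact: (xchart_xfin pD (nchart_compat pd nd dV hD)).
Qed.

Lemma nchart_xinf : xchart (tens A Phi) (xinf D).
Proof.
have [[pA pPhi _ _ _] _] := hst; have [[pD hG _] _] := hD.
have [d [pd nd dV]] := hV; have [q Gq] := GT.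
have [l [i1 [i2 [j0 [j1 [std _ _ aj]]]]]] := hG q Gq.
exact: (xchart_xinf pPhi pD (nchart_compat pd nd dV hD) std aj).
Qed.

End NChart.
End Charts8.

(** * The eight charts and the eight strata *)

Section Assembly.
Variable K : numClosedFieldType.
Variables a1 a2 a3 : K.

(* The point of C^3 with given coordinates in the j-th chart; junk where [bdry j] vanishes. *)
Definition unchart (j : nat) (q : pt K 3) : pt K 3 :=
  let: (x, y, z, t) := (xc q, yc q, zc q, q.2) in
  (match j with
   | 0 => q.1
   | 1 => row3 (1 / x - 1 / z) ((y * z - a2) * z) (1 / z)
   | 2 => row3 (x - 1 / z) ((y * z - a2) * z) (1 / z)
   | 3 => row3 (1 / x) y z
   | 4 => row3 ((x * z + a1) * z) ((y * z - 1 + a2 + a3) * z - 1 / z + t) (1 / z)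
   | 5 => row3 (1 / x) (1 / y) ((z * y + a3) * y)
   | 6 => row3 x (1 / y) ((z * y + a3) * y)
   | _ => row3 (z * (a1 * x + z) / x) ((y * z - 1 + a2 + a3) * z - 1 / z + t) (1 / z)
   end, t).

Definition bdry (j : nat) (q : pt K 3) : K :=
  match j with
  | 0 => 1 | 3 => xc q | 2 | 4 => zc q | 6 => yc q | 5 => xc q * yc q | _ => xc q * zc q
  end.

Lemma unchartP (j : 'I_8) q : bdry j q != 0 ->
  chart_dom a1 j (unchart j q) /\ chart a1 a2 a3 j (unchart j q) = q.1.
Proof.
rewrite -(row3_eta q).
case: j => -[|[|[|[|[|[|[|[|//]]]]]]]] hj /=; rewrite /unchart /chart_dom /chart /=
  ?mulf_eq0 ?negb_or; move=> h; try (case/andP: h => h h');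
  rewrite ?row3_xc ?row3_yc ?row3_zc.
- by split=> //; apply/rowP; apply: forall_I3; rewrite mxE inordK.
- split; last by congr row3; field; rewrite ?h ?h' //= ?addrNK ?subrK ?invr_eq0 ?h.
  by rewrite subrK !div1r !invr_neq0.
- split; last by congr row3; field.
  by rewrite div1r invr_neq0.
- split; last by congr row3; rewrite ?div1r ?invrK.
  by rewrite div1r invr_neq0.
- split; last by congr row3; field.
  by rewrite div1r invr_neq0.
- split; last by congr row3; field; rewrite ?h ?h'.
  by rewrite !div1r !invr_neq0.
- split; last by congr row3; field.
  by rewrite div1r invr_neq0.
have e : 1 / zc q * (zc q * (a1 * xc q + zc q) / xc q * (1 / zc q) - a1) = (xc q)^-1.
  by field; rewrite h h'.
split; first by rewrite -negb_or -mulf_eq0 e invr_neq0.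
by congr row3; rewrite ?e; field; rewrite ?h ?h'.
Qed.

Variables (N M : nat) (A : pt K 3 -> 'rV[K]_N) (Phi : pt K 3 -> 'rV[K]_M).
Variables (O : set (pt K N)) (D0 D2 D4 D6 : fdata K N M).
Hypothesis hst : sstate A Phi O.
Hypothesis n0 : nchart A Phi O D0 setT setT setT (@chi0 K) (@xc K).
Hypothesis n2 : nchart A Phi O D2 [set q | k1 q = 0] [set q | k1 q != 0]
  [set u | zc u != 0] (chi2 a2) (fun u => xc u + zc u).
Hypothesis n4 : nchart A Phi O D4 [set q | k1 q = 0] [set q | k1 q != 0]
  [set u | zc u != 0] (chi4 a2 a3) (fun u => (xc u * zc u - a1) * zc u).
Hypothesis n6 : nchart A Phi O D6 [set q | k1 q = 0] [set q | k1 q != 0]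
  [set u | yc u != 0] (chi6 a3) (@xc K).

Let B := tens A Phi.

Definition psi8 (j : 'I_8) : pt K 3 -> 'rV[K]_(N * M) :=
  match val j with
  | 0 => xfin D0
  | 1 => fun q => xinf D2 (swap q)
  | 2 => fun q => xfin D2 (swap q)
  | 3 => xinf D0
  | 4 => fun q => xfin D4 (swap q)
  | 5 => xinf D6
  | 6 => xfin D6
  | _ => fun q => xinf D4 (swap q)
  end.

Lemma psi8_chart (j : 'I_8) u : chart_dom a1 j u ->
  peq (B u) (psi8 j (chart a1 a2 a3 j u, u.2)).
Proof.
case: j => -[|[|[|[|[|[|[|[|//]]]]]]]] hj /=; rewrite /chart_dom /psi8 /=.
- by move=> _; apply: (peq_xfin n0) => //; rewrite /chi0 /base -?surjective_pairing.
- move=> [x0 z0]; apply: (peq_xinf n2) => //; last by rewrite /swap !row3_xc div1r.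
  by rewrite /swap /chi2 /base /= !row3_xc !row3_yc !row3_zc.
- move=> z0; apply: (peq_xfin n2) => //; last by rewrite /swap !row3_xc.
  by rewrite /swap /chi2 /base /= !row3_xc !row3_yc !row3_zc.
- move=> x0; apply: (peq_xinf n0) => //; last by rewrite row3_xc div1r.
  by rewrite /chi0 /base /= !row3_yc !row3_zc.
- move=> z0; apply: (peq_xfin n4) => //; last by rewrite /swap !row3_xc.
  by rewrite /swap /chi4 /base /= !row3_xc !row3_yc !row3_zc.
- move=> [x0 y0]; apply: (peq_xinf n6) => //; last by rewrite row3_xc div1r.
  by rewrite /chi6 /base /= !row3_yc !row3_zc.
- move=> y0; apply: (peq_xfin n6) => //; last by rewrite row3_xc.
  by rewrite /chi6 /base /= !row3_yc !row3_zc.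
- move=> xz0; apply: (peq_xinf n4) => //=.
  + by move: xz0; rewrite mulf_eq0 negb_or => /andP[].
  + rewrite /swap /chi4 /base /= !row3_xc !row3_yc !row3_zc.
    by rewrite [X in row2 _ X]mulrC.
  + by rewrite mulrC.
  + by rewrite /swap !row3_xc div1r mulrC.
Qed.

Let GVT (q : pt K 2) : [set: pt K 2] q \/ [set: pt K 2] q := or_introl I.
Let GV0 (q : pt K 2) : [set q | k1 q = 0] q \/ [set q : pt K 2 | k1 q != 0] q.
Proof. by case: (eqVneq (k1 q) 0) => h; [left|right]. Qed.

Lemma psi8_neq0 j q : psi8 j q != 0.
Proof.
case: j => -[|[|[|[|[|[|[|[|//]]]]]]]] hj; rewrite /psi8 /=.
- exact: (xfin_neq0 hst n0 GVT).
- exact: (xinf_neq0 hst n2 GV0).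
- exact: (xfin_neq0 hst n2 GV0).
- exact: (xinf_neq0 hst n0 GVT).
- exact: (xfin_neq0 hst n4 GV0).
- exact: (xinf_neq0 hst n6 GV0).
- exact: (xfin_neq0 hst n6 GV0).
- exact: (xinf_neq0 hst n4 GV0).
Qed.

Lemma xchart_psi8 j : xchart B (psi8 j).
Proof.
have g0 : exists q : pt K 2, [set: pt K 2] q by exists (0, 0).
have g1 : exists q : pt K 2, [set q | k1 q = 0] q by exists (row2 0 0, 0); rewrite /= row2_k1.
have v0 : exists d, [/\ ispoly d, forall t, exists2 q : pt K 2, q.2 = t & d q != 0 &
    forall q, d q != 0 -> [set: pt K 2] q].
  exists (fun=> 1); split=> //; [exact: ispoly_c|].
  by move=> t; exists (0, t) => //; exact: oner_neq0.
have v1 : exists d, [/\ ispoly d, forall t, exists2 q : pt K 2, q.2 = t & d q != 0 &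
    forall q, d q != 0 -> [set q : pt K 2 | k1 q != 0] q].
  exists (@k1 K); split=> //; [exact: ispoly_k1|].
  by move=> t; exists (row2 1 0, t) => //; rewrite row2_k1 oner_neq0.
case: j => -[|[|[|[|[|[|[|[|//]]]]]]]] hj; rewrite /psi8 /=.
- exact: (nchart_xfin hst n0 v0).
- exact: (xchart_swap (nchart_xinf hst n2 g1 v1)).
- exact: (xchart_swap (nchart_xfin hst n2 v1)).
- exact: (nchart_xinf hst n0 g0 v0).
- exact: (xchart_swap (nchart_xfin hst n4 v1)).
- exact: (nchart_xinf hst n6 g1 v1).
- exact: (nchart_xfin hst n6 v1).
- exact: (xchart_swap (nchart_xinf hst n4 g1 v1)).
Qed.

Lemma polyv_psi8 j : polyv (psi8 j).
Proof. by have [] := xchart_psi8 j. Qed.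

(** Away from the exceptional lines the frames need not be standard. There chart j is compared with
    chart 0 or 3, where local inverses exist everywhere, by explicit numerators and denominators in
    both directions. *)
Lemma regular_inverse_via (j k : 'I_8) (f g h S f' g' h' S' : pt K 3 -> K) d c :
  (forall q, regular_inverse (psi8 k) q) ->
  ispoly f -> ispoly g -> ispoly h -> ispoly S ->
  ispoly f' -> ispoly g' -> ispoly h' -> ispoly S' -> ispoly d -> (exists q, d q != 0) ->
  (forall q, d q != 0 -> bdry j q != 0 /\ let u := unchart j q in
     let T := (row3 (f q / S q) (g q / S q) (h q / S q), q.2) in
     [/\ chart_dom a1 k u, chart a1 a2 a3 k u = T.1 & [/\ f' T = xc q * S' T, g' T = yc q * S' T &
       h' T = zc q * S' T]]) ->
  S c != 0 -> S' (row3 (f c / S c) (g c / S c) (h c / S c), c.2) != 0 ->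
  regular_inverse (psi8 j) c.
Proof.
move=> hk pf pg ph pS pf' pg' ph' pS' pd nd H Sc S'c.
pose R (a : 'I_3) q := row3 (f q) (g q) (h q) ord0 a.
pose R' (a : 'I_3) q := row3 (f' q) (g' q) (h' q) ord0 a.
have RE q : ratmap R S q = (row3 (f q / S q) (g q / S q) (h q / S q), q.2).
  by congr pair; apply/rowP; apply: forall_I3; rewrite mxE /R !mxE inordK.
apply: (@regular_inverse_transfer _ _ (psi8 j) (psi8 k) R S R' S' d c) => //;
  try exact: polyv_psi8; try exact: psi8_neq0.
- exact: polyv_row3.
- exact: polyv_row3.
- move=> q /H[bq [du ec [e0 e1 e2]]]; have [du' ec'] := unchartP bq; rewrite RE; split.
    have e := psi8_chart du; have e' := psi8_chart du'.
    rewrite ec /= in e; rewrite ec' -surjective_pairing in e'.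
    exact: peq_trans (peq_sym e') e.
  by apply: forall_I3; rewrite /R' mxE inordK.
- by rewrite RE.
Qed.

Lemma regular_inverse0 c : regular_inverse (psi8 (@Ordinal 8 0 isT)) c.
Proof. exact: (regular_inverse_xfin n0). Qed.

Lemma regular_inverse3 c : regular_inverse (psi8 (@Ordinal 8 3 isT)) c.
Proof. exact: (regular_inverse_xinf n0). Qed.

Ltac via_tac j k f g h S f' g' h' S' d :=
  apply: (@regular_inverse_via (@Ordinal 8 j isT) (@Ordinal 8 k isT) f g h S f' g' h' S' d);
  [exact: regular_inverse0 || exact: regular_inverse3|ispoly_tac|ispoly_tac|ispoly_tac
  |ispoly_tac|ispoly_tac|ispoly_tac|ispoly_tac|ispoly_tac|ispoly_tac| | | | ].

Ltac unfold_tac := rewrite /= /unchart /chart_dom /chart /= ?row3_xc ?row3_yc ?row3_zc.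

Lemma regular_inverse2 c : regular_inverse (psi8 (@Ordinal 8 2 isT)) c.
Proof.
case: (eqVneq (zc c) 0) => [z0|z0].
  by apply/regular_inverse_swap/(regular_inverse_xfin n2); rewrite /= row2_k1 row3_yc.
via_tac 2%N 0%N (fun q : pt K 3 => xc q * zc q - 1)
  (fun q : pt K 3 => (yc q * zc q - a2) * (zc q * zc q)) (fun _ : pt K 3 => 1 : K) (@zc K)
  (fun q : pt K 3 => (xc q + zc q) * zc q)
  (fun q : pt K 3 => (yc q * zc q + a2) * (zc q * zc q)) (fun _ : pt K 3 => 1 : K) (@zc K)
  (@zc K).
- by exists (row3 0 0 1, 0); rewrite row3_zc oner_neq0.
- move=> q h; split=> //; unfold_tac; split=> //; first by congr row3; field.
  by split; field.
- by [].
- by rewrite row3_zc div1r invr_neq0.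
Qed.

Lemma regular_inverse4 c : regular_inverse (psi8 (@Ordinal 8 4 isT)) c.
Proof.
case: (eqVneq (zc c) 0) => [z0|z0].
  by apply/regular_inverse_swap/(regular_inverse_xfin n4); rewrite /= row2_k1 row3_yc.
via_tac 4%N 0%N (fun q : pt K 3 => (xc q * zc q + a1) * (zc q * zc q))
  (fun q : pt K 3 => (yc q * zc q - 1 + a2 + a3) * (zc q * zc q) - 1 + q.2 * zc q)
  (fun _ : pt K 3 => 1 : K) (@zc K)
  (fun q : pt K 3 => (xc q * zc q - a1) * (zc q * zc q))
  (fun q : pt K 3 => ((yc q + zc q - q.2) * zc q + 1 - a2 - a3) * (zc q * zc q))
  (fun _ : pt K 3 => 1 : K) (@zc K) (@zc K).
- by exists (row3 0 0 1, 0); rewrite row3_zc oner_neq0.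
- move=> q h; split=> //; unfold_tac; split=> //; first by congr row3; field.
  by split; field.
- by [].
- by rewrite row3_zc div1r invr_neq0.
Qed.

Lemma regular_inverse6 c : regular_inverse (psi8 (@Ordinal 8 6 isT)) c.
Proof.
case: (eqVneq (yc c) 0) => [z0|z0].
  by apply/(regular_inverse_xfin n6); rewrite /= row2_k1.
via_tac 6%N 0%N (fun q : pt K 3 => xc q * yc q) (fun _ : pt K 3 => 1 : K)
  (fun q : pt K 3 => (zc q * yc q + a3) * (yc q * yc q)) (@yc K)
  (fun q : pt K 3 => xc q * yc q) (fun _ : pt K 3 => 1 : K)
  (fun q : pt K 3 => (yc q * zc q - a3) * (yc q * yc q)) (@yc K) (@yc K).
- by exists (row3 0 1 0, 0); rewrite row3_yc oner_neq0.
- move=> q h; split=> //; unfold_tac; split=> //; first by congr row3; field.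
  by split; field.
- by [].
- by rewrite row3_yc div1r invr_neq0.
Qed.

Lemma regular_inverse5 c : regular_inverse (psi8 (@Ordinal 8 5 isT)) c.
Proof.
case: (eqVneq (yc c) 0) => [z0|z0].
  by apply/(regular_inverse_xinf n6); rewrite /= row2_k1.
via_tac 5%N 3%N (fun q : pt K 3 => xc q * yc q) (fun _ : pt K 3 => 1 : K)
  (fun q : pt K 3 => (zc q * yc q + a3) * (yc q * yc q)) (@yc K)
  (fun q : pt K 3 => xc q * yc q) (fun _ : pt K 3 => 1 : K)
  (fun q : pt K 3 => (yc q * zc q - a3) * (yc q * yc q)) (@yc K)
  (fun q : pt K 3 => xc q * yc q).
- by exists (row3 1 1 0, 0); rewrite row3_xc row3_yc mulr1 oner_neq0.
- move=> q h; split=> //; move: h; rewrite mulf_eq0 negb_or => /andP[h h'].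
  unfold_tac; split; first by rewrite div1r invr_neq0.
    by congr row3; field; rewrite ?h ?h'.
  by split; field; rewrite ?h ?h'.
- by [].
- by rewrite row3_yc div1r invr_neq0.
Qed.

(** For z_1 nonzero the point lies over C^2. Its coordinate x = 1/x_1 - 1/z_1 is infinite at x_1 =
    0, where chart 3 is used; otherwise chart 0 serves. *)
Lemma regular_inverse1 c : regular_inverse (psi8 (@Ordinal 8 1 isT)) c.
Proof.
case: (eqVneq (zc c) 0) => [z0|z0].
  by apply/regular_inverse_swap/(regular_inverse_xinf n2); rewrite /= row2_k1 row3_yc.
case: (eqVneq (xc c) 0) => [x0|x0].
  via_tac 1%N 3%N (fun q : pt K 3 => xc q * (zc q * zc q))
    (fun q : pt K 3 => (yc q * zc q - a2) * zc q * (zc q * (zc q - xc q)))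
    (fun q : pt K 3 => zc q - xc q) (fun q : pt K 3 => zc q * (zc q - xc q))
    (fun q : pt K 3 => xc q * zc q)
    (fun q : pt K 3 => (yc q * zc q + a2) * zc q * ((1 + xc q * zc q) * zc q))
    (fun q : pt K 3 => 1 + xc q * zc q) (fun q : pt K 3 => (1 + xc q * zc q) * zc q)
    (fun q : pt K 3 => xc q * zc q * (zc q - xc q)).
  - exists (row3 1 0 2, 0); rewrite row3_xc row3_zc mul1r.
    by rewrite (_ : 2 - 1 = 1 :> K) ?mulr1 ?pnatr_eq0 //; ring.
  - move=> q; rewrite !mulf_eq0 !negb_or => /andP[/andP[h h'] h''].
    split; first by rewrite h h'.
    unfold_tac; split.
    + rewrite (_ : 1 / xc q - 1 / zc q = (zc q - xc q) / (xc q * zc q)); last by field; rewrite h h'.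
      by rewrite !mulf_neq0 ?invr_neq0 ?mulf_neq0.
    + by congr row3; field; rewrite ?h ?h' ?h''.
    + by split; field; rewrite ?h ?h' ?h''.
  - by rewrite x0 subr0 mulf_neq0.
  - by rewrite row3_xc row3_zc x0 mul0r mul0r mul0r addr0 mul1r subr0 mulf_neq0 ?invr_neq0 ?mulf_neq0.
via_tac 1%N 0%N (fun q : pt K 3 => zc q - xc q)
  (fun q : pt K 3 => (yc q * zc q - a2) * zc q * (xc q * zc q))
  (@xc K) (fun q : pt K 3 => xc q * zc q)
  (@zc K) (fun q : pt K 3 => (yc q * zc q + a2) * zc q * ((xc q + zc q) * zc q))
  (fun q : pt K 3 => xc q + zc q) (fun q : pt K 3 => (xc q + zc q) * zc q)
  (fun q : pt K 3 => xc q * zc q).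
- by exists (row3 1 0 1, 0); rewrite row3_xc row3_zc mul1r oner_neq0.
- move=> q h; split=> //; move: h; rewrite mulf_eq0 negb_or => /andP[h h'].
  unfold_tac; split=> //; first by congr row3; field; rewrite ?h ?h'.
  by split; field; rewrite ?h ?h'.
- by rewrite mulf_neq0.
- rewrite row3_xc row3_zc (_ : _ * _ = (xc c)^-1 * (zc c)^-1).
    by rewrite mulf_neq0 ?invr_neq0.
  by field; rewrite x0 z0.
Qed.

Lemma regular_inverse7 c : regular_inverse (psi8 (@Ordinal 8 7 isT)) c.
Proof.
case: (eqVneq (zc c) 0) => [z0|z0].
  by apply/regular_inverse_swap/(regular_inverse_xinf n4); rewrite /= row2_k1 row3_yc.
case: (eqVneq (xc c) 0) => [x0|x0].
  via_tac 7%N 3%N (@xc K)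
    (fun q : pt K 3 => ((yc q * zc q - 1 + a2 + a3) * zc q + q.2) * (zc q * (a1 * xc q + zc q))
       - (a1 * xc q + zc q))
    (fun q : pt K 3 => a1 * xc q + zc q) (fun q : pt K 3 => zc q * (a1 * xc q + zc q))
    (@xc K) (fun q : pt K 3 => zc q * ((yc q + zc q - q.2) * zc q + 1 - a2 - a3) *
       (zc q * (zc q - a1 * xc q)))
    (fun q : pt K 3 => zc q - a1 * xc q) (fun q : pt K 3 => zc q * (zc q - a1 * xc q))
    (fun q : pt K 3 => xc q * zc q * (a1 * xc q + zc q)).
  - apply: nonzero_mul; [ispoly_tac|ispoly_tac| |].
      by exists (row3 1 0 1, 0); rewrite row3_xc row3_zc mulr1 oner_neq0.
    by exists (row3 0 0 1, 0); rewrite row3_xc row3_zc mulr0 add0r oner_neq0.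
  - move=> q; rewrite !mulf_eq0 !negb_or => /andP[/andP[h h'] h''].
    split; first by rewrite h h'.
    unfold_tac; split.
    + by rewrite !mulf_neq0 ?invr_neq0.
    + by congr row3; field; rewrite ?h ?h' ?h''.
    + by split; field; rewrite ?h ?h' ?h''.
  - by rewrite x0 mulr0 add0r mulf_neq0.
  - rewrite row3_xc row3_zc x0 mul0r !mulr0 subr0 add0r.
    by rewrite !mulf_neq0 ?invr_neq0 ?mulf_neq0.
via_tac 7%N 0%N (fun q : pt K 3 => zc q * zc q * (a1 * xc q + zc q))
  (fun q : pt K 3 => xc q * ((yc q * zc q - 1 + a2 + a3) * (zc q * zc q) - 1 + q.2 * zc q))
  (@xc K) (fun q : pt K 3 => xc q * zc q)
  (fun _ : pt K 3 => 1 : K) (fun q : pt K 3 => zc q * ((yc q + zc q - q.2) * zc q + 1 - a2 - a3) *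
       (zc q * (xc q * zc q - a1)))
  (fun q : pt K 3 => xc q * zc q - a1) (fun q : pt K 3 => zc q * (xc q * zc q - a1))
  (fun q : pt K 3 => xc q * zc q).
- by exists (row3 1 0 1, 0); rewrite row3_xc row3_zc mul1r oner_neq0.
- move=> q h; split=> //; move: h; rewrite mulf_eq0 negb_or => /andP[h h'].
  unfold_tac; split=> //; first by congr row3; field; rewrite ?h ?h'.
  by split; field; rewrite ?h ?h'.
- by rewrite mulf_neq0.
- rewrite row3_xc row3_zc (_ : _ * _ = (xc c)^-1).
    by rewrite invr_neq0.
  by field; rewrite x0 z0.
Qed.

Lemma regular_inverse8 j c : regular_inverse (psi8 j) c.
Proof.
case: j => -[|[|[|[|[|[|[|[|//]]]]]]]] hj; rewrite (bool_irrelevance hj isT).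
- exact: regular_inverse0.
- exact: regular_inverse1.
- exact: regular_inverse2.
- exact: regular_inverse3.
- exact: regular_inverse4.
- exact: regular_inverse5.
- exact: regular_inverse6.
- exact: regular_inverse7.
Qed.

Lemma achart8 j : achart B (psi8 j) (chart_dom a1 j) (chart a1 a2 a3 j).
Proof.
split.
- exact: xchart_psi8.
- exact: psi8_neq0.
- have w (f : pt K 3 -> K) (u : 'rV[K]_3) : ispoly f -> f (u, 0) != 0 ->
      (forall u, f u != 0 -> chart_dom a1 j u) ->
      exists w, [/\ ispoly w, exists u, w u != 0 & forall u, w u != 0 -> chart_dom a1 j u].
    by move=> pf fu h; exists f; split=> //; exists (u, 0).
  case: j w => -[|[|[|[|[|[|[|[|//]]]]]]]] hj w.
  + by apply: (w (fun=> 1) 0); [exact: ispoly_c|exact: oner_neq0|].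
  + apply: (w (fun u => (xc u + zc u) * zc u) (row3 0 0 1)); [ispoly_tac| |].
      by rewrite row3_xc row3_zc add0r mulr1 oner_neq0.
    by move=> u; rewrite mulf_eq0 negb_or => /andP[].
  + apply: (w (@zc K) (row3 0 0 1)) ; [ispoly_tac| |by []].
    by rewrite row3_zc oner_neq0.
  + apply: (w (@xc K) (row3 1 0 0)) ; [ispoly_tac| |by []].
    by rewrite row3_xc oner_neq0.
  + apply: (w (@zc K) (row3 0 0 1)) ; [ispoly_tac| |by []].
    by rewrite row3_zc oner_neq0.
  + apply: (w (fun u => xc u * yc u) (row3 1 1 0)); [ispoly_tac| |].
      by rewrite row3_xc row3_yc mulr1 oner_neq0.
    by move=> u; rewrite mulf_eq0 negb_or => /andP[].
  + apply: (w (@yc K) (row3 0 1 0)) ; [ispoly_tac| |by []].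
    by rewrite row3_yc oner_neq0.
  + apply: (w (fun u => zc u * (xc u * zc u - a1)) (row3 (1 + a1) 0 1)) ; [ispoly_tac| |by []].
    by rewrite row3_xc row3_zc mulr1 mul1r addrK oner_neq0.
- exact: psi8_chart.
- exact: regular_inverse8.
Qed.

Lemma bundle_point (D : fdata K N M) q p s w : fpoly D -> fcompat A Phi D -> goodat predT D q ->
  model B p -> p.1 = segre s w -> peq s (fE D q) -> q.2 = p.2 ->
  exists2 c, base c = q & peq (xfin D c) p.1 \/ (xc c = 0 /\ peq (xinf D c) p.1).
Proof.
have [[pA pPhi _ _ _] _] := hst.
move=> pD cD [l [i1 [i2 [j0 [j1 [std _ El aj]]]]]] mp ep sq qt.
case: (bundle_charts pA pPhi pD cD std mp ep sq qt El aj) => -[wj [_ _ _ e _]].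
  by eexists; last (by left; apply: peq_sym e); rewrite base_over.
case: (eqVneq (w ord0 j0) 0) => w0.
  exists (over q 0); rewrite ?base_over //; right; split; first exact: xc_over.
  by move: e; rewrite w0 mul0r => /peq_sym.
exists (over q (w ord0 j1 / w ord0 j0)); rewrite ?base_over //; left.
apply: (peq_trans _ (peq_sym e)); rewrite /xfin /xinf !base_over !xc_over.
have /peqP[+ _] := peq_sym e; rewrite /xinf base_over xc_over segre_neq0 => /andP[E0 v0].
have e1 : w ord0 j1 / w ord0 j0 * (w ord0 j0 / w ord0 j1) = 1 by field; rewrite w0 wj.
apply: segre_peq; first exact: peq_refl.
apply: peq_sym; apply: (@peq_of_eq _ _ _ _ (w ord0 j0 / w ord0 j1)).
- by rewrite mulf_neq0 ?invr_neq0.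
- apply: contra_neq v0 => v0; apply: (scalerI (a := w ord0 j1 / w ord0 j0)).
    by rewrite mulf_neq0 ?invr_neq0.
  by rewrite scaler0 scalerDr scalerA e1 scale1r.
- by rewrite scalerDr scalerA [w ord0 j0 / _ * _]mulrC e1 scale1r.
Qed.

Lemma compat0 : fcompat A Phi D0.
Proof.
apply: (nchart_compat (ispoly_c 2 1) _ _ n0) => // t.
by exists (0, t); rewrite ?oner_neq0.
Qed.

Lemma compat_k1 D dom chi xi : nchart A Phi O D [set q | k1 q = 0] [set q | k1 q != 0] dom chi xi ->
  fcompat A Phi D.
Proof.
move=> h; apply: (nchart_compat (ispoly_k1 K) _ _ h) => // t.
by exists (row2 1 0, t) => //; rewrite row2_k1 oner_neq0.
Qed.

(** Equations of the stratum seen in chart j: the equation of the exceptional line, unless the chart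
    lies over C^2, and x_j = 0 in the infinite charts of the fibre. *)
Definition bzero (j : nat) (q : pt K 3) : Prop :=
  match j with
  | 0 => True | 3 => xc q = 0 | 2 | 4 => zc q = 0 | 6 => yc q = 0
  | 5 => xc q = 0 /\ yc q = 0 | _ => xc q = 0 /\ zc q = 0
  end.

Hypothesis hcov : forall s, model A s -> O s ->
    (exists q, q.2 = s.2 /\ peq s.1 (fE D0 q)) \/
    exists q, [/\ q.2 = s.2, k1 q = 0 &
      [\/ peq s.1 (fE D2 q), peq s.1 (fE D4 q) | peq s.1 (fE D6 q)]].

Lemma phase_normal p : phase A Phi O p ->
  exists (j : 'I_8) c, [/\ c.2 = p.2, bzero j c & peq (psi8 j c) p.1].
Proof.
move=> ph; have [mp _] := ph; have [s [w [ep ms mw]]] := model_tens mp.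
have Os : O (s, p.2).
  have := phase_segre hst (s := s) (w := w) (t := p.2); rewrite -ep -surjective_pairing.
  by move=> /(_ mp) [h _]; apply: h.
have sq_of c : base (swap c) = (row2 (zc c) (yc c), c.2).
  by rewrite /base /swap /= row3_yc row3_zc.
have bs (c : pt K 3) : zc (swap c) = yc c /\ xc (swap c) = xc c.
  by rewrite /swap row3_zc row3_xc.
have bt (c : pt K 3) q : base c = q -> c.2 = q.2 by move=> <-.
case: (hcov ms Os) => [[q [qt sq]]|[q [qt k0 [] sq]]].
- have [[pD hG _] _] := n0.
  have [c ec [e|[x0 e]]] := bundle_point pD compat0 (hG q I) mp ep sq qt.
    by exists (@Ordinal 8 0 isT), c; split=> //; rewrite (bt _ _ ec).
  by exists (@Ordinal 8 3 isT), c; split=> //; rewrite (bt _ _ ec).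
- have [[pD hG _] _] := n2.
  have [c ec [e|[x0 e]]] := bundle_point pD (compat_k1 n2) (hG q k0) mp ep sq qt.
    exists (@Ordinal 8 2 isT), (swap c); split; [exact: (etrans (congr1 snd ec) qt)| |by rewrite /psi8 /= swapK].
    by rewrite /= (bs c).1 -k0 -ec row2_k1.
  exists (@Ordinal 8 1 isT), (swap c); split; [exact: (etrans (congr1 snd ec) qt)| |by rewrite /psi8 /= swapK].
  by split; [rewrite (bs c).2|rewrite (bs c).1 -k0 -ec row2_k1].
- have [[pD hG _] _] := n4.
  have [c ec [e|[x0 e]]] := bundle_point pD (compat_k1 n4) (hG q k0) mp ep sq qt.
    exists (@Ordinal 8 4 isT), (swap c); split; [exact: (etrans (congr1 snd ec) qt)| |by rewrite /psi8 /= swapK].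
    by rewrite /= (bs c).1 -k0 -ec row2_k1.
  exists (@Ordinal 8 7 isT), (swap c); split; [exact: (etrans (congr1 snd ec) qt)| |by rewrite /psi8 /= swapK].
  by split; [rewrite (bs c).2|rewrite (bs c).1 -k0 -ec row2_k1].
- have [[pD hG _] _] := n6.
  have [c ec [e|[x0 e]]] := bundle_point pD (compat_k1 n6) (hG q k0) mp ep sq qt.
    exists (@Ordinal 8 6 isT), c; split; [exact: (etrans (congr1 snd ec) qt)| |by []].
    by rewrite /= -k0 -ec row2_k1.
  exists (@Ordinal 8 5 isT), c; split; [exact: (etrans (congr1 snd ec) qt)| |by []].
  by split=> //; rewrite -k0 -ec row2_k1.
Qed.

Lemma psi8_model j q : model B (psi8 j q, q.2).
Proof. by apply: (xchart_model (xchart_psi8 j) (state_neq0 hst)); apply: psi8_neq0. Qed.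

Lemma psi8_phase j q : phase A Phi O (psi8 j q, q.2).
Proof.
have mp := psi8_model j q; split=> //=.
have [[_ _ h0] _] := n0; have [[_ _ h2] _] := n2.
have [[_ _ h4] _] := n4; have [[_ _ h6] _] := n6.
case: j {mp} => -[|[|[|[|[|[|[|[|//]]]]]]]] hj; rewrite /psi8 /=;
  do 2!eexists; (split; first reflexivity).
- exact: (h0 (base q)).
- exact: (h2 (base (swap q))).
- exact: (h2 (base (swap q))).
- exact: (h0 (base q)).
- exact: (h4 (base (swap q))).
- exact: (h6 (base q)).
- exact: (h6 (base q)).
- exact: (h4 (base (swap q))).
Qed.

Lemma phase_images : phase A Phi O = \bigcup_j image_over setT (psi8 j).
Proof.
apply/seteqP; split=> [p /phase_normal[j [c [ct _ e]]]|p [j _ [_ [c e]]]].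
  by exists j => //; split=> //; exists c.1; rewrite -ct -surjective_pairing.
have [mp [s [w [/= es Os]]]] := psi8_phase j (c, p.2).
have /peqP[_ [k k0 ep]] := e; rewrite [p]surjective_pairing ep; split.
  by apply: model_peq mp => /=; apply: peqZ => //; apply: psi8_neq0.
by exists s, (k *: w); rewrite /= es segreZr.
Qed.

Lemma affine_iso8 j : affine_iso setT (psi8 j) (image_over setT (psi8 j)).
Proof.
have h := slice_affine (achart8 j) setT (emb := id) (sel := id)
  (fun i => ispoly_x K i) (fun c a => erefl).
have e : (fun q : pt K 3 => psi8 j (id q.1, q.2)) = psi8 j.
  by apply/funext => q; rewrite /= -surjective_pairing.
by rewrite e in h.
Qed.

Lemma psi8_0 u : peq (B u) (psi8 ord0 u).
Proof. by have := @psi8_chart ord0 u I; rewrite /chart /= -surjective_pairing. Qed.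

Lemma glued8 Y : Y = phase A Phi O -> glued_from_charts a1 a2 a3 (model B) Y psi8.
Proof.
have [cB pB] := state_affine hst; have B0 := state_neq0 hst.
move=> ->; split.
- exact: phase_images.
- move=> j; split; last exact: affine_iso8.
  exact: (image_open pB B0 (achart8 j)).
- move=> j q dq; apply: peq_trans (psi8_chart dq).
  exact: peq_sym (psi8_0 q).
- move=> i j p q; split=> [[pq e]|[pq [G [H [G' [H' [[Hp Gp] _ id]]]]]]].
    split=> //.
    have [G [H [Hp Gp id]]] := transition_regular (achart8 i) (achart8 j) pq e.
    have [G' [H' [Hq Gq id']]] := transition_regular (achart8 j) (achart8 i)
      (esym pq) (peq_sym e).
    exists G, H, G', H'; split=> // u di dj; split=> h; [exact: id|exact: id'].
  split=> //.
  have -> : q = (fracv G H p, p.2) by rewrite Gp pq -surjective_pairing.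
  apply: (transition_peq pB B0 (achart8 i) (achart8 j)) => // u di dj h.
  by have [h1 _] := id u di dj; apply: h1.
Qed.

(** The part of the surface that the chart is centred on: 0 for C^2, and 2, 4, 6 for the exceptional
    lines, named after their finite charts. *)
Definition chart_class (j : nat) : nat :=
  match j with 0 | 3 => 0 | 1 | 2 => 2 | 4 | 7 => 4 | _ => 6 end.

Definition bcoord (j : nat) : pt K 3 -> K := if chart_class j == 6%N then @yc K else @zc K.

Lemma ispoly_bcoord j : ispoly (bcoord j).
Proof. by rewrite /bcoord; case: ifP => _; ispoly_tac. Qed.

Lemma class_coords (j : 'I_8) u : chart_dom a1 j u ->
  let c := (chart a1 a2 a3 j u, u.2) in
  match chart_class j with
  | 0 => yc c = yc u /\ zc c = zc u
  | 2 => [/\ zc u != 0, zc c = 1 / zc u & yc c = (yc u * zc u + a2) * zc u]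
  | 4 => [/\ zc u != 0, zc c = 1 / zc u &
             yc c = ((yc u + zc u - u.2) * zc u + 1 - a2 - a3) * zc u]
  | _ => [/\ yc u != 0, yc c = 1 / yc u & zc c = (yc u * zc u - a3) * yc u]
  end.
Proof.
case: j => -[|[|[|[|[|[|[|[|//]]]]]]]] hj; rewrite /chart_dom /chart /= ?row3_yc ?row3_zc.
- by [].
- by move=> [_ z0].
- by [].
- by [].
- by [].
- by move=> [_ z0].
- by [].
- by rewrite mulf_eq0 negb_or => /andP[z0 _]; split=> //; rewrite mulrC.
Qed.

Lemma overlap8 (i j : 'I_8) f g h p q : ispoly f -> ispoly g -> ispoly h ->
  (forall u, chart_dom a1 i u -> chart_dom a1 j u ->
     f (chart a1 a2 a3 i u, u.2) * g (chart a1 a2 a3 j u, u.2) =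
     h (chart a1 a2 a3 i u, u.2)) ->
  p.2 = q.2 -> peq (psi8 i p) (psi8 j q) -> f p * g q = h p.
Proof.
have [cB pB] := state_affine hst.
exact: (overlap_identity pB (state_neq0 hst) (achart8 i) (achart8 j)).
Qed.

(** On C^3 the boundary coordinate of chart i is 1/z or 1/y. Its product with z or y, which is a
    coordinate of chart j, is 1, but on the line it would be 0. *)
Lemma separate_affine (i j : 'I_8) p q : chart_class i != 0%N -> chart_class j == 0%N ->
  bcoord i p = 0 -> p.2 = q.2 -> ~ peq (psi8 i p) (psi8 j q).
Proof.
move=> ci cj b0 pq e.
have := @overlap8 i j (bcoord i) (bcoord i) (fun=> 1) p q (ispoly_bcoord i) (ispoly_bcoord i)
  (ispoly_c 3 1) _ pq e.
rewrite b0 mul0r => h; have := oner_neq0 K; rewrite -h ?eqxx // => u /class_coords + /class_coords.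
rewrite /bcoord (eqP cj) /=; case: i ci {p q b0 pq e h} => -[|[|[|[|[|[|[|[|//]]]]]]]] hi //= _;
  by move=> [h ei _] [e1 e2]; rewrite ei ?e1 ?e2 div1r mulVf.
Qed.

(** The fibre coordinates of the infinite and the finite chart over the same base have product 1. *)
Lemma separate_same (i j : 'I_8) p q :
  (val i, val j) \in [:: (3, 0); (1, 2); (7, 4); (5, 6)]%N ->
  xc p = 0 -> p.2 = q.2 -> ~ peq (psi8 i p) (psi8 j q).
Proof.
move=> ij x0 pq e.
have := @overlap8 i j (@xc K) (@xc K) (fun=> 1) p q (ispoly_xc K) (ispoly_xc K)
  (ispoly_c 3 1) _ pq e.
rewrite x0 mul0r => h; have := oner_neq0 K; rewrite -h ?eqxx // => u.
case: i j ij {p q x0 pq e h} => -[|[|[|[|[|[|[|[|//]]]]]]]] hi //=;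
  case=> -[|[|[|[|[|[|[|[|//]]]]]]]] hj // _; rewrite /chart_dom /chart /= ?row3_xc.
- by move=> [h _] _; rewrite div1r; apply: mulVf.
- by move=> h _; rewrite div1r; apply: mulVf.
- by move=> [h _] _; rewrite div1r; apply: mulVf.
- by move=> h _; rewrite [(_ - a1) * _]mulrC div1r; apply: mulVf.
Qed.

Lemma separate_class (i j : 'I_8) p q : chart_class i != 0%N ->
  (chart_class i < chart_class j)%N -> bcoord i p = 0 -> bcoord j q = 0 -> p.2 = q.2 ->
  ~ peq (psi8 i p) (psi8 j q).
Proof.
move=> ci ij bi bj pq e; apply: (elimN eqP (oner_neq0 K)).
have key f g h : ispoly f -> ispoly g -> ispoly h -> f p * g q = 0 -> h p = 1 ->
    (forall u, chart_dom a1 i u -> chart_dom a1 j u ->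
     f (chart a1 a2 a3 i u, u.2) * g (chart a1 a2 a3 j u, u.2) =
     h (chart a1 a2 a3 i u, u.2)) -> 1 = 0 :> K.
  move=> pf pg ph fg0 h1 id; rewrite -h1 -fg0; apply/esym.
  exact: (overlap8 pf pg ph id pq e).
have [[c1 c2]|[c1 c2]|[c1 c2]] : [\/ chart_class i = 2%N /\ chart_class j = 4%N,
    chart_class i = 2%N /\ chart_class j = 6%N | chart_class i = 4%N /\ chart_class j = 6%N].
  case: i j ci ij {bi bj e key} => -[|[|[|[|[|[|[|[|//]]]]]]]] hi //;
  case=> -[|[|[|[|[|[|[|[|//]]]]]]]] hj //= _ _;
  by [apply: Or31|apply: Or32|apply: Or33].
- (* yz + a2 and (y + z - t) z + 1 - a2 - a3 are regular at the two lines, z is not *)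
  move: bi bj; rewrite /bcoord c1 c2 /= => bi bj.
  apply: (key (fun=> 1) (fun q => zc q * zc q * (yc q * zc q - 1 + a2 + a3 + a2))
    (fun p => 1 - p.2 * zc p + yc p * zc p * (zc p * zc p))); try ispoly_tac.
  + by rewrite bj !mul0r mulr0.
  + by rewrite bi !mulr0 subr0 addr0.
  + move=> u /class_coords + /class_coords; rewrite c1 c2 => -[z0 -> ->] [_ -> ->].
    by field.
- move: bi bj; rewrite /bcoord c1 c2 /= => bi bj.
  apply: (key (fun p => (yc p * zc p - a2) * (zc p * zc p))
    (fun q => (zc q * yc q + a3) * (yc q * yc q)) (fun=> 1)); try ispoly_tac.
  + by rewrite bi !mulr0 mul0r.
  + by [].
  + move=> u /class_coords + /class_coords; rewrite c1 c2 => -[z0 -> ->] [y0 -> ->].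
    by field; rewrite z0 y0.
- move: bi bj; rewrite /bcoord c1 c2 /= => bi bj.
  apply: (key (fun p => (yc p * zc p - 1 + a2 + a3) * (zc p * zc p) - 1 + p.2 * zc p)
    (fun q => (zc q * yc q + a3) * (yc q * yc q)) (fun=> 1)); try ispoly_tac.
  + by rewrite bj !mulr0.
  + by [].
  + move=> u /class_coords + /class_coords; rewrite c1 c2 => -[z0 -> ->] [y0 -> ->].
    by field; rewrite z0 y0.
Qed.

Lemma unchart_peq (j : 'I_8) q : bdry j q != 0 -> peq (psi8 j q) (psi8 ord0 (unchart j q)).
Proof.
move=> /unchartP[du ec]; have e := psi8_chart du; rewrite ec -surjective_pairing in e.
exact: peq_trans (peq_sym e) (psi8_0 _).
Qed.

(** With nonzero boundary coordinate the base point is that of some u in C^3, so the point lies over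
    C^2 and is covered by the finite or the infinite chart there. *)
Lemma off_boundary (j : 'I_8) q : chart_class j != 0%N -> bcoord j q != 0 ->
  exists (i : 'I_8) q', [/\ chart_class i == 0%N, q'.2 = q.2 & peq (psi8 j q) (psi8 i q')].
Proof.
move=> cj b0; have [mp [s [w [ep Os]]]] := psi8_phase j q.
have sur D dom chi xi (q' : pt K 2) : nchart A Phi O D [set q | k1 q = 0] [set q | k1 q != 0]
    dom chi xi -> k1 q' != 0 -> peq s (fE D q') -> q'.2 = q.2 ->
    exists q0 : pt K 2, peq s (fE D0 q0) /\ q0.2 = q.2.
  move=> [_ [_ hf hs]] k0 e qt; have [u [du eu _]] := hs q' 0 k0.
  have [_ [_ hf0 _]] := n0; have [_ e1 _] := hf u du; have [t2 e2 _] := hf0 u I.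
  exists (chi0 u); split.
    by apply: (peq_trans e); rewrite -eu; apply: peq_trans (peq_sym e1) e2.
  by rewrite -t2 -qt; have [+ _ _] := hf u du; rewrite eu.
have [q0 [e0 t0]] : exists q0 : pt K 2, peq s (fE D0 q0) /\ q0.2 = q.2.
  have hs (D : fdata K N M) q' v : psi8 j q = segre (fE D q') v -> peq s (fE D q').
    move=> e; rewrite /= e in ep; have := peq_refl (psi8_neq0 j q); rewrite {1}e ep.
    rewrite e => /segre_peq_inv[_ _]; have : peq (segre s w) (segre (fE D q') v).
      by rewrite -ep; apply: peq_refl; rewrite -e; apply: psi8_neq0.
    by move=> /segre_peq_inv[].
  move: b0 hs cj; clear ep mp Os; case: j => -[|[|[|[|[|[|[|[|//]]]]]]]] hj;
    rewrite /bcoord /psi8 /= => b0 hs // _.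
  - by apply: (sur _ _ _ _ (base (swap q)) n2); [rewrite row2_k1 row3_yc|exact: hs|].
  - by apply: (sur _ _ _ _ (base (swap q)) n2); [rewrite row2_k1 row3_yc|exact: hs|].
  - by apply: (sur _ _ _ _ (base (swap q)) n4); [rewrite row2_k1 row3_yc|exact: hs|].
  - by apply: (sur _ _ _ _ (base q) n6); [rewrite row2_k1|exact: hs|].
  - by apply: (sur _ _ _ _ (base q) n6); [rewrite row2_k1|exact: hs|].
  - by apply: (sur _ _ _ _ (base (swap q)) n4); [rewrite row2_k1 row3_yc|exact: hs|].
have [[pD hG _] _] := n0.
have [c ec [e|[x0 e]]] := bundle_point pD compat0 (hG q0 I) mp ep e0 t0.
  exists (@Ordinal 8 0 isT), c; split=> //; last exact: peq_sym.
  exact: (etrans (congr1 snd ec) t0).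
exists (@Ordinal 8 3 isT), c; split=> //; last exact: peq_sym.
exact: (etrans (congr1 snd ec) t0).
Qed.

Definition chart_rank (j : nat) : nat := nth 0 [:: 3; 1; 2; 2; 2; 1; 2; 1]%N j.

(** A point in normal form in chart i is missed by all other charts of the same or larger rank.
    Disjointness, local closedness and the frontier condition of the strata all rest on this. *)
Lemma separate (i j : 'I_8) p q : i != j -> (chart_rank i <= chart_rank j)%N ->
  bzero i p -> p.2 = q.2 -> ~ peq (psi8 i p) (psi8 j q).
Proof.
move=> ij rk bz pq e.
have bi : chart_class i != 0%N -> bcoord i p = 0.
  move: bz; rewrite /bcoord; case: i {ij rk e} => -[|[|[|[|[|[|[|[|//]]]]]]]] hi //=; by case.
case: (boolP (chart_class i == 0%N)) => ci; last first.
  have bi0 := bi ci; case: (boolP (chart_class j == 0%N)) => cj.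
    exact: separate_affine ci cj bi0 pq e.
  case: (eqVneq (bcoord j q) 0) => bj; last first.
    have [k [q' [ck qt e']]] := off_boundary cj bj.
    apply: (separate_affine ci ck bi0 _ (peq_trans e e')); by rewrite qt.
  case: (ltngtP (chart_class i) (chart_class j)) => cij.
  - exact: separate_class ci cij bi0 bj pq e.
  - exact: separate_class cj cij bj bi0 (esym pq) (peq_sym e).
  apply: (separate_same _ _ pq e).
    move: ij rk ci cj cij; rewrite -val_eqE; clear; case: i => -[|[|[|[|[|[|[|[|//]]]]]]]] hi //;
    by case: j => -[|[|[|[|[|[|[|[|//]]]]]]]] hj.
  move: bz ij rk cij; rewrite -val_eqE; clear; case: i => -[|[|[|[|[|[|[|[|//]]]]]]]] hi //=;
    (case: j => -[|[|[|[|[|[|[|[|//]]]]]]]] hj //=); by case.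
have i3 : val i = 3%N.
  move: ij rk ci; rewrite -val_eqE; clear; case: i => -[|[|[|[|[|[|[|[|//]]]]]]]] hi //;
  by case: j => -[|[|[|[|[|[|[|[|//]]]]]]]] hj.
have x0 : xc p = 0 by move: bz; rewrite /bzero i3.
case: (boolP (chart_class j == 0%N)) => cj.
  apply: (separate_same _ x0 pq e); move: ij cj; rewrite -val_eqE /= i3; clear.
  by case: j => -[|[|[|[|[|[|[|[|//]]]]]]]] hj.
case: (eqVneq (bcoord j q) 0) => bj.
  exact: separate_affine cj ci bj (esym pq) (peq_sym e).
have bd : bdry j q != 0.
  move: bj rk cj; rewrite /bcoord i3; clear; by case: j => -[|[|[|[|[|[|[|[|//]]]]]]]] hj.
apply: (@separate_same i ord0 p (unchart j q) _ x0 pq); first by rewrite i3.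
exact: peq_trans e (unchart_peq bd).
Qed.

Definition stratum_chart (i : 'I_8) : 'I_8 := inord (nth 0 [:: 0; 3; 2; 4; 6; 1; 5; 7] i)%N.

Definition stratum_sel (i : 'I_8) (a : 'I_(stratum_dim i)) : 'I_3 :=
  inord (nth 0 (nth [::] [:: [:: 0; 1; 2]; [:: 1; 2]; [:: 0; 1]; [:: 0; 1]; [:: 0; 2];
    [:: 1]; [:: 2]; [:: 1]] i) a)%N.

Definition stratum_emb (i : 'I_8) (c : 'rV[K]_(stratum_dim i)) : 'rV[K]_3 :=
  \row_b (if [pick a | stratum_sel a == b] is Some a then c ord0 a else 0).

Definition stratum (t : K) (i : 'I_8) : set (pt K (N * M)) :=
  image_over [set t] (fun q : pt K (stratum_dim i) =>
    psi8 (stratum_chart i) (stratum_emb q.1, q.2)).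

Lemma stratum_sel_inj i : injective (@stratum_sel i).
Proof.
case: i => -[|[|[|[|[|[|[|[|//]]]]]]]] hi; rewrite /stratum_sel /=;
  (case=> -[|[|[|//]]] ha //; case=> -[|[|[|//]]] hb //);
  move=> /(congr1 val); rewrite /= ?inordK // => _; exact: val_inj.
Qed.

Lemma stratum_embE i (c : 'rV[K]_(stratum_dim i)) a : stratum_emb c ord0 (stratum_sel a) = c ord0 a.
Proof.
rewrite mxE; case: pickP => [a' /eqP/stratum_sel_inj -> //|/(_ a)].
by rewrite eqxx.
Qed.

Lemma stratum_emb0 i (c : 'rV[K]_(stratum_dim i)) b : (forall a : 'I_(stratum_dim i), stratum_sel a != b) ->
  stratum_emb c ord0 b = 0.
Proof. by move=> h; rewrite mxE; case: pickP => // a; rewrite (negbTE (h a)). Qed.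

Lemma polyv_emb i : polyv (fun q : pt K (stratum_dim i) => stratum_emb q.1).
Proof.
move=> b; case E: [pick a : 'I_(stratum_dim i) | stratum_sel a == b] => [a|].
  by apply: ispoly_ext (ispoly_x K a) => q; rewrite mxE E.
by apply: ispoly_ext (ispoly_c _ 0) => q; rewrite mxE E.
Qed.

Lemma bzero_emb i (c : 'rV[K]_(stratum_dim i)) t : bzero (stratum_chart i) (stratum_emb c, t).
Proof.
have h := @stratum_emb0 i c; rewrite /stratum_chart inordK; last first.
  by clear; case: i => -[|[|[|[|[|[|[|[|//]]]]]]]].
case: i c h => -[|[|[|[|[|[|[|[|//]]]]]]]] hi c h //=; rewrite /xc /yc /zc /=;
  try split; apply: h; (case=> -[|[|[|//]]] ha //);
  by rewrite /stratum_sel -val_eqE /= !inordK.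
Qed.

Lemma bzero_sel (i : 'I_8) (c : pt K 3) b : bzero (stratum_chart i) c ->
  (exists a : 'I_(stratum_dim i), stratum_sel a = b) \/ c.1 ord0 b = 0.
Proof.
rewrite /stratum_chart inordK; last first.
  by clear; case: i => -[|[|[|[|[|[|[|[|//]]]]]]]].
case: i => -[|[|[|[|[|[|[|[|//]]]]]]]] hi /=; rewrite /xc /yc /zc => h;
  move: b; apply: forall_I3; try (by right; case: h); try (by right; apply: h); left.
all: first [by exists (@Ordinal (stratum_dim (Ordinal hi)) 0 isT)
  | by exists (@Ordinal (stratum_dim (Ordinal hi)) 1 isT)
  | by exists (@Ordinal (stratum_dim (Ordinal hi)) 2 isT)].
Qed.

Lemma stratumP t i p : stratum t i p <-> exists c : pt K 3,
  [/\ p.2 = t, c.2 = t, bzero (stratum_chart i) c & peq (psi8 (stratum_chart i) c) p.1].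
Proof.
split=> [[pt [c e]]|[c [pt ct bz e]]].
  by exists (stratum_emb c, p.2); split=> //; exact: bzero_emb.
split=> //; exists (\row_a c.1 ord0 (stratum_sel a)); rewrite /= pt -ct.
rewrite (_ : stratum_emb _ = c.1) -?surjective_pairing //.
apply/rowP => b; case: (bzero_sel b bz) => [[a <-]|b0].
  by rewrite stratum_embE mxE.
rewrite b0 mxE; case: pickP => // a /eqP ab; by rewrite mxE ab.
Qed.

Lemma stratum_chart_inj : injective stratum_chart.
Proof.
have h (i : 'I_8) : (nth 0 [:: 0; 3; 2; 4; 6; 1; 5; 7] i < 8)%N.
  by case: i => -[|[|[|[|[|[|[|[|//]]]]]]]].
move=> i j /(congr1 val); rewrite /stratum_chart /= !inordK // => e.
apply: val_inj; move: e; case: i => -[|[|[|[|[|[|[|[|//]]]]]]]] hi;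
  by case: j => -[|[|[|[|[|[|[|[|//]]]]]]]] hj.
Qed.

Lemma chart_rank_dim i : chart_rank (stratum_chart i) = stratum_dim i.
Proof.
rewrite /stratum_chart inordK; last by clear; case: i => -[|[|[|[|[|[|[|[|//]]]]]]]].
by case: i => -[|[|[|[|[|[|[|[|//]]]]]]]].
Qed.

Lemma stratum_chart_sur j : exists i, stratum_chart i = j.
Proof.
have h k (hk : (k < 8)%N) (hj : (nth 0 [:: 0; 3; 2; 4; 6; 1; 5; 7] k < 8)%N) :
    exists i, stratum_chart i = Ordinal hj.
  by exists (Ordinal hk); apply: val_inj; rewrite /stratum_chart /= inordK.
case: j => -[|[|[|[|[|[|[|[|//]]]]]]]] hj; [exact: (h 0%N)|exact: (h 5%N)|exact: (h 2%N)
  |exact: (h 1%N)|exact: (h 3%N)|exact: (h 6%N)|exact: (h 4%N)|exact: (h 7%N)].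
Qed.

Lemma phase_stratum p : phase A Phi O p -> exists i, stratum p.2 i p.
Proof.
move=> /phase_normal[j [c [ct bz e]]]; have [i ei] := stratum_chart_sur j.
by exists i; apply/stratumP; exists c; rewrite ei.
Qed.

Lemma stratum_image t i p : stratum t i p -> image_over setT (psi8 (stratum_chart i)) p.
Proof.
move=> /stratumP[c [pt ct _ e]]; split=> //; exists c.1.
by rewrite pt -ct -surjective_pairing.
Qed.

Lemma stratum_phase t i p : stratum t i p -> phase A Phi O p.
Proof. by move=> /stratum_image h; rewrite phase_images; exists (stratum_chart i). Qed.

Lemma stratum_off_image t i (j : 'I_8) p : stratum_chart i != j ->
  (stratum_dim i <= chart_rank j)%N -> stratum t i p -> ~ image_over setT (psi8 j) p.
Proof.
move=> ij rk /stratumP[c [pt ct bz e]] [_ [c' e']].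
apply: (@separate _ j c (c', p.2) ij _ bz); first by rewrite chart_rank_dim.
  by rewrite ct pt.
exact: peq_trans e (peq_sym e').
Qed.

Lemma zclosed_all N' (T : Type) (C : T -> set (pt K N')) : (forall i, zclosed (C i)) ->
  zclosed [set q : pt K N' | q.1 != 0 /\ forall i, C i q].
Proof.
move=> h; have /choice[I hI] : forall i, exists I : nat -> (pt K N' -> K) -> Prop,
    (forall d g, I d g -> hpoly d g) /\
    forall q, C i q <-> q.1 != 0 /\ forall d g, I d g -> g q = 0.
  by move=> i; apply/zclosedP.
apply/zclosedP; exists (fun d g => exists i, I i d g); split=> [d g [i Ii] |q].
  by have [h1 _] := hI i; apply: h1 Ii.
split=> [[q0 hq]|[q0 hq]]; split=> //.
  move=> d g [i Ig]; have [_ h2] := hI i.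
  by have [/(_ (hq i))[_ h3] _] := h2 q; apply: h3 Ig.
move=> i; have [_ h2] := hI i; apply/h2; split=> // d g Ig.
by apply: (hq d g); exists i.
Qed.

Lemma fiber_zclosed N' (C : set (pt K N')) t : zclosed C -> zclosed (fiber C t).
Proof.
move=> zC; have -> : fiber C t = C `&` [set q : pt K N' | q.1 != 0 /\
    forall i : unit, (('X - t%:P : {poly K}).[q.2]) = 0].
  have [J _ CE] := zC; apply/seteqP; split=> q [Cq h]; split=> //.
    split=> [|_]; first by move: Cq; rewrite CE => -[].
    by rewrite hornerXsubC h subrr.
  by have [_ /(_ tt)/eqP] := h; rewrite hornerXsubC subr_eq0 => /eqP.
apply: zclosedI => //; apply: (zclosed_hpoly (d := fun=> 0%N)) => _.
exact: hpoly_tp.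
Qed.

Lemma stratification8 t : stratification (fiber (phase A Phi O) t) t stratum_dim (stratum t).
Proof.
have [cB pB] := state_affine hst; have B0 := state_neq0 hst.
have /choice[C hC] : forall j, exists C, zclosed C /\
    image_over setT (psi8 j) = model B `\` C.
  by move=> j; have [C zC e] := image_open pB B0 (achart8 j); exists C.
have closed j : zclosed (model B `\` image_over setT (psi8 j)).
  have [zC e] := hC j; rewrite e.
  have -> : model B `\` (model B `\` C j) = model B `&` C j.
    apply/seteqP; split=> p [mp h]; split=> //; first by apply: contrapT => nC; apply: h.
    by move=> [].
  by apply: zclosedI => //; exact: model_zclosed.
have sub_model i p : stratum t i p -> model B p by move=> /stratum_phase[].
split.
- apply/seteqP; split=> [p [/phase_stratum[i h] <-]|p [i _ h]]; first by exists i.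
  by split; [exact: stratum_phase h|case/stratumP: h => c []].
- move=> i j _ _ [p [hi hj]]; apply/stratum_chart_inj/eqP/negPn/negP => ij.
  case: (leqP (stratum_dim i) (stratum_dim j)) => rk.
    apply: (stratum_off_image ij _ hi (stratum_image hj)); by rewrite chart_rank_dim.
  apply: (stratum_off_image _ _ hj (stratum_image hi)); first by rewrite eq_sym.
  by rewrite chart_rank_dim ltnW.
(* The stratum consists of the points of its own chart that all other charts of rank at least its
   dimension miss. *)
- move=> i; pose Q j := (j != stratum_chart i) && (stratum_dim i <= chart_rank j)%N.
  exists (fiber (model B) t `&` [set q | q.1 != 0 /\
      forall j : {j | Q j}, (model B `\` image_over setT (psi8 (sval j))) q]), (C (stratum_chart i)).
  have [zC eC] := hC (stratum_chart i); split=> //.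
    apply: zclosedI; first by apply: fiber_zclosed; exact: model_zclosed.
    by apply: zclosed_all => j; apply: closed.
  apply/seteqP; split=> [p h|p [[[mp pt] [_ h]] nC]].
    have mp := sub_model _ _ h; split; last first.
      by have := stratum_image h; rewrite eC => -[].
    split; first by split=> //; case/stratumP: h => c [].
    split=> [|[j /= /andP[ij rk]]]; first exact: model_neq0 mp.
    split=> //; apply: stratum_off_image h => //; by rewrite eq_sym.
  have im : image_over setT (psi8 (stratum_chart i)) p by rewrite eC.
  have ph : phase A Phi O p by rewrite phase_images; exists (stratum_chart i).
  have [i' h'] := phase_stratum ph; rewrite pt in h'.
  case: (eqVneq i' i) => [<- //|ii]; exfalso.
  have cii : stratum_chart i' != stratum_chart i by apply: contra_neq ii => /stratum_chart_inj.
  case: (leqP (stratum_dim i) (stratum_dim i')) => rk.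
    have Qi : Q (stratum_chart i') by rewrite /Q cii chart_rank_dim.
    by have [_] := h (exist (fun j => is_true (Q j)) _ Qi); apply; apply: stratum_image h'.
  apply: (stratum_off_image cii _ h' im); by rewrite chart_rank_dim ltnW.
(* If the stratum i' through a frontier point had dimension at least that of stratum i, the open
   image of its chart would contain the point while missing stratum i, hence also its closure. *)
- move=> i p [[[ph pt] cl] np]; have [i' h'] := phase_stratum ph; rewrite pt in h'.
  exists i' => //=; rewrite ltnNge; apply/negP => rk; apply: np.
  case: (eqVneq i' i) => [<- //|ii]; exfalso.
  have cii : stratum_chart i != stratum_chart i'.
    by apply: contra_neq ii => /stratum_chart_inj.
  have : (model B `\` image_over setT (psi8 (stratum_chart i'))) p.
    apply: (zclosure_min (closed _) _ cl) => q hq; split; first exact: sub_model hq.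
    by apply: stratum_off_image hq => //; rewrite chart_rank_dim.
  by move=> [_]; apply; apply: stratum_image h'.
- move=> i; exists (fun q : pt K (stratum_dim i) => psi8 (stratum_chart i) (stratum_emb q.1, q.2)).
  exact: (slice_affine (achart8 _) [set t] (polyv_emb i) (@stratum_embE i)).
Qed.

End Assembly.

(** * A weighted l^1 norm on polynomials *)

Section PolynomialNorm.
Variable K : numClosedFieldType.
Implicit Types (p q : {poly K}) (r : K).

(** It bounds the values on the disc of radius r and is submultiplicative; primitives, derivatives
    and division by the variable are estimated coefficient by coefficient. *)
Definition pnorm r p : K := \sum_(i < size p) `|p`_i| * r ^+ i.

Lemma pnorm_wide r p n : (size p <= n)%N -> pnorm r p = \sum_(i < n) `|p`_i| * r ^+ i.
Proof.
move=> h; rewrite /pnorm (big_ord_widen n (fun i => `|p`_i| * r ^+ i) h) [RHS](bigID (fun i : 'I_n => i < size p)%N) /=.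
rewrite [X in _ + X]big1 ?addr0 // => i; rewrite -leqNgt => hi.
by rewrite nth_default // normr0 mul0r.
Qed.

Section Radius.
Variable r : K.
Hypothesis r0 : 0 <= r.

Lemma pnorm_ge0 p : 0 <= pnorm r p.
Proof. by apply: sumr_ge0 => i _; rewrite mulr_ge0 ?exprn_ge0. Qed.

Lemma pnormD p q : pnorm r (p + q) <= pnorm r p + pnorm r q.
Proof.
have h1 := leq_maxl (size p) (size q); have h2 := leq_maxr (size p) (size q).
rewrite (pnorm_wide r h1) (pnorm_wide r h2) (pnorm_wide r (size_polyD p q)) -big_split /=.
apply: ler_sum => i _; rewrite -mulrDl ler_wpM2r ?exprn_ge0 // coefD.
exact: ler_normD.
Qed.

Lemma pnormC c : pnorm r c%:P = `|c|.
Proof.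
rewrite (@pnorm_wide r _ 1%N) ?size_polyC_leq1 // big_ord1 coefC expr0 mulr1 //.
Qed.

Lemma pnormZ c p : pnorm r (c *: p) = `|c| * pnorm r p.
Proof.
rewrite (pnorm_wide r (size_scale_leq c p)) /pnorm mulr_sumr.
by apply: eq_bigr => i _; rewrite coefZ normrM mulrA.
Qed.

Lemma pnormMX p : pnorm r (p * 'X) = r * pnorm r p.
Proof.
rewrite (@pnorm_wide r _ (size p).+1); last first.
  by have := size_polyMleq p 'X; rewrite size_polyX addn2.
rewrite big_ord_recl coefMX eqxx normr0 mul0r add0r /pnorm mulr_sumr.
by apply: eq_bigr => i _; rewrite coefMX /= exprS mulrCA.
Qed.

Lemma pnormM p q : pnorm r (p * q) <= pnorm r p * pnorm r q.
Proof.
elim/poly_ind: p => [|p c IH]; first by rewrite mul0r (pnormC 0) normr0 mul0r.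
rewrite mulrDl mulrAC; apply: le_trans (pnormD _ _) _.
have -> : pnorm r (p * 'X + c%:P) = r * pnorm r p + `|c|.
  rewrite (@pnorm_wide r _ (size p).+1); last first.
    apply: leq_trans (size_polyD _ _) _; rewrite geq_max; apply/andP; split.
      by have := size_polyMleq p 'X; rewrite size_polyX addn2.
    exact: leq_trans (size_polyC_leq1 c) _.
  rewrite big_ord_recl coefD coefMX coefC eqxx add0r expr0 mulr1 addrC; congr (_ + _).
  rewrite /pnorm mulr_sumr; apply: eq_bigr => i _.
  by rewrite coefD coefMX coefC /= addr0 exprS mulrCA.
rewrite mulrDl; apply: lerD; first by rewrite pnormMX -mulrA ler_wpM2l.
by rewrite mul_polyC pnormZ.
Qed.

Lemma pnorm_horner p s : `|s| <= r -> `|p.[s]| <= pnorm r p.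
Proof.
move=> sr; rewrite horner_coef; apply: le_trans (ler_norm_sum _ _ _) _.
apply: ler_sum => i _; rewrite normrM normrX ler_wpM2l //.
by apply: lerXn2r => //; rewrite nnegrE.
Qed.

Definition primitive p : {poly K} := \poly_(i < (size p).+1) (p`_i.-1 / i%:R *+ (i != 0%N)).

Lemma coef_primitive p i : (primitive p)`_i.+1 = p`_i / i.+1%:R.
Proof.
rewrite coef_poly ltnS; case: ltnP => //= h.
by rewrite nth_default // mul0r.
Qed.

Lemma coef0_primitive p : (primitive p)`_0 = 0.
Proof. by rewrite coef_poly. Qed.

Lemma primitive_deriv p : (primitive p)^`() = p.
Proof.
apply/polyP => i; rewrite coef_deriv coef_primitive -[LHS]mulr_natr divfK //.
Qed.

Lemma primitiveB p q : primitive p - primitive q = primitive (p - q).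
Proof.
apply/polyP => -[|i]; rewrite coefB ?coef0_primitive ?subrr // !coef_primitive coefB.
by rewrite mulrBl.
Qed.

(** The factor r gained by integration is what makes the Picard iteration contract on a small
    disc. *)
Lemma pnorm_primitive p : pnorm r (primitive p) <= r * pnorm r p.
Proof.
rewrite (@pnorm_wide r _ (size p).+1) ?size_poly // big_ord_recl coef0_primitive.
rewrite normr0 mul0r add0r /pnorm mulr_sumr; apply: ler_sum => i _.
rewrite coef_primitive exprS mulrCA ler_wpM2l // ler_wpM2r ?exprn_ge0 //.
rewrite normrM normfV normr_nat ler_pdivrMr ?ltr0n // ler_peMr // ler1n //.
Qed.

Definition shiftp p : {poly K} := \poly_(i < size p) p`_i.+1.

Lemma shiftpE p : p = shiftp p * 'X + (p`_0)%:P.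
Proof.
apply/polyP => -[|i]; rewrite coefD coefMX coefC /= ?add0r // addr0 coef_poly.
by case: ltnP => // h; rewrite nth_default // leqW.
Qed.

Lemma shiftpB p q : shiftp p - shiftp q = shiftp (p - q).
Proof.
have h p' i : (shiftp p')`_i = p'`_i.+1.
  by rewrite coef_poly; case: ltnP => // hi; rewrite nth_default // leqW.
by apply/polyP => i; rewrite coefB !h coefB.
Qed.

Lemma pnorm_shiftp p : r * pnorm r (shiftp p) <= pnorm r p.
Proof.
rewrite -pnormMX; rewrite [X in _ <= pnorm r X]shiftpE.
rewrite (@pnorm_wide r _ (size p).+1); last first.
  have := size_polyMleq (shiftp p) 'X; rewrite size_polyX addn2 => h; apply: leq_trans h _.
  by rewrite ltnS size_poly.
rewrite -shiftpE (@pnorm_wide r p (size p).+1) //.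
apply: ler_sum => i _; rewrite ler_wpM2r ?exprn_ge0 // coefMX.
case: i => -[|i] hi /=; first by rewrite normr0.
rewrite coef_poly; case: ifP => // _; by rewrite normr0.
Qed.

End Radius.

Lemma pnorm_le r r' p : 0 <= r -> r <= r' -> pnorm r p <= pnorm r' p.
Proof.
move=> r0 rr; apply: ler_sum => i _; rewrite ler_wpM2l //.
by apply: lerXn2r => //; rewrite nnegrE // (le_trans r0).
Qed.

(** Termwise: x^{i+1} - y^{i+1} is x - y times a sum of i + 1 monomials of size at most r^i. *)
Lemma horner_lip r p x y : 0 <= r -> `|x| <= r -> `|y| <= r ->
  `|p.[x] - p.[y]| <= `|x - y| * pnorm r p^`().
Proof.
move=> r0 xr yr; rewrite !horner_coef -sumrB.
case E: (size p) => [|n].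
  by rewrite big_ord0 normr0 mulr_ge0 ?pnorm_ge0.
have hs : (size p^`() <= n)%N.
  by have := lt_size_deriv (p := p); case: (eqVneq p 0) => [->|p0 /(_ isT)]; rewrite ?deriv0 ?size_poly0 // E ltnS.
rewrite (pnorm_wide r hs) big_ord_recl !expr0 subrr add0r.
apply: le_trans (ler_norm_sum _ _ _) _; rewrite mulr_sumr; apply: ler_sum => i _.
rewrite -mulrBr normrM coef_deriv subrXX normrM mulrCA normrMn mulrnAl.
rewrite ler_wpM2l // -mulrnAr ler_wpM2l //.
apply: le_trans (ler_norm_sum _ _ _) _.
rewrite -[X in _ <= _ *+ X]card_ord -sumr_const; apply: ler_sum => j _.
rewrite normrM !normrX (_ : r ^+ i = r ^+ (i.+1 - j.+1) * r ^+ j); last first.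
  by rewrite -exprD subSS subnK // -ltnS.
apply: ler_pM => //.
- by apply: lerXn2r => //; rewrite nnegrE.
- by apply: lerXn2r => //; rewrite nnegrE.
Qed.

(** Coefficientwise this is i + 1 <= 2^{i+1}: halving the radius pays for the differentiation. *)
Lemma pnorm_deriv r p : 0 < r -> pnorm (r / 2) p^`() <= 2 / r * pnorm r p.
Proof.
move=> r0; have r0' := ltW r0; have r20 : 0 <= r / 2 by rewrite divr_ge0.
case E: (size p) => [|n].
  move/eqP: E; rewrite size_poly_eq0 => /eqP ->.
  by rewrite deriv0 !(pnormC _ 0) normr0 mulr0.
have hs : (size p^`() <= n)%N.
  by have := lt_size_deriv (p := p); case: (eqVneq p 0) => [->|p0 /(_ isT)]; rewrite ?deriv0 ?size_poly0 // E ltnS.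
rewrite (pnorm_wide _ hs) /pnorm E big_ord_recl mulrDr mulr_sumr.
apply: le_trans (_ : _ <= \sum_(i < n) 2 / r * (`|p`_(fintype.lift ord0 i)| * r ^+ fintype.lift ord0 i)) _; last first.
  by rewrite lerDr mulr_ge0 ?divr_ge0 ?mulr_ge0 ?expr0 ?ler01.
apply: ler_sum => i _; rewrite coef_deriv normrMn lift0.
rewrite -[_ *+ _]mulr_natr -mulrA (mulrCA (2 / r)) ler_wpM2l // exprS mulrA divfK ?gt_eqF //.
rewrite exprMn exprVn mulrCA [X in _ <= X]mulrC ler_wpM2l ?exprn_ge0 //.
rewrite ler_pdivrMr ?exprn_gt0 // -exprS -natrX ler_nat.
exact: ltnW (ltn_expl _ _).
Qed.

End PolynomialNorm.

(** * Rules for directional derivatives *)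

Section Derivatives.
Variable K : numFieldType.

Lemma is_deriveP (V W : normedModType K) (f : V -> W) (a v : V) d :
  is_derive a v f d <-> h^-1 *: (f (h *: v + a) - f a) @[h --> (0 : K)^'] --> d.
Proof.
split=> [[df <-]|h]; first exact: df.
apply: DeriveDef; first by apply/cvg_ex; exists d.
exact: cvg_lim h.
Qed.

Lemma is_derive_coord (V : normedModType K) n (M : V -> 'rV[K]_n) (a v : V) (D : 'rV[K]_n) i :
  is_derive a v M D -> is_derive a v (fun x => M x ord0 i) (D ord0 i).
Proof.
move=> /is_deriveP h; apply/is_deriveP.
have := cvg_comp _ _ h (@coord_continuous K 1 n ord0 i D).
by apply: cvg_trans; apply: near_eq_cvg; near=> x; rewrite /= !mxE.
Unshelve. all: by end_near. Qed.

Lemma is_derive_row (V : normedModType K) n (M : V -> 'rV[K]_n) (a v : V) (D : 'rV[K]_n) :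
  (forall i, is_derive a v (fun x => M x ord0 i) (D ord0 i)) -> is_derive a v M D.
Proof.
move=> h; apply/is_deriveP.
have e (w : 'rV[K]_n) : w = \sum_i w ord0 i *: delta_mx ord0 i by exact: row_sum_delta.
rewrite [X in _ --> X]e.
have -> : (fun h : K => h^-1 *: (M (h *: v + a) - M a)) =
    (fun h : K => \sum_i (h^-1 *: (M (h *: v + a) ord0 i - M a ord0 i)) *: delta_mx ord0 i).
  apply/funext => k; rewrite {1}[k^-1 *: _]e; apply: eq_bigr => i _.
  by rewrite !mxE.
have hi i : (h0^-1 *: (M (h0 *: v + a) ord0 i - M a ord0 i)) *: (delta_mx ord0 i : 'rV[K]_n)
    @[h0 --> (0 : K)^'] --> D ord0 i *: delta_mx ord0 i.
  by apply: cvgZr_tmp; apply/is_deriveP.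
elim: (index_enum _) => [|i s IH].
  rewrite big_nil; rewrite (_ : (fun _ => _) = cst 0); first exact: cvg_cst.
  by apply/funext => k; rewrite big_nil.
rewrite big_cons; under eq_cvg do rewrite big_cons.
exact: cvgD (hi i) IH.
Qed.

Lemma is_deriveV_num (V : normedModType K) (f : V -> K) (a v : V) d :
  f a != 0 -> is_derive a v f d -> is_derive a v (fun x => (f x)^-1) (- d / (f a * f a)).
Proof.
move=> fa df; apply/is_deriveP.
have /is_deriveP h := df.
have fc : f (k *: v + a) @[k --> (0 : K)^'] --> f a.
  have fc0 : {for (0 : K), continuous (fun h : K => f (h *: v + a))}.
    by apply/differentiable_continuous/derivable1_diffP/(derivable1P _ _ _).1; case: df.
  by move: fc0 => /continuous_withinNx; rewrite scale0r add0r.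
have fn0 : \forall k \near (0 : K)^', f (k *: v + a) != 0 := cvgr_neq0 _ fc fa.
have lim : - (k^-1 *: (f (k *: v + a) - f a)) / (f a * f (k *: v + a)) @[k --> (0 : K)^']
    --> - d / (f a * f a).
  apply: cvgM; first exact: cvgN.
  apply: cvgV; first by rewrite mulf_neq0.
  by apply: cvgM => //; apply: cvg_cst.
apply: cvg_trans lim; apply: near_eq_cvg.
near=> k.
have k0 : k != 0 by near: k; exact: nbhs_dnbhs_neq.
have fk : f (k *: v + a) != 0.
  near: k; exact: fn0.
by rewrite /GRing.scale /=; field; rewrite fk k0 fa.
Unshelve. all: by end_near. Qed.

Lemma is_derive_additive (V : normedModType K) (f : V -> K) (a v : V) :
  (forall h : K, f (h *: v + a) = h * f v + f a) -> is_derive a v f (f v).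
Proof.
move=> e; apply/is_deriveP.
have : (fun _ : K => f v) @ (0 : K)^' --> f v by apply: cvg_cst.
apply: cvg_trans; apply: near_eq_cvg; near=> k.
have k0 : k != 0 by near: k; exact: nbhs_dnbhs_neq.
by rewrite e addrK /GRing.scale /= mulKf.
Unshelve. all: by end_near. Qed.

Lemma is_deriveM_num (V : normedModType K) (f g : V -> K) (a v : V) df dg :
  is_derive a v f df -> is_derive a v g dg ->
  is_derive a v (fun x => f x * g x) (df * g a + f a * dg).
Proof.
move=> h1 h2; have h := is_deriveM h1 h2.
by apply: is_derive_eq h _; rewrite /GRing.scale /= addrC [g a * _]mulrC.
Qed.

Lemma is_derive_continuous (V : normedModType K) (c : K -> V) (t : K) d :
  is_derive t 1 c d -> {for t, continuous c}.
Proof. by move=> [h _]; apply/differentiable_continuous/derivable1_diffP. Qed.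

Lemma is_derive_unique (V W : normedModType K) (f : V -> W) (a v : V) d d' :
  is_derive a v f d -> is_derive a v f d' -> d = d'.
Proof. by move=> [_ <-] [_ <-]. Qed.

End Derivatives.

(** * Chain rule and differentiability of polynomial functions *)

Section PolynomialDerivatives.
Variable K : numClosedFieldType.

Lemma is_derive_horner (V : normedModType K) (p : {poly K}) (tau : V -> K) (a v : V) tau' :
  is_derive a v tau tau' -> is_derive a v (fun x => p.[tau x]) (p^`().[tau a] * tau').
Proof.
move=> ht; elim/poly_ind: p => [|p c IH].
  have -> : (fun x => (0 : {poly K}).[tau x]) = cst 0 by apply/funext => x; rewrite horner0.
  by apply: is_derive_eq; rewrite deriv0 horner0 mul0r.
have -> : (fun x => (p * 'X + c%:P).[tau x]) = (fun x => p.[tau x] * tau x) + cst c.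
  by apply/funext => x; rewrite hornerD hornerM hornerX hornerC.
have h := is_deriveD (is_deriveM_num IH ht) (is_derive_cst c a v).
apply: is_derive_eq h _.
rewrite derivD derivC derivM derivX !hornerE; ring.
Qed.

(* The partial derivatives of a polynomial function, characterized by the chain rule *)
Lemma ispoly_chain n (f : pt K n -> K) : ispoly f ->
  exists (Df : 'I_n -> pt K n -> K) (Dt : pt K n -> K),
  [/\ forall i, ispoly (Df i), ispoly Dt &
      forall (V : normedModType K) (c : V -> 'rV[K]_n) (tau : V -> K) (a v : V) (c' : 'rV[K]_n) tau',
      (forall i, is_derive a v (fun x => c x ord0 i) (c' ord0 i)) -> is_derive a v tau tau' ->
      is_derive a v (fun x => f (c x, tau x))
        (\sum_i Df i (c a, tau a) * c' ord0 i + Dt (c a, tau a) * tau')].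
Proof.
move: f; apply: ispoly_ind => [f g fg [Df [Dt [h1 h2 h3]]]|p|i|f g pf pg|f g pf pg].
- exists Df, Dt; split=> // V c tau a v c' tau' hc ht.
  rewrite (_ : (fun x => f (c x, tau x)) = (fun x => g (c x, tau x))); first exact: h3.
  by apply/funext => x; rewrite fg.
- exists (fun _ _ => 0), (fun q => p^`().[q.2]); split=> [i||V c tau a v c' tau' hc ht].
  + exact: ispoly_c.
  + exact: ispoly_tp.
  + by rewrite big1 ?add0r => [|i _]; [apply: is_derive_horner|rewrite mul0r].
- exists (fun j _ => (i == j)%:R), (fun=> 0); split=> [j||V c tau a v c' tau' hc ht].
  + exact: ispoly_c.
  + exact: ispoly_c.
  + rewrite mul0r addr0 (bigD1 i) //= eqxx mul1r big1 ?addr0 // => j ji.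
    by rewrite eq_sym (negbTE ji) mul0r.
- move=> [Df [Dft [h1 h2 h3]]] [Dg [Dgt [k1 k2 k3]]].
  exists (fun i q => Df i q + Dg i q), (fun q => Dft q + Dgt q).
  split=> [i||V c tau a v c' tau' hc ht]; try exact: ispolyD.
  have e := @is_deriveD _ _ _ _ _ _ _ _ _ (h3 V c tau a v c' tau' hc ht) (k3 V c tau a v c' tau' hc ht).
  apply: is_derive_eq e _.
  rewrite mulrDl addrACA; congr (_ + _); rewrite -big_split; apply: eq_bigr => i _.
  by rewrite mulrDl.
move=> [Df [Dft [h1 h2 h3]]] [Dg [Dgt [k1 k2 k3]]].
exists (fun i q => Df i q * g q + f q * Dg i q), (fun q => Dft q * g q + f q * Dgt q).
split=> [i||V c tau a v c' tau' hc ht]; try by apply: ispolyD; apply: ispolyM.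
have e := is_deriveM_num (h3 V c tau a v c' tau' hc ht) (k3 V c tau a v c' tau' hc ht).
apply: is_derive_eq e _.
rewrite !mulrDl !mulrDr !mulr_suml !mulr_sumr addrACA; congr (_ + _); last by ring.
by rewrite -big_split; apply: eq_bigr => i _ /=; ring.
Qed.

Lemma ispoly_differentiable n (f : 'rV[K]_n * K -> K) : ispoly (f : pt K n -> K) ->
  forall p : 'rV[K]_n * K, differentiable f p.
Proof.
move: f; apply: ispoly_ind => [f g fg h p|P|i p|f g pf pg hf hg p|f g pf pg hf hg p].
- by rewrite (_ : f = g); [exact: h|apply/funext => q; rewrite fg].
- elim/poly_ind: P => [|P c IH] p.
    rewrite (_ : (fun q => _) = cst 0); first exact: differentiable_cst.
    by apply/funext => q; rewrite horner0.
  rewrite (_ : (fun q => _) = (fun q : 'rV[K]_n * K => P.[q.2]) * snd + cst c); last first.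
    by apply/funext => q; rewrite hornerD hornerM hornerX hornerC.
  apply: differentiableD; last exact: differentiable_cst.
  apply: differentiableM; first exact: IH.
  apply: linear_differentiable => x; exact: cvg_snd.
- rewrite (_ : (fun q => _) = (fun N : 'rV[K]_n => N ord0 i) \o fst); last by [].
  apply: differentiable_comp; first by apply: linear_differentiable => x; exact: cvg_fst.
  exact: differentiable_coord.
- exact: differentiableD.
- exact: differentiableM.
Qed.

Lemma polyv_differentiable n m (F : 'rV[K]_n * K -> 'rV[K]_m) : polyv (F : pt K n -> 'rV[K]_m) ->
  forall p : 'rV[K]_n * K, differentiable F p.
Proof.
move=> pF p.
rewrite (_ : F = \sum_i (fun q => F q ord0 i *: delta_mx ord0 i)); last first.
  by apply/funext => q; rewrite fct_sumE [LHS]row_sum_delta.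
apply: differentiable_sum => i.
exact: (differentiableZl (delta_mx ord0 i) (ispoly_differentiable (pF i) p)).
Qed.

End PolynomialDerivatives.

(** * Completeness and the archimedean property of the complex numbers *)

Section CompleteComplexes.
Variable R : realType.
Local Notation K := (complexes R).

(** The intervals of radius 2c/2^n around x_n are nested, since 2c/2^n = c/2^n + 2c/2^{n+1}; the
    supremum of their left ends lies in all of them. *)
Lemma geometric_cvg_real (x : nat -> R) (c : R) : (forall n, `|x n.+1 - x n| <= c / 2 ^+ n) ->
  exists l, forall n, `|x n - l| <= 2 * c / 2 ^+ n.
Proof.
move=> h.
have h2 n : 0 < 2 ^+ n :> R by rewrite exprn_gt0.
have eS n : 2 * c / 2 ^+ n = c / 2 ^+ n + 2 * c / 2 ^+ n.+1.
  by rewrite exprS; field; rewrite lt0r_neq0.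
pose a n := x n - 2 * c / 2 ^+ n; pose b n := x n + 2 * c / 2 ^+ n.
have c0 n : 0 <= c / 2 ^+ n by apply: le_trans (h n).
have aS n : a n <= a n.+1.
  rewrite /a (eS n); have := h n; rewrite ler_norml => /andP[h1 _]; lra.
have bS n : b n.+1 <= b n.
  rewrite /b (eS n); have := h n; rewrite ler_norml => /andP[_ h1]; lra.
have am : {homo a : m n / (m <= n)%N >-> m <= n} by exact: homo_leq lexx le_trans aS.
have bm : {homo b : m n / (m <= n)%N >-> n <= m}.
  apply: (homo_leq (r := fun u v => v <= u)) bS => // u v w h1 h3; exact: le_trans h3 h1.
have ab n : a n <= b n.
  rewrite /a /b; have : 0 <= 2 * c / 2 ^+ n by rewrite -mulrA mulr_ge0.
  lra.
have ub m n : a m <= b n.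
  apply: (le_trans (am _ _ (leq_maxl m n))); apply: (le_trans (ab _)).
  exact: bm (leq_maxr m n).
exists (sup (range a)) => n.
have hs : has_sup (range a).
  by split; [exists (a 0%N), 0%N|exists (b 0%N) => _ [m _ <-]].
have h1 : a n <= sup (range a) by apply: sup_upper_bound => //; exists n.
have h3 : sup (range a) <= b n.
  by apply: ge_sup => [|_ [m _ <-]]; [exists (a 0%N), 0%N|exact: ub].
by rewrite ler_norml; move: h1 h3; rewrite /a /b => h1 h3; apply/andP; split; lra.
Qed.

Lemma norm_le_ReIm (z : K) : `|z| <= (`|complex.Re z| + `|complex.Im z|)%:C%C.
Proof.
rewrite {1}[z]complexE; apply: (le_trans (ler_normD _ _)).
by rewrite normrM !normc_def /= !expr0n /= !addr0 !add0r expr1n !sqrtr_sqr sqrtr1 mul1r lecE /= addr0 eqxx lexx.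
Qed.

Lemma norm_ge_Im (z : K) : `|complex.Im z|%:C%C <= `|z|.
Proof. by rewrite normc_def lecR -sqrtr_sqr ler_wsqrtr // lerDr sqr_ge0. Qed.

(** Real and imaginary parts each contribute an error 2C/2^n, whence the factor 4. *)
Lemma geometric_cvg (a : nat -> K) (C : K) : (forall n, `|a n.+1 - a n| <= C / 2 ^+ n) ->
  exists l, forall n, `|a n - l| <= 4 * C / 2 ^+ n.
Proof.
move=> h.
pose c := complex.Re C.
have C0 : 0 <= C by have := h 0%N; rewrite expr0 divr1; apply: le_trans.
have eC : C = c%:C%C by rewrite /c RRe_real // ger0_real.
have e2 n (k : R) : (k%:C / 2 ^+ n : K)%C = (k / 2 ^+ n)%:C%C.
  by rewrite rmorphM fmorphV rmorphXn rmorph_nat.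
have hre n : `|complex.Re (a n.+1) - complex.Re (a n)| <= c / 2 ^+ n.
  have := h n; rewrite eC e2 => /(le_trans (normc_ge_Re _)).
  by rewrite lecR raddfB.
have him n : `|complex.Im (a n.+1) - complex.Im (a n)| <= c / 2 ^+ n.
  have := h n; rewrite eC e2 => /(le_trans (norm_ge_Im _)).
  by rewrite lecR raddfB.
have [x hx] := geometric_cvg_real hre.
have [y hy] := geometric_cvg_real him.
exists (x +i* y)%C => n.
apply: (le_trans (norm_le_ReIm _)).
rewrite (_ : 4 * C = (4 * c)%:C%C); last by rewrite {1}eC rmorphM rmorph_nat.
rewrite e2 lecR (_ : 4 * c / 2 ^+ n = 2 * c / 2 ^+ n + 2 * c / 2 ^+ n); last by ring.
by rewrite !raddfB /=; apply: lerD.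
Qed.

Lemma geometric_lt (C e : K) : 0 <= C -> 0 < e -> exists n, C / 2 ^+ n < e.
Proof.
move=> C0 e0; pose c := complex.Re C; pose d := complex.Re e.
have eC : C = c%:C%C by rewrite /c RRe_real // ger0_real.
have ee : e = d%:C%C by rewrite /d RRe_real // gtr0_real.
have d0 : 0 < d by move: e0; rewrite ee ltcR.
have e2 n (k : R) : (k%:C / 2 ^+ n : K)%C = (k / 2 ^+ n)%:C%C.
  by rewrite rmorphM fmorphV rmorphXn rmorph_nat.
exists (Num.truncn (`|c| / d)).+1.
set n := (Num.truncn _).+1.
rewrite eC e2 ee ltcR ltr_pdivrMr ?exprn_gt0 // mulrC -ltr_pdivrMr //.
apply: (@le_lt_trans _ _ (`|c| / d)); first by apply: ler_wpM2r; [rewrite invr_ge0 ltW|exact: ler_norm].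
apply: (@lt_trans _ _ n%:R); first exact: truncnS_gt.
by rewrite -natrX ltr_nat ltn_expl.
Qed.

End CompleteComplexes.

(** * Limits of polynomials in the weighted norm *)

Section PowerLimits.
Variable K : numClosedFieldType.

(** With the archimedean property below, this is what the analysis asks of the complex numbers
    beyond the structure of a closed field with a norm. *)
Definition geometrically_complete := forall (a : nat -> K) (C : K),
  (forall n, `|a n.+1 - a n| <= C / 2 ^+ n) -> exists l, forall n, `|a n - l| <= 4 * C / 2 ^+ n.
Definition geometrically_archimedean := forall C e : K, 0 <= C -> 0 < e ->
  exists n, C / 2 ^+ n < e.

Hypothesis complete : geometrically_complete.
Hypothesis archimedean : geometrically_archimedean.

Lemma pnorm0 (r : K) : pnorm r 0 = 0.
Proof. by rewrite /pnorm size_poly0 big_ord0. Qed.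

Lemma pow2_gt0 n : 0 < 2 ^+ n :> K. Proof. by rewrite exprn_gt0. Qed.

Lemma geometric_le (C : K) m n : 0 <= C -> (n <= m)%N -> C / 2 ^+ m <= C / 2 ^+ n.
Proof.
move=> C0 nm; apply: ler_wpM2l => //; rewrite lef_pV2 ?posrE ?pow2_gt0 //.
by apply: ler_weXn2l => //; rewrite ler1n.
Qed.

Lemma geometric_le_limit (x y B : K) : 0 <= x -> 0 <= y -> 0 <= B ->
  (forall m, x <= y + B / 2 ^+ m) -> x <= y.
Proof.
move=> x0 y0 B0 h; rewrite real_leNgt ?ger0_real //; apply/negP => yx.
have xy0 : 0 < x - y by rewrite subr_gt0.
have [m hm] := archimedean B0 xy0.
suff : x < x by rewrite ltxx.
by apply: (le_lt_trans (h m)); rewrite addrC -ltrBrDr.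
Qed.

Lemma geometric_eq0 (x B : K) : 0 <= B -> (forall m, `|x| <= B / 2 ^+ m) -> x = 0.
Proof.
move=> B0 h; apply/eqP; rewrite -normr_eq0 eq_le normr_ge0 andbT.
by apply: (@geometric_le_limit _ 0 B) => // m; rewrite add0r.
Qed.

Section Telescope.
Variables (r C : K) (p : nat -> {poly K}).
Hypotheses (r0 : 0 <= r) (hp : forall n, pnorm r (p n.+1 - p n) <= C / 2 ^+ n).

Lemma geometric_ge0 : 0 <= C.
Proof. by have := hp 0; rewrite expr0 divr1; apply: le_trans; apply: pnorm_ge0. Qed.

Lemma pnorm_telescope n k : pnorm r (p (n + k)%N - p n) <= 2 * C / 2 ^+ n.
Proof.
suff : pnorm r (p (n + k)%N - p n) <= 2 * C / 2 ^+ n - 2 * C / 2 ^+ (n + k).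
  by move/le_trans; apply; rewrite gerBl divr_ge0 ?mulr_ge0 ?geometric_ge0 ?ltW ?pow2_gt0.
elim: k => [|k IH]; first by rewrite addn0 !subrr pnorm0.
rewrite addnS -(subrKA (p (n + k)%N)).
apply: (le_trans (pnormD r0 _ _)).
apply: (le_trans (lerD (hp _) IH)).
rewrite exprS le_eqVlt; apply/orP; left; apply/eqP.
by field; rewrite !lt0r_neq0 ?pow2_gt0.
Qed.

Lemma power_limit : exists u : K -> K, forall s, `|s| <= r -> forall n,
  `|(p n).[s] - u s| <= 4 * C / 2 ^+ n.
Proof.
have /choice[u hu] : forall s, exists l, `|s| <= r -> forall n, `|(p n).[s] - l| <= 4 * C / 2 ^+ n.
  move=> s; have [sr|sr] := boolP (`|s| <= r); last by exists 0.
  have [l hl] : exists l, forall n, `|(p n).[s] - l| <= 4 * C / 2 ^+ n.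
    apply: complete => n; apply: le_trans (hp n).
    by have := pnorm_horner r0 (p n.+1 - p n) sr; rewrite hornerD hornerN.
  by exists l.
by exists u.
Qed.

End Telescope.

(** The increment of u - p_n is the limit in k of that of p_{n+k} - p_n, which [horner_lip] bounds
    by |h| times a norm of order 2^{-n}. The difference quotients of u are thus uniformly close to
    those of p_n. *)
Lemma power_limit_derive r C D (p : nat -> {poly K}) (u u' : K -> K) : 0 < r -> 0 <= D ->
  (forall n, pnorm r (p n.+1 - p n) <= C / 2 ^+ n) ->
  (forall s, `|s| <= r -> forall n, `|(p n).[s] - u s| <= 4 * C / 2 ^+ n) ->
  (forall s, `|s| <= r / 2 -> forall n, `|(p n)^`().[s] - u' s| <= D / 2 ^+ n) ->
  forall s : K, `|s| < r / 2 -> is_derive s 1 u (u' s).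
Proof.
move=> r0 D0 hp hu hu' s sr.
have C0 := geometric_ge0 (ltW r0) hp.
have r20 : 0 < r / 2 by rewrite divr_gt0.
have r2r : r / 2 <= r by rewrite ler_pdivrMr // ler_peMr ?ltW // ltr1n.
have hd n : pnorm (r / 2) ((p n.+1)^`() - (p n)^`()) <= 2 / r * C / 2 ^+ n.
  rewrite -derivB; apply: (le_trans (pnorm_deriv _ r0)).
  by rewrite -[leRHS]mulrA ler_wpM2l // divr_ge0 // ltW.
pose E := 2 * (2 / r * C).
have E0 : 0 <= E by rewrite !mulr_ge0 ?invr_ge0 // ltW.
have key n (h : K) : `|s + h| <= r / 2 ->
    `|(u (s + h) - u s) - ((p n).[s + h] - (p n).[s])| <= `|h| * (E / 2 ^+ n).
  move=> hs.
  apply: (@geometric_le_limit _ _ (8 * C)) => [|||k] //.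
  - by rewrite mulr_ge0 // divr_ge0 // ltW ?pow2_gt0.
  - by rewrite mulr_ge0.
  have e : u (s + h) - u s - ((p n).[s + h] - (p n).[s]) =
     ((p (n + k)%N - p n).[s + h] - (p (n + k)%N - p n).[s]) +
     (((p (n + k)%N).[s] - u s) - ((p (n + k)%N).[s + h] - u (s + h))).
    by rewrite !hornerD !hornerN; ring.
  rewrite e; apply: (le_trans (ler_normD _ _)); apply: lerD.
    apply: (le_trans (horner_lip _ (ltW r20) hs (ltW sr))).
    rewrite [s + h]addrC addrK; apply: ler_wpM2l => //.
    by rewrite derivB; apply: pnorm_telescope (ltW r20) hd n k.
  apply: (le_trans (ler_normB _ _)).
  have hk t : `|t| <= r / 2 -> `|(p (n + k)%N).[t] - u t| <= 4 * C / 2 ^+ k.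
    move=> ht; apply: (le_trans (hu _ (le_trans ht r2r) _)).
    by apply: geometric_le; rewrite ?mulr_ge0 // leq_addl.
  apply: (le_trans (lerD (hk _ (ltW sr)) (hk _ hs))).
  by rewrite -mulrDl -mulrDl -natrD.
apply/is_deriveP/cvgrPdist_le => e e0.
(* One half of e covers the passage from u to p_n, in the derivative and in the increments; the
   other half the difference quotient of the polynomial p_n. *)
have e20 : 0 < e / 2 by rewrite divr_gt0.
have [n hn] := archimedean (addr_ge0 D0 E0) e20.
have /is_deriveP/cvgrPdist_le/(_ _ e20) hB := is_derive_horner (p n) (is_derive_id (s : K) (1 : K)).
have hr : 0 < r / 2 - `|s| by rewrite subr_gt0.
near=> h.
have h0 : h != 0 by near: h; exact: nbhs_dnbhs_neq.
have hh : `|h| <= r / 2 - `|s| by near: h; exact: dnbhs0_le.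
have hsh : `|s + h| <= r / 2.
  by apply: (le_trans (ler_normD _ _)); rewrite -lerBrDl.
have h1 : `|u' s - (p n)^`().[s]| <= D / 2 ^+ n by rewrite distrC; apply: hu' => //; apply: ltW.
have h2 : `|(p n)^`().[s] * 1 - h^-1 *: ((p n).[h *: 1 + s] - (p n).[s])| <= e / 2.
  by near: h.
rewrite (_ : h *: 1 + s = s + h) in h2 *; last by rewrite addrC /GRing.scale /= mulr1.
have h3 : `|h^-1 * ((u (s + h) - u s) - ((p n).[s + h] - (p n).[s]))| <= E / 2 ^+ n.
  by rewrite normrM normfV ler_pdivrMl ?normr_gt0 //; apply: key.
have -> : u' s - h^-1 *: (u (s + h) - u s) = (u' s - (p n)^`().[s]) +
    ((p n)^`().[s] * 1 - h^-1 *: ((p n).[s + h] - (p n).[s])) -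
    h^-1 * ((u (s + h) - u s) - ((p n).[s + h] - (p n).[s])).
  by rewrite /GRing.scale /=; ring.
apply: (le_trans (ler_normB _ _)).
apply: (le_trans (lerD (ler_normD _ _) (lexx _))).
apply: (le_trans (lerD (lerD h1 h2) h3)).
rewrite addrAC -mulrDl.
by apply: (le_trans (lerD (ltW hn) (lexx _))); rewrite -splitr.
Unshelve. all: by end_near. Qed.

(* Uniform limits on the disc |s| <= r of polynomials converging in the l^1 norm *)
Definition plim (r : K) (u : K -> K) := exists (p : nat -> {poly K}) C,
  (forall n, pnorm r (p n.+1 - p n) <= C / 2 ^+ n) /\
  (forall s, `|s| <= r -> forall n, `|(p n).[s] - u s| <= 4 * C / 2 ^+ n).

Lemma plim_derive r u : 0 < r -> plim r u ->
  exists2 u', plim (r / 2) u' & forall s : K, `|s| < r / 2 -> is_derive s 1 u (u' s).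
Proof.
move=> r0 [p [C [hp hu]]].
have hd n : pnorm (r / 2) ((p n.+1)^`() - (p n)^`()) <= 2 / r * C / 2 ^+ n.
  rewrite -derivB; apply: (le_trans (pnorm_deriv _ r0)).
  by rewrite -[leRHS]mulrA ler_wpM2l // divr_ge0 // ltW.
have r20 : 0 <= r / 2 by rewrite divr_ge0 // ltW.
have [u' hu'] := power_limit r20 hd.
exists u'; first by exists (fun n => (p n)^`()), (2 / r * C).
apply: power_limit_derive r0 _ hp hu hu'.
by rewrite mulr_ge0 // (geometric_ge0 r20 hd).
Qed.

(** The shifted polynomials converge too, by [pnorm_shiftp], and their limit satisfies u(s) = s g(s)
    because the constant terms tend to u(0) = 0. *)
Lemma plim_div r u : 0 < r -> plim r u -> u 0 = 0 ->
  exists2 g, plim r g & forall s, `|s| <= r -> u s = s * g s.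
Proof.
move=> r0 [p [C [hp hu]]] u0.
have C0 := geometric_ge0 (ltW r0) hp.
have hd n : pnorm r (shiftp (p n.+1) - shiftp (p n)) <= C / r / 2 ^+ n.
  rewrite shiftpB -(ler_pM2l r0); apply: (le_trans (pnorm_shiftp (ltW r0) _)).
  apply: (le_trans (hp n)); rewrite le_eqVlt; apply/orP; left; apply/eqP; field.
  by rewrite !lt0r_neq0 ?pow2_gt0.
have [g hg] := power_limit (ltW r0) hd.
exists g; first by exists (fun n => shiftp (p n)), (C / r).
move=> s sr; apply/eqP; rewrite -subr_eq0; apply/eqP.
have D0 : 0 <= C / r by rewrite divr_ge0 // ltW.
apply: (@geometric_eq0 _ (4 * C + `|s| * (4 * (C / r)) + 4 * C)) => [|m].
  have B1 : 0 <= `|s| * (4 * (C / r)) by apply: mulr_ge0 => //; apply: mulr_ge0.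
  by apply: addr_ge0; [apply: addr_ge0|] => //; apply: mulr_ge0.
have h1 := hu s sr m; have h2 := hg s sr m.
have := hu 0 _ m; rewrite normr0 u0 subr0 => /(_ (ltW r0)) h3.
have e : u s - s * g s = ((p m).[0] + s * ((shiftp (p m)).[s] - g s)) - ((p m).[s] - u s).
  rewrite [in (p m).[s]](shiftpE (p m)) hornerD hornerM hornerX hornerC horner_coef0; ring.
have h4 : `|s * ((shiftp (p m)).[s] - g s)| <= `|s| * (4 * (C / r)) / 2 ^+ m.
  by rewrite normrM -[leRHS]mulrA ler_wpM2l.
rewrite e; apply: (le_trans (ler_normB _ _)); rewrite mulrDl; apply: lerD h1.
by rewrite mulrDl; apply: (le_trans (ler_normD _ _)); apply: lerD h3 h4.
Qed.

End PowerLimits.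

(** * Picard iteration with polynomials *)

Section Picard.
Variable K : numClosedFieldType.
Hypothesis complete : geometrically_complete K.
Hypothesis archimedean : geometrically_archimedean K.

(** The function lifted to tuples of polynomials in s = t - t0. Its bound and Lipschitz constant on
    the ball of radius M do not depend on r <= 1, so r can be chosen after them. *)
Lemma ispoly_op n (f : pt K n -> K) (t0 : K) : ispoly f ->
  exists op : ('I_n -> {poly K}) -> {poly K},
  (forall X s, (op X).[s] = f (\row_a (X a).[s], t0 + s)) /\
  forall M, 0 <= M -> exists C L, [/\ 0 <= C, 0 <= L & forall r X Y, 0 <= r -> r <= 1 ->
    (forall a, pnorm r (X a) <= M) -> (forall a, pnorm r (Y a) <= M) ->
    pnorm r (op X) <= C /\ pnorm r (op X - op Y) <= L * \sum_a pnorm r (X a - Y a)].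
Proof.
move: f; apply: ispoly_ind => [f g fg [op [h1 h2]]|p|i|f g pf pg|f g pf pg].
- by exists op; split=> // X s; rewrite h1 fg.
- exists (fun _ => p \Po ('X + t0%:P)); split=> [X s|M M0].
    by rewrite horner_comp !hornerE addrC.
  exists (pnorm 1 (p \Po ('X + t0%:P))), 0; split=> //; first exact: pnorm_ge0.
  move=> r X Y r0 r1 hX hY; split; first exact: pnorm_le.
  by rewrite subrr mul0r pnorm0.
- exists (fun X => X i); split=> [X s|M M0]; first by rewrite /= mxE.
  exists M, 1; split=> // r X Y r0 r1 hX hY; split; first exact: hX.
  by rewrite mul1r (bigD1 i) //= lerDl sumr_ge0 // => j _; apply: pnorm_ge0.
- move=> [opf [f1 f2]] [opg [g1 g2]].
  exists (fun X => opf X + opg X); split=> [X s|M M0]; first by rewrite hornerD f1 g1.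
  have [Cf [Lf [Cf0 Lf0 hf]]] := f2 M M0; have [Cg [Lg [Cg0 Lg0 hg]]] := g2 M M0.
  exists (Cf + Cg), (Lf + Lg); split; try exact: addr_ge0.
  move=> r X Y r0 r1 hX hY; have [a1 a2] := hf r X Y r0 r1 hX hY; have [b1 b2] := hg r X Y r0 r1 hX hY.
  split; first by apply: (le_trans (pnormD r0 _ _)); apply: lerD.
  rewrite opprD addrACA mulrDl; apply: (le_trans (pnormD r0 _ _)); exact: lerD.
move=> [opf [f1 f2]] [opg [g1 g2]].
exists (fun X => opf X * opg X); split=> [X s|M M0]; first by rewrite hornerM f1 g1.
have [Cf [Lf [Cf0 Lf0 hf]]] := f2 M M0; have [Cg [Lg [Cg0 Lg0 hg]]] := g2 M M0.
exists (Cf * Cg), (Lf * Cg + Cf * Lg); split; [exact: mulr_ge0|by rewrite addr_ge0 ?mulr_ge0|].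
move=> r X Y r0 r1 hX hY; have [a1 a2] := hf r X Y r0 r1 hX hY; have [b1 b2] := hg r X Y r0 r1 hX hY.
have [a1' _] := hf r Y Y r0 r1 hY hY.
split.
  by apply: (le_trans (pnormM r0 _ _)); apply: ler_pM => //; apply: pnorm_ge0.
have -> : opf X * opg X - opf Y * opg Y = (opf X - opf Y) * opg X + opf Y * (opg X - opg Y) by ring.
apply: (le_trans (pnormD r0 _ _)); rewrite [leRHS]mulrDl; apply: lerD;
  apply: (le_trans (pnormM r0 _ _)).
  by rewrite mulrAC; apply: ler_pM => //; apply: pnorm_ge0.
by rewrite -mulrA; apply: ler_pM => //; apply: pnorm_ge0.
Qed.

Lemma polyv_op n m (F : pt K n -> 'rV[K]_m) (t0 : K) : polyv F ->
  exists op : 'I_m -> ('I_n -> {poly K}) -> {poly K},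
  (forall b X s, (op b X).[s] = F (\row_a (X a).[s], t0 + s) ord0 b) /\
  forall M, 0 <= M -> exists C L, [/\ 0 <= C, 0 <= L & forall b r X Y, 0 <= r -> r <= 1 ->
    (forall a, pnorm r (X a) <= M) -> (forall a, pnorm r (Y a) <= M) ->
    pnorm r (op b X) <= C /\ pnorm r (op b X - op b Y) <= L * \sum_a pnorm r (X a - Y a)].
Proof.
move=> pF.
have /choice[op hop] := fun b => ispoly_op t0 (pF b).
exists op; split=> [b|M M0]; first by case: (hop b).
have /choice[C hC] := fun b => (hop b).2 M M0.
have /choice[L hL] := hC.
have C0 b : 0 <= C b by case: (hL b).
have L0 b : 0 <= L b by case: (hL b).
have le_sum (g : 'I_m -> K) b : (forall b, 0 <= g b) -> g b <= \sum_b g b.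
  by move=> g0; rewrite (bigD1 b) //= lerDl sumr_ge0.
exists (\sum_b C b), (\sum_b L b); split; try by apply: sumr_ge0.
move=> b r X Y r0 r1 hX hY; have [_ _ /(_ r X Y r0 r1 hX hY)[h1 h2]] := hL b.
split; first exact: le_trans h1 (le_sum C b C0).
apply: (le_trans h2); apply: ler_wpM2r (le_sum L b L0).
by apply: sumr_ge0 => a _; apply: pnorm_ge0.
Qed.

Lemma polyv_lipschitz n m (F : pt K n -> 'rV[K]_m) (t0 M : K) : polyv F -> 0 <= M ->
  exists2 L, 0 <= L & forall (x y : 'rV[K]_n) t, `|t - t0| <= 1 ->
    (forall a, `|x ord0 a| <= M) -> (forall a, `|y ord0 a| <= M) ->
    forall b, `|F (x, t) ord0 b - F (y, t) ord0 b| <= L * \sum_a `|x ord0 a - y ord0 a|.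
Proof.
move=> pF M0; have [op [h1 h2]] := polyv_op t0 pF.
have [C [L [C0 L0 h]]] := h2 M M0.
exists L => // x y t ht hx hy b.
pose X a := (x ord0 a)%:P : {poly K}; pose Y a := (y ord0 a)%:P : {poly K}.
have hX a : pnorm 1 (X a) <= M by rewrite pnormC.
have hY a : pnorm 1 (Y a) <= M by rewrite pnormC.
have [_] := h b 1 X Y ler01 (lexx _) hX hY.
rewrite (eq_bigr (fun a => `|x ord0 a - y ord0 a|)) => [|a _]; last by rewrite -polyCB pnormC.
apply: le_trans; have := pnorm_horner ler01 (op b X - op b Y) ht.
rewrite hornerD hornerN !h1 (_ : t0 + (t - t0) = t); last by rewrite addrC subrK.
have e (z : 'rV[K]_n) : \row_a ((z ord0 a)%:P : {poly K}).[t - t0] = z.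
  by apply/rowP => a; rewrite mxE hornerC.
by rewrite !e.
Qed.

Theorem picard n (F : pt K n -> 'rV[K]_n) (q : pt K n) : polyv F ->
  exists r (c : K -> 'rV[K]_n), [/\ 0 < r, c 0 = q.1,
    forall b, plim r (fun s => c s ord0 b) &
    forall s : K, `|s| < r / 2 -> is_derive s 1 c (F (c s, q.2 + s))].
Proof.
case: q => [c0 t0] /= pF; have [op [hop hbound]] := polyv_op t0 pF.
(* The added 1 leaves room for the iterates, which stay within r C <= 1 of the initial value. *)
pose M := \sum_a `|c0 ord0 a| + 1.
have cM a : `|c0 ord0 a| + 1 <= M by rewrite lerD2r (bigD1 a) //= lerDl sumr_ge0.
have M0 : 0 <= M by rewrite addr_ge0 // sumr_ge0.
have [C [L [C0 L0 hCL]]] := hbound M M0.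
pose d : K := n%:R.
have d0 : 0 <= d by exact: ler0n.
(* The three terms give, for r = 1/Q, the bounds r <= 1, r C <= 1 and r d L <= 1/2; the last one
   makes the iteration contract. *)
pose Q := 1 + C + 2 * d * L.
have Q1 : 1 <= Q by rewrite /Q -addrA lerDl addr_ge0 // !mulr_ge0.
have Q0 : 0 < Q by apply: lt_le_trans Q1.
pose r := Q^-1.
have r0 : 0 < r by rewrite invr_gt0.
have r1 : r <= 1 by rewrite invf_le1.
have rC : r * C <= 1.
  by rewrite mulrC ler_pdivrMr // mul1r /Q addrAC lerDr addr_ge0 // !mulr_ge0.
have rL : r * (d * L) <= 2^-1.
  rewrite mulrC ler_pdivrMr // ler_pdivlMl // mulrA /Q lerDr addr_ge0 //.
pose fix X k : 'I_n -> {poly K} := if k is k'.+1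
  then fun b => (c0 ord0 b)%:P + primitive (op b (X k')) else fun b => (c0 ord0 b)%:P.
have XM k a : pnorm r (X k a) <= M.
  elim: k a => [|k IH] a.
    by rewrite pnormC; apply: le_trans (cM a); rewrite lerDl.
  apply: (le_trans (pnormD (ltW r0) _ _)); rewrite pnormC.
  apply: le_trans (cM a); rewrite lerD2l.
  apply: (le_trans (pnorm_primitive (ltW r0) _)); apply: le_trans rC.
  by apply: ler_wpM2l; [exact: ltW|]; have [] := hCL a r (X k) (X k) (ltW r0) r1 IH IH.
have Xd k a : pnorm r (X k.+1 a - X k a) <= d / 2 ^+ k.
  have le1 (g : 'I_n -> K) (B : K) : (forall b, g b <= B) -> \sum_b g b <= d * B.
    move=> h; apply: (le_trans (ler_sum _ (fun b _ => h b))).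
    by rewrite sumr_const card_ord mulr_natl.
  (* The Lipschitz bound involves the sum over all components, so it is this sum that is halved at
     each step. *)
  have bnd k' : \sum_b pnorm r (X k'.+1 b - X k' b) <= d / 2 ^+ k'.
    elim: k' => [|k' IH].
      apply: le1 => b; rewrite /= addrAC subrr add0r expr0 invr1.
      apply: (le_trans (pnorm_primitive (ltW r0) _)); apply: le_trans rC.
      by apply: ler_wpM2l; [exact: ltW|]; have [] := hCL b r (X 0%N) (X 0%N) (ltW r0) r1 (XM _) (XM _).
    apply: (@le_trans _ _ (d * (r * (L * (d / 2 ^+ k'))))).
      apply: le1 => b; change (pnorm r (((c0 ord0 b)%:P + primitive (op b (X k'.+1))) - ((c0 ord0 b)%:P + primitive (op b (X k')))) <= r * (L * (d / 2 ^+ k'))).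
      rewrite opprD addrACA subrr add0r primitiveB.
      apply: (le_trans (pnorm_primitive (ltW r0) _)); apply: ler_wpM2l; [exact: ltW|].
      have [_ h] := hCL b r (X k'.+1) (X k') (ltW r0) r1 (XM _) (XM _).
      by apply: (le_trans h); apply: ler_wpM2l.
    rewrite (_ : d * _ = (r * (d * L)) * (d / 2 ^+ k')); last by ring.
    rewrite exprS invfM [leRHS]mulrCA; apply: ler_wpM2r => //.
    by rewrite divr_ge0 // ltW // pow2_gt0.
  apply: le_trans (bnd k); rewrite (bigD1 a) //= lerDl sumr_ge0 // => b _.
  exact: pnorm_ge0 (ltW r0) _.
have /choice[c hc] := fun a => power_limit complete (ltW r0) (fun k => Xd k a).
exists r, (fun s => \row_b c b s); split=> //.
- apply/rowP => a; rewrite mxE; apply/eqP; rewrite eq_sym -subr_eq0; apply/eqP.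
  apply: (@geometric_eq0 _ archimedean _ (4 * d)) => [|m]; first exact: mulr_ge0.
  have := hc a 0 _ m; rewrite normr0 => /(_ (ltW r0)); congr (`|_ - _| <= _).
  by case: m => [|m] /=; rewrite !hornerE // horner_coef0 coef0_primitive addr0.
- move=> b; exists (fun k => X k b), d; split=> [k|s hs k]; first exact: Xd.
  by rewrite mxE; apply: hc.
have [L' L'0 hL'] := @polyv_lipschitz n n F t0 (M + 4 * d) pF (addr_ge0 M0 (mulr_ge0 (ler0n _ 4) d0)).
(* F along the iterates converges to F along c at the same geometric rate; these are the derivatives
   of the iterates, since X_{k+1} is built from a primitive of F at X_k. *)
have ext s k : `|s| <= r -> forall b,
    `|(op b (X k)).[s] - F (\row_b c b s, t0 + s) ord0 b| <= (L' * (d * (4 * d))) / 2 ^+ k.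
  move=> hs b; rewrite hop.
  have st : `|t0 + s - t0| <= 1 by rewrite addrC addKr; apply: le_trans hs r1.
  have Xs k' a : `|(X k' a).[s]| <= M by apply: le_trans (pnorm_horner (ltW r0) _ hs) (XM _ _).
  apply: (le_trans (hL' _ _ _ st _ _ b)) => [a|a|].
  - by rewrite mxE; apply: (le_trans (Xs _ _)); rewrite lerDl mulr_ge0.
  - rewrite mxE -(subKr (X 0%N a).[s] (c a s)); apply: (le_trans (ler_normB _ _)).
    by apply: lerD => //; have := hc a s hs 0%N; rewrite expr0 divr1.
  rewrite -!mulrA; apply: ler_wpM2l => //.
  apply: (@le_trans _ _ (\sum_(a < n) (4 * d / 2 ^+ k))).
    by apply: ler_sum => a _; rewrite !mxE; apply: hc.
  by rewrite sumr_const card_ord -[X in X <= _]mulr_natl -/d !mulrA.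
move=> s sr; apply: is_derive_row => b.
rewrite (_ : (fun s => _) = c b); last by apply/funext => x; rewrite mxE.
pose u' s := F (\row_b c b s, t0 + s) ord0 b.
have : is_derive s 1 (c b) (u' s); last by [].
apply: (@power_limit_derive _ archimedean r d (L' * (d * (4 * d))) (fun k => X k.+1 b) (c b) u') => //.
- by rewrite !mulr_ge0.
- by move=> k; apply: (le_trans (Xd k.+1 b)); apply: geometric_le.
- move=> x hx k; apply: (le_trans (hc b x hx k.+1)).
  by apply: geometric_le => //; rewrite mulr_ge0.
move=> x hx k; rewrite /= derivD derivC add0r primitive_deriv.
by apply: ext; apply: (le_trans hx); rewrite ler_pdivrMr // ler_peMr ?ltW // ltr1n.
Qed.

End Picard.

(** * Uniqueness of solutions *)

Section LocalUniqueness.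
Variable K : numClosedFieldType.
Hypothesis complete : geometrically_complete K.
Hypothesis archimedean : geometrically_archimedean K.

Lemma near_normP (t0 : K) (P : K -> Prop) :
  (\forall t \near t0, P t) <-> exists2 r : K, 0 < r & forall t, `|t - t0| < r -> P t.
Proof.
split=> [/nbhs_ballP[r /= r0 h]|[r r0 h]].
  by exists r => // t ht; apply: h; rewrite -ball_normE /ball_ /= distrC.
by apply/nbhs_ballP; exists r => // t; rewrite -ball_normE /ball_ /= distrC => /h.
Qed.

Lemma near_punctureP (t0 : K) (P : K -> Prop) : (\forall t \near t0^', P t) <->
  exists2 r : K, 0 < r & forall t, `|t - t0| < r -> t != t0 -> P t.
Proof. by split=> [/near_normP|h]; last by apply/near_normP. Qed.

(** If the bound fails on a segment, it fails on one of its halves. The bad segments shrink to a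
    point l, near which differentiability gives the bound. The constant 10 is (1 + 1/9)(4 + 5), the
    ends of a segment being within 4 and 5 of its lengths from l. *)
Lemma mean_value_inequality (f f' : K -> K) (t0 r M : K) : 0 < M ->
  (forall s : K, `|s - t0| < r -> is_derive s 1 f (f' s) /\ `|f' s| <= M) ->
  forall s, `|s - t0| < r -> `|f s - f t0| <= 10 * M * `|s - t0|.
Proof.
move=> M0 hf s sr; apply: contrapT => bad0.
pose good (ab : K * K) := `|f ab.2 - f ab.1| <= 10 * M * `|ab.2 - ab.1|.
pose mid (ab : K * K) := (ab.1 + ab.2) / 2.
pose step ab := if good (ab.1, mid ab) then (mid ab, ab.2) else (ab.1, mid ab).
pose P n := iter n step (t0, s).
pose d := `|s - t0|.
have midl ab : mid ab - ab.1 = (ab.2 - ab.1) / 2 by rewrite /mid; field.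
have midr ab : ab.2 - mid ab = (ab.2 - ab.1) / 2 by rewrite /mid; field.
have inv n : [/\ ~ good (P n), (P n).2 - (P n).1 = (s - t0) / 2 ^+ n,
    `|(P n).1 - t0| <= d & `|(P n).2 - t0| <= d].
  elim: n => [|n [h1 h2 h3 h4]].
    split; rewrite /P /=; [exact: bad0|by rewrite expr0 divr1|by rewrite subrr normr0 /d normr_ge0|by []].
  have hm : `|mid (P n) - t0| <= d.
    rewrite (_ : _ - t0 = ((P n).1 - t0) / 2 + ((P n).2 - t0) / 2); last by rewrite /mid; field.
    apply: (le_trans (ler_normD _ _)); rewrite !normrM normfV normr_nat -mulrDl ler_pdivrMr //.
    by rewrite mulr_natr mulr2n lerD.
  have e2 : (s - t0) / 2 ^+ n / 2 = (s - t0) / 2 ^+ n.+1.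
    by rewrite exprSr invfM mulrA.
  rewrite /P iterS -/(P n) /step; have [g|g] := boolP (good ((P n).1, mid (P n))); split=> //=.
  - move=> g'; apply: h1; rewrite /good.
    have g1 : `|f (P n).2 - f (mid (P n))| <= 10 * M * `|((P n).2 - (P n).1) / 2| by rewrite -midr; exact: g'.
    have g2 : `|f (mid (P n)) - f (P n).1| <= 10 * M * `|((P n).2 - (P n).1) / 2| by rewrite -midl; exact: g.
    have -> : f (P n).2 - f (P n).1 = (f (P n).2 - f (mid (P n))) + (f (mid (P n)) - f (P n).1) by ring.
    apply: (le_trans (ler_normD _ _)); apply: (le_trans (lerD g1 g2)); rewrite -mulrDr.
    by rewrite normrM normfV normr_nat -splitr.
  - by rewrite midr h2.
  - exact/negP.
  - by rewrite midl h2.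
have [l hl] : exists l, forall n, `|(P n).1 - l| <= 4 * d / 2 ^+ n.
  apply: complete => n; have [_ h2 _ _] := inv n.
  rewrite /P iterS -/(P n) /step; case: ifP => _ /=.
    rewrite midl h2 !normrM !normfV normrX normr_nat ler_pdivrMr //.
    by rewrite ler_peMr ?ler1n // divr_ge0 // ltW // pow2_gt0.
  by rewrite subrr normr0 !mulr_ge0 ?invr_ge0 ?exprn_ge0 // /d normr_ge0.
have d0 : 0 <= d := normr_ge0 _.
have lr : `|l - t0| < r.
  apply: le_lt_trans sr; rewrite -/d.
  apply: (@geometric_le_limit _ archimedean _ _ (4 * d)) => [|||m] //; first exact: mulr_ge0.
  have [_ _ h3 _] := inv m.
  rewrite (_ : l - t0 = ((P m).1 - t0) - ((P m).1 - l)); last by ring.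
  by apply: (le_trans (ler_normB _ _)); apply: lerD.
have [dl ml] := hf l lr.
have M9 : 0 < M / 9 by rewrite divr_gt0.
have /is_deriveP/cvgrPdist_le/(_ _ M9)/near_punctureP[e e0 he] := dl.
have lip x : `|x - l| < e -> `|f x - f l| <= (M + M / 9) * `|x - l|.
  move=> hx; have [->|xl] := eqVneq x l; first by rewrite !subrr normr0 mulr0.
  have xl0 : x - l != 0 by rewrite subr_eq0.
  have := he (x - l); rewrite subr0 => /(_ hx xl0).
  rewrite /GRing.scale /= mulr1 subrK => h.
  have : `|(x - l)^-1 * (f x - f l)| <= M + M / 9.
    rewrite -[X in `|X|](subKr (f' l)); apply: (le_trans (ler_normB _ _)); exact: lerD.
  by rewrite normrM normfV ler_pdivrMl ?normr_gt0 // mulrC.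
have [n hn] := archimedean (mulr_ge0 (ler0n K 5) d0) e0.
have [h1 h2 _ _] := inv n.
have dn : `|(P n).2 - (P n).1| = d / 2 ^+ n by rewrite h2 normrM normfV normrX normr_nat.
have dn0 : 0 <= d / 2 ^+ n by rewrite divr_ge0 // ltW // pow2_gt0.
have al : `|(P n).1 - l| <= 4 * (d / 2 ^+ n) by rewrite mulrA.
have bl : `|(P n).2 - l| <= 5 * (d / 2 ^+ n).
  have -> : 5 * (d / 2 ^+ n) = d / 2 ^+ n + 4 * (d / 2 ^+ n) by ring.
  rewrite (_ : (P n).2 - l = ((P n).2 - (P n).1) + ((P n).1 - l)); last by ring.
  by apply: (le_trans (ler_normD _ _)); rewrite dn lerD2l.
have hn' : 5 * (d / 2 ^+ n) < e by rewrite mulrA.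
have al' : `|(P n).1 - l| < e.
  apply: le_lt_trans hn'; apply: (le_trans al); apply: ler_wpM2r => //; rewrite ler_nat //.
apply: h1; rewrite /good dn.
rewrite (_ : f _ - f _ = (f (P n).2 - f l) - (f (P n).1 - f l)); last by ring.
apply: (le_trans (ler_normB _ _)).
have M10 : 0 <= M + M / 9 by rewrite addr_ge0 // ltW.
apply: (le_trans (lerD (le_trans (lip _ (le_lt_trans bl hn')) (ler_wpM2l M10 bl))
  (le_trans (lip _ al') (ler_wpM2l M10 al)))).
rewrite le_eqVlt; apply/orP; left; apply/eqP; field.
by rewrite lt0r_neq0 ?pow2_gt0.
Qed.

(** On a small disc the total distance E of the two solutions is at most B/2^k for every k: a bound
    on E bounds the difference of the derivatives, and the mean value inequality returns half of
    it. *)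
Lemma ode_unique n (F : pt K n -> 'rV[K]_n) (t0 : K) (c d : K -> 'rV[K]_n) : polyv F ->
  c t0 = d t0 -> (\forall t \near t0, is_derive (t : K) (1 : K) c (F (c t, t))) ->
  (\forall t \near t0, is_derive (t : K) (1 : K) d (F (d t, t))) -> \forall t \near t0, c t = d t.
Proof.
move=> pF cd0 hc hd.
pose M := \sum_a `|c t0 ord0 a| + 1.
have M1 : 1 <= M by rewrite lerDr sumr_ge0.
have M0 : 0 <= M by apply: le_trans M1.
have bound (x : K -> 'rV[K]_n) : x t0 = c t0 ->
    (\forall t \near t0, is_derive (t : K) (1 : K) x (F (x t, t))) ->
    forall a, \forall t \near t0, `|x t ord0 a| <= M.
  move=> x0 /nbhs_singleton hx a.
  have /is_derive_continuous h := is_derive_coord a hx.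
  have /cvgrPdist_le/(_ 1 ltr01) := h.
  apply: filterS => t ht; rewrite -(subKr (x t0 ord0 a) (x t ord0 a)).
  apply: (le_trans (ler_normB _ _)); apply: lerD => //.
  by rewrite x0 (bigD1 a) //= lerDl sumr_ge0.
have hM0 a : \forall t \near t0, `|c t ord0 a| <= M /\ `|d t ord0 a| <= M.
  by apply: filterI; [exact: (bound c erefl hc a)|exact: (bound d (esym cd0) hd a)].
have hM := @filter_forall K 'I_n (fun a t => `|c t ord0 a| <= M /\ `|d t ord0 a| <= M) (nbhs t0) _ hM0.
have [r r0 hr] : exists2 r, 0 < r & forall t, `|t - t0| < r ->
    [/\ is_derive (t : K) (1 : K) c (F (c t, t)), is_derive (t : K) (1 : K) d (F (d t, t)) &
        forall a, `|c t ord0 a| <= M /\ `|d t ord0 a| <= M].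
  have : \forall t \near t0, [/\ is_derive (t : K) (1 : K) c (F (c t, t)),
      is_derive (t : K) (1 : K) d (F (d t, t)) & forall a, `|c t ord0 a| <= M /\ `|d t ord0 a| <= M].
    near=> t; split; [near: t; exact: hc|near: t; exact: hd|near: t; exact: hM].
  by move/near_normP.
have [L L0 hL] := polyv_lipschitz t0 pF M0.
pose D : K := n%:R; have D0 : 0 <= D by exact: ler0n.
(* The last term makes 10 D (L + 1)/Q at most 1/2, which is the halving; the first two keep 1/Q
   below r and 1. *)
pose Q := r^-1 + 1 + 20 * D * (L + 1).
have Q1 : 1 <= Q.
  by rewrite /Q addrAC lerDr addr_ge0 ?invr_ge0 ?(ltW r0) // !mulr_ge0 ?addr_ge0.
have Q0 : 0 < Q by apply: lt_le_trans Q1.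
have rQ : Q^-1 <= r.
  rewrite -[leRHS]invrK lef_pV2 ?posrE ?invr_gt0 // /Q -addrA lerDl addr_ge0 //.
  by rewrite !mulr_ge0 ?addr_ge0.
have Qi1 : Q^-1 <= 1 by rewrite invf_le1.
have QL : 20 * D * (L + 1) * Q^-1 <= 1.
  by rewrite ler_pdivrMr // mul1r /Q lerDr addr_ge0 // invr_ge0 ltW.
pose E t := \sum_a `|c t ord0 a - d t ord0 a|.
pose B := D * (2 * M) + 1.
have B0 : 0 < B by rewrite ltr_wpDl // !mulr_ge0.
apply/near_normP; exists Q^-1; first by rewrite invr_gt0.
have claim k t : `|t - t0| < Q^-1 -> E t <= B / 2 ^+ k.
  elim: k t => [|k IH] t ht.
    rewrite expr0 divr1 /B; apply: ler_wpDr => //.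
    apply: (@le_trans _ _ (\sum_(a < n) (2 * M))); last by rewrite sumr_const card_ord -[X in X <= _]mulr_natl.
    apply: ler_sum => a _; have [_ _ /(_ a)[h1 h2]] := hr t (lt_le_trans ht rQ).
    by apply: (le_trans (ler_normB _ _)); rewrite mulr_natl mulr2n lerD.
  have Bk : 0 < B / 2 ^+ k by rewrite divr_gt0 // pow2_gt0.
  have M'0 : 0 < (L + 1) * (B / 2 ^+ k) by rewrite mulr_gt0 // ltr_wpDl.
  have one a : `|c t ord0 a - d t ord0 a| <= 10 * ((L + 1) * (B / 2 ^+ k)) * Q^-1.
    have := @mean_value_inequality (fun t => c t ord0 a - d t ord0 a)
      (fun t => F (c t, t) ord0 a - F (d t, t) ord0 a) t0 Q^-1 _ M'0 _ t ht.
    rewrite cd0 subrr subr0 => h; apply: (le_trans (h _)) => [s hs|].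
      have [h1 h2 h3] := hr s (lt_le_trans hs rQ).
      split; first exact: is_deriveB (is_derive_coord a h1) (is_derive_coord a h2).
      apply: (le_trans (hL _ _ s _ _ _ a)) => [|b|b|]; try by case: (h3 b).
        exact: ltW (lt_le_trans hs Qi1).
      apply: ler_pM => //; [exact: sumr_ge0|by rewrite lerDl|exact: IH].
    by apply: ler_wpM2l; [rewrite mulr_ge0 // ltW|exact: ltW].
  apply: (le_trans (ler_sum _ (fun a _ => one a))); rewrite sumr_const card_ord -[X in X <= _]mulr_natl -/D.
  have e (u v : K) : D * (10 * ((L + 1) * u) * v) = (20 * D * (L + 1) * v) * (u / 2) by field.
  rewrite exprS e.
  rewrite (_ : B / (2 * 2 ^+ k) = B / 2 ^+ k / 2); last first.
    by field; rewrite !lt0r_neq0 ?pow2_gt0.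
  by rewrite -[leRHS]mul1r; apply: ler_wpM2r => //; rewrite divr_ge0 // ltW.
move=> t ht; apply/rowP => a; apply/eqP; rewrite -subr_eq0; apply/eqP.
apply: (@geometric_eq0 _ archimedean _ B) => [|m]; first exact: ltW.
by apply: le_trans (claim m t ht); rewrite /E (bigD1 a) //= lerDl sumr_ge0.
Unshelve. all: by end_near. Qed.

End LocalUniqueness.

(** * The vector field in the eight charts *)

Section ChartFields.
Variable K : numClosedFieldType.
Variables a1 a2 a3 : K.

(** On C^3 the auxiliary p is yz in charts 1, 2, 5, 6 and (y + z - t)z in charts 4, 7, while n in
    chart 4 is xz - a1. In chart 7 the first component is arranged to show z^2 plus a multiple of
    x. *)
Definition vfields (j : 'I_8) (q : pt K 3) : 'rV[K]_3 :=
  let: (x, y, z, t) := (xc q, yc q, zc q, q.2) in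
  match val j with
  | 0 => vfield a1 a2 a3 q
  | 1 => let p := y * z - a2 in
    row3 (1 - t * x + (2 * p - a1 - a3) * (x * x))
         (t * y - 2 * p * z * y - p * (p - a3) + a3 * (y * z))
         (1 - t * z + 2 * p * (z * z) - a3 * (z * z))
  | 2 => let p := y * z - a2 in
    row3 (t * x - x * x - 2 * p + a1 + a3)
         (t * y - 2 * p * z * y - p * (p - a3) + a3 * (y * z))
         (1 - t * z + 2 * p * (z * z) - a3 * (z * z))
  | 3 => row3 (1 - (t - 2 * z) * x - a1 * (x * x))
              (y * (- t + y + 2 * z) + a2) (z * (t - 2 * y - z) + a3)
  | 4 => let: (m, n) := (y * z, x * z) in let p := m - 1 + a2 + a3 in
    row3 (- ((n + a1 + 2 * p - a3) * (n + a1)) - t * x - (2 * p - a3) * n)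
         (- (t * y) - p * (p - a3) - (2 * p - a3) * m)
         (- 1 + t * z + (2 * p - a3) * (z * z))
  | 5 => let p := y * z + a3 in
    row3 (1 - (t - 2 * p * y) * x - a1 * (x * x))
         (- 1 + t * y - 2 * p * (y * y) - a2 * (y * y))
         (p * (p + a2) - t * z + 2 * p * (y * z) + a2 * (y * z))
  | 6 => let p := y * z + a3 in
    row3 (x * (t - x - 2 * p * y) + a1)
         (- 1 + t * y - 2 * p * (y * y) - a2 * (y * y))
         (p * (p + a2) - t * z + 2 * p * (y * z) + a2 * (y * z))
  | _ => let m := y * z in let p := m - 1 + a2 + a3 in
    row3 ((z + (a1 + 2 * p - a3) * x) * (z + a1 * x) + t * x + (2 * p - a3) * z * x)
         (- (t * y) - p * (p - a3) - (2 * p - a3) * m)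
         (- 1 + t * z + (2 * p - a3) * (z * z))
  end.

Lemma polyv_vfields j : polyv (vfields j).
Proof.
case: j => -[|[|[|[|[|[|[|[|//]]]]]]]] hj; apply: polyv_row3; ispoly_tac.
Qed.

Section Rules.
Variables (V : normedModType K) (a v : V).

Lemma is_derive_addf (f g : V -> K) df dg : is_derive a v f df -> is_derive a v g dg ->
  is_derive a v (fun u => f u + g u) (df + dg).
Proof. exact: is_deriveD. Qed.

Lemma is_derive_oppf (f : V -> K) df : is_derive a v f df -> is_derive a v (fun u => - f u) (- df).
Proof. exact: is_deriveN. Qed.

Lemma is_derive_constf (k : K) : is_derive a v (fun=> k) 0.
Proof. exact: is_derive_cst. Qed.

Lemma is_derive_row3 (f g h : V -> K) df dg dh : is_derive a v f df -> is_derive a v g dg ->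
  is_derive a v h dh -> is_derive a v (fun u => row3 (f u) (g u) (h u)) (row3 df dg dh).
Proof.
move=> hf hg hh; apply: is_derive_row; apply: forall_I3.
- have [-> _ _] := row3_ord df dg dh; rewrite (_ : (fun x => _) = f) //.
  by apply/funext => x; have [-> _ _] := row3_ord (f x) (g x) (h x).
- have [_ -> _] := row3_ord df dg dh; rewrite (_ : (fun x => _) = g) //.
  by apply/funext => x; have [_ -> _] := row3_ord (f x) (g x) (h x).
- have [_ _ ->] := row3_ord df dg dh; rewrite (_ : (fun x => _) = h) //.
  by apply/funext => x; have [_ _ ->] := row3_ord (f x) (g x) (h x).
Qed.

End Rules.

Ltac derivation_tac := repeat match goal with
  | h : is_derive _ _ ?f _ |- is_derive _ _ ?f _ => exact h
  | |- is_derive _ _ (fun _ => ?k) _ => exact (is_derive_constf _ _ k)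
  | |- is_derive _ _ (fun u => @?f u + @?g u) _ => notypeclasses refine (is_derive_addf _ _)
  | |- is_derive _ _ (fun u => - @?f u) _ => notypeclasses refine (is_derive_oppf _)
  | |- is_derive _ _ (fun u => @?f u * @?g u) _ => notypeclasses refine (is_deriveM_num _ _)
  | |- is_derive _ _ (fun u => (@?f u)^-1) _ => notypeclasses refine (is_deriveV_num _ _)
  end.

Lemma extends8 : extends_holomorphically a1 a2 a3 vfields.
Proof.
move=> j; split=> [p|q].
  exact: polyv_differentiable (polyv_vfields j) p.
pose w : 'rV[K]_3 * K := (vfield a1 a2 a3 q, 1).
have coord (i : 'I_3) : is_derive q w (fun u => u.1 ord0 i) (w.1 ord0 i).
  by apply: is_derive_additive => h; rewrite !mxE.
have hx : is_derive q w (fun u => @xc K u) (xc q * (q.2 - xc q - 2 * zc q) + a1).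
  by apply: is_derive_eq (coord (inord 0)) _; rewrite -[LHS]/(xc w) /w /vfield row3_xc.
have hy : is_derive q w (fun u => @yc K u) (yc q * (- q.2 + yc q + 2 * zc q) + a2).
  by apply: is_derive_eq (coord (inord 1)) _; rewrite -[LHS]/(yc w) /w /vfield row3_yc.
have hz : is_derive q w (fun u => @zc K u) (zc q * (q.2 - 2 * yc q - zc q) + a3).
  by apply: is_derive_eq (coord (inord 2)) _; rewrite -[LHS]/(zc w) /w /vfield row3_zc.
have ht : is_derive q w (fun u => u.2) 1.
  exact: (@is_derive_additive _ _ (fun u : 'rV[K]_3 * K => u.2) q w (fun h => erefl)).
case: j => -[|[|[|[|[|[|[|[|//]]]]]]]] hj; rewrite /chart_dom /chart /vfields /= ?row3_xc ?row3_yc ?row3_zc.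
- move=> _; rewrite (_ : (fun u => _) = (fun u => row3 (xc u) (yc u) (zc u))); last first.
    by apply/funext => u; rewrite row3_eta.
  apply: is_derive_eq; first by notypeclasses refine (is_derive_row3 _ _ _); [exact: hx|exact: hy|exact: hz].
  by [].
all: move=> dq; apply: is_derive_eq; first by
  notypeclasses refine (is_derive_row3 _ _ _); derivation_tac; rewrite ?mulf_neq0 //; move: dq;
  rewrite ?mulf_eq0 ?negb_or; try (by case); move=> /andP[].
all: try (by []).
all: congr row3; rewrite /=.
all: move: dq; rewrite ?mulf_eq0 ?negb_or; try (case=> d1 d2); try (move=> /andP[d1 d2]); try (move=> d1).
all: field; rewrite ?d1 ?d2 //.
Qed.

End ChartFields.

(** * Integral curves and Cauchy's theorem on the phase space *)

Section Flow.
Variable K : numClosedFieldType.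
Variables a1 a2 a3 : K.
Variables (N : nat) (B : pt K 3 -> 'rV[K]_N) (psi : 'I_8 -> pt K 3 -> 'rV[K]_N).
Hypotheses (pB : polyv B) (B0 : forall u, B u != 0).
Hypothesis charts8 : forall j, achart B (psi j) (chart_dom a1 j) (chart a1 a2 a3 j).
Hypothesis complete : geometrically_complete K.
Hypothesis archimedean : geometrically_archimedean K.
Let F := vfields a1 a2 a3.

Lemma ispoly_near_neq0 n (f : 'rV[K]_n * K -> K) (p : 'rV[K]_n * K) :
  ispoly (f : pt K n -> K) -> f p != 0 -> \forall u \near p, f u != 0.
Proof.
move=> pf fp; have := differentiable_continuous (ispoly_differentiable pf p).
by move/cvgr_neq0; apply.
Qed.

Lemma is_derive_curve n (f : pt K n -> K) Df Dt (c : K -> 'rV[K]_n) (t : K) (c' : 'rV[K]_n) :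
  (forall (V : normedModType K) (c : V -> 'rV[K]_n) (tau : V -> K) (a v : V) (c' : 'rV[K]_n) tau',
     (forall i, is_derive a v (fun x => c x ord0 i) (c' ord0 i)) -> is_derive a v tau tau' ->
     is_derive a v (fun x => f (c x, tau x))
       (\sum_i Df i (c a, tau a) * c' ord0 i + Dt (c a, tau a) * tau')) ->
  is_derive (t : K) (1 : K) c c' ->
  is_derive (t : K) (1 : K) (fun s => f (c s, s)) (\sum_i Df i (c t, t) * c' ord0 i + Dt (c t, t)).
Proof.
move=> h hc; rewrite -[Dt _]mulr1.
exact: (h K c id t 1 c' 1 (fun i => is_derive_coord i hc) (is_derive_id _ _)).
Qed.

Lemma curve_continuous n (f : pt K n -> K) (c : K -> 'rV[K]_n) (t : K) (c' : 'rV[K]_n) :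
  ispoly f -> is_derive (t : K) (1 : K) c c' -> {for t, continuous (fun s : K => f (c s, s))}.
Proof.
move=> pf hc; have [Df [Dt [_ _ h]]] := ispoly_chain pf.
have d := is_derive_curve h hc.
exact: (is_derive_continuous d).
Qed.

(* The polynomial identity expressing that the transition map from chart i to chart j,
   which is G / H, carries F i to F j; it holds generically because both are v. *)
Lemma field_transition (i j : 'I_8) m (G : 'I_3 -> pt K N -> K) (H : pt K N -> K)
    (c : K -> 'rV[K]_3) (t : K) :
  (forall a, hpoly m (G a)) -> hpoly m H ->
  (forall q a, G a (psi j q, q.2) = q.1 ord0 a * H (psi j q, q.2)) ->
  is_derive (t : K) (1 : K) c (F i (c t, t)) -> H (psi i (c t, t), t) != 0 ->
  is_derive (t : K) (1 : K)
    (fun s => \row_a (G a (psi i (c s, s), s) / H (psi i (c s, s), s)))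
    (F j (\row_a (G a (psi i (c t, t), t) / H (psi i (c t, t), t)), t)).
Proof.
move=> hG hH eG hc H0.
have [xi _ [wi [pwi nwi wid]] Bi _] := charts8 i; have [pP _ _] := xi.
have [_ _ [wj [pwj nwj wjd]] Bj _] := charts8 j.
pose g a (q : pt K 3) := G a (psi i q, q.2); pose h (q : pt K 3) := H (psi i q, q.2).
have pg a : ispoly (g a) by apply: (ispoly_comp (hpoly_ispoly (hG a))).
have ph : ispoly h by apply: (ispoly_comp (hpoly_ispoly hH)).
have [D [R [hR [e RE]]]] := homogenize_forms (polyv_vfields a1 a2 a3 j) hG hH.
have [Dh [Dht [pDh pDht cDh]]] := ispoly_chain ph.
apply: is_derive_row => a.
have [Dg [Dgt [pDg pDgt cDg]]] := ispoly_chain (pg a).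
(* [A] and [C] are the derivatives of numerator and denominator along F i, and [f] below is the
   quotient rule cleared of denominators. *)
pose A q := \sum_b Dg b q * F i q ord0 b + Dgt q.
pose C q := \sum_b Dh b q * F i q ord0 b + Dht q.
have pF b : ispoly (fun q => F i q ord0 b) by exact: polyv_vfields.
have pA : ispoly A.
  by apply: ispolyD => //; apply: ispoly_sum => b; apply: ispolyM.
have pC : ispoly C.
  by apply: ispolyD => //; apply: ispoly_sum => b; apply: ispolyM.
have pR : ispoly (fun q => R a (psi i q, q.2)) by apply: (ispoly_comp (hpoly_ispoly (hR a))).
pose f q := h q * ((A q * h q - g a q * C q) * h q ^+ e - h q ^+ 2 * R a (psi i q, q.2)).
have pf : ispoly f.
  apply: ispolyM => //; apply: ispolyB; apply: ispolyM => //; try exact: ispolyX.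
  by apply: ispolyB; apply: ispolyM.
have f0 : forall q, f q = 0.
  apply: (density_chart pB B0 (charts8 i) pf (ispolyM pwi pwj)); first exact: nonzero_mul.
  move=> u _; rewrite mulf_eq0 negb_or => /andP[wiu wju].
  have di := wid _ wiu; have dj := wjd _ wju.
  pose ci := chart a1 a2 a3 i; pose cj := chart a1 a2 a3 j.
  have [_ /(_ u di) di'] := extends8 a1 a2 a3 i; have [_ /(_ u dj) dj'] := extends8 a1 a2 a3 j.
  (* The relation between numerator, denominator and the coordinates of chart j holds in a
     neighbourhood of u, so it may be differentiated along v. *)
  have nearu : \forall u' \near (u : 'rV[K]_3 * K),
      g a (ci u', u'.2) = cj u' ord0 a * h (ci u', u'.2).
    near=> u'.
    have wiu' : wi u' != 0 by near: u'; exact: ispoly_near_neq0.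
    have wju' : wj u' != 0 by near: u'; exact: ispoly_near_neq0.
    have := charts_peq (charts8 i) (charts8 j) (wid _ wiu') (wjd _ wju').
    move=> /peq_sym/peqP[_ [k k0 ek]]; rewrite /g /h /= -/(ci u') in ek *.
    rewrite ek (hpoly_scale _ _ _ (hG a)) (hpoly_scale _ _ _ hH).
    have := eG (cj u', u'.2) a => /= ->; ring.
  have d2 : is_derive (u : 'rV[K]_3 * K) ((vfield a1 a2 a3 u, 1) : 'rV[K]_3 * K)
      (fun u' : 'rV[K]_3 * K => u'.2) 1.
    exact: (@is_derive_additive _ _ (fun u' : 'rV[K]_3 * K => u'.2) u (vfield a1 a2 a3 u, 1) (fun h => erefl)).
  have D1 := cDg _ ci snd u _ _ 1 (fun b => is_derive_coord b di') d2.
  have D2 := is_deriveM_num (is_derive_coord a dj') (cDh _ ci snd u _ _ 1 (fun b => is_derive_coord b di') d2).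
  have /is_derive_unique/(_ D2) := near_eq_is_derive nearu D1.
  rewrite /= !mulr1 => E1.
  have E2 := nbhs_singleton nearu.
  have E3 : A (ci u, u.2) = F j (cj u, u.2) ord0 a * h (ci u, u.2) + cj u ord0 a * C (ci u, u.2) := E1.
  rewrite /f; case: (eqVneq (h (ci u, u.2)) 0) => [->|hu]; first by rewrite mul0r.
  have pe := charts_peq (charts8 i) (charts8 j) di dj.
  rewrite RE /= (frac_inverse (c := (cj u, u.2)) hG hH eG pe hu) -/(h (ci u, u.2)) E2 E3 /= -/F.
  rewrite -/(cj u); ring.
have hc0 : h (c t, t) != 0 by [].
have /eqP := f0 (c t, t); rewrite /f mulf_eq0 (negbTE hc0) /= RE /= subr_eq0 => /eqP E.
have E' : A (c t, t) * h (c t, t) - g a (c t, t) * C (c t, t) =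
    h (c t, t) ^+ 2 * F j (\row_a (G a (psi i (c t, t), t) / H (psi i (c t, t), t)), t) ord0 a.
  apply: (mulIf (expf_neq0 e hc0)); rewrite E -/(h (c t, t)) /F; ring.
rewrite (_ : (fun s => _) = (fun s => g a (c s, s) * (h (c s, s))^-1)); last first.
  by apply/funext => s; rewrite mxE.
have dh := is_derive_curve cDh hc; have dg := is_derive_curve cDg hc.
have dv := is_deriveV_num (f := fun s : K => h (c s, s)) hc0 dh.
have dq := is_deriveM_num dg dv.
apply: (is_derive_eq dq).
rewrite -/(A (c t, t)) -/(C (c t, t)).
apply: (mulfI (expf_neq0 2 hc0)); rewrite -E'; field; exact: hc0.
Unshelve. all: by end_near. Qed.

Lemma frac_peq m (G H : pt K N -> K) v w t : hpoly m G -> hpoly m H -> peq v w ->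
  G (v, t) / H (v, t) = G (w, t) / H (w, t) /\ (H (v, t) != 0 -> H (w, t) != 0).
Proof.
move=> hG hH /peqP[_ [k k0 ->]]; rewrite (hpoly_scale _ _ _ hG) (hpoly_scale _ _ _ hH).
have km : k ^+ m != 0 by rewrite expf_neq0.
split=> [|h0]; last by rewrite mulf_neq0.
by rewrite invfM mulrACA divff // mul1r.
Qed.

(** The local inverse of chart j, applied to gamma, gives its coordinates; by [field_transition]
    they solve the equation of chart j, whichever charts describe gamma at nearby times. *)
Lemma curve_in_chart (gamma : K -> 'rV[K]_N) (j : 'I_8) (q : pt K 3) :
  integral_curve psi F q.2 gamma -> peq (gamma q.2) (psi j q) ->
  exists d : K -> 'rV[K]_3, d q.2 = q.1 /\
    \forall t \near q.2, is_derive (t : K) (1 : K) d (F j (d t, t)) /\ peq (psi j (d t, t)) (gamma t).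
Proof.
move=> hg e; have [xP P0 _ _ hR] := charts8 j.
have [m [G [H [hG hH Hq eG]]]] := hR q.
pose d t : 'rV[K]_3 := \row_a (G a (gamma t, t) / H (gamma t, t)).
have Hg0 : H (gamma q.2, q.2) != 0.
  by have [_] := frac_peq q.2 hH hH (peq_sym e); apply.
have Hg : \forall t \near q.2, H (gamma t, t) != 0.
  have [i [c [ec dc]]] := nbhs_singleton hg.
  have ph : ispoly (fun p => H (psi i p, p.2)).
    by have [[pP _ _] _ _ _ _] := charts8 i; apply: (ispoly_comp (hpoly_ispoly hH)).
  have hcont := curve_continuous ph dc.
  have h0 : H (psi i (c q.2, q.2), q.2) != 0.
    have := nbhs_singleton ec => e'.
    by have [_] := frac_peq q.2 hH hH (peq_sym e'); apply.
  have hn : \forall s \near q.2, H (psi i (c s, s), s) != 0 := cvgr_neq0 _ hcont h0.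
  near=> s; have hs : H (psi i (c s, s), s) != 0 by near: s; exact: hn.
  have es : peq (psi i (c s, s)) (gamma s) by near: s; exact: ec.
  by have [_] := frac_peq s hH hH es; apply.
exists d; split.
  have -> : q.1 = \row_a (G a (gamma q.2, q.2) / H (gamma q.2, q.2)).
    by rewrite -[LHS](frac_inverse (c := q) hG hH eG e Hg0).
  by [].
near=> t.
have Ht : H (gamma t, t) != 0 by near: t; exact: Hg.
have [i [c [ec dc]]] : exists (i : 'I_8) (c : K -> 'rV[K]_3),
    (\forall s \near t, peq (psi i (c s, s)) (gamma s)) /\
    is_derive (t : K) (1 : K) c (F i (c t, t)) by near: t; exact: hg.
have et := nbhs_singleton ec.
have Hc : H (psi i (c t, t), t) != 0.
  by have [_] := frac_peq t hH hH (peq_sym et); apply.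
have near_d : \forall s \near t,
    \row_a (G a (psi i (c s, s), s) / H (psi i (c s, s), s)) = d s.
  apply: filterS ec => s es; apply/rowP => a; rewrite !mxE.
  by have [] := frac_peq s (hG a) hH es.
split.
  have := near_eq_is_derive near_d (field_transition hG hH eG dc Hc).
  by rewrite (nbhs_singleton near_d).
apply: peq_sym.
have mt : model B (gamma t, t).
  apply: model_peq et _.
  have [xi Pi0 _ _ _] := charts8 i.
  exact: (xchart_model xi B0 (Pi0 (c t, t))).
exact: (local_inverse pB B0 xP P0 hG hH eG mt Ht).
Unshelve. all: by end_near. Qed.

Lemma is_derive_shift (V : normedModType K) (c : K -> V) (t t0 : K) d :
  is_derive (t - t0) (1 : K) c d -> is_derive t (1 : K) (fun s => c (s - t0)) d.
Proof.
move=> /is_deriveP h; apply/is_deriveP.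
rewrite (_ : (fun k => _) = (fun k : K => k^-1 *: (c (k *: 1 + (t - t0)) - c (t - t0)))) //.
by apply/funext => k; rewrite addrA.
Qed.

Variable Y : set (pt K N).
Hypothesis hY : Y = \bigcup_j image_over setT (psi j).

Lemma initial_chart q : Y q -> exists j c, peq (psi j (c, q.2)) q.1.
Proof. by rewrite hY => -[j _ [_ [c e]]]; exists j, c. Qed.

Lemma chart_curve (j : 'I_8) (c : K -> 'rV[K]_3) (t0 : K) :
  (\forall t \near t0, is_derive (t : K) (1 : K) c (F j (c t, t))) ->
  integral_curve psi F t0 (fun t => psi j (c t, t)).
Proof.
apply: filterS => t dc; exists j, c; split=> //.
have [_ P0 _ _ _] := charts8 j.
by near=> s; apply: peq_refl.
Unshelve. all: by end_near. Qed.

Lemma chart_solution (j : 'I_8) (c0 : 'rV[K]_3) (t0 : K) :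
  exists r (c : K -> 'rV[K]_3), [/\ 0 < r, c 0 = c0,
    forall b, plim r (fun s => c s ord0 b),
    forall s : K, `|s| < r / 2 -> is_derive s 1 c (F j (c s, t0 + s)) &
    \forall t \near t0, is_derive (t : K) (1 : K) (fun t => c (t - t0)) (F j (c (t - t0), t))].
Proof.
have [r [c [r0 c0E hl hd]]] := picard complete archimedean (c0, t0) (polyv_vfields a1 a2 a3 j).
exists r, c; split=> //; apply/near_normP; exists (r / 2); first by rewrite divr_gt0.
move=> t /hd; rewrite /= addrCA subrr addr0; exact: is_derive_shift.
Qed.

Lemma cauchy8 : cauchy_property Y psi F.
Proof.
move=> q /initial_chart[j [c0 e]]; split.
  have [r [c [r0 cE _ _ hd]]] := chart_solution j c0 q.2.
  exists (fun t => psi j (c (t - q.2), t)); first exact: (chart_curve hd).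
  by rewrite subrr cE.
move=> g g' hg eg hg' eg'.
have [d [d0 hd]] := @curve_in_chart g j (c0, q.2) hg (peq_trans eg (peq_sym e)).
have [d' [d0' hd']] := @curve_in_chart g' j (c0, q.2) hg' (peq_trans eg' (peq_sym e)).
have := ode_unique complete archimedean (polyv_vfields a1 a2 a3 j) (etrans d0 (esym d0')).
move=> /(_ _ _)dd; near=> t.
have [_ h1] : is_derive (t : K) (1 : K) d (F j (d t, t)) /\ peq (psi j (d t, t)) (g t) by near: t.
have [_ h2] : is_derive (t : K) (1 : K) d' (F j (d' t, t)) /\ peq (psi j (d' t, t)) (g' t) by near: t.
have ed : d t = d' t.
  near: t; apply: dd; [apply: filterS hd|apply: filterS hd'] => t []; by [].
by apply: peq_trans (peq_sym h1) _; rewrite ed.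
Unshelve. all: by end_near. Qed.

End Flow.

(** * Derivability rules, zeros and poles of solutions *)

Section DerivableRules.
Variables (K : numClosedFieldType) (s : K).

Lemma derivable_is (f : K -> K) d : is_derive s (1 : K) f d -> derivable f s 1.
Proof. by case. Qed.

Lemma derivable_addf (f g : K -> K) : derivable f s 1 -> derivable g s 1 ->
  derivable (fun u => f u + g u) s 1.
Proof. exact: derivableD. Qed.

Lemma derivable_oppf (f : K -> K) : derivable f s 1 -> derivable (fun u => - f u) s 1.
Proof. exact: derivableN. Qed.

Lemma derivable_mulf (f g : K -> K) : derivable f s 1 -> derivable g s 1 ->
  derivable (fun u => f u * g u) s 1.
Proof. exact: derivableM. Qed.

Lemma derivable_invf (f : K -> K) : f s != 0 -> derivable f s 1 ->
  derivable (fun u => (f u)^-1) s 1.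
Proof. by move=> fs /derivableP h; apply: derivable_is (is_deriveV_num fs h). Qed.

Lemma derivable_constf (k : K) : derivable (fun _ : K => k) s 1.
Proof. exact: derivable_cst. Qed.

Lemma derivable_idf : derivable (fun u : K => u) s 1.
Proof. exact: derivable_id. Qed.

Lemma derivable_continuous (f : K -> K) : derivable f s 1 -> {for s, continuous f}.
Proof. by move=> /derivableP h; apply: is_derive_continuous h. Qed.

End DerivableRules.

Ltac derivable_tac := repeat match goal with
  | |- derivable (fun _ => ?k) _ _ => apply: derivable_constf
  | |- derivable (fun u => u) _ _ => apply: derivable_idf
  | |- derivable (fun u => @?f u + @?g u) _ _ => apply: derivable_addf
  | |- derivable (fun u => - @?f u) _ _ => apply: derivable_oppf
  | |- derivable (fun u => @?f u * @?g u) _ _ => apply: derivable_mulf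
  | |- derivable (fun u => (@?f u)^-1) _ _ => apply: derivable_invf
  | h : derivable ?f _ _ |- derivable ?g _ _ => constr_eq f g; exact h
  end.

Section Poles.
Variable K : numClosedFieldType.
Hypothesis complete : geometrically_complete K.
Hypothesis archimedean : geometrically_archimedean K.

Lemma near_punctured (t0 : K) (P : K -> Prop) : (\forall t \near t0, P t) -> \forall t \near t0^', P t.
Proof. by move=> /near_normP[r r0 h]; apply/near_punctureP; exists r => // t /h. Qed.

Lemma punctured_zero (t0 : K) (f : K -> K) : {for t0, continuous f} ->
  (\forall t \near t0^', f t = 0) -> f t0 = 0.
Proof.
move=> cf h; apply/eqP/negPn/negP => f0.
have n0 : \forall t \near t0, f t != 0 by exact: (cvgr_neq0 _ cf f0).
have [r r0 {}n0] := (near_normP t0 (fun t => f t != 0)).1 n0.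
move/near_punctureP: h => [e e0 h].
(* A positive number smaller than both radii. *)
pose d := (r^-1 + e^-1)^-1 / 2.
have s0 : 0 < r^-1 + e^-1 by rewrite addr_gt0 ?invr_gt0.
have d0 : 0 < d by rewrite divr_gt0 ?invr_gt0.
have dlt : d < (r^-1 + e^-1)^-1 by rewrite ltr_pdivrMr // ltr_pMr ?invr_gt0 // ltr1n.
have dr : d < r.
  by apply: (lt_trans dlt); rewrite -[ltRHS]invrK ltf_pV2 ?posrE ?invr_gt0 // ltrDl invr_gt0.
have de : d < e.
  by apply: (lt_trans dlt); rewrite -[ltRHS]invrK ltf_pV2 ?posrE ?invr_gt0 // ltrDr invr_gt0.
have ed : `|t0 + d - t0| = d by rewrite addrC addKr gtr0_norm.
have := n0 (t0 + d); rewrite ed h ?eqxx ?ed //; first by move=> /(_ dr).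
by rewrite -subr_eq0 addrC addKr lt0r_neq0.
Qed.

Lemma plim_derivable r g : 0 < r -> plim r g -> \forall s \near (0 : K), derivable g s 1.
Proof.
move=> r0 /(plim_derive complete archimedean r0)[g' _ h]; apply/near_normP.
exists (r / 2); first by rewrite divr_gt0.
by move=> s; rewrite subr0 => /h/derivable_is.
Qed.

Lemma simple_zero r f D : 0 < r -> plim r f -> f 0 = 0 -> is_derive (0 : K) (1 : K) f D ->
  exists g, [/\ plim r g, g 0 = D & \forall s \near (0 : K), f s = s * g s].
Proof.
move=> r0 pf f0 df; have [g pg fg] := plim_div complete archimedean r0 pf f0.
have nf : \forall s \near (0 : K), f s = s * g s.
  by apply/near_normP; exists r => // s; rewrite subr0 => /ltW/fg.
exists g; split=> //.
have /derivableP dg := nbhs_singleton (plim_derivable r0 pg).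
have nf' : \forall s \near (0 : K), s * g s = f s by apply: filterS nf.
have e := is_derive_unique (near_eq_is_derive nf' (is_deriveM_num (is_derive_id (0 : K) 1) dg)) df.
by rewrite -e mul1r mul0r addr0.
Qed.

Lemma nonzero_factor r f D : 0 < r -> plim r f -> f 0 = 0 -> is_derive (0 : K) (1 : K) f D ->
  D != 0 -> exists g, [/\ plim r g, g 0 = D &
    \forall s \near (0 : K), [/\ f s = s * g s, g s != 0 & derivable g s 1]].
Proof.
move=> r0 pf f0 df D0; have [g [pg gD fg]] := simple_zero r0 pf f0 df.
exists g; split=> //.
have dg := plim_derivable r0 pg.
have cg := derivable_continuous (nbhs_singleton dg).
have g0 : \forall s \near (0 : K), g s != 0 by apply: (cvgr_neq0 _ cg); rewrite gD.
by apply: filterS3 fg g0 dg.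
Qed.

(** The product rule for s^{n+1} g(s) with s^n taken out. Comparison with a differential equation
    for x then determines g(0). *)
Lemma power_factor_derive n r (x g h : K -> K) : 0 < r -> plim r g ->
  (forall s, `|s| <= r -> x s = s ^+ n.+1 * g s) ->
  (\forall s \near (0 : K), is_derive (s : K) (1 : K) x (h s)) ->
  exists2 g' : K -> K, derivable g' 0 1 &
    \forall s \near (0 : K), h s = s ^+ n * (n.+1%:R * g s + s * g' s).
Proof.
move=> r0 pg xg dx; have [g' pg' dg] := plim_derive complete archimedean r0 pg.
have r20 : 0 < r / 2 by rewrite divr_gt0.
exists g'; first exact: nbhs_singleton (plim_derivable r20 pg').
have ns : \forall s \near (0 : K), `|s| < r / 2.
  by apply/near_normP; exists (r / 2) => // s; rewrite subr0.
apply: filterS2 ns dx => s sr dxs.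
have nx : \forall u \near s, ('X^(n.+1)).[u] * g u = x u.
  apply/near_normP; exists (r / 2 - `|s|); first by rewrite subr_gt0.
  move=> u hu; rewrite hornerXn xg //.
  have : `|u| <= r / 2.
    rewrite -(subrK s u); apply: (le_trans (ler_normD _ _)); rewrite -lerBrDr; exact: ltW.
  by move/le_trans; apply; rewrite ler_pdivrMr // ler_peMr ?ltW // ltr1n.
have dp := is_derive_horner 'X^(n.+1) (is_derive_id (s : K) (1 : K)).
have e := is_derive_unique dxs (near_eq_is_derive nx (is_deriveM_num dp (dg s sr))).
rewrite e derivXn hornerMn !hornerXn mulr1 /= -mulr_natl exprS; ring.
Qed.

(** Write x = s^n g. Since z^2 = s^2 k^2, dividing x' = z^2 + x b by s^{n-1} and letting s tend to 0
    gives g(0) = 0 for n = 1 and n = 2, and 3 g(0) = k(0)^2 for n = 3. *)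
Lemma cubic_zero r (x z k b : K -> K) : 0 < r -> plim r x -> x 0 = 0 ->
  (\forall s \near (0 : K), is_derive (s : K) (1 : K) x (z s ^+ 2 + x s * b s)) ->
  (\forall s \near (0 : K), z s = s * k s) -> derivable k 0 1 -> derivable b 0 1 ->
  exists w, [/\ plim r w, 3 * w 0 = k 0 ^+ 2 & \forall s \near (0 : K), x s = s ^+ 3 * w s].
Proof.
move=> r0 px x0 dx zk dk db.
have ball P : (forall s, `|s| <= r -> P s) -> \forall s \near (0 : K), P s.
  by move=> h; apply/near_normP; exists r => // s; rewrite subr0 => /ltW/h.
have ne0 : \forall s \near (0 : K)^', s != 0 by exact: nbhs_dnbhs_neq.
have [g1 pg1 e1] := plim_div complete archimedean r0 px x0.
have e1' s : `|s| <= r -> x s = s ^+ 1 * g1 s by move=> /e1; rewrite expr1.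
have [h1 dh1 eh1] := power_factor_derive r0 pg1 e1' dx.
have g10 : g1 0 = 0.
  have := nbhs_singleton eh1; rewrite (nbhs_singleton zk) x0 !mul0r expr0n /= addr0.
  by rewrite expr0 !mul1r addr0 => <-.
have [g2 pg2 e2] := plim_div complete archimedean r0 pg1 g10.
have e2' s : `|s| <= r -> x s = s ^+ 2 * g2 s.
  by move=> h; rewrite e1 // e2 // expr2 mulrA.
have [h2 dh2 eh2] := power_factor_derive r0 pg2 e2' dx.
have dg2 := nbhs_singleton (plim_derivable r0 pg2).
have g20 : g2 0 = 0.
  pose f s := 2 * g2 s + s * h2 s + - (s * (k s * k s)) + - (s * (g2 s * b s)).
  suff : f 0 = 0.
    by rewrite /f !mul0r !oppr0 !addr0 => /eqP; rewrite mulf_eq0 pnatr_eq0 /= => /eqP.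
  apply: punctured_zero; first by apply: derivable_continuous; rewrite /f; derivable_tac.
  near=> s.
  have s0 : s != 0 by near: s.
  have E : z s ^+ 2 + x s * b s = s ^+ 1 * (2 * g2 s + s * h2 s) by near: s; exact: near_punctured eh2.
  have zs : z s = s * k s by near: s; apply: near_punctured zk.
  have xs : x s = s ^+ 2 * g2 s by near: s; apply: near_punctured; apply: ball.
  apply: (mulfI s0); rewrite mulr0.
  have -> : s * f s = s ^+ 1 * (2 * g2 s + s * h2 s) - (z s ^+ 2 + x s * b s).
    by rewrite /f zs xs; ring.
  by rewrite E subrr.
have [g3 pg3 e3] := plim_div complete archimedean r0 pg2 g20.
have e3' s : `|s| <= r -> x s = s ^+ 3 * g3 s.
  by move=> h; rewrite e2' // e3 // mulrA -exprSr.
have [h3 dh3 eh3] := power_factor_derive r0 pg3 e3' dx.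
have dg3 := nbhs_singleton (plim_derivable r0 pg3).
exists g3; split=> //; last exact: ball.
pose f s := 3 * g3 s + s * h3 s + - (k s * k s) + - (s * (g3 s * b s)).
suff : f 0 = 0.
  by rewrite /f !mul0r oppr0 !addr0 => /eqP; rewrite subr_eq0 expr2 => /eqP.
apply: punctured_zero; first by apply: derivable_continuous; rewrite /f; derivable_tac.
near=> s.
have s0 : s != 0 by near: s.
have E : z s ^+ 2 + x s * b s = s ^+ 2 * (3 * g3 s + s * h3 s) by near: s; exact: near_punctured eh3.
have zs : z s = s * k s by near: s; apply: near_punctured zk.
have xs : x s = s ^+ 3 * g3 s by near: s; apply: near_punctured; apply: ball.
apply: (mulfI (expf_neq0 2 s0)); rewrite mulr0.
have -> : s ^+ 2 * f s = s ^+ 2 * (3 * g3 s + s * h3 s) - (z s ^+ 2 + x s * b s).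
  by rewrite /f zs xs; ring.
by rewrite E subrr.
Unshelve. all: by end_near. Qed.

Lemma holomorphic_shift (t0 : K) (P : K -> K) : (\forall s \near (0 : K), derivable P s 1) ->
  holomorphic_at t0 (fun t => P (t - t0)).
Proof.
move=> /near_normP[r r0 h]; apply/near_normP; exists r => // t ht.
have : derivable P (t - t0) 1 by apply: h; rewrite subr0.
by move=> /derivableP d; apply: derivable_is (is_derive_shift d).
Qed.

Lemma meromorphic_of_factor (t0 : K) (f P : K -> K) : (\forall s \near (0 : K), derivable P s 1) ->
  (\forall t \near t0^', (t - t0) * f t = P (t - t0)) -> meromorphic_at t0 f.
Proof.
move=> hP e; exists 1%N, (fun t => P (t - t0)); split; first exact: holomorphic_shift.
by apply: filterS e => t; rewrite expr1.
Qed.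

Lemma pole_of_factor (t0 : K) (f P : K -> K) : (\forall s \near (0 : K), derivable P s 1) ->
  (\forall t \near t0^', (t - t0) * f t = P (t - t0)) -> P 0 != 0 -> pole_at t0 f.
Proof.
move=> hP e P0; split; first exact: meromorphic_of_factor hP e.
move=> [g hg fg].
have dg := nbhs_singleton hg; have dP := nbhs_singleton (holomorphic_shift t0 hP).
have := @punctured_zero t0 (fun t => (t + - t0) * g t + - P (t - t0)).
rewrite subrr mul0r add0r => h; move: P0; rewrite -oppr_eq0 h ?eqxx //.
  by apply: derivable_continuous; derivable_tac.
near=> t.
have e1 : (t - t0) * f t = P (t - t0) by near: t.
have e2 : f t = g t by near: t.
by rewrite -e1 e2 subrr.
Unshelve. all: by end_near. Qed.

End Poles.

(** * Poles of the solutions that start on the boundary of a chart *)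

Section ChartPoles.
Variable K : numClosedFieldType.
Variables a1 a2 a3 : K.
Hypothesis complete : geometrically_complete K.
Hypothesis archimedean : geometrically_archimedean K.
Let F := vfields a1 a2 a3.

Lemma row3_0 (a b c : K) : row3 a b c ord0 (inord 0) = a. Proof. by have [] := row3_ord a b c. Qed.
Lemma row3_1 (a b c : K) : row3 a b c ord0 (inord 1) = b. Proof. by have [] := row3_ord a b c. Qed.
Lemma row3_2 (a b c : K) : row3 a b c ord0 (inord 2) = c. Proof. by have [] := row3_ord a b c. Qed.

(** Multiplied by s, the coordinates become holomorphic with values P_i(0), their residues, not all
    zero: at most simple poles, and at least one. *)
Definition has_simple_poles (u : K -> pt K 3) := exists P0 P1 P2 : K -> K,
  [/\ \forall s \near (0 : K), [/\ derivable P0 s 1, derivable P1 s 1 & derivable P2 s 1],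
      [\/ P0 0 != 0, P1 0 != 0 | P2 0 != 0] &
      \forall s \near (0 : K)^', [/\ s * xc (u s) = P0 s, s * yc (u s) = P1 s & s * zc (u s) = P2 s]].

Lemma near_punctured_neq (P Q : K -> Prop) : (\forall s \near (0 : K), P s) ->
  (forall s, s != 0 -> P s -> Q s) -> \forall s \near (0 : K)^', Q s.
Proof. by move=> /near_normP[r r0 h] hQ; apply/near_punctureP; exists r => // s /h Ps s0; apply: hQ. Qed.

Lemma chart_poles (j : 'I_8) (t0 r : K) (c : K -> 'rV[K]_3) : j != ord0 -> 0 < r ->
  (forall b, plim r (fun s => c s ord0 b)) ->
  (forall s : K, `|s| < r / 2 -> is_derive s 1 c (F j (c s, t0 + s))) ->
  bzero j (c 0, t0) ->
  has_simple_poles (fun s => unchart a1 a2 a3 j (c s, t0 + s)) /\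
  \forall s \near (0 : K)^', bdry j (c s, t0 + s) != 0.
Proof.
move=> j0 r0 pc dc bz.
pose x s := c s ord0 (inord 0); pose y s := c s ord0 (inord 1); pose z s := c s ord0 (inord 2).
have px : plim r x by exact: pc.
have py : plim r y by exact: pc.
have pz : plim r z by exact: pc.
have r20 : `|0 : K| < r / 2 by rewrite normr0 divr_gt0.
have d0 := dc 0 r20; rewrite addr0 in d0.
have dx : is_derive (0 : K) (1 : K) x _ := is_derive_coord (inord 0) d0.
have dy : is_derive (0 : K) (1 : K) y _ := is_derive_coord (inord 1) d0.
have dz : is_derive (0 : K) (1 : K) z _ := is_derive_coord (inord 2) d0.
have dxs s : `|s| < r / 2 -> is_derive (s : K) (1 : K) x (F j (c s, t0 + s) ord0 (inord 0)).
  by move=> /dc; apply: is_derive_coord.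
have nx := plim_derivable complete archimedean r0 px.
have ny := plim_derivable complete archimedean r0 py.
have nz := plim_derivable complete archimedean r0 pz.
have nxyz : \forall s \near (0 : K), [/\ derivable x s 1, derivable y s 1 & derivable z s 1].
  by apply: filterS3 nx ny nz.
have nzf f D := @nonzero_factor _ complete archimedean r f D r0.
have N1 : - 1 != 0 :> K by rewrite oppr_eq0 oner_neq0.
have one := oner_neq0 K.
(* At the boundary the component of the field along each vanishing coordinate is 1 or -1, except for
   x_7; so these zeros are simple. *)
have inv1 (g : K) : g = 1 \/ g = - 1 -> g != 0 by case=> ->.
have cx s : xc (c s, t0 + s) = x s by []. have cy s : yc (c s, t0 + s) = y s by [].
have cz s : zc (c s, t0 + s) = z s by [].
have c0x : xc (c 0, t0) = x 0 by []. have c0y : yc (c 0, t0) = y 0 by [].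
have c0z : zc (c 0, t0) = z 0 by [].
clearbody x y z; clear pc dc d0 r20.
case: j j0 bz dx dy dz dxs => -[|[|[|[|[|[|[|[|//]]]]]]]] hj // _ bz dx dy dz dxs;
  rewrite /bzero /= in bz; rewrite /F /vfields /= ?row3_0 ?row3_1 ?row3_2 ?c0x ?c0y ?c0z in dx dy dz;
  rewrite /unchart /bdry /=.
- move: bz => [x0 z0]; rewrite c0x in x0; rewrite c0z in z0; rewrite x0 z0 in dx dz.
  have [g [pg g0 ng]] := nzf _ _ px x0 dx ltac:(apply: inv1; left; ring).
  have [k [pk k0 nk]] := nzf _ _ pz z0 dz ltac:(apply: inv1; left; ring).
  have gE : g 0 = 1 by rewrite g0; ring. have kE : k 0 = 1 by rewrite k0; ring.
  split; last by apply: (near_punctured_neq (filterI nxyz (filterI ng nk))) => s s0 [[dxx dys dzs] [[ex gs dg] [ek ks dk]]]; rewrite cx cz ?ek ?ex !mulf_neq0.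
  exists (fun s => (g s)^-1 + - (k s)^-1), (fun s => s * ((y s * z s + - a2) * z s)), (fun s => (k s)^-1); split.
  + by apply: filterS (filterI nxyz (filterI ng nk)) => s [[dxx dys dzs] [[ex gs dg] [ek ks dk]]]; split; derivable_tac.
  (* The residues of 1/x_1 and 1/z_1 are both 1 and cancel in x = 1/x_1 - 1/z_1; the pole that
     remains is that of z. *)
  + by apply: Or33; rewrite kE invr1.
  apply: (near_punctured_neq (filterI nxyz (filterI ng nk))) => s s0 [[dxx dys dzs] [[ex gs dg] [ek ks dk]]].
  rewrite /= ?row3_xc ?row3_yc ?row3_zc cx cy cz; split=> //; rewrite ?ek ?ex; field; rewrite ?s0 ?ks ?gs //.
- rewrite c0z in bz; rewrite bz in dz.
  have [k [pk k0 nk]] := nzf _ _ pz bz dz ltac:(apply: inv1; left; ring).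
  have kE : k 0 = 1 by rewrite k0; ring.
  split; last by apply: (near_punctured_neq (filterI nxyz nk)) => s s0 [[dxx dys dzs] [ek ks dk]]; rewrite cz ?ek ?ex !mulf_neq0.
  exists (fun s => s * x s + - (k s)^-1), (fun s => s * ((y s * z s + - a2) * z s)), (fun s => (k s)^-1); split.
  + by apply: filterS (filterI nxyz nk) => s [[dxx dys dzs] [ek ks dk]]; split; derivable_tac.
  + by apply: Or33; rewrite kE invr1.
  apply: (near_punctured_neq (filterI nxyz nk)) => s s0 [[dxx dys dzs] [ek ks dk]].
  rewrite /= ?row3_xc ?row3_yc ?row3_zc cx cy cz; split=> //; rewrite ?ek ?ex; field; rewrite ?s0 ?ks //.
- rewrite c0x in bz; rewrite bz in dx.
  have [k [pk k0 nk]] := nzf _ _ px bz dx ltac:(apply: inv1; left; ring).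
  have kE : k 0 = 1 by rewrite k0; ring.
  split; last by apply: (near_punctured_neq (filterI nxyz nk)) => s s0 [[dxx dys dzs] [ek ks dk]]; rewrite cx ?ek ?ex !mulf_neq0.
  exists (fun s => (k s)^-1), (fun s => s * y s), (fun s => s * z s); split.
  + by apply: filterS (filterI nxyz nk) => s [[dxx dys dzs] [ek ks dk]]; split; derivable_tac.
  + by apply: Or31; rewrite kE invr1.
  apply: (near_punctured_neq (filterI nxyz nk)) => s s0 [[dxx dys dzs] [ek ks dk]].
  rewrite /= ?row3_xc ?row3_yc ?row3_zc cx cy cz; split=> //; rewrite ?ek ?ex; field; rewrite ?s0 ?ks //.
- rewrite c0z in bz; rewrite bz in dz.
  have [k [pk k0 nk]] := nzf _ _ pz bz dz ltac:(apply: inv1; right; ring).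
  have kE : k 0 = - 1 by rewrite k0; ring.
  split; last by apply: (near_punctured_neq (filterI nxyz nk)) => s s0 [[dxx dys dzs] [ek ks dk]]; rewrite cz ?ek ?ex !mulf_neq0.
  exists (fun s => s * ((x s * z s + a1) * z s)),
    (fun s => s * ((y s * z s + - 1 + a2 + a3) * z s) + - (k s)^-1 + s * (t0 + s)), (fun s => (k s)^-1); split.
  + by apply: filterS (filterI nxyz nk) => s [[dxx dys dzs] [ek ks dk]]; split; derivable_tac.
  + by apply: Or33; rewrite kE invr_eq0.
  apply: (near_punctured_neq (filterI nxyz nk)) => s s0 [[dxx dys dzs] [ek ks dk]].
  rewrite /= ?row3_xc ?row3_yc ?row3_zc cx cy cz; split=> //; rewrite ?ek ?ex; field; rewrite ?s0 ?ks //.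
- move: bz => [x0 y0]; rewrite c0x in x0; rewrite c0y in y0; rewrite x0 y0 in dx dy.
  have [g [pg g0 ng]] := nzf _ _ px x0 dx ltac:(apply: inv1; left; ring).
  have [k [pk k0 nk]] := nzf _ _ py y0 dy ltac:(apply: inv1; right; ring).
  have gE : g 0 = 1 by rewrite g0; ring.
  split; last by apply: (near_punctured_neq (filterI nxyz (filterI ng nk))) => s s0 [[dxx dys dzs] [[ex gs dg] [ek ks dk]]]; rewrite cx cy ?ek ?ex !mulf_neq0.
  exists (fun s => (g s)^-1), (fun s => (k s)^-1), (fun s => s * ((z s * y s + a3) * y s)); split.
  + by apply: filterS (filterI nxyz (filterI ng nk)) => s [[dxx dys dzs] [[ex gs dg] [ek ks dk]]]; split; derivable_tac.
  + by apply: Or31; rewrite gE invr1.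
  apply: (near_punctured_neq (filterI nxyz (filterI ng nk))) => s s0 [[dxx dys dzs] [[ex gs dg] [ek ks dk]]].
  rewrite /= ?row3_xc ?row3_yc ?row3_zc cx cy cz; split=> //; rewrite ?ek ?ex; field; rewrite ?s0 ?ks ?gs //.
- rewrite c0y in bz; rewrite bz in dy.
  have [k [pk k0 nk]] := nzf _ _ py bz dy ltac:(apply: inv1; right; ring).
  have kE : k 0 = - 1 by rewrite k0; ring.
  split; last by apply: (near_punctured_neq (filterI nxyz nk)) => s s0 [[dxx dys dzs] [ek ks dk]]; rewrite cy ?ek ?ex !mulf_neq0.
  exists (fun s => s * x s), (fun s => (k s)^-1), (fun s => s * ((z s * y s + a3) * y s)); split.
  + by apply: filterS (filterI nxyz nk) => s [[dxx dys dzs] [ek ks dk]]; split; derivable_tac.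
  + by apply: Or32; rewrite kE invr_eq0.
  apply: (near_punctured_neq (filterI nxyz nk)) => s s0 [[dxx dys dzs] [ek ks dk]].
  rewrite /= ?row3_xc ?row3_yc ?row3_zc cx cy cz; split=> //; rewrite ?ek ?ex; field; rewrite ?s0 ?ks //.
move: bz => [x0 z0]; rewrite c0x in x0; rewrite c0z in z0; rewrite x0 z0 in dx dz.
have [k [pk k0 nk]] := nzf _ _ pz z0 dz ltac:(apply: inv1; right; ring).
have kE : k 0 = - 1 by rewrite k0; ring.
pose p s := y s * z s + - 1 + a2 + a3.
pose A s := a1 + 2 * p s + - a3.
pose b s := A s * (z s + a1 * x s) + a1 * z s + (t0 + s) + (2 * p s + - a3) * z s.
have nxd : \forall s \near (0 : K), is_derive (s : K) (1 : K) x (z s ^+ 2 + x s * b s).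
  apply/near_normP; exists (r / 2); first by rewrite divr_gt0.
  move=> s; rewrite subr0 => /dxs.
  rewrite /F /vfields /= row3_0 cx cy cz => h; apply: (is_derive_eq h).
  rewrite /b /A /p; ring.
have nzk : \forall s \near (0 : K), z s = s * k s by apply: filterS nk => s [].
have [_ _ dk0] := nbhs_singleton nk.
have db : derivable b 0 1.
  have dx0 := nbhs_singleton nx; have dy0 := nbhs_singleton ny; have dz0 := nbhs_singleton nz.
  by rewrite /b /A /p; derivable_tac.
(* x_7 behaves like s^3/3 and z_7 like -s, so x = a1 z_7 + z_7^2/x_7 has a pole of order one
   only. *)
have [w [pw w0 nw]] := cubic_zero complete archimedean r0 px x0 nxd nzk dk0 db.
have w00 : w 0 != 0.
  apply/eqP => w0E; move: w0; rewrite w0E mulr0 kE sqrrN expr1n => /eqP.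
  by rewrite eq_sym (negbTE one).
have dw := plim_derivable complete archimedean r0 pw.
have wn0 : \forall s \near (0 : K), w s != 0.
  exact: (cvgr_neq0 _ (derivable_continuous (nbhs_singleton dw)) w00).
split; last by apply: (near_punctured_neq (filterI nxyz (filterI nk (filterI nw (filterI dw wn0))))) => s s0 [[dxx dys dzs] [[ek ks dk] [ex [dws ws]]]]; rewrite cx cz ?ek ?ex !mulf_neq0 // expf_neq0.
exists (fun s => s * (a1 * z s) + k s * k s * (w s)^-1),
  (fun s => s * ((y s * z s + - 1 + a2 + a3) * z s) + - (k s)^-1 + s * (t0 + s)), (fun s => (k s)^-1); split.
+ by apply: filterS (filterI nxyz (filterI nk (filterI nw (filterI dw wn0)))) => s [[dxx dys dzs] [[ek ks dk] [ex [dws ws]]]]; split; derivable_tac.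
+ by apply: Or33; rewrite kE invr_eq0.
apply: (near_punctured_neq (filterI nxyz (filterI nk (filterI nw (filterI dw wn0))))) => s s0 [[dxx dys dzs] [[ek ks dk] [ex [dws ws]]]].
rewrite /= ?row3_xc ?row3_yc ?row3_zc cx cy cz; split=> //; rewrite ?ek ?ex; field; rewrite ?s0 ?ks ?ws //.
Qed.

End ChartPoles.

(** * Parameter spaces of solutions *)

Section ParameterSpaces.
Variable K : numClosedFieldType.
Variables a1 a2 a3 : K.
Variables (N : nat) (B : pt K 3 -> 'rV[K]_N) (psi : 'I_8 -> pt K 3 -> 'rV[K]_N).
Hypotheses (pB : polyv B) (B0 : forall u, B u != 0).
Hypothesis charts8 : forall j, achart B (psi j) (chart_dom a1 j) (chart a1 a2 a3 j).
Hypothesis complete : geometrically_complete K.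
Hypothesis archimedean : geometrically_archimedean K.
Let F := vfields a1 a2 a3.
Variable Y : set (pt K N).
Hypothesis hY : Y = \bigcup_j image_over setT (psi j).
Hypothesis psi_unchart : forall (j : 'I_8) q, bdry j q != 0 ->
  peq (psi j q) (psi ord0 (unchart a1 a2 a3 j q)).

Lemma near_near (t0 : K) (P : K -> Prop) : (\forall t \near t0, P t) ->
  \forall t \near t0, \forall s \near t, P s.
Proof.
move=> /near_normP[r r0 h]; apply/near_normP; exists r => // t tr.
apply/near_normP; exists (r - `|t - t0|); first by rewrite subr_gt0.
move=> s hs; apply: h; rewrite -(subrKA t); apply: (le_lt_trans (ler_normD _ _)).
by rewrite -ltrBrDr.
Qed.

Lemma near_near_punctured (t0 : K) (P : K -> Prop) : (\forall t \near t0^', P t) ->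
  \forall t \near t0^', \forall s \near t, P s.
Proof.
move=> /near_punctureP[r r0 h]; apply/near_punctureP; exists r => // t tr t0t.
have n1 : \forall s \near t, `|s - t0| < r.
  apply/near_normP; exists (r - `|t - t0|); first by rewrite subr_gt0.
  move=> s hs; rewrite -(subrKA t); apply: (le_lt_trans (ler_normD _ _)).
  by rewrite -ltrBrDr.
have n2 : \forall s \near t, s != t0.
  apply/near_normP; exists `|t - t0|; first by rewrite normr_gt0 subr_eq0.
  by move=> s; apply: contraTneq => ->; rewrite distrC ltxx.
by apply: filterS2 n1 n2 => s; apply: h.
Qed.

Lemma near_punctured_shift (t0 : K) (P : K -> Prop) : (\forall s \near (0 : K)^', P s) ->
  \forall t \near t0^', P (t - t0).
Proof.
move=> /near_punctureP[r r0 h]; apply/near_punctureP; exists r => // t tr t0t.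
by apply: h; rewrite ?subr0 // subr_eq0.
Qed.

Lemma solution_unique q u u' : Y q -> solution_from psi F q u -> solution_from psi F q u' ->
  \forall t \near q.2^', u t = u' t.
Proof.
move=> Yq [g [ig eg ug]] [g' [ig' eg' ug']].
have [_ /(_ g g' ig eg ig' eg') gg] := cauchy8 pB B0 charts8 complete archimedean hY Yq.
apply: filterS3 (near_punctured gg) ug ug' => t h1 h2 h3.
apply: (chart_inj (charts8 ord0) (t := t)).
exact: peq_trans (peq_sym h2) (peq_trans h1 h3).
Qed.

(** Read in charts around q and q', the two curves coincide for t near the initial time but
    different from it; the minors of the two chart vectors are continuous, so they vanish at the
    initial time as well. *)
Lemma solution_injective q q' u : Y q -> Y q' -> q.2 = q'.2 -> solution_from psi F q u ->
  solution_from psi F q' u -> peq q.1 q'.1.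
Proof.
move=> Yq Yq' qq [g [ig eg ug]] [g' [ig' eg' ug']].
have [j [c0 e]] := initial_chart hY Yq; have [j' [c0' e']] := initial_chart hY Yq'.
have [d [d0 hd]] := curve_in_chart pB B0 charts8 (q := (c0, q.2)) ig (peq_trans eg (peq_sym e)).
have [d' [d0' hd']] := curve_in_chart pB B0 charts8 (q := (c0', q'.2)) ig' (peq_trans eg' (peq_sym e')).
rewrite -qq in ug' e' hd' d0'; rewrite /= in d0 d0' hd hd'.
apply: peq_trans (peq_sym e) (peq_trans _ e').
have [xj Pj0 _ _ _] := charts8 j; have [pPj _ _] := xj.
have [xj' Pj0' _ _ _] := charts8 j'; have [pPj' _ _] := xj'.
have eqs : \forall t \near q.2^', peq (psi j (d t, t)) (psi j' (d' t, t)).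
  have h1 := near_punctured hd; have h2 := near_punctured hd'.
  apply: filterS2 (filterI h1 ug) (filterI h2 ug') => t [[_ k1] k2] [[_ k3] k4].
  exact: peq_trans k1 (peq_trans k2 (peq_trans (peq_sym k4) (peq_sym k3))).
have [dd _] := nbhs_singleton hd; have [dd' _] := nbhs_singleton hd'.
have cc a b : {for q.2, continuous (fun t : K => psi j (d t, t) ord0 a * psi j' (d' t, t) ord0 b
    - psi j (d t, t) ord0 b * psi j' (d' t, t) ord0 a)}.
  have k1 i := curve_continuous (pPj i) dd; have k2 i := curve_continuous (pPj' i) dd'.
  exact: (cvgB (cvgM (k1 a) (k2 b)) (cvgM (k1 b) (k2 a))).
apply: para_peq; [exact: Pj0|exact: Pj0'|].
move=> a b; have := punctured_zero (cc a b); rewrite d0 d0' => h.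
apply/eqP; rewrite -subr_eq0 h //.
apply: filterS eqs => t /peqP[_ [k _ ->]]; rewrite !mxE; ring.
Qed.

Lemma holomorphic_point c0 q : peq (psi ord0 (c0, q.2)) q.1 ->
  exists2 u, solution_from psi F q u & holomorphic_solution a1 a2 a3 q.2 u.
Proof.
move=> e; have [r [c [r0 cE _ _ hd]]] := chart_solution a1 a2 a3 complete archimedean ord0 c0 q.2.
exists (fun t => c (t - q.2)); last exact: hd.
exists (fun t => psi ord0 (c (t - q.2), t)); split.
- exact: (chart_curve charts8 hd).
- by rewrite subrr cE.
have [_ P0 _ _ _] := charts8 ord0.
by near=> t; apply: peq_refl.
Unshelve. all: by end_near. Qed.

Lemma holomorphic_from t0 u : holomorphic_solution a1 a2 a3 t0 u ->
  solution_from psi F (psi ord0 (u t0, t0), t0) u.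
Proof.
move=> hu; have [_ P0 _ _ _] := charts8 ord0.
exists (fun t => psi ord0 (u t, t)); split; first exact: (chart_curve charts8 (j := ord0) hu).
  exact: peq_refl.
by near=> t; apply: peq_refl.
Unshelve. all: by end_near. Qed.

Lemma meromorphic_point (j : 'I_8) c0 q : j != ord0 -> bzero j (c0, q.2) ->
  peq (psi j (c0, q.2)) q.1 ->
  exists2 u, solution_from psi F q u & meromorphic_solution_with_pole a1 a2 a3 q.2 u.
Proof.
move=> j0 bz e; set t0 := q.2.
have [r [c [r0 cE pc dc hd]]] := chart_solution a1 a2 a3 complete archimedean j c0 t0.
rewrite -cE in bz.
have [[P0 [P1 [P2 [hP P00 eP]]]] bd] := chart_poles complete archimedean j0 r0 pc dc bz.
pose u t : 'rV[K]_3 := (unchart a1 a2 a3 j (c (t - t0), t)).1.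
pose g t := psi j (c (t - t0), t).
have ig : integral_curve psi F t0 g by exact: (chart_curve charts8 hd).
have st t : t0 + (t - t0) = t by rewrite addrC subrK.
have gu : \forall t \near t0^', peq (g t) (psi ord0 (u t, t)).
  apply: filterS (near_punctured_shift t0 bd) => t; rewrite st => /psi_unchart.
  by rewrite [unchart _ _ _ _ _]surjective_pairing.
exists u; first by exists g; split=> //; rewrite /g subrr cE.
have igp := near_punctured (near_near ig).
have eqP : \forall t \near t0^', [/\ (t - t0) * u t ord0 (inord 0) = P0 (t - t0),
    (t - t0) * u t ord0 (inord 1) = P1 (t - t0) & (t - t0) * u t ord0 (inord 2) = P2 (t - t0)].
  by apply: filterS (near_punctured_shift t0 eP) => t; rewrite st.
have [hP0 hP1 hP2] : [/\ \forall s \near (0 : K), derivable P0 s 1,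
    \forall s \near (0 : K), derivable P1 s 1 & \forall s \near (0 : K), derivable P2 s 1].
  by split; apply: filterS hP => s [].
have e0 : \forall t \near t0^', (t - t0) * u t ord0 (inord 0) = P0 (t - t0).
  by apply: filterS eqP => t [].
have e1 : \forall t \near t0^', (t - t0) * u t ord0 (inord 1) = P1 (t - t0).
  by apply: filterS eqP => t [].
have e2 : \forall t \near t0^', (t - t0) * u t ord0 (inord 2) = P2 (t - t0).
  by apply: filterS eqP => t [].
split.
(* For t different from t0 the curve lies in C^3, where its coordinates in chart 0 are u by
   injectivity; hence u solves the original system there. *)
- apply: filterS3 igp (near_near_punctured gu) gu => t igt gut gt.
  have [d [d0 hdt]] := curve_in_chart pB B0 charts8 (q := (u t, t)) igt gt.
  rewrite /= in d0 hdt; have [dd _] := nbhs_singleton hdt; rewrite d0 in dd.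
  apply: near_eq_is_derive dd.
  apply: filterS2 hdt gut => s [_ k1] k2.
  exact: (chart_inj (charts8 ord0) (peq_trans k1 k2)).
- apply: forall_I3.
  + exact: (meromorphic_of_factor hP0 e0).
  + exact: (meromorphic_of_factor hP1 e1).
  + exact: (meromorphic_of_factor hP2 e2).
case: P00 => P00.
- by exists (inord 0); apply: (pole_of_factor hP0 e0 P00).
- by exists (inord 1); apply: (pole_of_factor hP1 e1 P00).
- by exists (inord 2); apply: (pole_of_factor hP2 e2 P00).
Qed.

End ParameterSpaces.

(** * Assembling the theorem *)

Section Statement.
Variable K : numClosedFieldType.
Hypothesis complete : geometrically_complete K.
Hypothesis archimedean : geometrically_archimedean K.

Lemma phase_space_family (alpha1 alpha2 alpha3 : K) :
  exists (N : nat) (X D : set (pt K N))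
         (phi : pt K N -> 'rV[K]_4)
         (psi : 'I_8 -> pt K 3 -> 'rV[K]_N)
         (F : 'I_8 -> pt K 3 -> 'rV[K]_3),
  [/\ smooth_projective_family 3 X,
      modification_of_P3 X phi,
      birational_map X (@Proj K 4) phi &
      divisor X D] /\
  [/\ regular_map (image_over setT (psi ord0)) phi,
      (forall q : pt K 3,
         peq (phi (psi ord0 q, q.2)) (row_mx 1 q.1 : 'rV_(1 + 3))),
      glued_from_charts alpha1 alpha2 alpha3 X (X `\` D) psi,
      extends_holomorphically alpha1 alpha2 alpha3 F &
      cauchy_property (X `\` D) psi F] /\
  forall t0 : K,
  exists S : 'I_8 -> set (pt K N),
  [/\ stratification (fiber (X `\` D) t0) t0 stratum_dim S,
      S ord0 = image_over [set t0] (psi ord0),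
      parameter_space psi F t0 (S ord0)
        (holomorphic_solution alpha1 alpha2 alpha3 t0),
      (forall u, holomorphic_solution alpha1 alpha2 alpha3 t0 u ->
         exists2 q, S ord0 q & solution_from psi F q u) &
      forall i : 'I_8, i != ord0 ->
        parameter_space psi F t0 (S i)
          (meromorphic_solution_with_pole alpha1 alpha2 alpha3 t0)].
Proof.
have [N [M [A [Phi [Op [D0 [D2 [D4 [D6 [[hst n0 n2 n4 n6] hcov]]]]]]]]]] :=
  phase_space alpha1 alpha2 alpha3.
have [cB pB] := state_affine hst; have B0 := state_neq0 hst.
have [[_ _ _ _ [phi mphi hphi]] _] := hst.
have charts8 := achart8 hst n0 n2 n4 n6.
have psi_unchart := unchart_peq n0 n2 n4 n6.
have hY := phase_images hst n0 n2 n4 n6 hcov.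
have psi0 := psi8_0 n0 n2 n4 n6.
set psi := psi8 D0 D2 D4 D6 in charts8 psi_unchart hY psi0.
set X := model (tens A Phi); set Y := phase A Phi Op in hY.
have XDD : X `\` (X `\` Y) = Y.
  apply/seteqP; split=> p; first by move=> [mp h]; apply: contrapT => np; apply: h.
  by move=> ph; split; [case: ph|case].
exists (N * M)%N, X, (X `\` Y), phi, psi, (vfields alpha1 alpha2 alpha3); rewrite XDD.
split; last split.
- split; [exact: smooth_family hst|exact: mphi|exact: birational_P3 hst _ hphi|exact: phase_divisor hst].
- split.
  + have sub p : image_over setT (psi ord0) p -> affine_part (tens A Phi) p.
      move=> [_ [c e]]; exists (c, p.2) => //.
      exact: peq_trans (peq_sym e) (peq_sym (psi0 _)).
    move=> p /sub/(homog_coords_regular pB cB hphi)[d [G [h1 h2 h3]]].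
    by exists d, G; split=> // q /sub; apply: h3.
  + by move=> q; apply: (hphi (psi ord0 q, q.2) q erefl); apply: peq_sym.
  + exact: (glued8 hst n0 n2 n4 n6 hcov erefl).
  + exact: extends8.
  + exact: (cauchy8 pB B0 charts8 complete archimedean hY).
move=> t0; exists (stratum D0 D2 D4 D6 t0).
have c00 : stratum_chart ord0 = ord0 by apply: val_inj; rewrite /stratum_chart /= inordK.
have S0 : stratum D0 D2 D4 D6 t0 ord0 = image_over [set t0] (psi ord0).
  apply/seteqP; split=> p.
    move/stratumP; rewrite c00 => -[c [pt ct _ e]]; split=> //.
    by exists c.1; rewrite pt -ct -surjective_pairing.
  by move=> [pt [c e]]; apply/stratumP; rewrite c00; exists (c, p.2).
(* Uniqueness of the solution from a point and injectivity hold for all strata alike; only the kind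
   of solution that exists has to be treated separately. *)
have par i Sol : (forall q, stratum D0 D2 D4 D6 t0 i q ->
      exists2 u, solution_from psi (vfields alpha1 alpha2 alpha3) q u & Sol u) ->
    parameter_space psi (vfields alpha1 alpha2 alpha3) t0 (stratum D0 D2 D4 D6 t0 i) Sol.
  have SY q : stratum D0 D2 D4 D6 t0 i q -> Y q := @stratum_phase _ _ _ _ _ _ _ _ _ _ _ _ _ hst n0 n2 n4 n6 hcov t0 i q.
  have St q : stratum D0 D2 D4 D6 t0 i q -> q.2 = t0 by move=> /stratumP[c []].
  move=> h; split=> //.
    move=> q u u' Sq su su'; rewrite -(St q Sq).
    exact: (solution_unique pB B0 charts8 complete archimedean hY (SY q Sq) su su').
  move=> q q' u Sq Sq' su su'.
  apply: (solution_injective pB B0 charts8 hY (SY q Sq) (SY q' Sq') _ su su').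
  by rewrite (St q Sq) (St q' Sq').
split.
- exact: (stratification8 hst n0 n2 n4 n6 hcov).
- exact: S0.
- apply: par => q; rewrite S0 => -[qt [c e]].
  have [u hu su] := holomorphic_point charts8 complete archimedean e.
  by exists u => //; rewrite -[t0]qt.
- move=> u hu; exists (psi ord0 (u t0, t0), t0).
    rewrite S0; split=> //; exists (u t0); apply: peq_refl.
    by have [_ P0 _ _ _] := charts8 ord0.
  exact: (holomorphic_from charts8 hu).
move=> i i0; apply: par => q /stratumP[c [qt ct bz e]].
have j0 : stratum_chart i != ord0.
  by apply: contra_neq i0 => e0; apply: stratum_chart_inj; rewrite e0 c00.
have cE : c = (c.1, q.2) by rewrite qt -ct -surjective_pairing.
rewrite cE in bz e.
have [u hu su] := meromorphic_point pB B0 charts8 complete archimedean psi_unchart j0 bz e.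
by exists u => //; rewrite -qt.
Qed.

End Statement.

Theorem theorem2p1 (R : realType) (alpha1 alpha2 alpha3 : complexes R) :
  exists (N : nat) (X D : set (pt (complexes R) N))
         (phi : pt (complexes R) N -> 'rV[complexes R]_4)
         (psi : 'I_8 -> pt (complexes R) 3 -> 'rV[complexes R]_N)
         (F : 'I_8 -> pt (complexes R) 3 -> 'rV[complexes R]_3),
  (* the family, the birational map and the boundary divisor *)
  [/\ smooth_projective_family 3 X,
      modification_of_P3 X phi,
      birational_map X (@Proj (complexes R) 4) phi &
      divisor X D] /\
  (* the phase space *)
  [/\ regular_map (image_over setT (psi ord0)) phi,
      (forall q : pt (complexes R) 3,
         peq (phi (psi ord0 q, q.2)) (row_mx 1 q.1 : 'rV_(1 + 3))),
      glued_from_charts alpha1 alpha2 alpha3 X (X `\` D) psi,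
      extends_holomorphically alpha1 alpha2 alpha3 F &
      cauchy_property (X `\` D) psi F] /\
  (* the stratification of the fibers *)
  forall t0 : complexes R,
  exists S : 'I_8 -> set (pt (complexes R) N),
  [/\ stratification (fiber (X `\` D) t0) t0 stratum_dim S,
      S ord0 = image_over [set t0] (psi ord0),
      parameter_space psi F t0 (S ord0)
        (holomorphic_solution alpha1 alpha2 alpha3 t0),
      (forall u, holomorphic_solution alpha1 alpha2 alpha3 t0 u ->
         exists2 q, S ord0 q & solution_from psi F q u) &
      forall i : 'I_8, i != ord0 ->
        parameter_space psi F t0 (S i)
          (meromorphic_solution_with_pole alpha1 alpha2 alpha3 t0)].
Proof. exact: phase_space_family (@geometric_cvg R) (@geometric_lt R) alpha1 alpha2 alpha3. Qed.
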